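(* Let $\mathbb X$ be a symmetric space of noncompact type, with $\tau_{mod},\zeta,\zeta_0,\kappa_0,c_0,\varepsilon(\zeta)$ as in the context. Let $0<\alpha_{new}<\alpha_0$ and $\delta>0$, and let $\epsilon>0$ and $s>2\delta$ satisfy 1. $5\epsilon\le\frac{\zeta_0^2}{2\kappa_0^2}$; 2. $\frac{\epsilon\kappa_0}{\zeta_0}e^{2\kappa_0\epsilon/\zeta_0-\alpha_0s}\le\sin\left(\frac{\epsilon}{4}\right)$; 3. $\frac{5\epsilon}{\zeta_0}\le\delta$; 4. $\alpha_0-\frac{2\delta(\alpha_0+\kappa_0)}{s-2\delta}\ge\alpha_{new}$; 5. $2\epsilon+\sin^{-1}\left(\frac{2\delta}{\alpha_0\zeta_0s}\right)<\varepsilon(\zeta)$. Then for every $(\alpha_0,\tau_{mod},\epsilon)$-straight $s$-spaced sequence $(x_n)$ in $\mathbb X$ there is a parallel set $P(\tau_-,\tau_+)$, with $\tau_\pm\in\mathrm{Flag}(\tau_{mod})$ antipodal, such that $d(x_n,P(\tau_-,\tau_+))\le\delta$ for all $n$ and, denoting by $\overline x_n$ the nearest point projection of $x_n$ to $P(\tau_-,\tau_+)$, $$\overline x_{n\pm m}\in V(\overline x_n,\mathrm{st}(\tau_\pm),\alpha_{new})$$ for all $n$ and $m\ge1$ (for which the indices are in range). It follows that the sequence is coarsely spaced: $$d(x_n,x_{n\pm m})\ge2\alpha_{new}\zeta_0c_0(s-2\delta)m-2\delta,$$ and if $(x_n)$ is coarsely Lipschitz it is then an $(\alpha_{new},\tau_{mod},\delta)$-Morse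 quasigeodesic.
   Context: $\mathbb X$ is a symmetric space of noncompact type with distance $d$, $G$ the identity component of its isometry group, with Lie algebra $\mathfrak g$ and Killing form $B$. For $p\in\mathbb X$, $\mathfrak g=\mathfrak k\oplus\mathfrak p$ is the Cartan decomposition at $p$; $\mathfrak p$ is identified with $T_p\mathbb X$ via $X\mapsto\frac{d}{dt}|_{t=0}e^{tX}p$, and the Riemannian metric is the one induced by $B|_{\mathfrak p}$. For a maximal abelian $\mathfrak a\subset\mathfrak p$, $\Lambda\subset\mathfrak a^*$ is the set of restricted roots, $\mathfrak g_\alpha$ the root spaces, and $\kappa_0=\max\{\alpha(A):\alpha\in\Lambda,A\in\mathfrak a,|A|=1\}$. Regularity. A spherical Weyl chamber $\sigma$ is the intersection of a closed Weyl chamber of $\mathfrak a$ with the unit sphere; $\Delta$ is its set of simple roots. For a face $\tau$ of $\sigma$, $\Delta_\tau^+=\{\alpha\in\Delta:\alpha>0\text{ on }\mathrm{int}\,\tau\}$ and $\Lambda_\tau^+=\{\alpha\in\Lambda:\alpha>0\text{ on }\mathrm{int}\,\tau\}$. A vector $X$ in the cone over $\sigma$ is $(\alpha_0,\tau)$-regular ($\alpha_0>0$) if $\alpha(X)\ge\alpha_0|X|$ for all $\alpha\in\Delta_\tau^+$, and $\tau$-regular if $\alpha(X)>0$ for these $\alpha$. Identifying unit tangent vectors at $p$ with the visual boundary $\partial\mathbb X$, the simplicial structure passes to $\partial\mathbb X$ (independently of $p$). $\theta:\partial\mathbb X\to\partial\mathbb X/G=\sigma_{mod}$ is the type map, $\iota:\sigma_{mod}\to\sigma_{mod}$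 the opposition involution induced by geodesic symmetries. $\tau_{mod}$ is a fixed $\iota$-invariant face of $\sigma_{mod}$, and $\mathrm{Flag}(\tau_{mod})$ the set of simplices of $\partial\mathbb X$ of type $\tau_{mod}$. An ideal point, ray or segment $pq$ is $(\alpha_0,\tau)$-regular if its direction is, and $(\alpha_0,\tau_{mod})$-regular if it is $(\alpha_0,\tau)$-regular for some $\tau\in\mathrm{Flag}(\tau_{mod})$; this $\tau$ is unique and denoted $\tau(pq)$. $V(p,\mathrm{st}(\tau),\alpha_0)$ is the union of the geodesic rays from $p$ to $(\alpha_0,\tau)$-regular ideal points. For an $(\alpha_0,\tau_{mod})$-regular segment $pq$, $\diamondsuit_{\alpha_0}(p,q)=V(p,\mathrm{st}(\tau(pq)),\alpha_0)\cap V(q,\mathrm{st}(\tau(qp)),\alpha_0)$. Simplices $\tau_\pm$ are antipodal if some geodesic line has its two endpoints in $\mathrm{int}(\tau_-)$ and $\mathrm{int}(\tau_+)$; the parallel set $P(\tau_-,\tau_+)$ is then the union of all geodesics parallel to such a line. Type $\zeta$ and $\zeta$-angles. $\zeta\in\mathrm{int}(\tau_{mod})$ is a fixed $\iota$-invariant point and $\zeta_0>0$ a constant with $\alpha(\zeta)\ge\zeta_0$ for all $\alpha\in\Delta_{\tau_{mod}}^+$ (viewing $\zeta$ as a unit vector). For $\tau\in\mathrm{Flag}(\tau_{mod})$, $\zeta(\tau)$ is the point of $\mathrm{int}(\tau)$ of type $\zeta$. For $\tau_{mod}$-regular segments $px,py$, the $\zeta$-angle is $\angle_p^\zeta(x,y)=\angle_p(\zeta(\tau(px)),\zeta(\tau(py)))$,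 where $\angle_p$ is the Riemannian angle at $p$. $\varepsilon(\zeta)$ is defined by $\sin(\frac12\varepsilon(\zeta))=\min_{\alpha\in\Lambda_{\tau_{mod}}^+}\alpha(\zeta)/|\alpha|$ (norm dual to $B$); two simplices of type $\tau_{mod}$ whose type-$\zeta$ points have Tits angle $>\pi-\varepsilon(\zeta)$ are antipodal. $c_0=\sum_{\alpha\in\Lambda_{\tau_{mod}}^+}\dim\mathfrak g_\alpha$. Sequences (finite, infinite or biinfinite). $(x_n)$ is $(\alpha_0,\tau_{mod},\epsilon)$-straight if each segment $x_nx_{n+1}$ is $(\alpha_0,\tau_{mod})$-regular and $\angle_{x_n}^\zeta(x_{n-1},x_{n+1})\ge\pi-\epsilon$ for all $n$; it is $s$-spaced if $d(x_n,x_{n+1})\ge s$ for all $n$. It is coarsely Lipschitz if $d(x_n,x_{n+N})\le c_3|N|+c_4$ for some constants $c_3,c_4$, coarsely spaced if $d(x_n,x_{n+N})\ge\frac1{c_1}|N|-c_2$ for some constants $c_1,c_2$, and a quasigeodesic if both. A quasigeodesic is $(\alpha_0,\tau_{mod},D)$-Morse if for all $n\le m$ there is a diamond $\diamondsuit_{\alpha_0}(p,q)$ with $d(p,x_n),d(q,x_m)\le D$ and $d(x_i,\diamondsuit_{\alpha_0}(p,q))\le D$ for $n\le i\le m$. *)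

(* Defs.v *)
From HB Require Import structures.
From mathcomp Require Import all_boot all_order all_algebra.
From mathcomp Require Import all_classical all_reals all_analysis.
Set Implicit Arguments.
Unset Strict Implicit.
Unset Printing Implicit Defensive.
Import Order.TTheory GRing.Theory Num.Theory.
Import numFieldNormedType.Exports.
Local Open Scope classical_set_scope.
Local Open Scope ring_scope.

(* A symmetric space of noncompact type, with the metric induced by the Killing
   form, is determined by the Lie algebra g of its isometry group, which is real
   semisimple without compact ideals.  The space is realised here as the set of
   Cartan involutions of g: a point p corresponds to the involution of g that is
   +1 on k and -1 on p in the Cartan decomposition at p.  The identity component
   G of the isometry group acts on g by the (faithful) adjoint representation,
   and on points by conjugation. *)

Record liealg (R : realType) := LieAlg {
  lie_vect :> vectType R;
  lie_br : lie_vect -> lie_vect -> lie_vect;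
  lie_br_linear : forall X, linear (lie_br X);
  lie_br_alt : forall X, lie_br X X = 0;
  lie_jacobi : forall X Y Z,
    lie_br X (lie_br Y Z) + lie_br Y (lie_br Z X) + lie_br Z (lie_br X Y) = 0 }.

Section SymmetricSpace.
Variables (R : realType) (L : liealg R).

Definition ad (X : L) : 'End(L) := linfun (@lie_br R L X).

Definition lftrace (f : 'End(L)) : R :=
  \sum_(i < \dim {:L}) coord (vbasis {:L}) i (f (vbasis {:L})`_i).

Definition killing (X Y : L) : R := lftrace (ad X \o ad Y)%VF.

Definition semisimple : Prop :=
  forall X : L, (forall Y, killing X Y = 0) -> X = 0.

Definition no_compact_ideal : Prop :=
  forall U : {vspace L},
    (forall X Y : L, Y \in U -> lie_br X Y \in U) ->
    (forall Y : L, Y \in U -> Y != 0 -> killing Y Y < 0) -> U = 0%VS.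

Definition noncompact_type : Prop := semisimple /\ no_compact_ideal.

(* The limit of the exponential series is taken coordinatewise. *)
Definition lfexp (f : 'End(L)) : 'End(L) :=
  linfun (fun v : L => \sum_(i < \dim {:L})
    lim (series (fun k : nat =>
           coord (vbasis {:L}) i (iter k f v) / k`!%:R) @ \oo)
      *: (vbasis {:L})`_i).

Definition symspace : set 'End(L) := [set p |
  [/\ forall X Y : L, p (lie_br X Y) = lie_br (p X) (p Y),
      forall X : L, p (p X) = X &
      forall X : L, X != 0 -> 0 < - killing X (p X)]].

Definition pspace (p : 'End(L)) : {vspace L} := passmx.leigenspace p (-1).

Definition knorm (X : L) : R := Num.sqrt (killing X X).

Definition usphere (p : 'End(L)) : set L :=
  [set X | X \in pspace p /\ knorm X = 1].

(* Image of the point q under a Lie algebra automorphism a.  For a in G this is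
   the action of G; for a = p a point, it is the geodesic symmetry at p. *)
Definition act (a q : 'End(L)) : 'End(L) := (a \o (q \o a^-1))%VF.

Inductive isomG : set 'End(L) :=
| isomG1 : isomG \1%VF
| isomG_exp X a : isomG a -> isomG (lfexp (ad X) \o a)%VF.

Definition geo (p : 'End(L)) (X : L) (t : R) : 'End(L) :=
  act (lfexp (ad (t *: X))) p.

(* The least length of a geodesic t |-> e^{tX}p, 0 <= t <= 1, from p to q; since
   the space is complete this is the Riemannian distance. *)
Definition dist (p q : 'End(L)) : R :=
  inf [set knorm X | X in [set X : L | X \in pspace p /\ geo p X 1 = q]].

Definition dist_set (p : 'End(L)) (A : set 'End(L)) : R :=
  inf [set dist p q | q in A].

Definition nearest (A : set 'End(L)) (p q : 'End(L)) : Prop :=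
  A q /\ forall q', A q' -> q' <> q -> dist p q < dist p q'.

(* An ideal point is an asymptote class of unit speed rays; the ray
   t |-> e^{tX}p, with X a unit vector at p, is encoded by the pair (p, X). *)
Definition asymptotic (p : 'End(L)) (X : L) (q : 'End(L)) (Y : L) : Prop :=
  exists c : R, forall t : R, 0 <= t -> dist (geo p X t) (geo q Y t) <= c.

Definition ideal := set ('End(L) * L)%type.

Definition endpt (p : 'End(L)) (X : L) : ideal :=
  [set r | [/\ symspace r.1, usphere r.1 r.2 & asymptotic p X r.1 r.2]].

Definition dir (p : 'End(L)) (xi : ideal) : L :=
  xget 0 [set X : L | usphere p X /\ endpt p X = xi].

Definition angle (p : 'End(L)) (xi eta : ideal) : R :=
  acos (killing (dir p xi) (dir p eta)).

Definition act_ideal (a : 'End(L)) (xi : ideal) : ideal :=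
  [set (act a r.1, a r.2) | r in xi].

(* The type map to the quotient of the ideal boundary by G; a type is a
   G-orbit of ideal points. *)
Definition type_of (xi : ideal) : set ideal :=
  [set act_ideal a xi | a in isomG].

Definition opposition (z : set ideal) : set ideal :=
  [set act_ideal p.1 p.2 | p in symspace `*` z].

Definition abelian_in (p : 'End(L)) (a : {vspace L}) : Prop :=
  (a <= pspace p)%VS /\ forall X Y : L, X \in a -> Y \in a -> lie_br X Y = 0.

Definition max_abelian (p : 'End(L)) (a : {vspace L}) : Prop :=
  abelian_in p a /\
  forall b : {vspace L}, abelian_in p b -> (a <= b)%VS -> b = a.

Definition dual (a : {vspace L}) := 'Hom(subvs_of a, R^o).

Definition rval (a : {vspace L}) (alpha : dual a) (X : L) : R :=
  alpha (vsproj a X).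

Definition root_space (a : {vspace L}) (alpha : dual a) : {vspace L} :=
  (\bigcap_(i < \dim a)
     passmx.leigenspace (ad (vbasis a)`_i) (rval alpha (vbasis a)`_i))%VS.

Definition roots (a : {vspace L}) : set (dual a) :=
  [set alpha | alpha != 0 /\ root_space alpha != 0%VS].

Definition dual_norm (a : {vspace L}) (alpha : dual a) : R :=
  sup [set rval alpha A | A in [set A : L | A \in a /\ knorm A = 1]].

Definition kappa0 (a : {vspace L}) : R :=
  sup [set r | exists alpha : dual a, exists A : L,
    [/\ roots alpha, A \in a, knorm A = 1 & r = rval alpha A]].

(* A Weyl chamber is presented by a vector ch_reg of its interior. *)
Record chamber := Chamber {
  ch_pt : 'End(L);
  ch_a : {vspace L};
  ch_reg : L;
  ch_ptP : symspace ch_pt;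
  ch_aP : max_abelian ch_pt ch_a;
  ch_reg_a : ch_reg \in ch_a;
  ch_regP : forall alpha : dual ch_a, roots alpha -> rval alpha ch_reg != 0 }.

Section Chamber.
Variable C : chamber.

Definition positive_roots : set (dual (ch_a C)) :=
  [set alpha | roots alpha /\ 0 < rval alpha (ch_reg C)].

Definition simple_roots : set (dual (ch_a C)) :=
  [set alpha | positive_roots alpha /\
    forall beta gamma, positive_roots beta -> positive_roots gamma ->
      alpha <> beta + gamma].

Definition spherical_chamber : set L :=
  [set A : L | [/\ A \in ch_a C, knorm A = 1 &
    forall alpha, positive_roots alpha -> 0 <= rval alpha A]].

Definition face (t : set L) : Prop :=
  t !=set0 /\ exists2 Theta, Theta `<=` simple_roots &
    t = [set A | spherical_chamber A /\
                 forall alpha, Theta alpha -> rval alpha A = 0].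

Definition face_int (t : set L) : set L :=
  [set A | t A /\ forall alpha, simple_roots alpha ->
    rval alpha A = 0 -> forall A', t A' -> rval alpha A' = 0].

Definition simple_plus (t : set L) : set (dual (ch_a C)) :=
  [set alpha | simple_roots alpha /\
    forall A, face_int t A -> 0 < rval alpha A].

Definition roots_plus (t : set L) : set (dual (ch_a C)) :=
  [set alpha | roots alpha /\ forall A, face_int t A -> 0 < rval alpha A].

Definition c0 (t : set L) : nat :=
  (\big[addn/0%N]_(alpha \in roots_plus t) \dim (root_space alpha))%N.

(* The infimum is over a finite nonempty set of numbers in ]0, 1]. *)
Definition eps_zeta (t : set L) (zeta : L) : R :=
  2 * asin (inf [set rval alpha zeta / dual_norm alpha
                | alpha in roots_plus t]).

End Chamber.
Arguments roots_plus C t _ : clear implicits.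
Arguments simple_plus C t _ : clear implicits.

(* Simplices of the ideal boundary are sets of ideal points. *)
Definition simplex (S : set ideal) : Prop :=
  exists C : chamber, exists t : set L,
    face C t /\ S = [set endpt (ch_pt C) X | X in t].

Definition simplex_int (S : set ideal) : set ideal :=
  [set xi | exists C : chamber, exists t : set L,
    [/\ face C t, S = [set endpt (ch_pt C) X | X in t] &
        exists2 X, face_int C t X & xi = endpt (ch_pt C) X]].

(* Regularity, with respect to a simplex S, of a unit vector X at p. *)
Definition regular_dir (a0 : R) (S : set ideal) (p : 'End(L)) (X : L) : Prop :=
  exists C : chamber, exists t : set L,
    [/\ ch_pt C = p, face C t, S = [set endpt p Y | Y in t],
        spherical_chamber C X &
        forall alpha, simple_plus C t alpha -> a0 * knorm X <= rval alpha X].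

Definition tau_regular_dir (S : set ideal) (p : 'End(L)) (X : L) : Prop :=
  exists C : chamber, exists t : set L,
    [/\ ch_pt C = p, face C t, S = [set endpt p Y | Y in t],
        spherical_chamber C X &
        forall alpha, simple_plus C t alpha -> 0 < rval alpha X].

Definition regular_ideal (a0 : R) (S : set ideal) (xi : ideal) : Prop :=
  exists p : 'End(L), exists X : L,
    xi = endpt p X /\ regular_dir a0 S p X.

Definition star_cone (p : 'End(L)) (S : set ideal) (a0 : R) : set 'End(L) :=
  [set q | exists X : L, exists t : R,
    [/\ usphere p X, regular_ideal a0 S (endpt p X), 0 <= t & q = geo p X t]].

Definition regular_seg (a0 : R) (S : set ideal) (p q : 'End(L)) : Prop :=
  exists X : L, exists t : R,
    [/\ 0 < t, q = geo p X t & regular_dir a0 S p X].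

Definition tau_regular_seg (S : set ideal) (p q : 'End(L)) : Prop :=
  exists X : L, exists t : R,
    [/\ 0 < t, q = geo p X t & tau_regular_dir S p X].

Definition antipodal (Sm Sp : set ideal) : Prop :=
  exists p : 'End(L), exists X : L,
    [/\ symspace p, usphere p X,
        simplex_int Sm (endpt p (- X)) & simplex_int Sp (endpt p X)].

Definition parallel (p : 'End(L)) (X : L) (q : 'End(L)) (Y : L) : Prop :=
  exists c : R, forall t : R, dist (geo p X t) (geo q Y t) <= c.

Definition parallel_set (Sm Sp : set ideal) : set 'End(L) :=
  [set r | exists p : 'End(L), exists X : L,
    [/\ symspace p, usphere p X,
        simplex_int Sm (endpt p (- X)), simplex_int Sp (endpt p X) &
        exists q : 'End(L), exists Y : L, exists t : R,
          [/\ symspace q, usphere q Y, parallel p X q Y & r = geo q Y t]]].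

Section ModelType.
(* T is the set of types forming tau_mod, and z the type zeta. *)
Variables (T : set (set ideal)) (z : set ideal).

Definition flag (S : set ideal) : Prop :=
  simplex S /\ [set type_of xi | xi in S] = T.

Definition mod_regular_seg (a0 : R) (p q : 'End(L)) : Prop :=
  exists2 S, flag S & regular_seg a0 S p q.

Definition tau_of (p q : 'End(L)) : set ideal :=
  xget set0 [set S | flag S /\ tau_regular_seg S p q].

Definition diamond (a0 : R) (p q : 'End(L)) : set 'End(L) :=
  star_cone p (tau_of p q) a0 `&` star_cone q (tau_of q p) a0.

Definition zeta_pt (S : set ideal) : ideal :=
  xget set0 [set xi | simplex_int S xi /\ type_of xi = z].

Definition zeta_angle (p x y : 'End(L)) : R :=
  angle p (zeta_pt (tau_of p x)) (zeta_pt (tau_of p y)).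

(* A sequence is indexed by an interval I of integers; the values of x outside
   I are irrelevant. *)
Definition interval_set (I : set int) : Prop :=
  forall i j k : int, I i -> I k -> i <= j <= k -> I j.

Variables (I : set int) (x : int -> 'End(L)).

Definition straight (a0 eps : R) : Prop :=
  (forall n : int, I n -> I (n + 1) -> mod_regular_seg a0 (x n) (x (n + 1))) /\
  (forall n : int, I (n - 1) -> I n -> I (n + 1) ->
     pi - eps <= zeta_angle (x n) (x (n - 1)) (x (n + 1))).

Definition spaced (s : R) : Prop :=
  forall n : int, I n -> I (n + 1) -> s <= dist (x n) (x (n + 1)).

Definition coarsely_lipschitz : Prop :=
  exists c3 c4 : R, forall n N : int, I n -> I (n + N) ->
    dist (x n) (x (n + N)) <= c3 * `|N|%:~R + c4.

Definition coarsely_spaced : Prop :=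
  exists c1 c2 : R, 0 < c1 /\ forall n N : int, I n -> I (n + N) ->
    c1^-1 * `|N|%:~R - c2 <= dist (x n) (x (n + N)).

Definition quasigeodesic : Prop := coarsely_lipschitz /\ coarsely_spaced.

Definition morse (a0 D : R) : Prop :=
  quasigeodesic /\
  forall n m : int, I n -> I m -> n <= m ->
    exists p q : 'End(L),
      [/\ symspace p, symspace q, mod_regular_seg a0 p q,
          dist p (x n) <= D /\ dist q (x m) <= D &
          forall i : int, n <= i <= m -> dist_set (x i) (diamond a0 p q) <= D].

End ModelType.

End SymmetricSpace.

Arguments simple_plus {R L} C t _.
Arguments roots_plus {R L} C t _.

(* Main.v *)
Require Import Defs.
From HB Require Import structures.
From mathcomp Require Import all_boot all_order all_algebra.
From mathcomp Require Import all_classical all_reals all_analysis.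
From mathcomp Require Import perm complex zify ring lra.
Require Import Defs.
Import Order.TTheory GRing.Theory Num.Theory.
Import numFieldNormedType.Exports.
Local Open Scope classical_set_scope.
Local Open Scope ring_scope.

(** Points are Cartan involutions, and [bp p u v = - killing u (p v)] is an inner product for which [ad X],
    [X] in [pspace p], is self-adjoint; spectral theory of these maps replaces Riemannian geometry.  An ideal
    point is determined by the filtration of the Lie algebra by eigenvalues of [ad X] along any of its rays, so
    simplices, types and parallel sets become statements on filtrations; the metric enters through the law of
    cosines, proved with volumes of the steps of the filtration.

    Let [Z n] be the unit vector at [x n] of type zeta pointing to the flag of the segment from [x n] to
    [x (n + 1)]; it is also a tangent vector at [x (n + 1)], and straightness says that [Z n - Z (n - 1)] has
    length at most [eps].  Following a regular segment backwards contracts the part of a direction in the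
    unstable horospherical subalgebra by [expR (- (a0 * s))], so the direction of a flag [3 * eps]-close to the
    segment at its end is [2 * eps]-close to it at its start.  Iterating, and passing to an ultralimit when the
    sequence is infinite, gives flags [tau_+] and [tau_-] whose directions at every [x n] are opposite up to
    [5 * eps].  They are antipodal and have a common axis direction [z]; the difference between [z] and the
    directions at [x n] bounds [bp (x n) z z - 1], which grows with the distance from [x n] to the parallel set.
    Finally, on the nilradical of [z] the inner products at successive projections contract at the rate of the
    regular segments, up to an error controlled by [delta]; contraction rates add up along the sequence, so the
    segment between any two projections is regular and long. *)

Set Implicit Arguments.
Unset Strict Implicit.
Unset Printing Implicit Defensive.

(** * Inner products *)

Section InnerProduct.
Variables (R : realType) (V : vectType R).
Implicit Types (u v w : V) (U : {vspace V}) (ip : V -> V -> R) (f g : 'End(V)).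

(** Directions at a point are compared by the length of their difference, so that perturbation
    theory of self-adjoint maps applies to them directly. Conditions 1 to 4 are put in the form
    [10 * (kappa * eps) <= zeta0], [4 * expR (- (a0 * s)) <= 1], [5 * eps <= delta * zeta0] and the
    spacing condition cleared of its denominator. The first keeps a perturbation of size 5 eps,
    which moves eigenvalues by at most [kappa * 5 * eps], within half of the spectral gap zeta0 of a
    type-zeta vector; the second makes pulling back along one segment a contraction. Three obstacles
    shape the proof. Simplices, types and regularity are defined through chambers, and have to be
    recast as inclusions of parabolic subalgebras before analysis can use them. Being of a given
    type is a condition on G-orbits whose closedness is not evident, so the type of a limit flag is
    found by exhibiting group elements. Errors in directions would accumulate over many segments,
    whereas contraction exponents on the nilradical add up exactly; hence regularity of long
    segments is derived from inner products. *)

Record inner ip : Prop := Inner {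
  ipC : forall u v, ip u v = ip v u;
  ipPl : forall a u v w, ip (a *: u + v) w = a * ip u w + ip v w;
  ip_gt0 : forall u, u != 0 -> 0 < ip u u }.

Definition nrm ip u : R := Num.sqrt (ip u u).

Variable ip : V -> V -> R.
Hypothesis Hip : inner ip.
Local Notation "|~ u ~|" := (nrm ip u) (at level 0, u at level 99, format "|~ u ~|").

Lemma ip0l w : ip 0 w = 0.
Proof. by move: (ipPl Hip 1 0 0 w); rewrite scaler0 addr0 mul1r; lra. Qed.

Lemma ipDl u v w : ip (u + v) w = ip u w + ip v w.
Proof. by rewrite -{1}[u]scale1r (ipPl Hip) mul1r. Qed.

Lemma ipZl a u w : ip (a *: u) w = a * ip u w.
Proof. by rewrite -[a *: u]addr0 (ipPl Hip) ip0l addr0. Qed.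

Lemma ipNl u w : ip (- u) w = - ip u w.
Proof. by rewrite -scaleN1r ipZl mulN1r. Qed.

Lemma ipBl u v w : ip (u - v) w = ip u w - ip v w.
Proof. by rewrite ipDl ipNl. Qed.

Lemma ip0r w : ip w 0 = 0.
Proof. by rewrite (ipC Hip) ip0l. Qed.

Lemma ipDr u v w : ip w (u + v) = ip w u + ip w v.
Proof. by rewrite ![ip w _](ipC Hip) ipDl. Qed.

Lemma ipZr a u w : ip w (a *: u) = a * ip w u.
Proof. by rewrite ![ip w _](ipC Hip) ipZl. Qed.

Lemma ipNr u w : ip w (- u) = - ip w u.
Proof. by rewrite ![ip w _](ipC Hip) ipNl. Qed.

Lemma ipBr u v w : ip w (u - v) = ip w u - ip w v.
Proof. by rewrite ipDr ipNr. Qed.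

Lemma ip_suml (I : Type) (r : seq I) (P : pred I) (F : I -> V) w :
  ip (\sum_(i <- r | P i) F i) w = \sum_(i <- r | P i) ip (F i) w.
Proof. by apply: (big_morph (ip^~ w) (fun x y => ipDl x y w) (ip0l w)). Qed.

Lemma ip_sumr (I : Type) (r : seq I) (P : pred I) (F : I -> V) w :
  ip w (\sum_(i <- r | P i) F i) = \sum_(i <- r | P i) ip w (F i).
Proof. by apply: (big_morph (ip w) (fun x y => ipDr x y w) (ip0r w)). Qed.

Lemma ip_ge0 u : 0 <= ip u u.
Proof. by have [->|/(ip_gt0 Hip)/ltW//] := eqVneq u 0; rewrite ip0l. Qed.

Lemma ip_eq0 u : ip u u = 0 -> u = 0.
Proof. by move=> h; apply/eqP/negPn/negP => /(ip_gt0 Hip); rewrite h ltxx. Qed.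

Lemma ip_inj u v : (forall w, ip u w = ip v w) -> u = v.
Proof.
by move=> h; apply/eqP; rewrite -subr_eq0; apply/eqP/ip_eq0; rewrite ipBl h subrr.
Qed.

Lemma nrm_ge0 u : 0 <= |~u~|.
Proof. exact: sqrtr_ge0. Qed.

Lemma sqr_nrm u : |~u~| ^+ 2 = ip u u.
Proof. by rewrite sqr_sqrtr // ip_ge0. Qed.

Lemma nrm0 : |~0~| = 0.
Proof. by rewrite /nrm ip0l sqrtr0. Qed.

Lemma nrm_gt0 u : u != 0 -> 0 < |~u~|.
Proof. by move=> /(ip_gt0 Hip); rewrite sqrtr_gt0. Qed.

Lemma nrmZ a u : |~a *: u~| = `|a| * |~u~|.
Proof. by rewrite /nrm ipZl ipZr mulrA -expr2 sqrtrM ?sqr_ge0 // sqrtr_sqr. Qed.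

Lemma nrmN u : |~- u~| = |~u~|.
Proof. by rewrite -scaleN1r nrmZ normrN1 mul1r. Qed.

Lemma ip_CS_sqr u v : ip u v ^+ 2 <= ip u u * ip v v.
Proof.
have [->|v0] := eqVneq v 0; first by rewrite !ip0r expr0n /= mulr0.
have vv := ip_gt0 Hip v0.
have := ip_ge0 (ip v v *: u - ip u v *: v).
rewrite ipBl !ipBr !ipZl !ipZr (ipC Hip v u) => h.
have : 0 <= ip v v * (ip u u * ip v v - ip u v ^+ 2) by move: h; lra.
by rewrite pmulr_rge0 // subr_ge0.
Qed.

Lemma ip_CS u v : `|ip u v| <= |~u~| * |~v~|.
Proof.
by rewrite /nrm -sqrtrM ?ip_ge0 // -sqrtr_sqr ler_wsqrtr // ip_CS_sqr.
Qed.

Lemma ip_le u v : ip u v <= |~u~| * |~v~|.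
Proof. exact: le_trans (ler_norm _) (ip_CS u v). Qed.

Lemma nrmD u v : |~u + v~| <= |~u~| + |~v~|.
Proof.
rewrite -(ler_pXn2r (n:=2)) ?nnegrE ?addr_ge0 ?nrm_ge0 // sqrrD !sqr_nrm ipDl !ipDr.
by rewrite (ipC Hip v u); move: (ip_le u v); lra.
Qed.

Lemma nrm_sum (I : Type) (r : seq I) (P : pred I) (F : I -> V) :
  |~\sum_(i <- r | P i) F i~| <= \sum_(i <- r | P i) |~F i~|.
Proof.
apply: (big_ind2 (fun x y => |~x~| <= y)) => //; first by rewrite nrm0.
by move=> x1 x2 y1 y2 h1 h2; apply: le_trans (nrmD _ _) (lerD h1 h2).
Qed.

Definition orthon n (e : 'I_n -> V) := forall i j, ip (e i) (e j) = (i == j)%:R.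

Definition onb U n (e : 'I_n -> V) :=
  [/\ orthon e, forall i, e i \in U & forall v, v \in U -> v = \sum_i ip (e i) v *: e i].

Definition selfadj f := forall u v, ip (f u) v = ip u (f v).

Lemma orthon_coef n (e : 'I_n -> V) (c : 'I_n -> R) j :
  orthon e -> ip (e j) (\sum_i c i *: e i) = c j.
Proof.
move=> he; rewrite ip_sumr (bigD1 j) //= ipZr he eqxx mulr1 big1 ?addr0 // => i ij.
by rewrite ipZr he eq_sym (negPf ij) mulr0.
Qed.

Lemma onb_sum_ip U n (e : 'I_n -> V) u v : onb U e -> v \in U ->
  ip u v = \sum_i ip (e i) u * ip (e i) v.
Proof.
case=> _ _ he hv; rewrite {1}(he v hv) ip_sumr.
by apply: eq_bigr => i _; rewrite ipZr (ipC Hip u) mulrC.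
Qed.

Lemma onb0 : onb 0%VS (fun i : 'I_0 => 0).
Proof.
split=> [[]//|[]//|v]; rewrite memv0 => /eqP ->.
by rewrite big_ord0.
Qed.

(* Complexifying produces u + iv with f u = a u - b v and f v = b u + a v; self-adjointness forces b = 0. *)
Lemma selfadj_eigenvector U f : selfadj f -> (forall v, v \in U -> f v \in U) -> U != 0%VS ->
  exists a v, [/\ v \in U, v != 0 & f v = a *: v].
Proof.
move=> hf hU U0; set n := \dim U; set b := vbasis U.
have bU (i : 'I_n) : b`_i \in U by apply: vbasis_mem; rewrite mem_nth // size_tuple.
pose A : 'M[R]_n := \matrix_(i, j) coord b j (f b`_i).
pose vec (x : 'rV[R]_n) := \sum_i x 0 i *: b`_i.
have vecU x : vec x \in U by apply: rpred_sum => i _; rewrite rpredZ.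
have fvec x : f (vec x) = vec (x *m A).
  rewrite linear_sum /=; under eq_bigr => i _ do
    rewrite linearZ /= (coord_vbasis (hU _ (bU i))) scaler_sumr.
  rewrite exchange_big /=; apply: eq_bigr => j _; rewrite mxE scaler_suml.
  by apply: eq_bigr => i _; rewrite scalerA mxE.
have vecP x : vec x = 0 -> x = 0.
  move=> h; have /freeP /(_ (fun i => x 0 i) h) hx := basis_free (vbasisP U).
  by apply/rowP => i; rewrite hx mxE.
have n0 : (0 < n)%N by rewrite lt0n dimv_eq0.
pose Ac := map_mx (fun x : R => (x%:C)%C) A.
have /closed_rootP [z hz] : size (char_poly Ac) != 1%N.
  by rewrite size_char_poly; case: (n) n0.
move: hz; rewrite -eigenvalue_root_char => /eigenvalueP [w hw w0].
pose x := map_mx (@complex.Re R) w; pose y := map_mx (@complex.Im R) w.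
case: z hw => c d hw.
have hre k : (x *m A) 0 k = c * x 0 k - d * y 0 k.
  have := congr1 (fun M : 'rV_n => complex.Re (M 0 k)) hw.
  rewrite !mxE raddf_sum /= => h.
  transitivity (complex.Re (Complex c d * w 0 k)%R); last by case: (w 0 k).
  rewrite -h; apply: eq_bigr => i _; rewrite !mxE.
  by case: (w 0 i) => p q /=; rewrite mulr0 subr0.
have him k : (y *m A) 0 k = d * x 0 k + c * y 0 k.
  have := congr1 (fun M : 'rV_n => complex.Im (M 0 k)) hw.
  rewrite !mxE raddf_sum /= => h.
  transitivity (complex.Im (Complex c d * w 0 k)%R); last first.
    by case: (w 0 k) => p q /=; rewrite addrC.
  rewrite -h; apply: eq_bigr => i _; rewrite !mxE.
  by case: (w 0 i) => p q /=; rewrite mulr0 add0r.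
have fx : f (vec x) = c *: vec x - d *: vec y.
  rewrite fvec /vec !scaler_sumr -sumrB; apply: eq_bigr => i _.
  by rewrite hre scalerBl !scalerA.
have fy : f (vec y) = d *: vec x + c *: vec y.
  rewrite fvec /vec !scaler_sumr -big_split; apply: eq_bigr => i _ /=.
  by rewrite him scalerDl !scalerA.
have xy0 : (vec x != 0) || (vec y != 0).
  apply/negPn/negP; rewrite negb_or !negbK => /andP [/eqP hx /eqP hy].
  case/negP: w0; apply/eqP/rowP => i; rewrite mxE.
  have := congr1 (fun M : 'rV_n => M 0 i) (vecP _ hx); rewrite !mxE.
  have := congr1 (fun M : 'rV_n => M 0 i) (vecP _ hy); rewrite !mxE.
  by case: (w 0 i) => p q /= -> ->.
have d0 : d = 0.
  have := hf (vec x) (vec y); rewrite fx fy ipBl ipDr !ipZl !ipZr => h.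
  have h2 : d * (ip (vec x) (vec x) + ip (vec y) (vec y)) = 0 by lra.
  have : 0 < ip (vec x) (vec x) + ip (vec y) (vec y).
    have := ip_ge0 (vec x); have := ip_ge0 (vec y).
    by case/orP: xy0 => /(ip_gt0 Hip) h0; lra.
  by move/eqP: h2; rewrite mulf_eq0 => /orP [/eqP //|/eqP ->]; rewrite ltxx.
move: fx fy; rewrite d0 !scale0r subr0 add0r => fx fy.
by case/orP: xy0 => h0; [exists c, (vec x) | exists c, (vec y)].
Qed.

End InnerProduct.

(** * Simultaneous diagonalisation, orthogonal projections and the angle between spectral
    subspaces *)

Section Spectral.
Variables (R : realType) (V : vectType R) (ip : V -> V -> R).
Hypothesis Hip : inner ip.
Implicit Types (u v w : V) (U A B : {vspace V}) (f g : 'End(V)).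
Local Notation "|~ u ~|" := (nrm ip u) (at level 0, u at level 99, format "|~ u ~|").

Lemma lfun_linear (W : vectType R) (h : V -> W) : linear h -> exists f : 'Hom(V, W), f =1 h.
Proof.
move=> hl; pose h' : {linear V -> W} := HB.pack h (GRing.isLinear.Build _ _ _ _ h hl).
by exists (linfun h') => v; rewrite lfunE.
Qed.

(** If the family does not act by scalars on U, one of its members has a proper eigenspace in U,
    which the others preserve because they commute with it; the dimension drops. The family may be
    infinite. *)
Lemma joint_eigenvector (S : set 'End(V)) U :
  (forall f, S f -> selfadj ip f) -> (forall f g v, S f -> S g -> f (g v) = g (f v)) ->
  (forall f v, S f -> v \in U -> f v \in U) -> U != 0%VS ->
  exists v, [/\ v \in U, v != 0 & forall f, S f -> exists a, f v = a *: v].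
Proof.
move=> hs hc; have [n] := ubnP (\dim U); elim: n U => // n IH U hn hU U0.
have [h|] := pselect (forall f, S f -> exists a, forall v, v \in U -> f v = a *: v).
  exists (vpick U); split; rewrite ?memv_pick ?vpick0 // => f /h [a ha].
  by exists a; apply: ha; exact: memv_pick.
move=> /existsNP [f /not_implyP [Sf /forallNP hf]].
have [a [v [vU v0 fv]]] := selfadj_eigenvector Hip (hs _ Sf) (fun v => hU f v Sf) U0.
pose U' := (U :&: lker (f - a *: \1%VF))%VS.
have memU' w : (w \in U') = (w \in U) && (f w == a *: w).
  by rewrite memv_cap memv_ker add_lfunE opp_lfunE scale_lfunE id_lfunE subr_eq0.
have U'0 : U' != 0%VS.
  apply: contraNneq v0 => h; have : v \in U' by rewrite memU' vU fv eqxx.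
  by rewrite h memv0.
have lt : (\dim U' < n)%N.
  have hle : (U' <= U)%VS by apply: capvSl.
  rewrite -ltnS; apply: leq_trans hn; rewrite ltnS ltn_neqAle dimvS // andbT.
  apply/negP => /eqP h; apply: (hf a) => w wU.
  have : w \in U' by rewrite (eqP (_ : U' == U)) // eqEdim hle h leqnn.
  by rewrite memU' => /andP [_ /eqP].
have hU' g w : S g -> w \in U' -> g w \in U'.
  move=> Sg; rewrite !memU' => /andP [h1 /eqP h2].
  by rewrite hU //= (hc _ _ _ Sf Sg) h2 linearZ.
have [w [wU w0 hw]] := IH U' lt hU' U'0.
by move: wU; rewrite memU' => /andP [wU _]; exists w.
Qed.

Lemma orthogonal_complement v U :
  exists U', forall u, (u \in U') = (u \in U) && (ip v u == 0).
Proof.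
have [h hh] := @lfun_linear R^o (ip v)
  (fun a x y => etrans (ipDr Hip _ _ _) (congr1 (+%R^~ _) (ipZr Hip _ _ _))).
by exists (U :&: lker h)%VS => u; rewrite memv_cap memv_ker hh.
Qed.

Lemma joint_spectral (S : set 'End(V)) U :
  (forall f, S f -> selfadj ip f) -> (forall f g v, S f -> S g -> f (g v) = g (f v)) ->
  (forall f v, S f -> v \in U -> f v \in U) ->
  exists n (e : 'I_n -> V), onb ip U e /\ forall f i, S f -> exists a, f (e i) = a *: e i.
Proof.
move=> hs hc; have [n] := ubnP (\dim U); elim: n U => // n IH U hn hU.
have [->|U0] := eqVneq U 0%VS.
  by exists 0%N, (fun=> 0); split=> [|f []]; first exact: onb0.
have [v0 [v0U v00 hv0]] := joint_eigenvector hs hc hU U0.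
pose v := |~ v0 ~|^-1 *: v0.
have nv0 := nrm_gt0 Hip v00.
have vU : v \in U by rewrite rpredZ.
have vv : ip v v = 1.
  by rewrite ipZl // ipZr // -sqr_nrm //; field; rewrite gt_eqF.
have hv f : S f -> exists a, f v = a *: v.
  by move=> /hv0 [a ha]; exists a; rewrite linearZ /= ha !scalerA mulrC.
have [U' memU'] := orthogonal_complement v U.
have lt : (\dim U' < n)%N.
  have hle : (U' <= U)%VS by apply/subvP => u; rewrite memU' => /andP [].
  rewrite -ltnS; apply: leq_trans hn; rewrite ltnS ltn_neqAle dimvS // andbT.
  apply/negP => /eqP h.
  have : v \in U' by rewrite (eqP (_ : U' == U)) // eqEdim hle h leqnn.
  by rewrite memU' vv oner_eq0 andbF.
have [f u Sf|m [e [[oe eU' he] heig]]] := IH U' lt.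
  rewrite !memU' => /andP [uU /eqP h]; rewrite hU //= -(hs _ Sf).
  by have [a ->] := hv _ Sf; rewrite ipZl // h mulr0.
have ve i : ip v (e i) = 0 by move: (eU' i); rewrite memU' => /andP [_ /eqP].
exists m.+1, (fun i => if unlift ord0 i is Some j then e j else v).
split=> [|f i Sf] /=; last by case: unliftP => [j|] _; [apply: heig|apply: hv].
split.
- move=> i j /=; case: unliftP => [i'|] ->; case: unliftP => [j'|] ->.
  + by rewrite oe (inj_eq lift_inj).
  + by rewrite ipC // ve.
  + by rewrite ve.
  + by rewrite vv eqxx.
- by move=> i /=; case: unliftP => [j|] _ //; move: (eU' j); rewrite memU' => /andP [].
- move=> u uU; rewrite big_ord_recl unlift_none.
  under eq_bigr => i _ do rewrite liftK.
  have hu : u - ip v u *: v \in U'.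
    by rewrite memU' rpredB ?rpredZ //= ipBr // ipZr // vv mulr1 subrr.
  rewrite -[LHS](subrK (ip v u *: v)) addrC; congr (_ + _); rewrite (he _ hu).
  by apply: eq_bigr => i _; rewrite ipBr // ipZr // (ipC Hip _ v) ve mulr0 subr0.
Qed.

Lemma spectral f U : selfadj ip f -> (forall v, v \in U -> f v \in U) ->
  exists n (e : 'I_n -> V) (m : 'I_n -> R), onb ip U e /\ forall i, f (e i) = m i *: e i.
Proof.
move=> hf hU; have [|||n [e [he h]]] := @joint_spectral [set f] U.
- by move=> _ ->.
- by move=> _ _ v -> ->.
- by move=> _ v -> /hU.
have [m hm] := choice (fun i => h f i erefl).
by exists n, e, m.
Qed.

Lemma exists_onb U : exists n (e : 'I_n -> V), onb ip U e.
Proof.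
(* The zero map is self-adjoint, so its spectral theorem is the existence of an orthonormal
   basis. *)
by have [| |n [e [m [he _]]]] := @spectral 0 U; [move=> u v; rewrite !lfunE /= ip0l // ip0r|
  move=> v _; rewrite lfunE rpred0|exists n, e].
Qed.

Lemma onb_dim U n (e : 'I_n -> V) : onb ip U e -> n = \dim U.
Proof.
move=> [oe eU he]; pose s := [tuple e i | i < n].
have sP : basis_of U s.
  apply/andP; split.
    apply/eqP/vspaceP => v; apply/idP/idP => [|vU].
      apply/subvP/span_subvP => x /tnthP [i ->]; rewrite tnth_mktuple; exact: eU.
    rewrite (he v vU); apply: rpred_sum => i _; apply: rpredZ; apply: memv_span.
    by apply/tnthP; exists i; rewrite tnth_mktuple.
  apply/freeP => k hk i.
  rewrite -(orthon_coef Hip k i oe); have -> : \sum_(i0 < n) k i0 *: e i0 = 0; last by rewrite ip0r.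
  by rewrite -[RHS]hk; apply: eq_bigr => j _; rewrite -(tnth_nth 0 s j) tnth_mktuple.
by rewrite (size_basis sP).
Qed.

Lemma exists_proj U : exists P : 'End(V),
  [/\ forall v, P v \in U, forall u, u \in U -> P u = u & forall u v, u \in U -> ip u (P v) = ip u v].
Proof.
have [n [e [oe eU he]]] := exists_onb U.
have [|P hP] := @lfun_linear V (fun v => \sum_i ip (e i) v *: e i).
  move=> a u v; rewrite scaler_sumr -big_split; apply: eq_bigr => i _ /=.
  by rewrite ipDr // ipZr // scalerDl scalerA.
have PU v : P v \in U by rewrite hP; apply: rpred_sum => i _; rewrite rpredZ.
exists P; split=> // [u /he {2}->|u v uU]; first by rewrite hP.
rewrite !(ipC Hip u) !(onb_sum_ip Hip _ (And3 oe eU he) uU).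
by apply: eq_bigr => i _; rewrite hP orthon_coef.
Qed.

Definition oproj U : 'End(V) := projT1 (cid (exists_proj U)).

Lemma oproj_mem U v : oproj U v \in U.
Proof. by rewrite /oproj; case: cid => P []. Qed.

Lemma oproj_id U v : v \in U -> oproj U v = v.
Proof. by rewrite /oproj; case: cid => P [] /= _ h _ /h. Qed.

Lemma ip_oproj U u v : u \in U -> ip u (oproj U v) = ip u v.
Proof. by rewrite /oproj; case: cid => P [] /= _ _ h /h. Qed.

Lemma oproj_selfadj U : selfadj ip (oproj U).
Proof.
by move=> u v; rewrite -(ip_oproj _ (oproj_mem U u)) (ipC Hip) ip_oproj ?oproj_mem // (ipC Hip).
Qed.

Lemma oproj_sub U A v : (U <= A)%VS -> oproj U (oproj A v) = oproj U v.
Proof.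
move=> /subvP h; apply: (ip_inj Hip) => w; rewrite !oproj_selfadj.
by rewrite (oproj_id (h _ (oproj_mem U w))).
Qed.

(* Davis-Kahan. *)
Lemma spectral_gap_ip f g A B m1 m2 eta :
  selfadj ip f -> selfadj ip g ->
  (forall v, v \in A -> f v \in A) -> (forall v, v \in B -> g v \in B) ->
  (forall v, v \in A -> m1 * ip v v <= ip v (f v)) ->
  (forall v, v \in B -> ip v (g v) <= m2 * ip v v) ->
  (forall v, |~ f v - g v ~| <= eta * |~ v ~|) -> m2 < m1 ->
  forall a b, a \in A -> b \in B -> `|ip a b| <= eta / (m1 - m2) * (|~ a ~| * |~ b ~|).
Proof.
move=> sf sg fA gB hA hB hfg m12 a b aA bB.
have m0 : 0 < m1 - m2 by rewrite subr_gt0.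
(* The eigenvalues of the compression S of the projection to A are the squared cosines between A and
   B. On a unit eigenvector e in B with projection a to A, pairing a with [f e - g e] costs at most
   [eta * |a|] and yields at least [(m1 - m2) * |a|^2]. *)
pose S := (oproj B \o oproj A \o oproj B)%VF.
have SE v : S v = oproj B (oproj A (oproj B v)) by rewrite !lfunE /= lfunE.
have sS : selfadj ip S by move=> u v; rewrite !SE !oproj_selfadj.
have [v _|n [e [s [oe hs]]]] := spectral (U := B) sS; first by rewrite SE oproj_mem.
have eB i : e i \in B by case: oe.
set K := eta / (m1 - m2).
have s2 i : s i = ip (oproj A (e i)) (oproj A (e i)).
  have := congr1 (ip (e i)) (hs i); rewrite SE ip_oproj // (oproj_id (eB i)) ipZr //.
  by case: (oe) => -> _ _; rewrite eqxx mulr1 oproj_selfadj (oproj_id (oproj_mem _ _)).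
have K0 : 0 <= K * |~ b ~|.
  rewrite /K mulrAC; apply: divr_ge0; last exact: ltW.
  exact: le_trans (nrm_ge0 _ _) (hfg b).
have sK i : s i <= K ^+ 2.
  have h1 : (m1 - m2) * s i <= eta * |~ oproj A (e i) ~|.
    have ei1 : |~ e i ~| = 1 by rewrite /nrm; case: oe => -> _ _; rewrite eqxx sqrtr1.
    have := ip_le Hip (oproj A (e i)) (f (e i) - g (e i)); rewrite ipBr //.
    have -> : ip (oproj A (e i)) (f (e i)) = ip (oproj A (e i)) (f (oproj A (e i))).
      by rewrite -sf -(ip_oproj _ (fA _ (oproj_mem A (e i)))) sf.
    have -> : ip (oproj A (e i)) (g (e i)) = s i * ip (e i) (g (e i)).
      have h2 : oproj B (oproj A (e i)) = s i *: e i by rewrite -hs SE (oproj_id (eB i)).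
      by rewrite (ipC Hip) -(ip_oproj _ (gB _ (eB i))) h2 ipZr // (ipC Hip).
    have h2 := hA _ (oproj_mem A (e i)); have h3 := hB _ (eB i).
    have h4 := hfg (e i); rewrite ei1 mulr1 in h4.
    have h5 : s i * ip (e i) (g (e i)) <= s i * m2.
      rewrite ler_wpM2l //; first by rewrite s2 ip_ge0.
      by case: (oe) h3 => -> _ _; rewrite eqxx mulr1.
    have h6 : |~ oproj A (e i) ~| * |~ f (e i) - g (e i) ~| <= |~ oproj A (e i) ~| * eta.
      by rewrite ler_wpM2l ?nrm_ge0.
    rewrite -s2 in h2; lra.
  have sE : s i = |~ oproj A (e i) ~| ^+ 2 by rewrite sqr_nrm.
  have [z|nz] := eqVneq (|~ oproj A (e i) ~|) 0.
    by rewrite sE z expr0n sqr_ge0.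
  have np : 0 < |~ oproj A (e i) ~| by rewrite lt_neqAle eq_sym nz nrm_ge0.
  have h7 : |~ oproj A (e i) ~| <= K.
    rewrite /K ler_pdivlMr // mulrC -(ler_pM2r np) -mulrA -expr2 -sE //.
  by rewrite sE ler_pXn2r ?nnegrE ?nrm_ge0 // (le_trans _ h7) ?nrm_ge0.
have hPb : |~ oproj A b ~| <= K * |~ b ~|.
  rewrite -(ler_pXn2r (n:=2)) ?nnegrE ?nrm_ge0 // exprMn !sqr_nrm //.
  rewrite oproj_selfadj (oproj_id (oproj_mem _ _)) -(ip_oproj _ bB).
  have -> : oproj B (oproj A b) = S b by rewrite SE (oproj_id bB).
  rewrite -sS (onb_sum_ip Hip _ oe bB) [in leRHS](onb_sum_ip Hip _ oe bB) mulr_sumr.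
  apply: ler_sum => i _; rewrite (ipC Hip _ (S b)) sS hs ipZr // (ipC Hip b).
  by rewrite -mulrA ler_wpM2r // -expr2 sqr_ge0.
rewrite -(ip_oproj _ aA); apply: le_trans (ip_CS Hip _ _) _.
by rewrite [leRHS]mulrCA ler_wpM2l ?nrm_ge0.
Qed.

End Spectral.

(** * Limits and exponentials in a finite-dimensional space *)

Section VectorLimits.
Variables (R : realType).
Implicit Types V W : vectType R.

Definition cb V i (v : V) : R := coord (vbasis {:V}) i v.

Lemma cbE V (v : V) : v = \sum_i cb i v *: (vbasis {:V})`_i.
Proof. by rewrite {1}(coord_vbasis (memvf v)). Qed.

Lemma cb_inj V (u v : V) : (forall i, cb i u = cb i v) -> u = v.
Proof. by move=> h; rewrite (cbE u) (cbE v); apply: eq_bigr => i _; rewrite h. Qed.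

Definition additive_hom V W (h : V -> W) := forall a u v, h (a *: u + v) = a *: h u + h v.

Definition lfunctional V (h : V -> R) := forall a u v, h (a *: u + v) = a * h u + h v.

Lemma lfunctional0 V (h : V -> R) : lfunctional h -> h 0 = 0.
Proof. by move=> hl; move: (hl 1 0 0); rewrite scaler0 addr0 mul1r; lra. Qed.

Lemma lfunctional_sum V (h : V -> R) I (r : seq I) (c : I -> R) (F : I -> V) : lfunctional h ->
  h (\sum_(i <- r) c i *: F i) = \sum_(i <- r) c i * h (F i).
Proof.
move=> hl; elim: r => [|x r IH]; first by rewrite !big_nil lfunctional0.
by rewrite !big_cons hl IH.
Qed.

Lemma lfunctionalE V (h : V -> R) v : lfunctional h ->
  h v = \sum_i cb i v * h (vbasis {:V})`_i.
Proof. by move=> hl; rewrite {1}(cbE v) lfunctional_sum. Qed.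

Section Limits.
Variable (F : set_system nat).
Context {FF : ProperFilter F}.

(** Coordinatewise, so that no norm has to be chosen. The filter is arbitrary because the same
    lemmas serve the exponential series and ultralimits of directions. *)
Definition vcvg V (u : nat -> V) (l : V) := forall i, (fun k => cb i (u k)) @ F --> cb i l.

Lemma cvg_sumr I (r : seq I) (f : I -> nat -> R) (l : I -> R) :
  (forall i, f i @ F --> l i) -> (fun k => \sum_(i <- r) f i k) @ F --> \sum_(i <- r) l i.
Proof.
move=> h; elim: r => [|x r IH].
  by under eq_fun => k do rewrite big_nil; rewrite big_nil; apply: cvg_cst.
by under eq_fun => k do rewrite big_cons; rewrite big_cons; apply: cvgD.
Qed.

Lemma cvgr_uniq (u : nat -> R) (a b : R) : u @ F --> a -> u @ F --> b -> a = b.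
Proof. by move=> h1 h2; apply: (cvg_unique (@Rhausdorff R) h1 h2). Qed.

Lemma cvgr_lel (u v : nat -> R) (a b : R) :
  u @ F --> a -> v @ F --> b -> (forall k, u k <= v k) -> a <= b.
Proof.
move=> hu hv h; rewrite -subr_ge0; have hd : (v - u) x @[x --> F] --> b - a by apply: cvgB.
rewrite -(cvg_lim (@Rhausdorff R) hd); apply: limr_ge; first exact: cvgP hd.
by apply: nearW => k; rewrite /= subr_ge0.
Qed.

Lemma vcvg_functional V (h : V -> R) (u : nat -> V) l : lfunctional h -> vcvg u l ->
  (fun k => h (u k)) @ F --> h l.
Proof.
move=> hl hu; rewrite (lfunctionalE l hl).
under eq_fun => k do rewrite (lfunctionalE (u k) hl).
by apply: cvg_sumr => i; apply: cvgM; [exact: hu|exact: cvg_cst].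
Qed.

Lemma vcvg_lin V W (h : V -> W) (u : nat -> V) l : additive_hom h -> vcvg u l ->
  vcvg (fun k => h (u k)) (h l).
Proof.
move=> hl hu i; apply: (@vcvg_functional _ (fun v => cb i (h v))) => // a x y.
by rewrite hl /cb linearP.
Qed.

Lemma vcvg_lfun V W (h : 'Hom(V, W)) (u : nat -> V) l : vcvg u l -> vcvg (fun k => h (u k)) (h l).
Proof. by apply: vcvg_lin => a x y; rewrite linearP. Qed.

Lemma vcvg_uniq V (u : nat -> V) a b : vcvg u a -> vcvg u b -> a = b.
Proof. by move=> h1 h2; apply: cb_inj => i; apply: cvgr_uniq (h1 i) (h2 i). Qed.

Lemma vcvg_cst V (v : V) : vcvg (fun=> v) v.
Proof. by move=> i; apply: cvg_cst. Qed.

Lemma vcvgD V (u v : nat -> V) a b : vcvg u a -> vcvg v b -> vcvg (fun k => u k + v k) (a + b).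
Proof.
move=> h1 h2 i; rewrite /cb linearD /=; under eq_fun => k do rewrite linearD /=.
by apply: cvgD; [exact: h1|exact: h2].
Qed.

Lemma vcvgZ V (c : nat -> R) (u : nat -> V) (x : R) a :
  c @ F --> x -> vcvg u a -> vcvg (fun k => c k *: u k) (x *: a).
Proof.
move=> h1 h2 i; rewrite /cb linearZ /=; under eq_fun => k do rewrite linearZ /=.
by apply: cvgM => //; exact: h2.
Qed.

Lemma vcvg_sum V I (r : seq I) (u : I -> nat -> V) l : (forall i, vcvg (u i) (l i)) ->
  vcvg (fun k => \sum_(i <- r) u i k) (\sum_(i <- r) l i).
Proof.
move=> h; elim: r => [|x r IH].
  by under eq_fun => k do rewrite big_nil; rewrite big_nil; apply: vcvg_cst.
by under eq_fun => k do rewrite big_cons; rewrite big_cons; apply: vcvgD.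
Qed.

Lemma vcvgB V (u v : nat -> V) a b : vcvg u a -> vcvg v b -> vcvg (fun k => u k - v k) (a - b).
Proof.
move=> h1 h2; rewrite -scaleN1r; under eq_fun => k do rewrite -scaleN1r.
by apply: vcvgD => //; apply: vcvgZ => //; apply: cvg_cst.
Qed.

Lemma vcvg_bil V W (Z : vectType R) (b : V -> W -> Z) (u : nat -> V) (w : nat -> W) x y :
  (forall v, additive_hom (b v)) -> (forall v, additive_hom (b^~ v)) ->
  vcvg u x -> vcvg w y -> vcvg (fun k => b (u k) (w k)) (b x y).
Proof.
move=> h1 h2 hu hw.
have sumE : forall v z, b v z = \sum_i cb i v *: b (vbasis {:V})`_i z.
  move=> v z; rewrite {1}(cbE v).
  have b0 : b 0 z = 0.
    by move: (h2 z 1 0 0); rewrite scaler0 addr0 scale1r => /eqP; rewrite -subr_eq0 opprD addNKr oppr_eq0 => /eqP.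
  elim: (index_enum _) => [|i r IH]; first by rewrite !big_nil.
  by rewrite !big_cons h2 IH.
rewrite sumE; under eq_fun => k do rewrite sumE.
by apply: vcvg_sum => i; apply: vcvgZ; [exact: hu|apply: vcvg_lin].
Qed.

Lemma vcvg_bilr V W (b : V -> W -> R) (u : nat -> V) (w : nat -> W) x y :
  (forall v, lfunctional (b v)) -> (forall v, lfunctional (b^~ v)) ->
  vcvg u x -> vcvg w y -> (fun k => b (u k) (w k)) @ F --> b x y.
Proof.
move=> h1 h2 hu hw.
have sumE v z : b v z = \sum_i cb i v * b (vbasis {:V})`_i z.
  exact: (lfunctionalE v (h2 z)).
rewrite sumE; under eq_fun => k do rewrite sumE.
by apply: cvg_sumr => i; apply: cvgM; [exact: hu|apply: vcvg_functional].
Qed.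

Lemma vcvg_mem V (U : {vspace V}) (u : nat -> V) l :
  (forall k, u k \in U) -> vcvg u l -> l \in U.
Proof.
move=> hU hu; have : projv U l = l.
  apply: (@vcvg_uniq _ u) => //.
  by have := vcvg_lfun (h := projv U) hu; under eq_fun => k do rewrite projv_id //.
by move=> <-; exact: memv_proj.
Qed.

End Limits.

Lemma exists_free_ultrafilter : exists U : set_system nat, UltraFilter U /\ \oo `<=` U.
Proof. by apply: ultraFilterLemma; exact: eventually_filter. Qed.

Lemma ultra_cvgr (U : set_system nat) (u : nat -> R) M : UltraFilter U ->
  (forall k, `|u k| <= M) -> exists l : R, u @ U --> l.
Proof.
move=> UU hu; have [|l [_ hl]] := @segment_compact R (- M) M (u @ U) _.
  by apply: (@filterS _ U _ setT) => [k _ /=|]; [rewrite in_itv /= -ler_norml|exact: filterT].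
exists l => N hN; have [//|hc] := in_ultra_setVsetC (u @^-1` N) UU.
have [||y [h1 h2]] := hl (~` N) N; by [].
Qed.

Lemma ultra_vcvg V (U : set_system nat) (u : nat -> V) (M : R) : UltraFilter U ->
  (forall k i, `|cb i (u k)| <= M) -> exists l, vcvg U u l.
Proof.
move=> UU hu.
have /choice [c hc] i : exists l : R, (fun k => cb i (u k)) @ U --> l.
  by apply: (@ultra_cvgr U _ M) => k.
exists (\sum_i c i *: (vbasis {:V})`_i) => i.
have -> // : cb i (\sum_i c i *: (vbasis {:V})`_i) = c i.
by rewrite /cb coord_sum_free // (basis_free (vbasisP _)).
Qed.

Lemma oo_cvg_ultra (U : set_system nat) (u : nat -> R) (l : R) : \oo `<=` U -> u @ \oo --> l -> u @ U --> l.
Proof. by move=> h hu A /hu; apply: h. Qed.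

End VectorLimits.

Section VectorExponential.
Variables (R : realType).
Implicit Types V W : vectType R.

Lemma linfunE V W (h : V -> W) v : linear h -> linfun h v = h v.
Proof.
move=> hl; pose h' : {linear V -> W} := HB.pack h (GRing.isLinear.Build _ _ _ _ h hl).
exact: (lfunE h' v).
Qed.

Definition vN V (v : V) : R := \sum_i `|cb i v|.

Lemma vN_ge0 V (v : V) : 0 <= vN v.
Proof. by apply: sumr_ge0. Qed.

Lemma cb_le_vN V (v : V) i : `|cb i v| <= vN v.
Proof. by rewrite /vN (bigD1 i) //= lerDl sumr_ge0. Qed.

Lemma vND V (u v : V) : vN (u + v) <= vN u + vN v.
Proof.
by rewrite /vN -big_split; apply: ler_sum => i _; rewrite /cb linearD ler_normD.
Qed.

Lemma vNZ V a (v : V) : vN (a *: v) = `|a| * vN v.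
Proof. by rewrite /vN mulr_sumr; apply: eq_bigr => i _; rewrite /cb linearZ normrM. Qed.

Lemma vN0 V : vN (0 : V) = 0.
Proof. by rewrite -(scale0r 0) vNZ normr0 mul0r. Qed.

Lemma vN_sum V I (r : seq I) P (F : I -> V) :
  vN (\sum_(i <- r | P i) F i) <= \sum_(i <- r | P i) vN (F i).
Proof.
apply: (big_ind2 (fun x y => vN x <= y)) => //; first by rewrite vN0.
by move=> x1 x2 y1 y2 h1 h2; apply: le_trans (vND _ _) (lerD h1 h2).
Qed.

Lemma lfunctional_bound V (h : V -> R) : lfunctional h ->
  exists2 K : R, 0 <= K & forall v, `|h v| <= K * vN v.
Proof.
move=> hl; exists (\sum_(i < \dim {:V}) `|h (vbasis {:V})`_i|); first exact: sumr_ge0.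
move=> v; rewrite (lfunctionalE v hl); apply: le_trans (ler_norm_sum _ _ _) _.
rewrite mulr_suml; apply: ler_sum => i _.
by rewrite normrM mulrC ler_wpM2l // cb_le_vN.
Qed.

Lemma lfun_bound V W (h : V -> W) : additive_hom h ->
  exists2 K : R, 0 <= K & forall v, vN (h v) <= K * vN v.
Proof.
move=> hl; have /choice [K hK] i : exists K : R, 0 <= K /\ forall v, `|cb i (h v)| <= K * vN v.
  have [a x y|K K0 hK] := @lfunctional_bound _ (fun v => cb i (h v)).
    by rewrite hl /cb linearP.
  by exists K.
exists (\sum_i K i); first by apply: sumr_ge0 => i _; case: (hK i).
by move=> v; rewrite mulr_suml; apply: ler_sum => i _; case: (hK i).
Qed.

(** The formula of [lfexp] over an arbitrary space: the exponential is also taken on spaces of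
    endomorphisms and of tensors. *)
Definition vexp V (f : 'End(V)) : 'End(V) :=
  linfun (fun v : V => \sum_(i < \dim {:V})
    lim (series (fun k : nat => coord (vbasis {:V}) i (iter k f v) / k`!%:R) @ \oo)
      *: (vbasis {:V})`_i).

Definition expsum V (f : 'End(V)) n (v : V) : V := \sum_(k < n) k`!%:R^-1 *: iter k f v.

Lemma iter_linear V (f : 'End(V)) k a u v : iter k f (a *: u + v) = a *: iter k f u + iter k f v.
Proof. by elim: k => //= k ->; rewrite linearP. Qed.

Lemma iter_bound V (f : 'End(V)) K k v : 0 <= K -> (forall w, vN (f w) <= K * vN w) ->
  vN (iter k f v) <= K ^+ k * vN v.
Proof.
move=> K0 hK; elim: k => [|k IH]; first by rewrite mul1r.
by rewrite iterS exprS -mulrA; apply: le_trans (hK _) _; rewrite ler_wpM2l.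
Qed.

Definition esum_ (x : R) n := \sum_(k < n) x ^+ k / k`!%:R.

Lemma esum_cvg x : esum_ x @ \oo --> expR x.
Proof.
have -> : esum_ x = series (exp_coeff x); last exact: is_cvg_series_exp_coeff.
by apply/funext => n; rewrite /esum_ /series /= big_mkord.
Qed.

Section Fixed.
Variables (V : vectType R) (f : 'End(V)) (K : R).
Hypotheses (K0 : 0 <= K) (hK : forall w, vN (f w) <= K * vN w).

Let c i v := (fun k : nat => cb i (iter k f v) / k`!%:R).

Lemma exp_coeff_bound i v k : `|c i v k| <= vN v * (K ^+ k / k`!%:R).
Proof.
rewrite /c normrM [`|_^-1|]ger0_norm ?invr_ge0 ?ler0n // mulrA ler_wpM2r ?invr_ge0 ?ler0n //.
by rewrite mulrC; apply: le_trans (cb_le_vN _ _) (iter_bound _ _ K0 hK).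
Qed.

Lemma exp_series_cvg i v : cvgn (series (c i v)).
Proof.
apply: normed_cvg; apply: (@series_le_cvg _ _ (fun k => vN v * exp_coeff K k)).
- by move=> k; apply: normr_ge0.
- by move=> k; rewrite mulr_ge0 ?vN_ge0 ?exp_coeff_ge0.
- exact: exp_coeff_bound.
- have -> : series (fun k => vN v * exp_coeff K k) = (fun n => vN v * series (exp_coeff K) n).
    by apply/funext => n; rewrite /series /= mulr_sumr.
  by apply: is_cvgMr; exact: is_cvg_series_exp_coeff.
Qed.

Lemma vexp_coord i v : cb i (vexp f v) = limn (series (c i v)).
Proof.
rewrite /vexp linfunE; last first.
  move=> a u w; rewrite scaler_sumr -big_split; apply: eq_bigr => j _ /=.
  rewrite scalerA -scalerDl; congr (_ *: _).
  apply: cvg_lim => //.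
  have -> : series (fun k => coord (vbasis {:V}) j (iter k f (a *: u + w)) / k`!%:R) =
    (fun n => a * series (c j u) n + series (c j w) n).
    apply/funext => n; rewrite /series /= mulr_sumr -big_split; apply: eq_bigr => k _ /=.
    by rewrite iter_linear linearP /c /cb /= mulrDl mulrA.
  by apply: cvgD; [apply: cvgMr|]; apply: exp_series_cvg.
by rewrite /cb coord_sum_free // (basis_free (vbasisP _)).
Qed.

Lemma expsum_cb i v n : cb i (expsum f n v) = series (c i v) n.
Proof.
rewrite /expsum /cb linear_sum /= /series /= big_mkord; apply: eq_bigr => k _.
by rewrite linearZ /= mulrC.
Qed.

Lemma vexp_cvg v : vcvg \oo (fun n => expsum f n v) (vexp f v).
Proof.
by move=> i; rewrite vexp_coord; under eq_fun => n do rewrite expsum_cb; apply: exp_series_cvg.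
Qed.

Lemma expsum_tail v n m i : (n <= m)%N ->
  `|cb i (expsum f m v) - cb i (expsum f n v)| <= vN v * (esum_ K m - esum_ K n).
Proof.
move=> nm; rewrite !expsum_cb /series /= /esum_ -!(big_mkord xpredT (fun k => K ^+ k / k`!%:R)).
have E (F : nat -> R) : \sum_(0 <= k < m) F k = \sum_(0 <= k < n) F k + \sum_(n <= k < m) F k.
  by rewrite -big_cat_nat.
rewrite !E ![_ + \sum_(n <= k < m) _ - _]addrAC !subrr !add0r.
rewrite mulr_sumr; apply: le_trans (ler_norm_sum _ _ _) _.
by apply: ler_sum => k _; apply: exp_coeff_bound.
Qed.

Lemma vexp_tail v n i : `|cb i (vexp f v) - cb i (expsum f n v)| <= vN v * (expR K - esum_ K n).
Proof.
have h1 : (fun m => `|cb i (expsum f (m + n) v) - cb i (expsum f n v)|) @ \oo -->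
    `|cb i (vexp f v) - cb i (expsum f n v)|.
  apply: cvg_norm; apply: cvgB; last exact: cvg_cst.
  by rewrite (cvg_shiftn n (fun m => cb i (expsum f m v))); apply: vexp_cvg.
have h2 : (fun m => vN v * (esum_ K (m + n) - esum_ K n)) @ \oo --> vN v * (expR K - esum_ K n).
  apply: cvgMr; apply: cvgB; last exact: cvg_cst.
  by rewrite (cvg_shiftn n (esum_ K)); apply: esum_cvg.
by apply: cvgr_lel h1 h2 _ => m; apply: expsum_tail; rewrite leq_addl.
Qed.

End Fixed.

Lemma lfun_bound_End V (f : 'End(V)) : exists2 K : R, 0 <= K & forall v, vN (f v) <= K * vN v.
Proof. by apply: lfun_bound => a u v; rewrite linearP. Qed.

Lemma vexpP V (f : 'End(V)) v : vcvg \oo (fun n => expsum f n v) (vexp f v).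
Proof. by have [K K0 hK] := lfun_bound_End f; apply: vexp_cvg K0 hK _. Qed.

(** Naturality of the exponential series. It is applied to automorphisms, to [ad] as a map into the
    endomorphisms, to evaluation at a vector and to a slot of a tensor. *)
Lemma vexp_intertwine V W (h : V -> W) (f : 'End(V)) (g : 'End(W)) : additive_hom h ->
  (forall v, h (f v) = g (h v)) -> forall v, h (vexp f v) = vexp g (h v).
Proof.
move=> hl hfg v; apply: (vcvg_uniq (vcvg_lin hl (@vexpP _ f v))).
have -> : (fun n => h (expsum f n v)) = (fun n => expsum g n (h v)); last exact: vexpP.
apply/funext => n; rewrite /expsum.
have h0 : h 0 = 0.
  move: (hl 1 0 0); rewrite scaler0 addr0 scale1r => /eqP.
  by rewrite -subr_eq0 opprD addNKr oppr_eq0 => /eqP.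
have hi k : h (iter k f v) = iter k g (h v) by elim: k => //= k <-.
elim: n => [|n IH]; first by rewrite !big_ord0.
by rewrite !big_ord_recr /= addrC hl IH hi addrC.
Qed.

Lemma vexp_mem V (f : 'End(V)) (U : {vspace V}) : (forall v, v \in U -> f v \in U) ->
  forall v, v \in U -> vexp f v \in U.
Proof.
move=> h v vU; apply: vcvg_mem (@vexpP _ f v) => n; apply: rpred_sum => k _; apply: rpredZ.
by elim: (val k) => //= m; apply: h.
Qed.

Lemma vexp_eigen V (f : 'End(V)) a v : f v = a *: v -> vexp f v = expR a *: v.
Proof.
move=> h; apply: (vcvg_uniq (@vexpP _ f v)).
have -> : (fun n => expsum f n v) = (fun n => esum_ a n *: v).
  apply/funext => n; rewrite /expsum /esum_ scaler_suml; apply: eq_bigr => k _.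
  have -> : iter k f v = a ^+ k *: v.
    by elim: (val k) => [|m IH]; rewrite ?scale1r //= IH linearZ /= h scalerA exprSr.
  by rewrite scalerA mulrC.
by apply: vcvgZ; [exact: esum_cvg|exact: vcvg_cst].
Qed.

Lemma vexp0 V v : vexp (0 : 'End(V)) v = v.
Proof. by rewrite (@vexp_eigen _ 0 0) ?expR0 ?scale1r // lfunE scale0r. Qed.

End VectorExponential.
Arguments vexpP {R V} f v.

(** * The exponential of a sum, its first-order remainder and its continuity *)

Section ExponentialSum.
Variables (R : realType).
Implicit Types V W : vectType R.

(** The sum over the triangle i + j < N, that is a partial sum of the Cauchy product. *)
Definition tri_sum (Z : zmodType) (G : nat -> nat -> Z) N := \sum_(k < N) \sum_(i < k.+1) G i (k - i)%N.

Lemma tri_sumE (Z : zmodType) (G : nat -> nat -> Z) N :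
  tri_sum G N = \sum_(i < N) \sum_(j < N - i) G i j.
Proof.
rewrite /tri_sum; elim: N => [|N IH]; first by rewrite !big_ord0.
rewrite big_ord_recr /= {}IH [RHS]big_ord_recr /= subSnn big_ord1 [in LHS]big_ord_recr /= subnn addrA.
congr (_ + _); rewrite -big_split /=; apply: eq_bigr => i _.
by rewrite subSn ?big_ord_recr //= ltnW.
Qed.

Lemma tri_square (Z : zmodType) (G : nat -> nat -> Z) n :
  tri_sum G (n + n) - \sum_(i < n) \sum_(j < n) G i j =
  \sum_(i < n) \sum_(j < n - i) G i (n + j)%N + \sum_(i < n) \sum_(j < n - i) G (n + i)%N j.
Proof.
rewrite tri_sumE big_split_ord /= addrAC; congr (_ + _); last first.
  by apply: eq_bigr => i _; rewrite subnDl.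
rewrite -sumrB; apply: eq_bigr => i _.
by rewrite -addnBA ?big_split_ord /= ?(ltnW (ltn_ord i)) // addrAC subrr add0r.
Qed.

(** The square of side n lies inside the triangle of side 2n, so the difference is a sum of entries
    taken with sign plus and inherits termwise bounds. *)
Lemma tri_square_bound V (G : nat -> nat -> V) (q : nat -> nat -> R) n :
  (forall i j, vN (G i j) <= q i j) ->
  vN (tri_sum G (n + n) - \sum_(i < n) \sum_(j < n) G i j) <=
  tri_sum q (n + n) - \sum_(i < n) \sum_(j < n) q i j.
Proof.
move=> h; rewrite !tri_square; apply: le_trans (vND _ _) _.
by apply: lerD; (apply: le_trans (vN_sum _ _ _) _; apply: ler_sum => i _;
  apply: le_trans (vN_sum _ _ _) _; apply: ler_sum => j _; apply: h).
Qed.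

(** The binomial theorem in divided powers: f sends [Q i j] to i + 1 times [Q i.+1 j], g does the
    same in j, and the two coefficients falling on an entry of degree k + 1 add up to k + 1. *)
Lemma expsum_add V (f g : 'End(V)) n v : (forall v, f (g v) = g (f v)) ->
  expsum (f + g) n v = tri_sum (fun i j => (i`!%:R^-1 * j`!%:R^-1) *: iter i f (iter j g v)) n.
Proof.
move=> fg; rewrite /expsum /tri_sum; apply: eq_bigr => k _; move: (val k) => {}k.
pose Q i j : V := (i`!%:R^-1 * j`!%:R^-1) *: iter i f (iter j g v).
rewrite -[RHS]/(\sum_(i < k.+1) Q i (k - i)%N).
have fQ i j : f (Q i j) = i.+1%:R *: Q i.+1 j.
  rewrite /Q linearZ /= scalerA; congr (_ *: _).
  by rewrite factS natrM invfM mulrA mulrA mulfV ?pnatr_eq0 // mul1r.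
have gQ i j : g (Q i j) = j.+1%:R *: Q i j.+1.
  rewrite /Q linearZ /= scalerA; congr (_ *: _).
    by rewrite (factS j) natrM invfM mulrCA [j.+1%:R * _]mulrA mulfV ?pnatr_eq0 // mul1r.
  by elim: i => //= i <-; rewrite fg.
elim: k => [|k IH]; first by rewrite big_ord1 /Q /= !fact0 invr1 mulr1.
have k0 : (k.+1%:R : R) != 0 by rewrite pnatr_eq0.
apply: (scalerI k0); rewrite scalerA factS natrM invfM mulrA mulfV // mul1r iterS -linearZ /= IH.
rewrite lfunE /= !linear_sum /=.
under eq_bigr => i _ do rewrite fQ.
under [X in _ + X]eq_bigr => i _ do rewrite gQ.
have -> : \sum_(i < k.+1) i.+1%:R *: Q i.+1 (k - i)%N =
  \sum_(i < k.+2) (i%:R : R) *: Q i (k.+1 - i)%N.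
  rewrite [RHS]big_ord_recl scale0r add0r; apply: eq_bigr => i _ /=.
  by rewrite /bump /= add1n subSS.
have -> : \sum_(i < k.+1) (k - i).+1%:R *: Q i (k - i).+1 =
  \sum_(i < k.+2) ((k.+1 - i)%:R : R) *: Q i (k.+1 - i)%N.
  rewrite [RHS]big_ord_recr /= subnn scale0r addr0; apply: eq_bigr => i _ /=.
  by rewrite subSn // -ltnS.
rewrite -big_split /=; apply: eq_bigr => i _.
by rewrite -scalerDl -natrD subnKC // -ltnS.
Qed.

Lemma esum_add (a b : R) n :
  esum_ (a + b) n = tri_sum (fun i j => (i`!%:R^-1 * j`!%:R^-1) * (a ^+ i * b ^+ j)) n.
Proof.
(* The numerical identity is the operator identity for homotheties of the line. *)
pose f c : 'End(R^o) := c *: \1%VF.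
have fE c v : f c v = c * v by rewrite /f scale_lfunE id_lfunE.
have itE c i v : iter i (f c) v = c ^+ i * v.
  by elim: i => [|i IH]; rewrite ?mul1r //= IH fE exprS mulrA.
have := @expsum_add R^o (f a) (f b) n 1; rewrite -scalerDl => h.
transitivity (expsum ((a + b) *: \1%VF : 'End(R^o)) n 1).
  by rewrite /expsum /esum_; apply: eq_bigr => i _; rewrite itE mulr1 mulrC.
rewrite h => [|v]; last by rewrite !fE mulrCA.
by apply: eq_bigr => k _; apply: eq_bigr => i _; rewrite !itE mulr1.
Qed.

Lemma End_sum V W (f : 'Hom(V, W)) :
  f = \sum_(j < \dim {:V}) \sum_(i < \dim {:W}) cb i (f (vbasis {:V})`_j) *:
        (linfun (fun v => cb j v *: (vbasis {:W})`_i) : 'Hom(V, W)).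
Proof.
apply/lfunP => v; rewrite sum_lfunE {1}(cbE v) linear_sum; apply: eq_bigr => j _ /=.
rewrite sum_lfunE linearZ /= [in LHS](cbE (f _)) scaler_sumr; apply: eq_bigr => i _.
rewrite scale_lfunE linfunE ?scalerA 1?mulrC // => a x y.
by rewrite /cb linearP scalerDl scalerA.
Qed.

Lemma vcvg_End V W (F : set_system nat) {FF : ProperFilter F} (u : nat -> 'Hom(V, W)) (l : 'Hom(V, W)) :
  (forall v, vcvg F (fun k => u k v) (l v)) -> vcvg F u l.
Proof.
move=> h; rewrite (End_sum l) (funext (fun k => End_sum (u k))).
apply: vcvg_sum => j; apply: vcvg_sum => i; apply: vcvgZ; last exact: vcvg_cst.
exact: h.
Qed.

Lemma vcvg_eval V W (F : set_system nat) {FF : ProperFilter F} (u : nat -> 'Hom(V, W)) (l : 'Hom(V, W)) w v :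
  vcvg F u l -> vcvg F w v -> vcvg F (fun k => u k (w k)) (l v).
Proof.
move=> hu hw; apply: (vcvg_bil (b := fun (f : 'Hom(V, W)) v => f v)) => // [f a x y|x a f g].
  by rewrite linearP.
by rewrite add_lfunE scale_lfunE.
Qed.

Lemma expsum_lfun V (f : 'End(V)) n : exists E : 'End(V), forall v, E v = expsum f n v.
Proof.
exists (linfun (expsum f n)) => v; rewrite linfunE // => a x y.
rewrite /expsum scaler_sumr -big_split; apply: eq_bigr => k _ /=.
by rewrite iter_linear scalerDr !scalerA mulrC.
Qed.

(** The product of the partial sums of order n is summed over a square, the partial sum of order 2n
    for f + g over a triangle. Their difference is dominated by the same difference for the numbers
    a and b bounding f and g, where the addition formula of the real exponential makes it tend to
    0. *)
Lemma vexpD V (f g : 'End(V)) : (forall v, f (g v) = g (f v)) ->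
  forall v, vexp (f + g) v = vexp f (vexp g v).
Proof.
move=> fg v; have [a a0 ha] := lfun_bound_End f; have [b b0 hb] := lfun_bound_End g.
have /choice [E hE] := expsum_lfun f.
have h1 : vcvg \oo (fun n => E n (expsum g n v)) (vexp f (vexp g v)).
  apply: vcvg_eval (vexpP g v); apply: vcvg_End => w.
  by under eq_fun => n do rewrite hE; apply: vexpP.
apply: (vcvg_uniq (F := \oo) _ h1).
pose G i j := (i`!%:R^-1 * j`!%:R^-1) *: iter i f (iter j g v).
pose q i j := vN v * ((i`!%:R^-1 * j`!%:R^-1) * (a ^+ i * b ^+ j)).
have hG i j : vN (G i j) <= q i j.
  have h0 : 0 <= (i`!%:R^-1 * j`!%:R^-1 : R) by rewrite mulr_ge0 ?invr_ge0 ?ler0n.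
  rewrite /G /q vNZ ger0_norm // mulrCA ler_wpM2l // mulrC -mulrA.
  apply: le_trans (iter_bound _ _ a0 ha) _; rewrite ler_wpM2l ?exprn_ge0 //.
  exact: iter_bound.
have sqE n : E n (expsum g n v) = \sum_(i < n) \sum_(j < n) G i j.
  rewrite hE /expsum; apply: eq_bigr => i _.
  have -> : iter i f (\sum_(k < n) k`!%:R^-1 *: iter k g v) = \sum_(k < n) k`!%:R^-1 *: iter i f (iter k g v).
    elim: (val i) => //= m ->; rewrite linear_sum; apply: eq_bigr => k _.
    by rewrite linearZ.
  by rewrite scaler_sumr; apply: eq_bigr => j _; rewrite scalerA.
have qT n : tri_sum q n = vN v * esum_ (a + b) n.
  by rewrite esum_add /tri_sum mulr_sumr; apply: eq_bigr => k _; rewrite mulr_sumr.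
have qS n : \sum_(i < n) \sum_(j < n) q i j = vN v * (esum_ a n * esum_ b n).
  rewrite /q; move: (vN v) => m; rewrite /esum_ mulr_suml mulr_sumr; apply: eq_bigr => i _.
  rewrite !mulr_sumr; apply: eq_bigr => j _.
  by congr (_ * _); rewrite mulrACA ![_^-1 * _]mulrC.
have dbl (u : nat -> R) (l : R) : u @ \oo --> l -> (fun n => u (n + n)%N) @ \oo --> l.
  move=> hu; apply: (cvg_comp (fun n => (n + n)%N) u _ hu) => A [N _ hN].
  by exists N => // n /= Nn; apply: hN => /=; apply: leq_trans Nn (leq_addr _ _).
have h2 : (fun n => vN (expsum (f + g) (n + n) v - E n (expsum g n v))) @ \oo --> (0 : R).
  have hq : (fun n => vN v * (esum_ (a + b) (n + n) - esum_ a n * esum_ b n)) @ \oo --> (0 : R).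
    rewrite -[X in _ --> X](mulr0 (vN v)) -(subrr (expR (a + b))) {2}expRD.
    apply: cvgMr; apply: cvgB; first by apply: dbl; apply: esum_cvg.
    by apply: cvgM; apply: esum_cvg.
  apply: squeeze_cvgr (cvg_cst 0) hq; apply: nearW => n; rewrite vN_ge0 /=.
  by rewrite mulrBr -qT -qS sqE expsum_add //; apply: tri_square_bound.
move=> i; have h3 : (fun n => cb i (expsum (f + g) (n + n) v)) @ \oo --> cb i (vexp (f + g) v).
  exact: (dbl (fun n => cb i (expsum (f + g) n v)) _ (vexpP (f + g) v i)).
have h4 : (fun n => cb i (expsum (f + g) (n + n) v - E n (expsum g n v))) @ \oo --> (0 : R).
  apply: norm_cvg0; apply: squeeze_cvgr (cvg_cst 0) h2; apply: nearW => n.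
  by rewrite normr_ge0 cb_le_vN.
rewrite -[cb i (vexp (f + g) v)]subr0.
rewrite (_ : (fun n => cb i _) = (fun n => cb i (expsum (f + g) (n + n) v) -
  cb i (expsum (f + g) (n + n) v - E n (expsum g n v)))); first exact: cvgB.
by apply/funext => n; rewrite /cb [in RHS]linearB /= opprB addrC subrK.
Qed.

Lemma vexpNK V (f : 'End(V)) v : vexp (- f) (vexp f v) = v.
Proof.
rewrite -vexpD; first by rewrite addNr vexp0.
by move=> w; rewrite !opp_lfunE linearN.
Qed.

Lemma vexpKN V (f : 'End(V)) v : vexp f (vexp (- f) v) = v.
Proof. by rewrite -{1}(opprK f) vexpNK. Qed.

Lemma cbB V (u v : V) i : cb i (u - v) = cb i u - cb i v.
Proof. by rewrite /cb linearB. Qed.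

Lemma vexp_remainder V (f : 'End(V)) v : exists2 C : R, 0 <= C &
  forall s, `|s| <= 1 -> vN (vexp (s *: f) v - (v + s *: f v)) <= C * s ^+ 2.
Proof.
have [K K0 hK] := lfun_bound_End f; pose n := \dim {:V}.
exists (n%:R * (vN v * (expR K * K ^+ 2))) => [|s s1].
  by rewrite !mulr_ge0 ?vN_ge0 ?exprn_ge0 ?expR_ge0.
have hs w : vN ((s *: f) w) <= `|s| * K * vN w.
  by rewrite scale_lfunE vNZ -mulrA ler_wpM2l.
have sK0 : 0 <= `|s| * K by rewrite mulr_ge0.
have e2 : expsum (s *: f) 2 v = v + s *: f v.
  by rewrite /expsum !big_ord_recl big_ord0 /= scale_lfunE invr1 !scale1r addr0.
have bnd (x : R) : 0 <= x -> expR x - esum_ x 2 <= x ^+ 2 * expR x.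
  move=> x0; rewrite /esum_ !big_ord_recl big_ord0 /= /bump /= expr0 expr1 !divr1 addr0.
  have h1 : (1 - x) * expR x <= 1.
    rewrite -[leRHS](expRxMexpNx_1 x) mulrC ler_wpM2l ?expR_ge0 //.
    exact: expR_ge1Dx.
  have h2 := expR_ge1Dx x; have h3 := expR_ge0 x.
  have [x1|x1] := leP x 1; last by nra.
  by nra.
have h i : `|cb i (vexp (s *: f) v - (v + s *: f v))| <= vN v * (expR K * K ^+ 2) * s ^+ 2.
  have := vexp_tail sK0 hs v 2 i; rewrite e2 => h.
  rewrite cbB; apply: (le_trans h).
  rewrite -mulrA ler_wpM2l ?vN_ge0 //; apply: (le_trans (bnd _ sK0)).
  rewrite exprMn real_normK ?num_real // [leRHS]mulrC -mulrA ler_wpM2l ?sqr_ge0 // [leRHS]mulrC ler_wpM2l ?exprn_ge0 //.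
  by rewrite ler_expR ler_piMl.
rewrite /vN; apply: le_trans (ler_sum _ (fun i _ => h i)) _.
by rewrite sumr_const card_ord -[leRHS]mulrA mulr_natl lexx.
Qed.

(** The common bound K makes all tails uniformly small, so it is enough that a fixed partial sum, a
    polynomial in the operator, converges. *)
Lemma vexp_cvg_ultra V (F : set_system nat) {FF : ProperFilter F} (u : nat -> 'End(V)) (f : 'End(V)) (K : R) v :
  0 <= K -> (forall k w, vN (u k w) <= K * vN w) -> (forall w, vN (f w) <= K * vN w) ->
  vcvg F u f -> vcvg F (fun k => vexp (u k) v) (vexp f v).
Proof.
move=> K0 hu hf uf i; apply/cvgrPdist_lt => e e0.
have hn : \forall n \near \oo, vN v * (expR K - esum_ K n) < e / 3.
  have : (fun n => vN v * (expR K - esum_ K n)) @ \oo --> (0 : R).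
    rewrite -[X in _ --> X](mulr0 (vN v)) -(subrr (expR K)).
    by apply: cvgMr; apply: cvgB; [exact: cvg_cst|exact: esum_cvg].
  move=> /cvgrPdist_lt /(_ (e / 3)) h; have e3 : 0 < e / 3 by rewrite divr_gt0.
  apply: filterS (h e3) => n; rewrite sub0r normrN => /(le_lt_trans (ler_norm _)) //.
have [n nh] : exists n, vN v * (expR K - esum_ K n) < e / 3.
  by case: hn => N _ /(_ N (leqnn N)); exists N.
have h1 : vcvg F (fun k => expsum (u k) n v) (expsum f n v).
  rewrite /expsum; elim: n {nh} => [|n IH].
    by under eq_fun => k do rewrite big_ord0; rewrite big_ord0; apply: vcvg_cst.
  under eq_fun => k do rewrite big_ord_recr /=; rewrite big_ord_recr /=.
  apply: vcvgD => //; apply: vcvgZ; first exact: cvg_cst.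
  elim: {IH} n => [|n IH] /=; first exact: vcvg_cst.
  exact: vcvg_eval.
have e3 : 0 < e / 3 by rewrite divr_gt0.
have /cvgrPdist_lt /(_ _ e3) := h1 i; apply: filterS => k hk.
have t1 := vexp_tail K0 hf v n i; have t2 := vexp_tail K0 (hu k) v n i.
have -> : cb i (vexp f v) - cb i (vexp (u k) v) = (cb i (vexp f v) - cb i (expsum f n v))
  + (cb i (expsum f n v) - cb i (expsum (u k) n v)) - (cb i (vexp (u k) v) - cb i (expsum (u k) n v)) by ring.
apply: le_lt_trans (ler_normB _ _) _; apply: le_lt_trans (lerD (ler_normD _ _) (lexx _)) _.
by lra.
Qed.

End ExponentialSum.

(** * The Killing form and derivations *)

Section Coordinates.
Variables (R : realType) (V : vectType R).
Implicit Types u v : V.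

Lemma cbD i u v : cb i (u + v) = cb i u + cb i v.
Proof. by rewrite /cb linearD. Qed.

Lemma cbN i u : cb i (- u) = - cb i u.
Proof. by rewrite /cb linearN. Qed.

Lemma cbZ i a u : cb i (a *: u) = a * cb i u.
Proof. by rewrite /cb linearZ. Qed.

Lemma cb0 i : cb i (0 : V) = 0.
Proof. by rewrite /cb linear0. Qed.

End Coordinates.

Ltac vring := apply: cb_inj => ?; rewrite !(cbD, cbN, cbZ, cb0); ring.
Ltac vfield := apply: cb_inj => ?; rewrite !(cbD, cbN, cbZ, cb0); field.

Definition lfe := (comp_lfunE, add_lfunE, opp_lfunE, scale_lfunE, id_lfunE, zero_lfunE).

Section Trace.
Variables (R : realType) (L : liealg R).
Implicit Types (X Y Z u v w : L) (f g p q : 'End(L)).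

Lemma lftrace_dual n (e : 'I_n -> L) (phi : 'I_n -> L -> R) f :
  (forall i, lfunctional (phi i)) -> (forall v, v = \sum_i phi i v *: e i) ->
  lftrace f = \sum_i phi i (f (e i)).
Proof.
move=> hl he; rewrite /lftrace.
have h j : cb j (f (vbasis {:L})`_j) = \sum_i phi i (vbasis {:L})`_j * cb j (f (e i)).
  rewrite {1}(he (vbasis {:L})`_j) linear_sum /= /cb linear_sum; apply: eq_bigr => i _.
  by rewrite !linearZ.
under eq_bigr => j _ do rewrite -/(cb j _) h.
rewrite exchange_big; apply: eq_bigr => i _ /=.
by rewrite (lfunctionalE _ (hl i)); apply: eq_bigr => j _; rewrite mulrC.
Qed.

Lemma lftraceC f g : lftrace (f \o g)%VF = lftrace (g \o f)%VF.
Proof.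
have h (f1 g1 : 'End(L)) : lftrace (f1 \o g1)%VF = \sum_(j < \dim {:L}) \sum_(k < \dim {:L})
    cb k (g1 (vbasis {:L})`_j) * cb j (f1 (vbasis {:L})`_k).
  apply: eq_bigr => j _; rewrite lfunE /= {1}(cbE (g1 _)) linear_sum /= linear_sum.
  by apply: eq_bigr => k _; rewrite !linearZ.
rewrite !h exchange_big; apply: eq_bigr => j _; apply: eq_bigr => k _.
by rewrite mulrC.
Qed.

Lemma lftraceP a f g : lftrace (a *: f + g) = a * lftrace f + lftrace g.
Proof.
rewrite /lftrace mulr_sumr -big_split; apply: eq_bigr => i _ /=.
by rewrite add_lfunE scale_lfunE linearP.
Qed.

Lemma lftrace0 : lftrace (0 : 'End(L)) = 0.
Proof. by rewrite /lftrace big1 // => i _; rewrite zero_lfunE linear0. Qed.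

(** Write f as pi f with pi a projector onto the image of f; by cyclicity the trace is that of f pi,
    and f kills its own image. *)
Lemma lftrace_sqr0 f : (forall v, f (f v) = 0) -> lftrace f = 0.
Proof.
move=> h; have {1}-> : f = (projv (limg f) \o f)%VF.
  by apply/lfunP => v; rewrite lfunE /= projv_id // memv_img ?memvf.
rewrite lftraceC -[RHS]lftrace0; congr lftrace; apply/lfunP => v; rewrite lfunE /= zero_lfunE.
by have /memv_imgP [u _ ->] := memv_proj (limg f) v; apply: h.
Qed.

End Trace.

Section LieBasics.
Variables (R : realType) (L : liealg R).
Implicit Types (X Y Z u v w : L) (f g p q : 'End(L)).
Local Notation br := (@lie_br R L).
Local Notation B := (@killing R L).

Lemma brPr X a u v : br X (a *: u + v) = a *: br X u + br X v.
Proof. exact: lie_br_linear. Qed.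

Lemma adE X v : ad X v = br X v.
Proof. by rewrite /ad linfunE //; exact: lie_br_linear. Qed.

Lemma brDr X u v : br X (u + v) = br X u + br X v.
Proof. by rewrite -!adE linearD. Qed.

Lemma br0r X : br X 0 = 0.
Proof. by rewrite -adE linear0. Qed.

Lemma brZr X a u : br X (a *: u) = a *: br X u.
Proof. by rewrite -!adE linearZ. Qed.

Lemma brNr X u : br X (- u) = - br X u.
Proof. by rewrite -!adE linearN. Qed.

Lemma brBr X u v : br X (u - v) = br X u - br X v.
Proof. by rewrite brDr brNr. Qed.

Hypothesis hss : semisimple L.

(* The defect of linearity of the bracket in its first argument.  Only linearity in the second
   argument is part of the definition; linearity in the first one follows from semisimplicity,
   as the values of the defect lie in the radical of the Killing form. *)
Let D a Z Z' v := br (a *: Z + Z') v - a *: br Z v - br Z' v.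

Lemma brPl a Z Z' v : br (a *: Z + Z') v = a *: br Z v + br Z' v.
Proof.
have Dlin b c Y Y' u w : D b Y Y' (c *: u + w) = c *: D b Y Y' u + D b Y Y' w.
  by rewrite /D !brPr; vring.
have D0 b Y Y' : D b Y Y' 0 = 0 by rewrite /D !br0r; vring.
have DN b Y Y' u : D b Y Y' (- u) = - D b Y Y' u by rewrite /D !brNr; vring.
have D2 b Y Y' X u : br u (D b Y Y' X) = - D b Y Y' (br X u).
  have j1 := lie_jacobi X u (b *: Y + Y'); have j2 := lie_jacobi X u Y; have j3 := lie_jacobi X u Y'.
  apply/eqP; rewrite -addr_eq0 /D !brBr !brZr; apply/eqP.
  have : (br X (br u (b *: Y + Y')) + br u (br (b *: Y + Y') X) + br (b *: Y + Y') (br X u)) -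
    (b *: (br X (br u Y) + br u (br Y X) + br Y (br X u)) +
     (br X (br u Y') + br u (br Y' X) + br Y' (br X u))) = 0 by rewrite j1 j2 j3 scaler0 addr0 subr0.
  by rewrite !brPr => <-; vring.
(* By D2 a bracket with a defect value becomes a defect of a bracket, where linearity in the second
   argument is available; the outer defect then cancels. *)
have D3 b Y Y' c W W' X : D c W W' (D b Y Y' X) = 0.
  rewrite {1}/D -!adE. rewrite !adE !D2.
  have -> : br X (c *: W + W') = c *: br X W + br X W' by exact: brPr.
  by rewrite Dlin; vring.
suff D4 b Y Y' X : D b Y Y' X = 0.
  by apply/eqP; rewrite -subr_eq0 -(D4 a Z Z' v) /D; apply/eqP; vring.
apply: hss => U; apply: lftrace_sqr0 => w; rewrite !lfunE /= !adE.
set m := D b Y Y' X.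
(* Alternation rewrites the bracket with m in terms of defects only. Bracketing such a value with U
   gives defects again, and m annihilates them, so the composite of [ad m] and [ad U] has square
   zero and trace zero. *)
have bm y : br m y = - D 1 m y (m + y) + D b Y Y' (br X y).
  have E m' : D 1 m' y (m' + y) = - br m' y - br y m'.
    by rewrite /D !scale1r lie_br_alt !brDr !lie_br_alt; vring.
  by rewrite -[D b Y Y' (br X y)]opprK -D2 -/m E; vring.
have mM c W W' y : br m (D c W W' y) = 0.
  by rewrite D2 /m D2 DN D3 !oppr0.
by rewrite (bm (br U w)) brDr brNr !D2 opprK brDr brNr !mM oppr0 addr0.
Qed.


Lemma brDl X Y v : br (X + Y) v = br X v + br Y v.
Proof. by have := brPl 1 X Y v; rewrite !scale1r. Qed.

Lemma br0l v : br 0 v = 0.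
Proof. by have := brPl (-1) 0 0 v; rewrite scaler0 addr0 scaleN1r addNr. Qed.

Lemma brZl a X v : br (a *: X) v = a *: br X v.
Proof. by have := brPl a X 0 v; rewrite br0l !addr0. Qed.

Lemma brNl X v : br (- X) v = - br X v.
Proof. by rewrite -scaleN1r brZl scaleN1r. Qed.

Lemma brBl X Y v : br (X - Y) v = br X v - br Y v.
Proof. by rewrite brDl brNl. Qed.

Lemma brC X Y : br X Y = - br Y X.
Proof.
have := lie_br_alt (X + Y); rewrite brDl !brDr !lie_br_alt add0r addr0 => h.
by apply/eqP; rewrite -addr_eq0; apply/eqP.
Qed.

Lemma jacobi X Y Z : br (br X Y) Z = br X (br Y Z) - br Y (br X Z).
Proof.
have := lie_jacobi X Y Z; rewrite (brC Z (br X Y)) (brC Z X) brNr => h.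
by apply/eqP; rewrite eq_sym -subr_eq0 -[X in _ == X]h; apply/eqP; vring.
Qed.

Lemma adP a X Y : ad (a *: X + Y) = a *: ad X + ad Y.
Proof. by apply/lfunP => v; rewrite add_lfunE scale_lfunE !adE brPl. Qed.

Lemma adZ a X : ad (a *: X) = a *: ad X.
Proof. by apply/lfunP => v; rewrite scale_lfunE !adE brZl. Qed.

Lemma adN X : ad (- X) = - ad X.
Proof. by apply/lfunP => v; rewrite opp_lfunE !adE brNl. Qed.

Lemma killingC X Y : B X Y = B Y X.
Proof. exact: lftraceC. Qed.

Lemma killingPl a X Y Z : B (a *: X + Y) Z = a * B X Z + B Y Z.
Proof. by rewrite /killing adP -lftraceP; congr lftrace; apply/lfunP => v; rewrite !lfe. Qed.

Lemma killing0l Z : B 0 Z = 0.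
Proof. by have := killingPl (-1) 0 0 Z; rewrite scaler0 addr0 mulN1r addNr. Qed.

Lemma killingDl X Y Z : B (X + Y) Z = B X Z + B Y Z.
Proof. by have := killingPl 1 X Y Z; rewrite scale1r mul1r. Qed.

Lemma killingZl a X Z : B (a *: X) Z = a * B X Z.
Proof. by have := killingPl a X 0 Z; rewrite killing0l !addr0. Qed.

Lemma killingNl X Z : B (- X) Z = - B X Z.
Proof. by rewrite -scaleN1r killingZl mulN1r. Qed.

Lemma killingBl X Y Z : B (X - Y) Z = B X Z - B Y Z.
Proof. by rewrite killingDl killingNl. Qed.

Lemma killingZr a X Z : B Z (a *: X) = a * B Z X.
Proof. by rewrite !(killingC Z) killingZl. Qed.
Lemma killingNr X Z : B Z (- X) = - B Z X.
Proof. by rewrite !(killingC Z) killingNl. Qed.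
Lemma killing_inv X Y Z : B (br X Y) Z = B X (br Y Z).
Proof.
have h f g k : lftrace (f \o g \o k)%VF = lftrace (g \o k \o f)%VF by rewrite -comp_lfunA lftraceC.
have adb U W : ad (br U W) = -1 *: (ad W \o ad U)%VF + (ad U \o ad W)%VF.
  by apply/lfunP => v; rewrite !lfe !adE jacobi; vring.
rewrite /killing !adb.
have e1 : ((-1 *: (ad Y \o ad X) + (ad X \o ad Y)) \o ad Z)%VF =
  (-1 *: (ad Y \o ad X \o ad Z) + (ad X \o ad Y \o ad Z))%VF.
  by apply/lfunP => v; rewrite !lfe.
have e2 : (ad X \o (-1 *: (ad Z \o ad Y) + (ad Y \o ad Z)))%VF =
  (-1 *: (ad X \o ad Z \o ad Y) + (ad X \o ad Y \o ad Z))%VF.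
  by apply/lfunP => v; rewrite !lfe linearD linearZ.
by rewrite e1 e2 !lftraceP; congr (_ * _ + _); rewrite h.
Qed.

Lemma killing_nondeg X : (forall Y, B X Y = 0) -> X = 0.
Proof. exact: hss. Qed.

Lemma ad_inj X Y : (forall v, br X v = br Y v) -> X = Y.
Proof.
move=> h; apply/eqP; rewrite -subr_eq0; apply/eqP/killing_nondeg => Z.
rewrite /killing (_ : ad (X - Y) = 0) ?comp_lfun0l ?lftrace0 //.
by apply/lfunP => v; rewrite adE brBl h subrr zero_lfunE.
Qed.

Definition isaut g := (forall X Y, g (br X Y) = br (g X) (g Y)) /\ lker g == 0%VS.

Lemma autK g : isaut g -> forall v, (g^-1)%VF (g v) = v.
Proof. by case=> _ /lker0_lfunK. Qed.

Lemma autVK g : isaut g -> forall v, g ((g^-1)%VF v) = v.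
Proof. by case=> _ /lker0_lfunVK. Qed.

Lemma aut_br g X Y : isaut g -> g (br X Y) = br (g X) (g Y).
Proof. by case. Qed.

Lemma autI g h : (forall X Y, g (br X Y) = br (g X) (g Y)) -> (forall v, h (g v) = v) -> isaut g.
Proof. by move=> h1 h2; split=> //; apply/lker0P => u v /(congr1 h); rewrite !h2. Qed.

Lemma aut_inj g : isaut g -> injective g.
Proof. by move=> hg u v /(congr1 (g^-1)%VF); rewrite !autK. Qed.

Lemma autV g : isaut g -> isaut (g^-1)%VF.
Proof.
move=> hg; apply: (@autI _ g) => [X Y|v]; last exact: autVK.
by apply: (aut_inj hg); rewrite (aut_br _ _ hg) !(autVK hg).
Qed.

Lemma aut_comp g f : isaut g -> isaut f -> isaut (g \o f)%VF.
Proof.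
move=> hg hf; apply: (@autI _ (f^-1 \o g^-1)%VF) => [X Y|v].
  by rewrite !lfe (aut_br _ _ hf) (aut_br _ _ hg).
by rewrite !lfe (autK hg) (autK hf).
Qed.

Lemma aut1 : isaut (\1%VF : 'End(L)).
Proof. by apply: (@autI _ \1%VF) => [X Y|v]; rewrite !id_lfunE. Qed.

Lemma invlE g (h : 'End(L)) : isaut g -> (forall v, g (h v) = v) -> (g^-1)%VF = h.
Proof. by move=> hg hh; apply/lfunP => v; apply: (aut_inj hg); rewrite autVK. Qed.

Lemma killing_aut g X Y : isaut g -> B (g X) (g Y) = B X Y.
Proof.
move=> hg; have adg U : ad (g U) = (g \o ad U \o g^-1)%VF.
  by apply/lfunP => v; rewrite !lfe !adE (aut_br _ _ hg) (autVK hg).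
rewrite /killing !adg; have -> : (g \o ad X \o g^-1 \o (g \o ad Y \o g^-1) = g \o ((ad X \o ad Y) \o g^-1))%VF.
  by apply/lfunP => v; rewrite !lfe (autK hg).
rewrite (lftraceC g); have -> : ((ad X \o ad Y \o g^-1) \o g = ad X \o ad Y)%VF by apply/lfunP => v; rewrite !lfe (autK hg).
by [].
Qed.

End LieBasics.

Section InnerLemmas.
Variables (R : realType) (V : vectType R) (ip : V -> V -> R).
Hypothesis Hip : inner ip.

Lemma full_onb n (e : 'I_n -> V) v : onb ip fullv e -> v = \sum_i ip (e i) v *: e i.
Proof. by case=> _ _; apply; rewrite memvf. Qed.

Lemma ip_lfunctional u : lfunctional (ip u).
Proof. by move=> a v w; rewrite ipDr // ipZr. Qed.

Lemma full_spectral (f : 'End(V)) : selfadj ip f ->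
  exists n (e : 'I_n -> V) (m : 'I_n -> R), onb ip fullv e /\ forall i, f (e i) = m i *: e i.
Proof. by move=> hf; apply: spectral => // v _; rewrite memvf. Qed.

Lemma eq_on_onb n (e : 'I_n -> V) (f g : 'End(V)) : onb ip fullv e ->
  (forall i, f (e i) = g (e i)) -> f = g.
Proof.
move=> he h; apply/lfunP => v; rewrite (full_onb v he) !linear_sum; apply: eq_bigr => i _.
by rewrite !linearZ /= h.
Qed.

Lemma onb_ext n (e : 'I_n -> V) u v : onb ip fullv e -> (forall i, ip (e i) u = ip (e i) v) -> u = v.
Proof. by move=> he h; rewrite (full_onb u he) (full_onb v he); apply: eq_bigr => i _; rewrite h. Qed.

Lemma sa_coef n (e : 'I_n -> V) (m : 'I_n -> R) (f : 'End(V)) v i : selfadj ip f ->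
  (forall i, f (e i) = m i *: e i) -> ip (e i) (f v) = m i * ip (e i) v.
Proof. by move=> sf h; rewrite -sf h ipZl. Qed.

Lemma vexp_coef n (e : 'I_n -> V) (m : 'I_n -> R) (f : 'End(V)) v i : onb ip fullv e ->
  (forall i, f (e i) = m i *: e i) -> ip (e i) (vexp f v) = expR (m i) * ip (e i) v.
Proof.
move=> he h; have oe : orthon ip e by case: he.
rewrite {1}(full_onb v he) linear_sum /=; under eq_bigr => j _ do
  rewrite linearZ /= (vexp_eigen (h j)) scalerA.
by rewrite orthon_coef // mulrC.
Qed.

Lemma eigen_coef n (e : 'I_n -> V) (m : 'I_n -> R) (f : 'End(V)) v a : onb ip fullv e ->
  selfadj ip f -> (forall i, f (e i) = m i *: e i) ->
  (f v = a *: v <-> forall i, ip (e i) v = 0 \/ m i = a).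
Proof.
move=> he sf h; split=> [hv i|hv].
  have := congr1 (ip (e i)) hv; rewrite (sa_coef _ _ sf h) ipZr // => /eqP.
  by rewrite -subr_eq0 -mulrBl mulf_eq0 subr_eq0 => /orP [/eqP ->|/eqP ->]; [right|left].
apply: (onb_ext he) => i; rewrite (sa_coef _ _ sf h) ipZr //.
by case: (hv i) => ->; rewrite ?mulr0.
Qed.

Lemma vexp_eigen_inv (f : 'End(V)) a v : selfadj ip f -> vexp f v = expR a *: v -> f v = a *: v.
Proof.
move=> sf; have [n [e [m [he h]]]] := full_spectral sf => hv.
apply/(eigen_coef v a he sf h) => i; have := congr1 (ip (e i)) hv.
rewrite (vexp_coef _ _ he h) ipZr // => /eqP.
rewrite -subr_eq0 -mulrBl mulf_eq0 subr_eq0 => /orP [/eqP /expR_inj|/eqP]; by [right|left].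
Qed.

Lemma vexp_selfadj (f : 'End(V)) : selfadj ip f -> selfadj ip (vexp f).
Proof.
move=> sf u v; have [n [e [m [he h]]]] := full_spectral sf.
rewrite (ipC Hip) (onb_sum_ip Hip _ he (memvf _)) [RHS](onb_sum_ip Hip _ he (memvf _)).
by apply: eq_bigr => i _; rewrite !(vexp_coef _ _ he h); ring.
Qed.

End InnerLemmas.

(** * Cartan involutions, the exponential map, geodesics and distance *)

Section SymmetricSpace.
Variables (R : realType) (L : liealg R).
Hypothesis hss : semisimple L.
Implicit Types (X Y Z u v w : L) (f g p q a b : 'End(L)).
Local Notation br := (@lie_br R L).
Local Notation B := (@killing R L).
Local Notation S := (@symspace R L).
Local Notation P := (@pspace R L).

Lemma lfexpE f : lfexp f = vexp f. Proof. by []. Qed.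
Opaque lfexp vexp ad.

Definition bp p u v : R := - B u (p v).

Lemma sym_br p X Y : S p -> p (br X Y) = br (p X) (p Y). Proof. by case=> h _ _; apply: h. Qed.
Lemma symK p X : S p -> p (p X) = X. Proof. by case=> _ h _; apply: h. Qed.

Lemma sym_aut p : S p -> isaut p.
Proof. by move=> hp; apply: (@autI _ _ p p) => *; [apply: sym_br|apply: symK]. Qed.

Lemma sym_killing p u v : S p -> B (p u) (p v) = B u v.
Proof. by move=> hp; apply: killing_aut; apply: sym_aut. Qed.

Lemma sym_killingl p u v : S p -> B (p u) v = B u (p v).
Proof. by move=> hp; rewrite -(sym_killing (p u)  v hp) symK. Qed.

Lemma bp_inner p : S p -> inner (bp p).
Proof.
move=> hp; split.
- by move=> u v; rewrite /bp -sym_killingl // (killingC v).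
- by move=> c u v w; rewrite /bp (killingPl hss); lra.
- by case: hp => _ _ h u /h.
Qed.
Hint Resolve bp_inner : core.

Lemma bp_sym p u v : S p -> bp p (p u) (p v) = bp p u v.
Proof. by move=> hp; rewrite /bp sym_killing. Qed.

Lemma memP p X : X \in P p <-> p X = - X.
Proof.
rewrite /pspace memv_ker !lfe scaleN1r opprK; split=> [/eqP h|->]; last by rewrite addNr.
by apply/eqP; rewrite -addr_eq0; apply/eqP.
Qed.

Lemma bpPr p X Y : Y \in P p -> bp p X Y = B X Y.
Proof. by move/memP => h; rewrite /bp h (killingNr hss) opprK. Qed.

Lemma bpPl p X Y : S p -> X \in P p -> bp p X Y = B X Y.
Proof. by move=> hp hX; rewrite (ipC (bp_inner hp)) bpPr // killingC. Qed.

Lemma knormE p X : X \in P p -> knorm X = nrm (bp p) X.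
Proof. by move=> h; rewrite /knorm /nrm bpPr. Qed.

Lemma ad_selfadj p X : S p -> X \in P p -> selfadj (bp p) (ad X).
Proof.
move=> hp /memP hX u v; rewrite !adE /bp (sym_br _ _ hp) hX (brNl hss) (killingNr hss).
by rewrite (brC hss X u) (killingNl hss) (killing_inv hss) opprK.
Qed.

Lemma riesz p (phi : L -> R) : S p -> lfunctional phi -> exists X, forall Y, B X Y = phi Y.
Proof.
move=> hp hphi; have [n [e he]] := exists_onb (bp_inner hp) fullv.
exists (- p (\sum_i phi (e i) *: e i)) => Y.
rewrite (killingNl hss) sym_killingl // -/(bp p _ Y) (ip_suml (bp_inner hp)).
rewrite {2}(full_onb Y he) lfunctional_sum //; apply: eq_bigr => i _.
by rewrite (ipZl (bp_inner hp)) mulrC.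
Qed.

(** By nondegeneracy some X represents Y -> tr(D ad Y). The derivation E = D - ad X then satisfies
    tr(E ad T) = 0 for all T, and B(E U, W) = tr(E ad [U, W]) by cyclicity. *)
Lemma inner_derivation p (D : 'End(L)) : S p ->
  (forall X Y, D (br X Y) = br (D X) Y + br X (D Y)) -> exists X, D = ad X.
Proof.
move=> hp hD; have [Y|X hX] := @riesz p (fun Y => lftrace (D \o ad Y)%VF) hp.
  move=> u v; rewrite (adP hss) -lftraceP; congr lftrace; apply/lfunP => w.
  by rewrite !lfe linearD linearZ.
exists X; have [E EE] : exists E, E = D - ad X by exists (D - ad X).
suff E0 U : E U = 0.
  by apply/lfunP => U; apply/eqP; rewrite -subr_eq0; move: (E0 U); rewrite EE !lfe => ->.
have hE T W : E (br T W) = br (E T) W + br T (E W).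
  rewrite EE !lfe hD !adE (brBl hss) brBr.
  have -> : br X (br T W) = br (br X T) W + br T (br X W) by rewrite (jacobi hss) subrK.
  by vring.
have adE' T : ad (E T) = ((E \o ad T) - (ad T \o E))%VF.
  by apply/lfunP => w; rewrite !lfe !adE hE; vring.
have tE T : lftrace (E \o ad T)%VF = 0.
  have -> : (E \o ad T)%VF = (-1 *: (ad X \o ad T) + (D \o ad T))%VF.
    by apply/lfunP => w; rewrite EE !lfe scaleN1r addrC.
  by rewrite lftraceP -hX /killing mulN1r addNr.
apply: (killing_nondeg hss) => W; rewrite /killing adE'.
have -> : (((E \o ad U) - (ad U \o E)) \o ad W = -1 *: (ad U \o (E \o ad W)) + (E \o ad U \o ad W))%VF.
  by apply/lfunP => w; rewrite !lfe scaleN1r addrC.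
rewrite lftraceP lftraceC -(lftraceP).
have -> : (-1 *: (E \o ad W \o ad U) + (E \o ad U \o ad W) = E \o ad (br U W))%VF.
  by apply/lfunP => w; rewrite !lfe !adE (jacobi hss) linearB scaleN1r addrC.
exact: tE.
Qed.

(** [ad] intertwines [ad X] with the commutator by [ad X], which is the sum of the commuting left
    and right multiplications LX and RX. Exponentiating the sum gives conjugation of [ad w] by the
    exponential, that is, compatibility with the bracket. *)
Lemma expA_aut X : isaut (vexp (ad X)).
Proof.
have adN' : ad (- X) = - ad X := adN hss X.
apply: (@autI _ _ _ (vexp (ad (- X)))) => [u v|v]; last by rewrite adN' vexpNK.
have [l|LX hLX] := @lfun_linear R ('End(L)) ('End(L)) (fun F => (ad X \o F)%VF).
  by move=> F G; apply/lfunP => w; rewrite !lfe linearP.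
have [l|RX hRX] := @lfun_linear R ('End(L)) ('End(L)) (fun F => (- (F \o ad X))%VF).
  by move=> F G; apply/lfunP => w; rewrite !lfe opprD scalerN.
have h1 : forall w, ad (vexp (ad X) w) = vexp (LX + RX) (ad w).
  apply: vexp_intertwine => [c x y|w]; first exact: adP.
  apply/lfunP => z; rewrite !lfe hLX hRX !lfe !adE (jacobi hss) //.
have h2 F w : (vexp LX F) w = vexp (ad X) (F w).
  apply: (@vexp_intertwine _ _ _ (fun G : 'End(L) => G w)) => [c x y|G]; first by rewrite !lfe.
  by rewrite hLX !lfe.
have h3 F w : (vexp RX F) w = F (vexp (ad (- X)) w).
  have c1 : vcvg \oo (fun n => (expsum RX n F) w) ((vexp RX F) w).
    by apply: (vcvg_eval (w := fun=> w)); [exact: vexpP|exact: vcvg_cst].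
  have c2 : vcvg \oo (fun n => F (expsum (ad (- X)) n w)) (F (vexp (ad (- X)) w)).
    by apply: vcvg_lfun; apply: vexpP.
  apply: (vcvg_uniq c1); rewrite (_ : (fun n => _) = (fun n => F (expsum (ad (- X)) n w))) //.
  apply/funext => n; rewrite /expsum sum_lfunE linear_sum; apply: eq_bigr => k _.
  rewrite scale_lfunE linearZ; congr (_ *: _).
  elim: (val k) (w) => //= m IH z; rewrite hRX !lfe IH -linearN; congr (F _).
  rewrite -iterS iterSr adN' !lfe.
  by elim: m {IH} (ad X z) => //= m IH z'; rewrite -IH linearN.
have lrc F : LX (RX F) = RX (LX F).
  by rewrite hLX !hRX hLX; apply/lfunP => w; rewrite !lfe linearN.
rewrite -[RHS]adE h1 vexpD // h2 h3 adE; congr (vexp _ _); congr (br _ _).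
by rewrite adN' vexpNK.
Qed.

Lemma aut_exp g X v : isaut g -> g (vexp (ad X) v) = vexp (ad (g X)) (g v).
Proof.
move=> hg; apply: vexp_intertwine => [c x y|w]; first by rewrite linearP.
by rewrite !adE (aut_br _ _ hg).
Qed.

Lemma expAN X v : vexp (ad (- X)) (vexp (ad X) v) = v.
Proof. by rewrite (adN hss) vexpNK. Qed.

Lemma expANr X v : vexp (ad X) (vexp (ad (- X)) v) = v.
Proof. by rewrite (adN hss) vexpKN. Qed.

Lemma expA_inv X : ((vexp (ad X))^-1)%VF = vexp (ad (- X)).
Proof. by apply: invlE (expA_aut X) _ => v; rewrite expANr. Qed.

Lemma expAD (s t : R) X v : vexp (ad ((s + t) *: X)) v = vexp (ad (s *: X)) (vexp (ad (t *: X)) v).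
Proof.
by rewrite scalerDl -[s *: X]scale1r (adP hss) !scale1r vexpD // => w;
  rewrite !(adZ hss) !lfe !linearZ /= !scalerA mulrC.
Qed.

Lemma isomG_aut a : isomG a -> isaut a.
Proof. by elim=> [|X b _ hb]; [exact: aut1|apply: aut_comp => //; exact: expA_aut]. Qed.

Lemma isomG_comp a b : isomG a -> isomG b -> isomG (a \o b)%VF.
Proof.
move=> ha hb; elim: ha => [|X c _ IH]; first by rewrite comp_lfun1l.
by rewrite -comp_lfunA; apply: isomG_exp.
Qed.

Lemma isomG_expA X : isomG (vexp (ad X)).
Proof. by rewrite -[vexp _]comp_lfun1r; apply: isomG_exp; exact: isomG1. Qed.

Lemma isomG_inv a : isomG a -> isomG (a^-1)%VF.
Proof.
elim=> [|X b hb IH].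
  have -> : (\1^-1)%VF = \1%VF :> 'End(L) by apply: invlE (aut1 L) _ => v; rewrite !lfe.
  exact: isomG1.
have hc := aut_comp (expA_aut X) (isomG_aut hb).
rewrite (@invlE _ _ _ (b^-1 \o vexp (ad (- X)))%VF hc).
  by apply: isomG_comp => //; exact: isomG_expA.
by move=> v; rewrite !lfe (autVK (isomG_aut hb)) expANr.
Qed.

Lemma actE a q v : act a q v = a (q (a^-1%VF v)).
Proof. by rewrite /act !lfe. Qed.

Lemma act_app a q v : isaut a -> act a q (a v) = a (q v).
Proof. by move=> ha; rewrite actE autK. Qed.

Lemma act_comp a b q : isaut a -> isaut b -> act (a \o b)%VF q = act a (act b q).
Proof.
move=> ha hb; apply/lfunP => v; rewrite !actE.
have -> : ((a \o b)^-1 = b^-1 \o a^-1)%VF.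
  by apply: invlE (aut_comp ha hb) _ => w; rewrite !lfe !autVK.
by rewrite !lfe.
Qed.

Lemma act1 q : act \1%VF q = q.
Proof.
have h : (\1^-1)%VF = \1%VF :> 'End(L) by apply: invlE (aut1 L) _ => v; rewrite !lfe.
by apply/lfunP => v; rewrite actE h !lfe.
Qed.

Lemma act_sym a q : isaut a -> S q -> S (act a q).
Proof.
move=> ha hq; split.
- move=> X Y; rewrite !actE (aut_br _ _ (autV ha)) (sym_br _ _ hq) (aut_br _ _ ha) //.
- by move=> X; rewrite !actE autK // symK // autVK.
- move=> X X0; rewrite actE -{1}(autVK ha X) killing_aut //.
  case: hq => _ _; apply; apply: contraNneq X0 => h.
  by rewrite -(autVK ha X) h linear0.
Qed.

Lemma act_self p : S p -> act p p = p.
Proof.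
move=> hp; have h : (p^-1)%VF = p by apply: invlE (sym_aut hp) _ => v; rewrite symK.
by apply/lfunP => v; rewrite actE h symK.
Qed.

Lemma pspace_act a p X : isaut a -> X \in P p -> a X \in P (act a p).
Proof. by move=> ha /memP h; apply/memP; rewrite act_app // h linearN. Qed.

Lemma bp_act a p u v : isaut a -> bp (act a p) (a u) (a v) = bp p u v.
Proof. by move=> ha; rewrite /bp act_app // killing_aut. Qed.

Lemma knorm_aut a X : isaut a -> knorm (a X) = knorm X.
Proof. by move=> ha; rewrite /knorm killing_aut. Qed.

(** Since p X = - X, conjugating p by e^{tX} equals composing p with e^{2tX}. This is the origin of
    the factor 2 in all later exponents. *)
Lemma geoE p X t v : S p -> X \in P p -> geo p X t v = vexp (ad ((2 * t) *: X)) (p v).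
Proof.
move=> hp /memP hX; rewrite /geo lfexpE actE expA_inv (aut_exp _ _ (sym_aut hp)).
rewrite linearN linearZ /= hX scalerN opprK.
have -> : 2 * t = t + t by ring.
by rewrite (expAD t t).
Qed.

Lemma geoEr p X t v : S p -> X \in P p -> geo p X t v = p (vexp (ad ((- 2 * t) *: X)) v).
Proof.
move=> hp hX; rewrite geoE // (aut_exp _ _ (sym_aut hp)) linearZ /=.
by rewrite ((memP _ _).1 hX); have -> : (- 2 * t) *: - X = (2 * t) *: X by vring.
Qed.

Lemma geo_sym p X t : S p -> S (geo p X t).
Proof. by move=> hp; apply: act_sym => //; rewrite lfexpE; exact: expA_aut. Qed.

Lemma geo0 p X : S p -> X \in P p -> geo p X 0 = p.
Proof.
by move=> hp hX; apply/lfunP => v; rewrite geoE // mulr0 scale0r -(scale0r 0) (adZ hss) scale0r vexp0.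
Qed.

Lemma geo_P p X t : S p -> X \in P p -> X \in P (geo p X t).
Proof.
move=> hp hX; apply/memP; rewrite geoE // ((memP _ _).1 hX) linearN /=; congr (- _).
by rewrite (@vexp_eigen _ _ _ 0) ?expR0 ?scale1r // adE (brZl hss) lie_br_alt scaler0 scale0r.
Qed.

Lemma geoD p X s t : S p -> X \in P p -> geo (geo p X s) X t = geo p X (s + t).
Proof.
move=> hp hX; apply/lfunP => v.
rewrite (geoE _ _ (geo_sym _ _ hp) (geo_P _ hp hX)) !(geoE _ _ hp hX).
have -> : 2 * (s + t) = 2 * t + 2 * s by ring.
by symmetry; apply: expAD.
Qed.

Lemma geoZ p X c t : S p -> X \in P p -> geo p (c *: X) t = geo p X (c * t).
Proof.
move=> hp hX; apply/lfunP => v; rewrite !geoE ?rpredZ // scalerA.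
by have -> : 2 * t * c = 2 * (c * t) by ring.
Qed.

Lemma bp_geo p X t u v : S p -> X \in P p ->
  bp (geo p X t) u v = bp p u (vexp (ad ((- 2 * t) *: X)) v).
Proof. by move=> hp hX; rewrite /bp geoEr. Qed.

(** M = q p is a positive self-adjoint automorphism for [bp p], and e^{2 ad X} p = q asks for half
    its logarithm. That logarithm is a derivation, hence inner. *)
Lemma exists_log p q : S p -> S q -> exists2 X, X \in P p & geo p X 1 = q.
Proof.
move=> hp hq; pose M := (q \o p)%VF.
have Hp := bp_inner hp.
have Maut : isaut M by apply: aut_comp; apply: sym_aut.
have sM : selfadj (bp p) M by move=> u v; rewrite /bp !lfe -!sym_killingl // symK.
have [n [e [m [he hm]]]] := full_spectral Hp sM.
have oe : orthon (bp p) e by case: he.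
have m0 i : 0 < m i.
  have : bp p (e i) (M (e i)) = m i by rewrite hm (ipZr Hp) oe eqxx mulr1.
  move=> <-; rewrite /bp !lfe -sym_killingl // -{1}(symK (e i) hp).
  rewrite symK //; case: hq => _ _; apply.
  apply/negP => /eqP h; have := oe i i; rewrite -(symK (e i) hp) h linear0 (ip0l Hp) eqxx.
  by move/eqP; rewrite eq_sym oner_eq0.
have [l|D hD] := @lfun_linear R L L (fun v => \sum_i (ln (m i) / 2 * bp p (e i) v) *: e i).
  move=> u v; rewrite scaler_sumr -big_split; apply: eq_bigr => i _ /=.
  by rewrite (ipDr Hp) (ipZr Hp) scalerA -scalerDl; congr (_ *: _); ring.
have De i : D (e i) = (ln (m i) / 2) *: e i.
  rewrite hD (bigD1 i) //= oe eqxx mulr1 big1 ?addr0 // => j ij.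
  by rewrite oe (negPf ij) mulr0 scale0r.
have sD : selfadj (bp p) D.
  move=> u v; rewrite (ipC Hp) !(onb_sum_ip Hp _ he (memvf _)); apply: eq_bigr => i _.
  by rewrite !hD !(orthon_coef Hp) //; ring.
have DM c v : M v = c *: v -> D v = (ln c / 2) *: v.
  move/(eigen_coef Hp v c he sM hm) => h; apply/(eigen_coef Hp v _ he sD De) => i.
  by case: (h i) => ->; [left|right].
(* The bracket of eigenvectors of the automorphism M is an eigenvector for the product of the
   eigenvalues, and the logarithm turns products into sums. *)
have hder X Y : D (br X Y) = br (D X) Y + br X (D Y).
  have base i j : D (br (e i) (e j)) = br (D (e i)) (e j) + br (e i) (D (e j)).
    rewrite (@DM (m i * m j)) ?lnM ?posrE // ?mulrDl ?scalerDl ?De ?(brZl hss) ?brZr //.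
    by rewrite (aut_br _ _ Maut) !hm (brZl hss) brZr scalerA.
  rewrite (full_onb X he) (full_onb Y he).
  have brs (r : seq 'I_n) c F Z : br (\sum_(i <- r) c i *: F i) Z = \sum_(i <- r) c i *: br (F i) Z.
    elim: r => [|x r IH]; first by rewrite !big_nil (br0l hss).
    by rewrite !big_cons (brDl hss) (brZl hss) IH.
  have brr (r : seq 'I_n) c F Z : br Z (\sum_(i <- r) c i *: F i) = \sum_(i <- r) c i *: br Z (F i).
    elim: r => [|x r IH]; first by rewrite !big_nil br0r.
    by rewrite !big_cons brDr brZr IH.
  have Ds (r : seq 'I_n) c F : D (\sum_(i <- r) c i *: F i) = \sum_(i <- r) c i *: D (F i).
    by rewrite linear_sum; apply: eq_bigr => i _; rewrite linearZ.
  rewrite brs !Ds !brs -big_split; apply: eq_bigr => i _ /=.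
  rewrite !brr Ds -scalerDr; congr (_ *: _); rewrite -big_split; apply: eq_bigr => j _ /=.
  by rewrite base scalerDr.
have [X hX] := inner_derivation hp hder.
have MV v : M (p (M v)) = p v by rewrite /M !lfe !symK.
have XP : X \in P p.
  apply/memP/(ad_inj hss) => v; rewrite (brNl hss) -!adE -hX.
  have -> : ad (p X) v = p (D (p v)) by rewrite hX !adE (sym_br _ _ hp) symK.
  suff h : (p \o (D \o p))%VF = - D by have := congr1 (fun f : 'End(L) => f v) h; rewrite !lfe.
  apply: (eq_on_onb he) => i; rewrite !lfe.
  (* From M p M = p, the involution p sends an eigenvector of M to one with the inverse eigenvalue,
     where the logarithm changes sign. *)
  rewrite (@DM (m i)^-1) ?De.
    by rewrite linearZ /= symK // lnV ?posrE // mulNr scaleNr.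
  have := MV (e i); rewrite hm !linearZ /= => h.
  by rewrite -[in RHS]h scalerA mulVf ?scale1r // gt_eqF.
exists X => //; apply/lfunP => v; rewrite geoE // mulr1.
have -> : q v = M (p v) by rewrite !lfe symK.
congr (fun_of_lfun _ _); apply: (eq_on_onb he) => i; rewrite hm.
rewrite (@vexp_eigen _ _ _ (2 * (ln (m i) / 2))).
  by rewrite mulrC divfK ?pnatr_eq0 // lnK // posrE.
by rewrite (adZ hss) lfe -hX De scalerA.
Qed.

Lemma log_unique p X Y : S p -> X \in P p -> Y \in P p -> geo p X 1 = geo p Y 1 -> X = Y.
Proof.
move=> hp hX hY h; have Hp := bp_inner hp; have sX := ad_selfadj hp hX.
have [n [e [m [he hm]]]] := full_spectral Hp sX.
apply: (ad_inj hss) => v; rewrite -!adE; congr (fun_of_lfun _ _); apply: (eq_on_onb he) => i.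
have hv : vexp (ad (2 *: Y)) (e i) = expR (2 * m i) *: e i.
  have := congr1 (fun f : 'End(L) => f (p (e i))) h; rewrite !geoE // !mulr1 symK // => <-.
  by rewrite (@vexp_eigen _ _ _ (2 * m i)) // (adZ hss) !lfe hm scalerA.
have := vexp_eigen_inv Hp (ad_selfadj hp (memvZ 2 hY)) hv.
rewrite (adZ hss) !lfe hm -scalerA => /scalerI -> //; by rewrite pnatr_eq0.
Qed.

(** Uniqueness of the logarithm makes the set in the infimum a singleton. *)
Lemma dist_geo p X t : S p -> X \in P p -> dist p (geo p X t) = `|t| * knorm X.
Proof.
move=> hp hX; rewrite -[t]mulr1 -geoZ //.
have tX : t *: X \in P p by rewrite rpredZ.
rewrite /dist (_ : [set knorm Y | Y in _] = [set knorm (t *: X)]).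
  by rewrite inf1 !(@knormE p) // (nrmZ (bp_inner hp)) mulr1.
apply/seteqP; split=> [r [Y [hY hg] <-]|r ->]; last by exists (t *: X).
by rewrite (log_unique hp hY tX hg).
Qed.

Lemma dist_log p X q : S p -> X \in P p -> geo p X 1 = q -> dist p q = knorm X.
Proof. by move=> hp hX <-; rewrite dist_geo // normr1 mul1r. Qed.

Lemma knorm_ge0 X : 0 <= knorm X. Proof. exact: sqrtr_ge0. Qed.

Lemma dist_ge0 p q : S p -> S q -> 0 <= dist p q.
Proof. by move=> hp hq; have [X hX h] := exists_log hp hq; rewrite (dist_log hp hX h) knorm_ge0. Qed.

Lemma distxx p : S p -> dist p p = 0.
Proof. by move=> hp; rewrite -{2}(@geo0 p 0) ?mem0v // dist_geo ?mem0v // normr0 mul0r. Qed.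

Lemma geo_back p X t : S p -> X \in P p -> geo (geo p X t) (- X) t = p.
Proof.
move=> hp hX; rewrite -scaleN1r (geoZ _ _ (geo_sym _ _ hp) (geo_P _ hp hX)) mulN1r.
by rewrite (geoD _ _ hp hX) subrr (geo0 hp hX).
Qed.

Lemma knormN p X : S p -> X \in P p -> knorm (- X) = knorm X.
Proof. by move=> hp hX; rewrite (knormE hX) (@knormE p (- X)) ?rpredN // (nrmN (bp_inner hp)). Qed.

Lemma distC p q : S p -> S q -> dist p q = dist q p.
Proof.
move=> hp hq; have [X hX h] := exists_log hp hq.
rewrite (dist_log hp hX h) -h -{2}(geo_back 1 hp hX).
rewrite (dist_geo _ (geo_sym _ _ hp)) ?rpredN ?(geo_P _ hp hX) //.
by rewrite normr1 mul1r (knormN hp hX).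
Qed.

Lemma act_geo a p X t : isaut a -> S p -> X \in P p -> act a (geo p X t) = geo (act a p) (a X) t.
Proof.
move=> ha hp hX; apply/lfunP => v.
rewrite actE (geoE _ _ hp hX) (geoE _ _ (act_sym ha hp) (pspace_act ha hX)).
by rewrite (aut_exp _ _ ha) linearZ actE.
Qed.

Lemma dist_act a p q : isaut a -> S p -> S q -> dist (act a p) (act a q) = dist p q.
Proof.
move=> ha hp hq; have [X hX h] := exists_log hp hq.
rewrite -h (act_geo _ ha hp hX) (dist_geo _ hp hX) (dist_geo _ (act_sym ha hp) (pspace_act ha hX)).
by rewrite (knorm_aut _ ha).
Qed.

Lemma transitive p q : S p -> S q -> exists2 a, isomG a & act a p = q.
Proof.
move=> hp hq; have [X hX <-] := exists_log hp hq.
by exists (vexp (ad X)); [exact: isomG_expA|rewrite /geo scale1r].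
Qed.

End SymmetricSpace.

(** * The law of cosines *)

Section LayerCake.
Variable R : realType.

Lemma seq_max (s : seq R) : s != [::] -> exists2 x, x \in s & forall y, y \in s -> y <= x.
Proof.
elim: s => // a [|b s] IH _; first by exists a => [|y]; rewrite inE // => /eqP ->.
have [//|x xs hx] := IH; have [ax|xa] := leP a x.
  by exists x => [|y]; rewrite inE ?xs ?orbT // => /orP [/eqP -> //|/hx].
exists a => [|y]; first by rewrite inE eqxx.
by rewrite inE => /orP [/eqP -> //|/hx h]; apply: le_trans h (ltW xa).
Qed.

(** A pair of [cl] is an increment with its threshold. Increments are differences of successive
    values, hence nonnegative, except that the lowest one is the least value itself; its threshold
    is below everything. *)
Lemma layer_cake_seq (s : seq R) : exists cl : seq (R * R),
  [/\ forall x, x \in cl -> 0 <= x.1 \/ forall y, y \in s -> x.2 <= y,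
      forall x, x \in cl -> x.2 \in s &
      forall y, y \in s -> \sum_(x <- cl | x.2 <= y) x.1 = y].
Proof.
have [k] := ubnP (size s); elim: k s => // k IH s hs.
have [->|s0] := eqVneq s [::]; first by exists [::].
have [x xs hx] := seq_max s0; pose s' := [seq y <- s | y < x].
have hs' : (size s' < k)%N.
  have h : (size s' < size s)%N.
    rewrite size_filter -(count_predC (fun y => y < x) s) -[X in (X < _)%N]addn0 ltn_add2l -has_count.
    by apply/hasP; exists x; rewrite //= ltxx.
  by apply: leq_trans h _; rewrite -ltnS.
have ms' y : y \in s -> y = x \/ y \in s'.
  move=> ys; rewrite mem_filter ys andbT; have := hx _ ys.
  by rewrite le_eqVlt => /orP [/eqP|]; [left|right].
have ss' y : y \in s' -> (y \in s) /\ y < x by rewrite mem_filter => /andP [].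
have [cl [h1 h2 h3]] := IH s' hs'.
have [e|s'0] := eqVneq s' [::].
  exists [:: (x, x)]; split=> [z|z|y /ms' [->|]]; rewrite ?e ?inE //.
  - by move=> /eqP ->; right => y /ms' [->|] //; rewrite e.
  - by move=> /eqP ->.
  - by rewrite big_cons big_nil lexx addr0.
have [t ts' ht] := seq_max s'0; have [ts tx] := ss' _ ts'.
exists ((x - t, x) :: cl); split.
- move=> z; rewrite inE => /orP [/eqP ->|zc] /=; first by left; rewrite subr_ge0 ltW.
  have [?|hz] := h1 _ zc; [by left|right => y /ms' [->|/hz //]].
  by have [_ /ltW] := ss' _ (h2 _ zc).
- by move=> z; rewrite inE => /orP [/eqP -> //|/h2 /ss' []].
- move=> y ys; rewrite big_cons /=; have [yx|ys'] := ms' _ ys.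
    rewrite yx lexx; suff -> : \sum_(j <- cl | j.2 <= x) j.1 = t by rewrite subrK.
    rewrite -[RHS](h3 _ ts') !(big_seq_cond (fun j : R * R => j.2 <= _)); apply: eq_bigl => z.
    case zc: (z \in cl) => //=; have zs := h2 _ zc.
    by rewrite (ht _ zs) (ltW (ss' _ zs).2).
  by have [_ yx] := ss' _ ys'; rewrite leNgt yx /= h3.
Qed.

Lemma layer_cake n (m : 'I_n -> R) : exists cl : seq (R * R),
  (forall x, x \in cl -> 0 <= x.1 \/ forall i, x.2 <= m i) /\
  forall i, m i = \sum_(x <- cl | x.2 <= m i) x.1.
Proof.
have [cl [h1 _ h3]] := layer_cake_seq [seq m i | i <- enum 'I_n].
have hm i : m i \in [seq m i | i <- enum 'I_n] by apply: map_f; rewrite mem_enum.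
exists cl; split=> [x /h1 [h|h]|i]; [by left|by right => i; apply: h|by rewrite h3].
Qed.

End LayerCake.

Section Volume.
Variables (R : realType) (V : vectType R).
Implicit Types (F U : {vspace V}) (ip : V -> V -> R).

Definition gram ip F : 'M[R]_(\dim F) := \matrix_(i, j) ip (vbasis F)`_i (vbasis F)`_j.

(** The logarithm of a squared volume, relative to the basis chosen by [vbasis]; meaningful in
    differences between two inner products on the same F. *)
Definition logvol ip F : R := ln (\det (gram ip F)).

Lemma logvol_diff ip1 ip2 F n (f : 'I_n -> V) : inner ip1 -> inner ip2 -> onb ip1 F f ->
  (forall i j, i != j -> ip2 (f i) (f j) = 0) ->
  logvol ip2 F - logvol ip1 F = \sum_i ln (ip2 (f i) (f i)).
Proof.
move=> H1 H2 hf hd; have nE := onb_dim H1 hf; subst n.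
have [of1 fF _] := hf.
have [T fE] : exists T : 'M[R]_(\dim F), forall i, f i = \sum_j T i j *: (vbasis F)`_j.
  exists (\matrix_(i, j) coord (vbasis F) j (f i)) => i.
  by rewrite {1}(coord_vbasis (fF i)); apply: eq_bigr => j _; rewrite mxE.
have gE ip : inner ip -> T *m gram ip F *m T^T = \matrix_(i, j) ip (f i) (f j).
  move=> H; apply/matrixP => i j; rewrite !mxE (fE j) (ip_sumr H); apply: eq_bigr => k _.
  rewrite (ipZr H) [RHS]mulrC !mxE; congr (_ * _).
  rewrite (fE i) (ip_suml H); apply: eq_bigr => l _.
  by rewrite (ipZl H) !mxE.
have detE ip : inner ip -> \det T ^+ 2 * \det (gram ip F) = \det (\matrix_(i, j) ip (f i) (f j)).
  by move=> H; rewrite -gE // !det_mulmx det_tr; ring.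
have e1 : \det T ^+ 2 * \det (gram ip1 F) = 1.
  rewrite detE // (_ : \matrix_(i, j) _ = 1%:M) ?det1 //.
  by apply/matrixP => i j; rewrite !mxE of1.
have f0 i : f i != 0.
  apply/negP => /eqP h; have := of1 i i; rewrite h (ip0l H1) eqxx.
  by move/eqP; rewrite eq_sym oner_eq0.
have p2 i : 0 < ip2 (f i) (f i) by apply: (ip_gt0 H2).
have e2 : \det T ^+ 2 * \det (gram ip2 F) = \prod_i ip2 (f i) (f i).
  rewrite detE // (_ : \matrix_(i, j) _ = diag_mx (\row_i ip2 (f i) (f i))).
    by rewrite det_diag; apply: eq_bigr => i _; rewrite mxE.
  apply/matrixP => i j; rewrite !mxE; have [->|ij] := eqVneq i j; rewrite ?mulr1n //.
  by rewrite mulr0n hd.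
have T0 : 0 < \det T ^+ 2.
  rewrite lt_neqAle sqr_ge0 andbT eq_sym; apply/negP => /eqP h.
  by move/eqP: e1; rewrite h mul0r eq_sym oner_eq0.
have g1 : 0 < \det (gram ip1 F) by rewrite -(pmulr_rgt0 _ T0) e1.
have g2 : 0 < \det (gram ip2 F) by rewrite -(pmulr_rgt0 _ T0) e2 prodr_gt0.
rewrite /logvol; have -> : ln (\det (gram ip1 F)) = - ln (\det T ^+ 2).
  by apply/eqP; rewrite -addr_eq0 -lnM ?posrE // mulrC e1 ln1.
rewrite opprK addrC -lnM ?posrE // e2.
elim: (index_enum _) => [|i r IH]; first by rewrite !big_nil ln1.
by rewrite !big_cons lnM ?posrE ?prodr_gt0 // IH.
Qed.

Lemma oproj_sum ip F n (e : 'I_n -> V) v : inner ip -> forall H : inner ip, onb ip F e ->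
  oproj H F v = \sum_i ip (e i) v *: e i.
Proof.
move=> H Hip [oe eF he]; rewrite (he _ (oproj_mem Hip F v)); apply: eq_bigr => i _.
by rewrite ip_oproj.
Qed.

End Volume.

Section Cosine.
Variables (R : realType) (L : liealg R).
Hypothesis hss : semisimple L.
Implicit Types (X Y Z U V W u v w : L) (f g p q r : 'End(L)) (F : {vspace L}).
Local Notation br := (@lie_br R L).
Local Notation B := (@killing R L).
Local Notation S := (@symspace R L).
Local Notation P := (@pspace R L).

Lemma lftrace_onb ip n (e : 'I_n -> L) f : inner ip -> onb ip fullv e ->
  lftrace f = \sum_i ip (e i) (f (e i)).
Proof.
move=> H he; rewrite (@lftrace_dual _ _ _ e (fun i => ip (e i))) // => [i|v].
  exact: ip_lfunctional.
exact: full_onb.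
Qed.

Lemma lftrace_proj ip n (e : 'I_n -> L) F f (H : inner ip) : onb ip F e ->
  lftrace (oproj H F \o f)%VF = \sum_i ip (e i) (f (e i)).
Proof.
move=> he; have [m [g hg]] := exists_onb H fullv.
rewrite (lftrace_onb _ H hg).
under eq_bigr => k _ do rewrite lfe -oproj_selfadj (oproj_sum _ H H he) (ip_suml H).
rewrite exchange_big; apply: eq_bigr => i _ /=.
under eq_bigr => k _ do rewrite (ipZl H).
have -> : f (e i) = \sum_k ip (g k) (e i) *: f (g k).
  by rewrite {1}(full_onb (e i) hg) linear_sum; apply: eq_bigr => k _; rewrite linearZ.
by rewrite (ip_sumr H); apply: eq_bigr => k _; rewrite (ipZr H) (ipC H).
Qed.

Lemma lftrace_CS ip f g (H : inner ip) : selfadj ip f -> selfadj ip g ->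
  lftrace (f \o g)%VF ^+ 2 <= lftrace (f \o f)%VF * lftrace (g \o g)%VF.
Proof.
move=> sf sg; have [m [e he]] := exists_onb H fullv.
have E f1 g1 : selfadj ip f1 -> lftrace (f1 \o g1)%VF = \sum_i ip (f1 (e i)) (g1 (e i)).
  by move=> s1; rewrite (lftrace_onb _ H he); apply: eq_bigr => i _; rewrite lfe s1.
rewrite !E //; set a := \sum_i _; set b := \sum_i _; set c := \sum_i _.
have hq t : 0 <= b - 2 * t * a + t ^+ 2 * c.
  have -> : b - 2 * t * a + t ^+ 2 * c = \sum_i ip (f (e i) - t *: g (e i)) (f (e i) - t *: g (e i)).
    rewrite /a /b /c !mulr_sumr -sumrB -big_split; apply: eq_bigr => i _ /=.
    by rewrite !(ipBl H, ipBr H, ipZl H, ipZr H) (ipC H (g _) (f _)); ring.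
  by apply: sumr_ge0 => i _; apply: ip_ge0.
have c0 : 0 <= c by apply: sumr_ge0 => i _; apply: ip_ge0.
have [c00|cn0] := eqVneq c 0.
  have [->|a0] := eqVneq a 0; first by rewrite expr0n /= mulr_ge0 // sumr_ge0 // => i _; apply: ip_ge0.
  have := hq ((b + 1) / (2 * a)); rewrite c00 mulr0 addr0.
  have -> : 2 * ((b + 1) / (2 * a)) * a = b + 1 by field; rewrite a0.
  by lra.
have cp : 0 < c by rewrite lt_neqAle eq_sym cn0.
have := hq (a / c); have -> : b - 2 * (a / c) * a + (a / c) ^+ 2 * c = (b * c - a ^+ 2) / c by field.
by rewrite pmulr_lge0 ?invr_gt0 // subr_ge0.
Qed.

(** In an eigenbasis of [ad V] the new squared length of u is a mean of the numbers e^{-2 m i} with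
    weights w i, so this is Jensen's inequality with its equality case. The excess over the
    exponential of the mean is a sum of terms e^t - 1 - t, each positive unless t = 0. *)
Lemma jensen_geo p V u : S p -> V \in P p -> bp p u u = 1 ->
  - 2 * bp p u (br V u) <= ln (bp (geo p V 1) u u) /\
  (ln (bp (geo p V 1) u u) = - 2 * bp p u (br V u) -> exists c, br V u = c *: u).
Proof.
move=> hp hV u1; have Hp := bp_inner hss hp; have sV := ad_selfadj hss hp hV.
have [n [e [m [he hm]]]] := full_spectral Hp sV.
have hm2 i : ad ((- 2 * 1) *: V) (e i) = (- 2 * m i) *: e i.
  by rewrite (adZ hss) !lfe hm scalerA mulr1.
set c := bp p u (br V u).
pose w i := bp p (e i) u ^+ 2.
have w1 : \sum_i w i = 1.
  by rewrite -u1 (onb_sum_ip Hp _ he (memvf u)); apply: eq_bigr => i _; rewrite /w expr2.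
have cE : c = \sum_i w i * m i.
  rewrite /c -adE (onb_sum_ip Hp _ he (memvf _)); apply: eq_bigr => i _.
  by rewrite (sa_coef Hp _ _ sV hm) /w; ring.
have bE : bp (geo p V 1) u u = \sum_i w i * expR (- 2 * m i).
  rewrite bp_geo // (onb_sum_ip Hp _ he (memvf _)); apply: eq_bigr => i _.
  by rewrite (vexp_coef Hp _ _ he hm2) /w; ring.
have E : bp (geo p V 1) u u = expR (- 2 * c) * (1 + \sum_i w i * (expR (- 2 * (m i - c)) - 1 - (- 2 * (m i - c)))).
  have -> : \sum_i w i * (expR (- 2 * (m i - c)) - 1 - (- 2 * (m i - c))) =
      \sum_i w i * expR (- 2 * (m i - c)) + (\sum_i w i * m i * 2 - \sum_i w i * (1 + 2 * c)).
    by rewrite -sumrB -big_split; apply: eq_bigr => i _ /=; ring.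
  rewrite -!mulr_suml -cE w1; have -> : 1 + (\sum_i w i * expR (- 2 * (m i - c)) + (c * 2 - 1 * (1 + 2 * c))) =
    \sum_i w i * expR (- 2 * (m i - c)) by ring.
  rewrite bE mulr_sumr; apply: eq_bigr => i _.
  by rewrite mulrCA -expRD; congr (_ * expR _); ring.
have t0 i : 0 <= w i * (expR (- 2 * (m i - c)) - 1 - (- 2 * (m i - c))).
  by rewrite mulr_ge0 ?sqr_ge0 // -addrA -opprD subr_ge0 expR_ge1Dx.
have pos : 0 < bp (geo p V 1) u u.
  have un0 : u != 0 by apply: contraPneq u1 => ->; rewrite (ip0l Hp) => /eqP; rewrite eq_sym oner_eq0.
  exact: (ip_gt0 (bp_inner hss (geo_sym hss V 1 hp))).
have s0 : 0 <= \sum_i w i * (expR (- 2 * (m i - c)) - 1 - (- 2 * (m i - c))) by apply: sumr_ge0.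
have lE : ln (bp (geo p V 1) u u) = - 2 * c + ln (1 + \sum_i w i * (expR (- 2 * (m i - c)) - 1 - (- 2 * (m i - c)))).
  by rewrite E lnM ?posrE ?expR_gt0 ?expRK //; rewrite ltr_pwDl.
split=> [|h]; first by rewrite lE lerDl ln_ge0 // lerDl.
have s00 : \sum_i w i * (expR (- 2 * (m i - c)) - 1 - (- 2 * (m i - c))) = 0.
  move: h; rewrite lE -[RHS]addr0 => /addrI /eqP.
  rewrite ln_eq0 ?ltr_pwDl // => /eqP; rewrite -[RHS]addr0 => /addrI //.
exists c; rewrite -adE; apply/(eigen_coef Hp u c he sV hm) => i.
have /eqP := s00; rewrite psumr_eq0 // => /allP /(_ i (mem_index_enum _)) /=.
rewrite mulf_eq0 => /orP [|h0]; first by rewrite sqrf_eq0 => /eqP; left.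
right; apply/eqP; apply: contraTT h0 => mc; rewrite gt_eqF // -addrA -opprD subr_gt0.
by rewrite expR_gt1Dx // mulf_neq0 // ?oppr_eq0 ?pnatr_eq0 // subr_eq0.
Qed.

(** Diagonalising the compression of e^{-2 ad V} to F gives a basis orthonormal at p and orthogonal
    at the other point, so volumes factor and Jensen applies to each vector. In the equality case
    every basis vector is an eigenvector of [ad V], whence F is invariant. *)
Lemma logvol_geo p V F (H : inner (bp p)) : S p -> V \in P p ->
  [/\ - 2 * lftrace (oproj H F \o ad V)%VF <= logvol (bp (geo p V 1)) F - logvol (bp p) F,
      logvol (bp (geo p V 1)) F - logvol (bp p) F = - 2 * lftrace (oproj H F \o ad V)%VF ->
        forall v, v \in F -> br V v \in F &
      (forall v, v \in F -> br V v \in F) ->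
        logvol (bp (geo p V 1)) F - logvol (bp p) F = - 2 * lftrace (oproj H F \o ad V)%VF].
Proof.
move=> hp hV; have hr := geo_sym hss V 1 hp; have Hr := bp_inner hss hr.
have sV := ad_selfadj hss hp hV.
have s2 : selfadj (bp p) (ad ((- 2 * 1) *: V)) by apply: (ad_selfadj hss hp); rewrite rpredZ.
pose M := vexp (ad ((- 2 * 1) *: V)).
have sM : selfadj (bp p) M by apply: vexp_selfadj.
pose C := (oproj H F \o (M \o oproj H F))%VF.
have sC : selfadj (bp p) C by move=> u v; rewrite !lfe oproj_selfadj sM oproj_selfadj.
have [v _|n [e [s [he hs]]]] := spectral H (U := F) sC; first by rewrite !lfe oproj_mem.
have [oe eF _] := he.
have rE i j : bp (geo p V 1) (e i) (e j) = s j * (i == j)%:R.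
  rewrite bp_geo // -/M -(ip_oproj H _ (eF i)) -{1}(oproj_id H (eF j)).
  by have := congr1 (bp p (e i)) (hs j); rewrite !lfe (ipZr H) oe.
have dE : logvol (bp (geo p V 1)) F - logvol (bp p) F = \sum_i ln (bp (geo p V 1) (e i) (e i)).
  apply: logvol_diff => // i j /negPf ij; by rewrite rE ij mulr0.
have tE : - 2 * lftrace (oproj H F \o ad V)%VF = \sum_i (- 2 * bp p (e i) (br V (e i))).
  by rewrite (lftrace_proj _ H he) mulr_sumr; apply: eq_bigr => i _; rewrite adE.
have J i := jensen_geo hp hV (etrans (oe i i) (congr1 (fun b : bool => b%:R) (eqxx i))).
split.
- by rewrite dE tE; apply: ler_sum => i _; case: (J i).
- rewrite dE tE => h v /(let: And3 _ _ x := he in x) ->; rewrite -adE linear_sum; apply: rpred_sum => i _.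
  rewrite linearZ /= rpredZ // adE; have [_ Ji] := J i.
  have [|c ->] := Ji; last by rewrite rpredZ.
  have /eqP : \sum_i (ln (bp (geo p V 1) (e i) (e i)) - (- 2 * bp p (e i) (br V (e i)))) = 0.
    by rewrite sumrB h subrr.
  rewrite psumr_eq0 => [/allP /(_ i (mem_index_enum _))|k _]; first by rewrite subr_eq0 => /eqP.
  by rewrite subr_ge0; case: (J k).
- move=> hF; have [v|n' [g [m [hg hm]]]] := spectral H (U := F) sV; first by rewrite adE; exact: hF.
  have [og _ _] := hg.
  have gE i j : bp (geo p V 1) (g i) (g j) = expR (- 2 * m j) * (i == j)%:R.
    rewrite bp_geo // (@vexp_eigen _ _ _ (- 2 * m j)); first by rewrite (ipZr H) og.
    by rewrite (adZ hss) !lfe hm scalerA mulr1.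
  rewrite (logvol_diff H Hr hg); last by move=> i j /negPf ij; rewrite gE ij mulr0.
  rewrite (lftrace_proj _ H hg) mulr_sumr; apply: eq_bigr => i _.
  by rewrite gE eqxx mulr1 expRK hm (ipZr H) og eqxx mulr1.
Qed.

Lemma cosine_arith1 (a b c k w d : R) :
  - d <= b - a -> c - a = - k -> b - c <= w -> k - d <= w.
Proof. lra. Qed.

Lemma cosine_arith3 (a t : R) : 2^-1 * a + t = 0 -> a = - 2 * t.
Proof. lra. Qed.

Lemma cosine_arith4 (a t : R) : - 2 * t <= a -> 0 <= 2^-1 * a + t.
Proof. lra. Qed.

Lemma cosine_arith2 (a b c k w d : R) :
  - d <= b - a -> c - a = - k -> b - c <= w -> w <= k - d -> b - a = - d.
Proof. lra. Qed.

(* The horofunction of the ray e^{tU}p is a combination of logarithms of volumes of the spaces F_x of the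
   eigenspace filtration of ad U.  Its slope at any point is controlled by Jensen's inequality on each F_x. *)
Theorem cosine_inequality p U V : S p -> U \in P p -> V \in P p ->
  knorm U ^+ 2 - B U V <= knorm U * dist (geo p U 1) (geo p V 1) /\
  (knorm U * dist (geo p U 1) (geo p V 1) <= knorm U ^+ 2 - B U V -> br U V = 0).
Proof.
move=> hp hU hV; have H := bp_inner hss hp; have sU := ad_selfadj hss hp hU.
set q := geo p U 1; set r := geo p V 1.
have hq : S q by apply: geo_sym. have hr : S r by apply: geo_sym.
have Hr := bp_inner hss hr.
have [W hW rq] := exists_log hss hr hq.
rewrite (distC hss hq hr) (dist_log hss hr hW rq).
have [n [e [m [he hm]]]] := full_spectral H sU; have [oe _ _] := he.
have [cl [hc1 hc2]] := layer_cake m.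
pose F (x : R) : {vspace L} := <<[seq e i | i <- enum 'I_n & (x <= m i)%R]>>%VS.
have Fe x i : x <= m i -> e i \in F x.
  by move=> h; apply: memv_span; apply: map_f; rewrite mem_filter h mem_enum.
have Fp x i v : m i < x -> v \in F x -> bp p (e i) v = 0.
  move=> h; have [U' memU'] := orthogonal_complement H (e i) fullv.
  have /subvP FU' : (F x <= U')%VS.
    apply/span_subvP => w /mapP [k]; rewrite mem_filter => /andP [hk _] ->.
    have [ik|/negPf ik] := eqVneq i k; first by move: h; rewrite ik ltNge hk.
    by rewrite memU' memvf oe ik eqxx.
  by move/FU'; rewrite memU' memvf => /eqP.
have PF x i : oproj H (F x) (e i) = (x <= m i)%R%:R *: e i.
  have [h|h] := leP x (m i); first by rewrite scale1r oproj_id // Fe.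
  rewrite scale0r; apply: (ip_inj H) => w; rewrite oproj_selfadj (ip0l H).
  by apply: (Fp _ _ _ h); apply: oproj_mem.
have FU x v : v \in F x -> br U v \in F x.
  move=> vF; rewrite -(oproj_id H vF) -adE (full_onb v he) !linear_sum; apply: rpred_sum => i _ /=.
  rewrite !linearZ /= rpredZ // PF linearZ /= hm scalerA.
  by have [h|h] := leP x (m i); rewrite ?mul0r ?scale0r ?rpred0 // rpredZ // Fe.
have Ftop x : (forall i, x <= m i) -> F x = fullv.
  move=> h; apply/eqP; rewrite eqEsubv subvf /=; apply/subvP => v _.
  by rewrite (full_onb v he); apply: rpred_sum => i _; rewrite rpredZ // Fe.
(* An analogue of [ad U] for any inner product K: the thresholds and increments are kept, the
   projections are those of K. At p it is [ad U]. *)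
pose D ip (K : inner ip) : 'End(L) := \sum_(x <- cl) x.1 *: oproj K (F x.2).
have Dp : D _ H = ad U.
  apply: (eq_on_onb he) => i; rewrite sum_lfunE hm.
  under eq_bigr => x _ do rewrite lfe PF scalerA.
  rewrite -scaler_suml; congr (_ *: _); rewrite [RHS]hc2 [RHS]big_mkcond /=; apply: eq_bigr => x _.
  by case: (x.2 <= m i); rewrite ?mulr1 ?mulr0.
have Dtr ip (K : inner ip) f : lftrace (D _ K \o f)%VF =
    \sum_(x <- cl) x.1 * lftrace (oproj K (F x.2) \o f)%VF.
  rewrite /D; elim: (cl) => [|x s IH]; first by rewrite !big_nil comp_lfun0l lftrace0.
  by rewrite !big_cons -IH -lftraceP; congr lftrace; apply/lfunP => v; rewrite !lfe.
have Dsa ip (K : inner ip) : selfadj ip (D _ K).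
  move=> u v; rewrite /D !sum_lfunE (ip_suml K) (ip_sumr K); apply: eq_bigr => x _.
  by rewrite !lfe (ipZl K) (ipZr K) oproj_selfadj.
(* The half undoes the square in [logvol]. *)
pose phi t := 2^-1 * \sum_(x <- cl) x.1 * logvol (bp t) (F x.2).
have phiB t t' : phi t - phi t' = \sum_(x <- cl) x.1 * (2^-1 * (logvol (bp t) (F x.2) - logvol (bp t') (F x.2))).
  by rewrite /phi -mulrBr -sumrB mulr_sumr; apply: eq_bigr => x _; ring.
(* A negative coefficient occurs at most at a lowest threshold, where F is the whole algebra and the
   Jensen inequality is an equality. *)
have stepw t (K : inner (bp t)) T x : S t -> T \in P t -> x \in cl ->
    0 <= x.1 * (2^-1 * (logvol (bp (geo t T 1)) (F x.2) - logvol (bp t) (F x.2)) +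
       lftrace (oproj K (F x.2) \o ad T)%VF).
  move=> ht hT xc; have [h1 _ h3] := logvol_geo (F x.2) K ht hT.
  have [c0|/Ftop e1] := hc1 _ xc; first by rewrite mulr_ge0 // cosine_arith4.
  by rewrite h3 => [|v _]; [rewrite le_eqVlt; apply/orP; left; apply/eqP; field|rewrite e1 memvf].
have step t (K : inner (bp t)) T : S t -> T \in P t ->
    - lftrace (D _ K \o ad T)%VF <= phi (geo t T 1) - phi t.
  move=> ht hT; rewrite phiB Dtr -subr_ge0 opprK -big_split /= big_seq_cond.
  by apply: sumr_ge0 => x /andP [xc _]; rewrite -mulrDr stepw.
have s1 : - B U V <= phi r - phi p by have := step p H V hp hV; rewrite Dp.
have s2 : phi q - phi p = - knorm U ^+ 2.
  rewrite (knormE hss hU) (sqr_nrm H) (bpPr hss _ hU) phiB /killing -[X in (X \o _)%VF]Dp Dtr -sumrN.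
  apply: eq_bigr => x _; have [_ _ h3] := logvol_geo (F x.2) H hp hU.
  by rewrite h3 => [|v]; [field|exact: FU].
(* The trace of D squared involves dimensions of filtration steps and no inner product: projections
   to nested subspaces multiply to the projection to the smaller one. Hence the Hilbert-Schmidt norm
   of D at r is that of [ad U], namely [knorm U]. *)
have D2 ip (K : inner ip) : lftrace (D _ K \o D _ K)%VF =
    \sum_(x <- cl) \sum_(y <- cl) x.1 * (y.1 * (\dim (F (Num.max x.2 y.2)))%:R).
  rewrite Dtr; apply: eq_bigr => x _; rewrite -mulr_sumr; congr (_ * _).
  rewrite lftraceC Dtr; apply: eq_bigr => y _; congr (_ * _).
  have tdim G : lftrace (oproj K G) = (\dim G)%:R.
    have [k [g hg]] := exists_onb K G; have [og _ _] := hg.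
    rewrite -[oproj K G]comp_lfun1r (lftrace_proj _ K hg) -(onb_dim K hg).
    under eq_bigr => i _ do rewrite lfe og eqxx.
    by rewrite sumr_const card_ord.
  have Fle a b : a <= b -> (F b <= F a)%VS.
    move=> ab; apply/subvP => v vF; rewrite (full_onb v he); apply: rpred_sum => i _.
    have [h|h] := leP a (m i); first by rewrite rpredZ // Fe.
    by rewrite (Fp _ _ _ (lt_le_trans h ab) vF) scale0r rpred0.
  have [xy|yx] := leP x.2 y.2.
    rewrite -tdim; congr lftrace; apply/lfunP => v; rewrite lfe.
    by rewrite oproj_sub // Fle.
  rewrite -tdim lftraceC; congr lftrace; apply/lfunP => v; rewrite lfe.
  by rewrite oproj_sub // Fle // ltW.
have kU0 := knorm_ge0 U; have kW0 := knorm_ge0 W.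
have s3 : phi r - phi q <= knorm U * knorm W.
  have := step r Hr W hr hW; rewrite rq => h.
  apply: le_trans (_ : lftrace (D _ Hr \o ad W)%VF <= _); first by rewrite -opprB lerNl.
  have hCS := lftrace_CS Hr (Dsa _ Hr) (ad_selfadj hss hr hW).
  rewrite D2 -(D2 _ H) Dp in hCS.
  rewrite -/(killing U U) -/(killing W W) -{1}(bpPr hss _ hU) -{1}(bpPr hss _ hW) in hCS.
  rewrite -(sqr_nrm H) -(sqr_nrm Hr) -(knormE hss hU) -(knormE hss hW) -exprMn in hCS.
  apply: le_trans (ler_norm _) _.
  by rewrite -(ler_pXn2r (n:=2)) ?nnegrE ?mulr_ge0 // real_normK ?num_real.
split=> [|h]; first exact: cosine_arith1 s1 s2 s3.
have E : phi r - phi p = - B U V := cosine_arith2 s1 s2 s3 h.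
(* Equality forces every term to vanish, so [ad V] preserves each step with nonzero increment,
   commutes with its orthogonal projection at p, and therefore with their combination [ad U]. *)
have hz : \sum_(x <- cl) x.1 * (2^-1 * (logvol (bp r) (F x.2) - logvol (bp p) (F x.2)) +
       lftrace (oproj H (F x.2) \o ad V)%VF) = 0.
  under eq_bigr => x _ do rewrite mulrDr.
  by rewrite big_split /= -phiB -Dtr E Dp addNr.
have sV := ad_selfadj hss hp hV.
have comm x : x \in cl -> forall v, x.1 *: oproj H (F x.2) (br V v) = x.1 *: br V (oproj H (F x.2) v).
  move=> xc v; have [->|x10] := eqVneq x.1 0; first by rewrite !scale0r.
  congr (_ *: _); have FV w : w \in F x.2 -> br V w \in F x.2.
    have [_ h2 _] := logvol_geo (F x.2) H hp hV; apply: h2.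
    have /eqP := hz; rewrite big_seq_cond psumr_eq0 => [/allP /(_ x xc)|y /andP [yc _]]; last exact: stepw.
    rewrite xc /= mulf_eq0 (negPf x10) /= => /eqP; exact: cosine_arith3.
  apply: (ip_inj H) => w; rewrite oproj_selfadj -!adE !sV !adE (ipC H v).
  rewrite -(ip_oproj H _ (FV _ (oproj_mem H _ w))) -adE sV adE oproj_selfadj.
  by rewrite (oproj_id H (FV _ (oproj_mem H _ v))) -adE -sV (ipC H) adE.
apply: (ad_inj hss) => v; rewrite (br0l hss) (jacobi hss) -!adE -Dp !sum_lfunE linear_sum.
apply/eqP; rewrite subr_eq0; apply/eqP; rewrite !(big_seq_cond xpredT); apply: eq_bigr => x /andP [xc _].
by rewrite !lfe linearZ /= !adE comm.
Qed.

(** [dist] comes from the exponential map and not from lengths of paths, so the triangle inequality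
    is deduced from the law of cosines at p and Cauchy-Schwarz. *)
Lemma dist_triangle p q r : S p -> S q -> S r -> dist p r <= dist p q + dist q r.
Proof.
move=> hp hq hr; have H := bp_inner hss hp.
have [U hU <-] := exists_log hss hp hq; have [V hV <-] := exists_log hss hp hr.
have [] := cosine_inequality hp hV hU; set q' := geo p U 1; set r' := geo p V 1.
have hq' : S q' by apply: geo_sym. have hr' : S r' by apply: geo_sym.
rewrite (distC hss hr' hq') (dist_geo hss 1 hp hU) (dist_geo hss 1 hp hV) normr1 !mul1r => h _.
have [->|V0] := eqVneq V 0.
  rewrite (@knormE _ _ hss p 0 (mem0v _)) (nrm0 H) addr_ge0 ?knorm_ge0 //; exact: dist_ge0.
have Vp : 0 < knorm V by rewrite (knormE hss hV); apply: nrm_gt0.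
have hCS : B V U <= knorm V * knorm U.
  by rewrite (knormE hss hV) (knormE hss hU) -(bpPr hss V hU); apply: ip_le.
rewrite -(ler_pM2l Vp) mulrDr; move: h; rewrite expr2; lra.
Qed.

End Cosine.

(** * Filtrations and ideal points *)

Section Filtration.
Variables (R : realType) (L : liealg R).
Hypothesis hss : semisimple L.
Implicit Types (X Y Z U V W u v w z : L) (f g p q r : 'End(L)) (A : set R).
Local Notation br := (@lie_br R L).
Local Notation B := (@killing R L).
Local Notation S := (@symspace R L).
Local Notation P := (@pspace R L).

Definition eigenbasis p X n (e : 'I_n -> L) (m : 'I_n -> R) :=
  onb (bp p) fullv e /\ forall i, ad X (e i) = m i *: e i.

Lemma exists_eigenbasis p X : S p -> X \in P p ->
  exists n (e : 'I_n -> L) (m : 'I_n -> R), eigenbasis p X e m.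
Proof. by move=> hp hX; apply: (full_spectral (bp_inner hss hp) (ad_selfadj hss hp hX)). Qed.

Lemma eb_coef p X n (e : 'I_n -> L) m v i : S p -> X \in P p -> eigenbasis p X e m ->
  bp p (e i) (br X v) = m i * bp p (e i) v.
Proof.
move=> hp hX [he hm]; rewrite -adE.
exact: (sa_coef (bp_inner hss hp) _ _ (ad_selfadj hss hp hX) hm).
Qed.

Lemma eb_geo p X n (e : 'I_n -> L) m u v t : S p -> X \in P p -> eigenbasis p X e m ->
  bp (geo p X t) u v = \sum_i expR (- 2 * t * m i) * (bp p (e i) u * bp p (e i) v).
Proof.
move=> hp hX [he hm]; have H := bp_inner hss hp.
rewrite bp_geo // (onb_sum_ip H _ he (memvf _)); apply: eq_bigr => i _.
rewrite (@vexp_coef _ _ _ H _ _ (fun i => (- 2 * t) * m i) _ _ _ he); first by rewrite mulrCA.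
by move=> j; rewrite (adZ hss) !lfe hm scalerA.
Qed.

Lemma eb_knorm p X n (e : 'I_n -> L) m : S p -> X \in P p -> eigenbasis p X e m ->
  knorm X ^+ 2 = \sum_i m i ^+ 2.
Proof.
move=> hp hX [he hm]; have H := bp_inner hss hp; have [oe _ _] := he.
rewrite (knormE hss hX) (sqr_nrm H) (bpPr hss _ hX) /killing (lftrace_onb _ H he).
by apply: eq_bigr => i _; rewrite !lfe hm linearZ /= hm (ipZr H) (ipZr H) oe eqxx mulr1 expr2.
Qed.

Lemma eb_le_knorm p X n (e : 'I_n -> L) m i : S p -> X \in P p -> eigenbasis p X e m ->
  `|m i| <= knorm X.
Proof.
move=> hp hX he; rewrite -(ler_pXn2r (n:=2)) ?nnegrE ?knorm_ge0 // real_normK ?num_real //.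
rewrite (eb_knorm hp hX he) (bigD1 i) //= lerDl; apply: sumr_ge0 => j _; exact: sqr_ge0.
Qed.

Lemma nrm_br_le p X k v n (e : 'I_n -> L) m : S p -> X \in P p -> eigenbasis p X e m ->
  0 <= k -> (forall i, `|m i| <= k) -> nrm (bp p) (br X v) <= k * nrm (bp p) v.
Proof.
move=> hp hX he k0 hk; have H := bp_inner hss hp; have [ho _] := he.
rewrite -(ler_pXn2r (n:=2)) ?nnegrE ?mulr_ge0 ?nrm_ge0 // exprMn !(sqr_nrm H).
rewrite !(onb_sum_ip H _ ho (memvf _)) mulr_sumr; apply: ler_sum => i _.
rewrite (eb_coef _ _ hp hX he) -!expr2 exprMn ler_wpM2r ?sqr_ge0 //.
by rewrite -[m i ^+ 2]real_normK ?num_real // ler_pXn2r ?nnegrE.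
Qed.

Lemma bp_le_exp p q X k v : S p -> X \in P p -> geo p X 1 = q ->
  (forall u, nrm (bp p) (br X u) <= k * nrm (bp p) u) ->
  bp q v v <= expR (2 * k) * bp p v v.
Proof.
move=> hp hX <- hk; have H := bp_inner hss hp.
have [n [e [m he]]] := exists_eigenbasis hp hX; have [ho hm] := he; have [oe _ _] := ho.
rewrite (eb_geo v v 1 hp hX he) (onb_sum_ip H _ ho (memvf _)) mulr_sumr.
apply: ler_sum => i _; rewrite ler_wpM2r -?expr2 ?sqr_ge0 // ler_expR mulr1.
have e1 : nrm (bp p) (e i) = 1 by rewrite /nrm oe eqxx sqrtr1.
have := hk (e i); rewrite -adE hm (nrmZ H) e1 !mulr1 => h.
by have := ler_norm (- m i); rewrite normrN; lra.
Qed.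

Lemma bp_le_dist p q v : S p -> S q -> bp q v v <= expR (2 * dist p q) * bp p v v.
Proof.
move=> hp hq; have [X hX hXq] := exists_log hss hp hq.
rewrite (dist_log hss hp hX hXq); apply: (bp_le_exp v hp hX hXq) => u.
have [n [e [m he]]] := exists_eigenbasis hp hX.
by apply: (nrm_br_le _ hp hX he) => [|i]; [exact: knorm_ge0|apply: eb_le_knorm he].
Qed.

(** Together with [bp_le_dist] this translates bounded distance into comparability of inner
    products. The logarithm has eigenvalues at most ln c / 2, and [knorm] is the Hilbert-Schmidt
    norm of [ad], hence the square root of the dimension. *)
Lemma dist_le_ln p q (c : R) : S p -> S q -> 1 <= c ->
  (forall v, bp q v v <= c * bp p v v) -> (forall v, bp p v v <= c * bp q v v) ->
  dist p q <= Num.sqrt (\dim {:L})%:R * (ln c / 2).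
Proof.
move=> hp hq c1 h1 h2; have H := bp_inner hss hp; have [X hX hXq] := exists_log hss hp hq.
rewrite (dist_log hss hp hX hXq).
have [n [e [m he]]] := exists_eigenbasis hp hX; have [ho hm] := he; have [oe _ _] := ho.
have c0 : 0 < c := lt_le_trans ltr01 c1.
have lc0 : 0 <= ln c by rewrite ln_ge0.
have qe i : bp q (e i) (e i) = expR (- 2 * m i).
  rewrite -hXq (eb_geo _ _ 1 hp hX he) (bigD1 i) //= oe eqxx !mulr1 big1 ?addr0 // => j ij.
  by rewrite oe (negPf ij) !mulr0.
have hm2 i : `|m i| <= ln c / 2.
  have a1 := h1 (e i); have a2 := h2 (e i).
  rewrite qe oe eqxx mulr1 in a1; rewrite qe oe eqxx in a2.
  have b1 : - 2 * m i <= ln c by rewrite -[leLHS]expRK ler_ln ?posrE ?expR_gt0.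
  have b2 : 0 <= ln c + - 2 * m i.
    by rewrite -(expRK (- 2 * m i)) -lnM ?posrE ?expR_gt0 // ln_ge0.
  by rewrite ler_norml; apply/andP; split; lra.
rewrite -(ler_pXn2r (n:=2)) ?nnegrE ?knorm_ge0 ?mulr_ge0 ?sqrtr_ge0 ?divr_ge0 //.
rewrite (eb_knorm hp hX he) exprMn sqr_sqrtr ?ler0n // -(onb_dim H ho).
have -> : n%:R * (ln c / 2) ^+ 2 = \sum_(i < n) (ln c / 2) ^+ 2 by rewrite sumr_const card_ord mulr_natl.
apply: ler_sum => i _; rewrite -[m i ^+ 2]real_normK ?num_real //.
by rewrite ler_pXn2r ?nnegrE ?divr_ge0.
Qed.

(* [fil z (ge_ 0)] is the parabolic subalgebra of the ideal point of direction [z], and [fil z (gt_ 0)] its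
   nilradical. *)
Definition fil z A v : Prop := exists k (a : 'I_k -> R) (w : 'I_k -> L),
  [/\ forall i, w i != 0 -> A (a i), forall i, br z (w i) = a i *: w i & v = \sum_i w i].

Definition ge_ (x : R) : set R := [set a | x <= a].
Definition gt_ (x : R) : set R := [set a | x < a].
Definition lt_ (x : R) : set R := [set a | a < x].
Definition le_ (x : R) : set R := [set a | a <= x].
Definition opp_ A : set R := [set a | A (- a)].

Lemma fil_eigen z A a v : A a -> br z v = a *: v -> fil z A v.
Proof.
move=> Aa h; exists 1%N, (fun=> a), (fun=> v); split=> //.
by rewrite big_ord1.
Qed.

Lemma fil_sub z A A' v : A `<=` A' -> fil z A v -> fil z A' v.
Proof. by move=> AA [k [a [w [h1 h2 h3]]]]; exists k, a, w; split=> // i /h1; apply: AA. Qed.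

Lemma fil_onb p z n (e : 'I_n -> L) m A v : S p -> z \in P p -> eigenbasis p z e m ->
  fil z A v <-> forall i, ~ A (m i) -> bp p (e i) v = 0.
Proof.
move=> hp hz he; have H := bp_inner hss hp; have [ho hm] := he; split.
  move=> [k [a [w [h1 h2 ->]]]] i hi; rewrite (ip_sumr H) big1 // => j _.
  have [->|w0] := eqVneq (w j) 0; first by rewrite (ip0r H).
  have := eb_coef (w j) i hp hz he; rewrite h2 (ipZr H) => /eqP.
  rewrite -subr_eq0 -mulrBl mulf_eq0 subr_eq0 => /orP [/eqP ae|/eqP //].
  by case: hi; rewrite -ae; apply: h1.
move=> h; exists n, m, (fun i => bp p (e i) v *: e i); split.
- by move=> i w0; apply: contrapT => /h hi; move: w0; rewrite hi scale0r eqxx.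
- by move=> i; rewrite brZr -adE hm !scalerA mulrC.
- exact: full_onb.
Qed.

Lemma fil_aut g z A v : isaut g -> fil z A v -> fil (g z) A (g v).
Proof.
move=> hg [k [a [w [h1 h2 ->]]]]; exists k, a, (fun i => g (w i)); split.
- move=> i gw; apply: h1; apply: contraNneq gw => ->; by rewrite linear0.
- by move=> i; rewrite -(aut_br _ _ hg) h2 linearZ.
- by rewrite linear_sum.
Qed.

Lemma fil_autE g z A v : isaut g -> fil (g z) A (g v) <-> fil z A v.
Proof.
move=> hg; split; last exact: fil_aut.
by move=> /(fil_aut (autV hg)); rewrite !(autK hg).
Qed.

Lemma fil_oppE z A v : fil (- z) A v <-> fil z (opp_ A) v.
Proof.
split=> -[k [a [w [h1 h2 ->]]]]; exists k, (fun i => - a i), w; split=> // i.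
- by move=> /h1; rewrite /opp_ /= opprK.
- by rewrite -[z]opprK (brNl hss) h2 scaleNr.
- by rewrite (brNl hss) h2 scaleNr.
Qed.

Lemma fil_sym p z A v : S p -> z \in P p -> fil z A v -> fil z (opp_ A) (p v).
Proof.
move=> hp /memP hz hv; apply/fil_oppE; rewrite -hz; apply: fil_aut => //.
exact: sym_aut.
Qed.

Lemma fil0 z A : fil z A 0.
Proof. by exists 0%N, (fun=> 0), (fun=> 0); split=> [[]//|[]//|]; rewrite big_ord0. Qed.

Section AtPoint.
Variables (p : 'End(L)) (z : L).
Hypotheses (hp : S p) (hz : z \in P p).
Let H := bp_inner hss hp.

Lemma fil_space A : exists U : {vspace L}, forall v, v \in U <-> fil z A v.
Proof.
have [n [e [m he]]] := exists_eigenbasis hp hz; have [ho hm] := he; have [oe _ _] := ho.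
exists <<[seq e i | i <- enum 'I_n & `[< A (m i) >]]>>%VS => v; split.
  move=> vU; apply/(fil_onb A v hp hz he) => i hi.
  have [U' memU'] := orthogonal_complement H (e i) fullv.
  have /subvP : (<<[seq e i | i <- enum 'I_n & `[< A (m i) >]]>> <= U')%VS.
    apply/span_subvP => w /mapP [k]; rewrite mem_filter => /andP [/asboolP hk _] ->.
    have [ik|/negPf ik] := eqVneq i k; first by case: hi; rewrite ik.
    by rewrite memU' memvf oe ik eqxx.
  by move/(_ v vU); rewrite memU' memvf => /eqP.
move/(fil_onb A v hp hz he) => h; rewrite (full_onb v ho); apply: rpred_sum => i _.
have [hi|/h ->] := pselect (A (m i)); last by rewrite scale0r mem0v.
by rewrite rpredZ // memv_span //; apply: map_f; rewrite mem_filter mem_enum andbT; apply/asboolP.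
Qed.

Lemma fil_lin A a u v : fil z A u -> fil z A v -> fil z A (a *: u + v).
Proof. by have [U hU] := fil_space A; rewrite -!hU => hu hv; rewrite rpredD // rpredZ. Qed.

Lemma filD A u v : fil z A u -> fil z A v -> fil z A (u + v).
Proof. by move=> hu hv; rewrite -[u]scale1r; apply: fil_lin. Qed.

Lemma filZ A a u : fil z A u -> fil z A (a *: u).
Proof. by move=> hu; rewrite -[_ *: _]addr0; apply: fil_lin hu (fil0 _ _). Qed.

Lemma filN A u : fil z A u -> fil z A (- u).
Proof. by rewrite -scaleN1r; apply: filZ. Qed.

Lemma filB A u v : fil z A u -> fil z A v -> fil z A (u - v).
Proof. by move=> hu /filN; apply: filD. Qed.

Lemma fil_sum A I (r : seq I) (F : I -> L) : (forall i, fil z A (F i)) -> fil z A (\sum_(i <- r) F i).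
Proof.
by move=> h; elim: r => [|x r IH]; rewrite ?big_nil ?big_cons; [exact: fil0|apply: filD].
Qed.

Lemma filI A A' v : fil z A v -> fil z A' v -> fil z (A `&` A') v.
Proof.
have [n [e [m he]]] := exists_eigenbasis hp hz.
move=> /(fil_onb A v hp hz he) h1 /(fil_onb A' v hp hz he) h2; apply/(fil_onb _ v hp hz he) => i.
by move=> /not_andP [/h1|/h2].
Qed.

Lemma fil_split A v : exists u w, [/\ v = u + w, fil z A u & fil z (~` A) w].
Proof.
have [n [e [m he]]] := exists_eigenbasis hp hz; have [ho hm] := he; have [oe _ _] := ho.
exists (\sum_(i | `[< A (m i) >]) bp p (e i) v *: e i).
exists (\sum_(i | ~~ `[< A (m i) >]) bp p (e i) v *: e i); split.
- by rewrite {1}(full_onb v ho) (bigID (fun i => `[< A (m i) >])).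
- rewrite big_mkcond; apply: fil_sum => i; case: asboolP => h; last exact: fil0.
  by apply: filZ; apply: fil_eigen h _; rewrite -adE.
- rewrite big_mkcond; apply: fil_sum => i; case: asboolP => h; first exact: fil0.
  by apply: filZ; apply: fil_eigen h _; rewrite -adE.
Qed.

Lemma fil_orth A A' u v : (forall a, A a -> A' a -> False) -> fil z A u -> fil z A' v -> bp p u v = 0.
Proof.
have [n [e [m he]]] := exists_eigenbasis hp hz; have [ho hm] := he.
move=> hd /(fil_onb A u hp hz he) h1 /(fil_onb A' v hp hz he) h2.
rewrite (onb_sum_ip H _ ho (memvf _)) big1 // => i _.
have [a|/h1 ->] := pselect (A (m i)); last by rewrite mul0r.
by rewrite h2 ?mulr0 // => a'; apply: (hd (m i)).
Qed.

Lemma fil_killing A A' u v : (forall a b, A a -> A' b -> a + b <> 0) ->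
  fil z A u -> fil z A' v -> B u v = 0.
Proof.
move=> h hu hv; rewrite -[v](symK _ hp) -[B _ _]opprK -/(bp p u (p v)).
rewrite (@fil_orth A (opp_ A') u (p v)) ?oppr0 //; last exact: fil_sym.
by move=> a Aa A'a; apply: (h a (- a)) => //; rewrite subrr.
Qed.

Lemma fil_zero A v : (forall a, ~ A a) -> fil z A v -> v = 0.
Proof.
move=> h [k [a [w [h1 _ ->]]]]; rewrite big1 // => i _.
by apply/eqP/negPn/negP => /h1 /h.
Qed.

Lemma fil_all v : fil z setT v.
Proof.
have [n [e [m he]]] := exists_eigenbasis hp hz.
by apply/(fil_onb _ v hp hz he) => i [].
Qed.

Lemma fil_br A A' A'' u v : (forall a b, A a -> A' b -> A'' (a + b)) ->
  fil z A u -> fil z A' v -> fil z A'' (br u v).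
Proof.
move=> h [k [a [w [h1 h2 ->]]]] [l [b [x [h3 h4 ->]]]].
have -> : br (\sum_i w i) (\sum_j x j) = \sum_i \sum_j br (w i) (x j).
  have e1 (r : seq 'I_k) y : br (\sum_(i <- r) w i) y = \sum_(i <- r) br (w i) y.
    by elim: r => [|i r IH]; rewrite ?big_nil ?(br0l hss) // !big_cons (brDl hss) IH.
  rewrite e1; apply: eq_bigr => i _.
  elim: (index_enum _) => [|j r IH]; first by rewrite !big_nil br0r.
  by rewrite !big_cons brDr IH.
apply: fil_sum => i; apply: fil_sum => j.
have [->|w0] := eqVneq (w i) 0; first by rewrite (br0l hss); apply: fil0.
have [->|x0] := eqVneq (x j) 0; first by rewrite br0r; apply: fil0.
apply: (@fil_eigen _ _ (a i + b j)); first by apply: h; [apply: h1|apply: h3].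
have -> : br z (br (w i) (x j)) = br (br z (w i)) (x j) + br (w i) (br z (x j)).
  by rewrite (jacobi hss) subrK.
by rewrite h2 h4 (brZl hss) brZr scalerDl.
Qed.

Lemma fil_br0 A v : fil z A v -> fil z A (br z v).
Proof.
apply: (@fil_br [set 0]) => [a b -> //|]; first by rewrite add0r.
by apply: (@fil_eigen _ _ 0) => //; rewrite lie_br_alt scale0r.
Qed.

(** The spectrum is finite, so a strict bound has a margin. This is how [samefil], formulated with
    closed half-lines, controls nilradicals. *)
Lemma fil_ge_gt x v : fil z (gt_ x) v -> exists2 y, x < y & fil z (ge_ y) v.
Proof.
have [n [e [m he]]] := exists_eigenbasis hp hz => hv.
have [y xy hy] : exists2 y, x < y & forall i, x < m i -> y <= m i.
  elim: (n) (m) => [|k IH] m'; first by exists (x + 1) => [|[]//]; rewrite ltrDl.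
  have [y xy hy] := IH (fun i => m' (lift ord0 i)).
  have [h0|h0] := ltP x (m' ord0); last first.
    exists y => // i; case: (unliftP ord0 i) => [j|] ->; first exact: hy.
    by rewrite ltNge h0.
  exists (Num.min y (m' ord0)); first by rewrite lt_min xy.
  move=> i; rewrite ge_min; case: (unliftP ord0 i) => [j|] -> h.
    by rewrite hy.
  by rewrite lexx orbT.
exists y => //; apply/(fil_onb _ v hp hz he) => i hi.
by move/(fil_onb _ v hp hz he): hv; apply; apply: contra_not hi => /hy.
Qed.

Lemma fil_nrm A v x : (forall a, A a -> a <= x) -> fil z A v -> bp p v (br z v) <= x * bp p v v.
Proof.
have [n [e [m he]]] := exists_eigenbasis hp hz; have [ho hm] := he.
move=> h /(fil_onb A v hp hz he) hv; rewrite !(onb_sum_ip H _ ho (memvf _)) mulr_sumr.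
apply: ler_sum => i _; rewrite (eb_coef _ _ hp hz he) mulrCA -expr2.
have [/h a|/hv ->] := pselect (A (m i)); last by rewrite expr0n !mulr0.
by rewrite ler_wpM2r ?sqr_ge0.
Qed.

Lemma fil_nrm_ge A v x : (forall a, A a -> x <= a) -> fil z A v -> x * bp p v v <= bp p v (br z v).
Proof.
have [n [e [m he]]] := exists_eigenbasis hp hz; have [ho hm] := he.
move=> h /(fil_onb A v hp hz he) hv; rewrite !(onb_sum_ip H _ ho (memvf _)) mulr_sumr.
apply: ler_sum => i _; rewrite (eb_coef _ _ hp hz he) [leRHS]mulrCA -expr2.
have [/h a|/hv ->] := pselect (A (m i)); last by rewrite expr0n !mulr0.
by rewrite ler_wpM2r ?sqr_ge0.
Qed.

Lemma fil_decay x v : fil z (ge_ x) v -> forall t, 0 <= t ->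
  bp (geo p z t) v v <= expR (- 2 * t * x) * bp p v v.
Proof.
have [n [e [m he]]] := exists_eigenbasis hp hz; have [ho hm] := he.
move=> /(fil_onb _ v hp hz he) hv t t0; rewrite (eb_geo _ _ t hp hz he).
rewrite [X in _ <= _ * X](onb_sum_ip H _ ho (memvf _)) mulr_sumr; apply: ler_sum => i _.
have [h|/hv ->] := pselect (ge_ x (m i)); last by rewrite !mulr0.
rewrite ler_wpM2r -?expr2 ?sqr_ge0 // ler_expR -!mulrA ler_wnM2l ?oppr_le0 //.
by rewrite ler_wpM2l.
Qed.

(** Converse of [fil_decay]: the filtration is read off from the growth of inner products along the
    ray, a description stable under bounded perturbation and under limits. A component of eigenvalue
    below x would violate the bound at a late time, by e^y >= 1 + y. *)
Lemma decay_fil x v C : (forall t, 0 <= t -> bp (geo p z t) v v <= C * expR (- 2 * t * x)) ->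
  fil z (ge_ x) v.
Proof.
have [n [e [m he]]] := exists_eigenbasis hp hz; have [ho hm] := he.
move=> hC; apply/(fil_onb _ v hp hz he) => i /negP; rewrite -ltNge => mx.
apply/eqP/negPn/negP => c0; have cp : 0 < bp p (e i) v ^+ 2 by rewrite exprn_even_gt0.
have hb t : 0 <= t -> expR (2 * t * (x - m i)) * bp p (e i) v ^+ 2 <= C.
  move=> t0; rewrite -(ler_pM2r (expR_gt0 (- 2 * t * x))); apply: le_trans (hC t t0).
  rewrite (eb_geo _ _ t hp hz he) (bigD1 i) //= -expr2 mulrAC -expRD.
  have -> : 2 * t * (x - m i) + - 2 * t * x = - 2 * t * m i by ring.
  by rewrite lerDl; apply: sumr_ge0 => j _; rewrite mulr_ge0 ?expR_ge0 // -expr2 sqr_ge0.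
set b := bp p (e i) v ^+ 2 in cp hb; have C0 : 0 <= C.
  by apply: le_trans (hb 0 (lexx 0)); rewrite mulr_ge0 ?expR_ge0 // ltW.
have dx : 0 < x - m i by rewrite subr_gt0.
pose t := C / b / (x - m i).
have t0 : 0 <= t by rewrite !divr_ge0 // ltW.
have := hb t t0; apply/negP; rewrite -ltNge.
have -> : 2 * t * (x - m i) = 2 * (C / b) by rewrite /t; field; rewrite !gt_eqF.
rewrite mulrC -ltr_pdivrMl // mulrC; apply: lt_le_trans (expR_ge1Dx _).
have h0 : 0 <= C / b by rewrite divr_ge0 // ltW.
by move: h0; move: (C / b) => y; lra.
Qed.

End AtPoint.

(** The algebraic form of asymptoticity, see [asymptoticP]. *)
Definition samefil z z' := forall x v, fil z (ge_ x) v <-> fil z' (ge_ x) v.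

Lemma samefil_sym z z' : samefil z z' -> samefil z' z.
Proof. by move=> h x v; split=> /h. Qed.

Lemma samefil_trans z z' z'' : samefil z z' -> samefil z' z'' -> samefil z z''.
Proof. by move=> h h' x v; split=> [/h /h'|/h' /h]. Qed.

Lemma samefil_aut g z z' : isaut g -> samefil z z' -> samefil (g z) (g z').
Proof. by move=> hg h x v; rewrite -(autVK hg v) !(fil_autE _ _ _ hg). Qed.

Lemma samefil_gt p q z z' x v : S p -> z \in P p -> S q -> z' \in P q -> samefil z z' ->
  fil z (gt_ x) v <-> fil z' (gt_ x) v.
Proof.
move=> hp hz hq hz' h; split.
  move=> /(fil_ge_gt hp hz) [y xy /h]; apply: fil_sub => a /= ya; exact: lt_le_trans xy ya.
move=> /(fil_ge_gt hq hz') [y xy /h]; apply: fil_sub => a /= ya; exact: lt_le_trans xy ya.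
Qed.

Lemma fil_single p z a v : S p -> z \in P p -> fil z [set a] v -> br z v = a *: v.
Proof.
move=> hp hz; have [n [e [m he]]] := exists_eigenbasis hp hz; have [ho hm] := he.
move=> /(fil_onb _ v hp hz he) hv.
rewrite -adE; apply/(eigen_coef (bp_inner hss hp) v a ho (ad_selfadj hss hp hz) hm) => i.
by have [->|/hv ->] := pselect ([set a] (m i)); [right|left].
Qed.

Lemma eq_of_fil p q z z' : S p -> z \in P p -> S q -> z' \in P q ->
  (forall a v, br z v = a *: v -> fil z' (ge_ a) v /\ fil z' (le_ a) v) -> z = z'.
Proof.
move=> hp hz hq hz' h; have [n [e [m [ho hm]]]] := exists_eigenbasis hp hz.
apply: (ad_inj hss) => v; rewrite -!adE; congr (fun_of_lfun _ _); apply: (eq_on_onb ho) => i.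
have [h1 h2] : fil z' (ge_ (m i)) (e i) /\ fil z' (le_ (m i)) (e i) by apply: h; rewrite -adE.
rewrite hm adE (@fil_single q z' (m i)) //; apply: fil_sub (filI hq hz' h1 h2) => a [] /= ma am.
by apply/eqP; rewrite eq_le am.
Qed.

(** At a common point the eigenspaces are recovered from the filtration by taking orthogonal
    complements of one step in the next larger one. *)
Lemma samefil_eq p z z' : S p -> z \in P p -> z' \in P p -> samefil z z' -> z = z'.
Proof.
move=> hp hz hz' h; have H := bp_inner hss hp; apply: (eq_of_fil hp hz hp hz') => a v hv.
split; first by apply/h; apply: fil_eigen hv; rewrite /ge_ /=.
have [n [e [m he]]] := exists_eigenbasis hp hz'; have [ho hm] := he.
apply/(fil_onb _ v hp hz' he) => i /negP; rewrite -ltNge => ami.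
have : fil z (gt_ a) (e i).
  by apply/(samefil_gt a _ hp hz hp hz' h); apply: fil_eigen ami _; rewrite -adE.
move=> he'; apply: (fil_orth hp hz (A := gt_ a) (A' := [set a])) => //.
  by move=> b; rewrite /gt_ /= => ab ba; move: ab; rewrite ba ltxx.
exact: fil_eigen hv.
Qed.

(** Two opposite filtrations determine the grading, hence the derivation. Parallel lines therefore
    have literally the same direction vector in the Lie algebra. *)
Lemma samefil_parallel p q z z' : S p -> z \in P p -> S q -> z' \in P q ->
  samefil z z' -> samefil (- z) (- z') -> z = z'.
Proof.
move=> hp hz hq hz' h1 h2; apply: (eq_of_fil hp hz hq hz') => a v hv; split.
  by apply/h1; apply: fil_eigen hv; rewrite /ge_ /=.
have : fil (- z') (ge_ (- a)) v.
  by apply/h2/fil_oppE; apply: fil_eigen hv; rewrite /opp_ /ge_ /=.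
by move=> /fil_oppE; apply: fil_sub => b; rewrite /opp_ /ge_ /le_ /= lerN2.
Qed.

Lemma fil_ge_killing p z x v : S p -> z \in P p ->
  (forall u, fil z (gt_ (- x)) u -> B u v = 0) -> fil z (ge_ x) v.
Proof.
move=> hp hz h; have [n [e [m he]]] := exists_eigenbasis hp hz; have [ho hm] := he.
apply/(fil_onb _ v hp hz he) => i /negP; rewrite -ltNge => mx.
rewrite /bp -(sym_killingl _ _ hp) h ?oppr0 //; apply: (@fil_eigen _ _ (- m i)).
  by rewrite /gt_ /= ltrN2.
rewrite -(opprK z) -((memP p z).1 hz) (brNl hss) -(sym_br _ _ hp) -adE hm linearZ /=.
by rewrite scaleNr.
Qed.

Lemma derivation_basis n (e : 'I_n -> L) (l : 'I_n -> R) (D : 'End(L)) :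
  (forall v, exists c : 'I_n -> R, v = \sum_i c i *: e i) -> (forall i, D (e i) = l i *: e i) ->
  (forall i j, D (br (e i) (e j)) = (l i + l j) *: br (e i) (e j)) ->
  forall X Y, D (br X Y) = br (D X) Y + br X (D Y).
Proof.
move=> he hD hb X Y; have [c ->] := he X; have [d ->] := he Y.
have brs (r : seq 'I_n) a F Z : br (\sum_(i <- r) a i *: F i) Z = \sum_(i <- r) a i *: br (F i) Z.
  elim: r => [|x r IH]; first by rewrite !big_nil (br0l hss).
  by rewrite !big_cons (brDl hss) (brZl hss) IH.
have brr (r : seq 'I_n) a F Z : br Z (\sum_(i <- r) a i *: F i) = \sum_(i <- r) a i *: br Z (F i).
  elim: r => [|x r IH]; first by rewrite !big_nil br0r.
  by rewrite !big_cons brDr brZr IH.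
have Ds (r : seq 'I_n) a F : D (\sum_(i <- r) a i *: F i) = \sum_(i <- r) a i *: D (F i).
  by rewrite linear_sum; apply: eq_bigr => i _; rewrite linearZ.
rewrite brs !Ds !brs -big_split; apply: eq_bigr => i _ /=.
rewrite !brr Ds -scalerDr; congr (_ *: _); rewrite -big_split; apply: eq_bigr => j _ /=.
by rewrite hb !hD (brZl hss) brZr -scalerDr scalerDl.
Qed.

(* The direction at q of the ideal point of the ray of direction X at p is the derivation acting by l on
   the intersection of F_l and q F_(-l), where F is the filtration of X. *)
Lemma exists_transport p q X : S p -> S q -> X \in P p -> exists2 Y, Y \in P q &
  samefil X Y.
Proof.
move=> hp hq hX; have Hq := bp_inner hss hq.
have [n [e [m he]]] := exists_eigenbasis hp hX; have [ho hm] := he; have [oe _ _] := ho.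
have /choice [F hF] x := fil_space hp hX (ge_ x).
(* Orthogonal projections at q onto nested subspaces commute; a joint eigenbasis is an orthonormal
   basis adapted to the whole filtration. *)
have [|||k [f [hf hj]]] := @joint_spectral _ _ _ Hq [set g | exists x, g = oproj Hq (F x)] fullv.
- by move=> _ [x ->]; apply: oproj_selfadj.
- have h x y v : x <= y -> oproj Hq (F x) (oproj Hq (F y) v) = oproj Hq (F y) v.
    move=> xy; rewrite oproj_id //; apply/hF; have := oproj_mem Hq (F y) v.
    by move/hF; apply: fil_sub => a; apply: le_trans.
  have h' x y v : x <= y -> oproj Hq (F y) (oproj Hq (F x) v) = oproj Hq (F y) v.
    move=> xy; apply: oproj_sub; apply/subvP => w /hF hw; apply/hF.
    by apply: fil_sub hw => a; apply: le_trans.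
  move=> _ _ v [x ->] [y ->]; have [xy|/ltW yx] := leP x y; first by rewrite h // h'.
  by rewrite h' // h.
- by move=> _ v [x ->] _; rewrite memvf.
have dich i x : f i \in F x \/ forall u, u \in F x -> bp q (f i) u = 0.
  have [a ha] := hj (oproj Hq (F x)) i (ex_intro _ x erefl).
  have [a0|a0] := eqVneq a 0; last first.
    left; rewrite -[f i]scale1r -(mulVf a0) -scalerA -ha rpredZ // oproj_mem //.
  by right => u uF; rewrite (ipC Hq) -(ip_oproj Hq _ uF) ha a0 scale0r (ip0r Hq).
have f0 i : f i != 0.
  apply/negP => /eqP h; have [of_ _ _] := hf; have := of_ i i; rewrite h (ip0l Hq) eqxx.
  by move/eqP; rewrite eq_sym oner_eq0.
(* The level of [f i] is the largest eigenvalue of [ad X] whose step contains [f i]; by adaptedness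
   [f i] is orthogonal to all higher steps. *)
have /choice [l hl] i : exists x, f i \in F x /\ forall y u, x < y -> u \in F y -> bp q (f i) u = 0.
  pose s := [seq m j | j <- enum 'I_n & f i \in F (m j)].
  have ex y : f i \in F y -> exists2 j, y <= m j & f i \in F (m j).
    move=> /hF hy; pose s' := [seq - m j | j <- enum 'I_n & y <= m j].
    have [s0|/seq_max [x /mapP [j]]] := eqVneq s' [::].
      case/negP: (f0 i); apply/eqP; rewrite (full_onb (f i) ho) big1 // => j _.
      have [yj|yj] := leP y (m j).
        have : - m j \in s' by apply: map_f; rewrite mem_filter yj mem_enum.
        by rewrite s0.
      by have /(fil_onb _ _ hp hX he) -> := hy; rewrite ?scale0r //; apply/negP; rewrite -ltNge.
    rewrite mem_filter => /andP [yj _] -> hmax; exists j => //; apply/hF/(fil_onb _ _ hp hX he) => k1 hk1.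
    move/(fil_onb _ _ hp hX he): hy; apply; apply: contra_not hk1 => yk; rewrite /ge_ /= -lerN2.
    by apply: hmax; apply: map_f; rewrite mem_filter mem_enum andbT.
  have [s0|/seq_max [x /mapP [j]]] := eqVneq s [::].
    have hb : exists y, forall j, y <= m j.
      elim: (n) (m) => [|k' IH] m'; first by exists 0 => -[].
      have [y hy] := IH (fun j => m' (lift ord0 j)); exists (Num.min y (m' ord0)) => j.
      by rewrite ge_min; case: (unliftP ord0 j) => [j'|] ->; rewrite ?hy ?lexx ?orbT.
    have [y hy] := hb; have [|j _ hj'] := ex y.
      by apply/hF/(fil_onb _ _ hp hX he) => j []; apply: hy.
    have : m j \in s by apply: map_f; rewrite mem_filter hj' mem_enum.
    by rewrite s0.
  rewrite mem_filter => /andP [hj' _] -> hmax; exists (m j); split=> // y u jy uF.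
  have [fy|/(_ u uF) //] := dich i y.
  have [j' yj' fj'] := ex y fy; have : m j' <= m j.
    by apply: hmax; apply: map_f; rewrite mem_filter fj' mem_enum.
  by rewrite leNgt (lt_le_trans jy yj').
pose E x v := fil X (ge_ x) v /\ fil X (ge_ (- x)) (q v).
have fE i : E (l i) (f i).
  have [h1 h2] := hl i; split; first exact/hF.
  apply: (fil_ge_killing hp hX) => u; rewrite opprK => /(fil_ge_gt hp hX) [y ly /hF uF].
  by rewrite killingC -[B _ _]opprK sym_killingl // -/(bp q (f i) u) (h2 y) // oppr0.
have [of_ _ _] := hf.
have [|D hD] := @lfun_linear R L L (fun v => \sum_i (l i * bp q (f i) v) *: f i).
  move=> a u v; rewrite scaler_sumr -big_split; apply: eq_bigr => i _ /=.
  by rewrite (ipDr Hq) (ipZr Hq) scalerA -scalerDl; congr (_ *: _); ring.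
have Df i : D (f i) = l i *: f i.
  rewrite hD (bigD1 i) //= of_ eqxx mulr1 big1 ?addr0 // => j ij.
  by rewrite of_ (negPf ij) mulr0 scale0r.
have DE x v : E x v -> D v = x *: v.
  move=> [h1 h2]; rewrite hD {2}(full_onb v hf) scaler_sumr; apply: eq_bigr => i _.
  rewrite scalerA; have [h3 h4] := hl i; have [lx|xl|-> //] := ltgtP (l i) x.
    by rewrite (h4 x) ?mulr0 //; apply/hF.
  rewrite /bp (fil_killing hp hX (A := gt_ x) (A' := ge_ (- x)) _ _ h2) ?oppr0 ?mulr0 //.
    by move=> a b /= xa xb; apply/eqP; rewrite gt_eqF //; move: xa xb; rewrite /gt_ /ge_ /=; lra.
  by move/hF: h3; apply: fil_sub => a /=; apply: lt_le_trans.
have Ebr x y u v : E x u -> E y v -> E (x + y) (br u v).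
  move=> [h1 h2] [h3 h4]; split.
    by apply: (fil_br hp hX _ h1 h3) => a b; rewrite /ge_ /=; apply: lerD.
  rewrite (sym_br _ _ hq); apply: (fil_br hp hX _ h2 h4) => a b; rewrite /ge_ /= opprD.
  exact: lerD.
have [Y DY] : exists Y, D = ad Y.
  apply: (inner_derivation hss hp); apply: (derivation_basis (e := f) (l := l)) => // [v|i j].
    by exists (fun i => bp q (f i) v); apply: full_onb.
  by apply/DE/Ebr.
have YP : Y \in P q.
  apply/memP/(ad_inj hss) => v; rewrite (brNl hss) -!adE -DY.
  have -> : ad (q Y) v = q (D (q v)) by rewrite DY !adE (sym_br _ _ hq) symK.
  suff h : (q \o (D \o q))%VF = - D by have := congr1 (fun g : 'End(L) => g v) h; rewrite !lfe.
  apply: (eq_on_onb hf) => i; rewrite !lfe Df.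
  have -> : D (q (f i)) = - l i *: q (f i).
    by apply: DE; have [h1 h2] := fE i; split; rewrite ?symK // opprK.
  by rewrite linearZ /= symK // scaleNr.
exists Y => //; have hY : eigenbasis q Y f l by split=> // i; rewrite -DY.
move=> x v; split=> [/hF vF|].
  apply/(fil_onb _ _ hq YP hY) => i /negP; rewrite -ltNge => lx.
  by have [_ h] := hl i; apply: h lx vF.
move=> /(fil_onb _ _ hq YP hY) h; rewrite (full_onb v hf); apply: (fil_sum hp hX) => i.
have [lx|lx] := leP x (l i); last by rewrite h ?scale0r; [exact: fil0|apply/negP; rewrite -ltNge].
apply: (filZ hp hX); have [/hF h1 _] := hl i.
by apply: fil_sub h1 => a /=; apply: le_trans.
Qed.

(** The constant depends on the two base points but neither on t nor on the directions, so the
    estimate survives limits of directions and [bound_samefil] can be applied to the limit. *)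
Lemma samefil_bound p q X Y : S p -> S q -> X \in P p -> Y \in P q -> samefil X Y ->
  forall t v, 0 <= t ->
  bp (geo q Y t) v v <= (\dim {:L})%:R ^+ 2 * expR (2 * dist p q) * bp (geo p X t) v v.
Proof.
move=> hp hq hX hY h t v t0; have H := bp_inner hss hp.
have Ht := bp_inner hss (geo_sym hss X t hp); have Kt := bp_inner hss (geo_sym hss Y t hq).
have [n [e [m he]]] := exists_eigenbasis hp hX; have [ho hm] := he; have [oe _ _] := ho.
set C := expR _; have C0 : 0 <= C by apply: expR_ge0.
have term i : nrm (bp (geo q Y t)) (bp p (e i) v *: e i) <= Num.sqrt C * nrm (bp (geo p X t)) v.
  rewrite /nrm -sqrtrM //; apply: ler_wsqrtr; rewrite (ipZl Kt) (ipZr Kt) mulrA -expr2.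
  have hi : fil Y (ge_ (m i)) (e i).
    by apply/h; apply: (@fil_eigen _ _ (m i)); [rewrite /ge_ /=|rewrite -adE; exact: hm].
  have h1 := fil_decay hq hY hi t0.
  have h2 : bp q (e i) (e i) <= C by have := bp_le_dist (e i) hp hq; rewrite oe eqxx mulr1.
  have h3 : bp p (e i) v ^+ 2 * expR (- 2 * t * m i) <= bp (geo p X t) v v.
    rewrite (eb_geo _ _ t hp hX he) (bigD1 i) //= mulrC -expr2 lerDl.
    by apply: sumr_ge0 => j _; rewrite mulr_ge0 ?expR_ge0 // -expr2 sqr_ge0.
  apply: le_trans (ler_wpM2l (sqr_ge0 _) h1) _; rewrite mulrA [leRHS]mulrC.
  by apply: ler_pM => //; [rewrite mulr_ge0 ?sqr_ge0 ?expR_ge0|exact: ip_ge0 (bp_inner hss hq) _].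
have hN : nrm (bp (geo q Y t)) v <= n%:R * (Num.sqrt C * nrm (bp (geo p X t)) v).
  rewrite {1}(full_onb v ho); apply: le_trans (nrm_sum Kt _ _ _) _.
  apply: le_trans (ler_sum _ (fun i _ => term i)) _.
  by rewrite sumr_const card_ord mulr_natl.
rewrite -(sqr_nrm Kt) -(sqr_nrm Ht) -(onb_dim H ho) -mulrA -{1}(sqr_sqrtr C0) -!exprMn.
by rewrite ler_pXn2r ?nnegrE ?mulr_ge0 ?nrm_ge0 ?sqrtr_ge0.
Qed.

Lemma bound_samefil p q X Y C D : S p -> S q -> X \in P p -> Y \in P q -> 0 <= C -> 0 <= D ->
  (forall t v, 0 <= t -> bp (geo q Y t) v v <= C * bp (geo p X t) v v) ->
  (forall t v, 0 <= t -> bp (geo p X t) v v <= D * bp (geo q Y t) v v) -> samefil X Y.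
Proof.
move=> hp hq hX hY C0 D0 h1 h2 x v; split=> hv.
  apply: (decay_fil hq hY (C := C * bp p v v)) => t t0; apply: le_trans (h1 t v t0) _.
  by rewrite -[leRHS]mulrA ler_wpM2l // mulrC; apply: fil_decay.
apply: (decay_fil hp hX (C := D * bp q v v)) => t t0; apply: le_trans (h2 t v t0) _.
by rewrite -[leRHS]mulrA ler_wpM2l // mulrC; apply: fil_decay.
Qed.

Lemma asymptoticP p q X Y : S p -> S q -> X \in P p -> Y \in P q ->
  asymptotic p X q Y <-> samefil X Y.
Proof.
move=> hp hq hX hY; split=> [[c hc]|h].
  have b t v : 0 <= t -> bp (geo q Y t) v v <= expR (2 * c) * bp (geo p X t) v v.
    move=> t0; apply: le_trans (bp_le_dist v (geo_sym hss X t hp) (geo_sym hss Y t hq)) _.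
    rewrite ler_wpM2r ?ler_expR ?ler_wpM2l ?hc //.
    exact: ip_ge0 (bp_inner hss (geo_sym hss X t hp)) _.
  have b' t v : 0 <= t -> bp (geo p X t) v v <= expR (2 * c) * bp (geo q Y t) v v.
    move=> t0; apply: le_trans (bp_le_dist v (geo_sym hss Y t hq) (geo_sym hss X t hp)) _.
    rewrite (distC hss (geo_sym hss Y t hq) (geo_sym hss X t hp)) ler_wpM2r ?ler_expR ?ler_wpM2l ?hc //.
    exact: ip_ge0 (bp_inner hss (geo_sym hss Y t hq)) _.
  by apply: bound_samefil b b' => //; apply: expR_ge0.
have [C [C1 hC]] : exists C : R, 1 <= C /\ (\dim {:L})%:R ^+ 2 * expR (2 * dist p q) <= C.
  exists (Num.max 1 ((\dim {:L})%:R ^+ 2 * expR (2 * dist p q))).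
  by rewrite le_max lexx /=; split=> //; rewrite le_max lexx orbT.
exists (Num.sqrt (\dim {:L})%:R * (ln C / 2)) => t t0.
apply: dist_le_ln => // [||v|v]; try exact: geo_sym.
  apply: le_trans (samefil_bound hp hq hX hY h v t0) _; rewrite ler_wpM2r //.
  exact: ip_ge0 (bp_inner hss (geo_sym hss X t hp)) _.
apply: le_trans (samefil_bound hq hp hY hX (samefil_sym h) v t0) _.
rewrite (distC hss hq hp) ler_wpM2r //; exact: ip_ge0 (bp_inner hss (geo_sym hss Y t hq)) _.
Qed.

End Filtration.

Lemma vexp_mem2 (R : realType) (V : vectType R) (f : 'End(V)) (U : {vspace V}) w :
  (forall v, v \in U -> f v \in U) -> f (f w) \in U -> vexp f w - (w + f w) \in U.
Proof.
move=> hU hw.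
have h : vcvg \oo (fun n => expsum f n.+2 w) (vexp f w).
  move=> i; have := @vexpP _ _ f w i; rewrite -(cvg_shiftn 2) /=.
  by under [X in X @ _ --> _ -> _]funext do rewrite addn2.
have h2 : vcvg \oo (fun n => expsum f n.+2 w - (w + f w)) (vexp f w - (w + f w)).
  by apply: vcvgB => //; apply: vcvg_cst.
apply: (vcvg_mem _ h2) => n; rewrite /expsum !big_ord_recl /= !fact0 invr1 !scale1r addrA addrAC.
rewrite [X in X - _]addrAC [X in X - _]addrC addrK; apply: rpred_sum => k _; apply: rpredZ.
by elim: (val k) => //= m; apply: hU.
Qed.

(** * Ideal points, the action of G on them, and unipotent elements *)

Section Ends.
Variables (R : realType) (L : liealg R).
Hypothesis hss : semisimple L.
Implicit Types (X Y Z U V W u v w z : L) (f g p q r : 'End(L)) (A : set R).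
Local Notation br := (@lie_br R L).
Local Notation S := (@symspace R L).
Local Notation P := (@pspace R L).

Definition fsp z A : {vspace L} := xget 0%VS [set U : {vspace L} | forall v, v \in U <-> fil z A v].

Lemma fspP p z A v : S p -> z \in P p -> v \in fsp z A <-> fil z A v.
Proof.
move=> hp hz; have [U hU] := fil_space hss hp hz A.
by have /(_ v) := @xgetI _ 0%VS [set U : {vspace L} | forall v, v \in U <-> fil z A v] U hU.
Qed.

Lemma fsp_dim_aut p g z A : S p -> z \in P p -> isaut g -> \dim (fsp (g z) A) = \dim (fsp z A).
Proof.
move=> hp hz hg; have hp' := act_sym hg hp; have hz' := pspace_act hg hz.
have -> : fsp (g z) A = (g @: fsp z A)%VS.
  apply/vspaceP => v; apply/idP/memv_imgP => [/(fspP _ _ hp' hz') h|[u /(fspP _ _ hp hz) h ->]].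
    exists (g^-1%VF v); last by rewrite (autVK hg).
    by apply/(fspP _ _ hp hz)/(fil_autE _ _ _ hg); rewrite (autVK hg).
  by apply/(fspP _ _ hp' hz')/(fil_autE _ _ _ hg).
by apply: limg_dim_eq; case: hg => _ /eqP ->; rewrite capv0.
Qed.

Lemma fsp_dim_opp p z A : S p -> z \in P p -> \dim (fsp z (opp_ A)) = \dim (fsp z A).
Proof.
move=> hp hz; rewrite -(fsp_dim_aut A hp hz (sym_aut hp)) ((memP p z).1 hz).
have hz' : - z \in P p by rewrite rpredN.
congr (\dim _); apply/vspaceP => v.
by apply/idP/idP => [/(fspP _ _ hp hz)|/(fspP _ _ hp hz')] h; [apply/(fspP _ _ hp hz')|apply/(fspP _ _ hp hz)];
  apply/fil_oppE.
Qed.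

Lemma fsp_dimC p z A : S p -> z \in P p -> (\dim (fsp z A) + \dim (fsp z (~` A)) = \dim {:L})%N.
Proof.
move=> hp hz; have H := bp_inner hss hp.
rewrite -dimv_disjoint_sum; last first.
  apply/eqP; rewrite -subv0; apply/subvP => v; rewrite memv_cap memv0.
  move=> /andP [/(fspP _ _ hp hz) h1 /(fspP _ _ hp hz) h2].
  by apply/eqP/(ip_eq0 H); apply: (fil_orth hss hp hz _ h1 h2) => a.
congr (\dim _); apply/vspaceP => v; rewrite memvf.
have [u [w [-> h1 h2]]] := fil_split hss hp hz A v.
by apply: memv_add; apply/(fspP _ _ hp hz).
Qed.

(** Of two rays of different speed the faster one outruns the other, by the triangle inequality. *)
Lemma samefil_knorm p q X Y : S p -> S q -> X \in P p -> Y \in P q -> samefil X Y -> knorm X = knorm Y.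
Proof.
suff h p' q' X' Y' : S p' -> S q' -> X' \in P p' -> Y' \in P q' -> samefil X' Y' -> knorm X' <= knorm Y'.
  by move=> hp hq hX hY hXY; apply/eqP; rewrite eq_le !(h p q X Y, h q p Y X) //; apply: samefil_sym.
move=> hp hq hX hY /(asymptoticP hss hp hq hX hY) [c hc].
rewrite leNgt; apply/negP => lt.
have c0 : 0 <= c.
  by apply: le_trans (hc 0 (lexx 0)); apply: (dist_ge0 hss); apply: (geo_sym hss).
have e1 t : 0 <= t -> t * knorm X' <= dist p' q' + t * knorm Y' + c.
  move=> t0; have hpt := geo_sym hss X' t hp; have hqt := geo_sym hss Y' t hq.
  have <- : dist p' (geo p' X' t) = t * knorm X' by rewrite (dist_geo hss t hp hX) ger0_norm.
  have <- : dist q' (geo q' Y' t) = t * knorm Y' by rewrite (dist_geo hss t hq hY) ger0_norm.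
  apply: le_trans (dist_triangle hss hp hqt hpt) _; apply: lerD; last by rewrite (distC hss hqt hpt) hc.
  exact: (dist_triangle hss hp hq hqt).
have dl : 0 < knorm X' - knorm Y' by rewrite subr_gt0.
have d0 := dist_ge0 hss hp hq.
pose t := (dist p' q' + c + 1) / (knorm X' - knorm Y').
have t0 : 0 <= t by rewrite divr_ge0 ?(ltW dl) // addr_ge0 // addr_ge0.
have := e1 t t0.
have -> : t * knorm X' = dist p' q' + c + 1 + t * knorm Y' by rewrite /t; field; rewrite gt_eqF.
by move: (dist p' q') (t * knorm Y') => x y; lra.
Qed.

Lemma exists_dir p q X : S p -> S q -> X \in P p ->
  exists Y, [/\ Y \in P q, samefil X Y & knorm Y = knorm X].
Proof.
move=> hp hq hX; have [Y hY hXY] := exists_transport hss hp hq hX.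
by exists Y; split=> //; rewrite (samefil_knorm hp hq hX hY hXY).
Qed.

Lemma mem_endpt p X q Y : S p -> X \in P p ->
  endpt p X (q, Y) <-> [/\ S q, usphere q Y & samefil X Y].
Proof.
move=> hp hX; split=> -[/= hq [hY nY] h]; split; try exact: hq; try by split.
  exact/(asymptoticP hss hp hq hX hY).
exact/(asymptoticP hss hp hq hX hY).
Qed.

Opaque endpt asymptotic.

Lemma endptP p q X Y : S p -> S q -> usphere p X -> usphere q Y ->
  endpt p X = endpt q Y <-> samefil X Y.
Proof.
move=> hp hq [hX nX] [hY nY]; split=> [h|h].
  have : endpt q Y (p, X) by rewrite -h; apply/(mem_endpt _ _ hp hX); split; [exact: hp|split|].
  by move=> /(mem_endpt _ _ hq hY) [_ _]; apply: samefil_sym.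
apply/seteqP; split=> -[r W].
  move=> /(mem_endpt _ _ hp hX) [hr hW h']; apply/(mem_endpt _ _ hq hY); split; [exact: hr|exact: hW|].
  exact: samefil_trans (samefil_sym h) _.
move=> /(mem_endpt _ _ hq hY) [hr hW h']; apply/(mem_endpt _ _ hp hX); split; [exact: hr|exact: hW|].
exact: samefil_trans h _.
Qed.

Lemma act_inv_sym a q : isaut a -> act a (act a^-1%VF q) = q.
Proof.
move=> ha; rewrite -(act_comp _ ha (autV ha)) -[in RHS](act1 q); congr act.
by apply/lfunP => v; rewrite !lfe (autVK ha).
Qed.

Lemma usphere_act a p X : isaut a -> usphere p X -> usphere (act a p) (a X).
Proof. by move=> ha [hX nX]; split; [apply: pspace_act|rewrite (knorm_aut _ ha)]. Qed.

Lemma act_endpt a p X : isaut a -> S p -> usphere p X -> act_ideal a (endpt p X) = endpt (act a p) (a X).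
Proof.
move=> ha hp uX; have [hX nX] := uX; have hp' := act_sym ha hp; have [hX' nX'] := usphere_act ha uX.
apply/seteqP; split=> [_ [[r W] /(mem_endpt _ _ hp hX) [hr hW has] <-]|[r W]].
  apply/(mem_endpt _ _ hp' hX'); split; [exact: act_sym|exact: usphere_act|exact: samefil_aut].
move=> /(mem_endpt _ _ hp' hX') [hr hW has].
have hV := autV ha; exists (act a^-1%VF r, a^-1%VF W); last by rewrite /= act_inv_sym // (autVK ha).
apply/(mem_endpt _ _ hp hX); split; [exact: act_sym|exact: usphere_act|].
by move/(samefil_aut hV): has; rewrite (autK ha).
Qed.

Opaque act_ideal.

Definition sametype X Y := exists2 g, isomG g & samefil (g X) Y.

Lemma samefil_refl X : samefil X X. Proof. by []. Qed.

Lemma sametype_refl X : sametype X X.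
Proof. by exists \1%VF; [exact: isomG1|rewrite id_lfunE]. Qed.

Lemma sametype_fil X Y : samefil X Y -> sametype X Y.
Proof. by move=> h; exists \1%VF; [exact: isomG1|rewrite id_lfunE]. Qed.

Lemma sametype_sym X Y : sametype X Y -> sametype Y X.
Proof.
move=> [g hg h]; have ag := isomG_aut hss hg; exists g^-1%VF; first exact: isomG_inv.
by have := samefil_aut (autV ag) (samefil_sym h); rewrite (autK ag).
Qed.

Lemma sametype_trans X Y Z : sametype X Y -> sametype Y Z -> sametype X Z.
Proof.
move=> [g hg h] [g' hg' h']; exists (g' \o g)%VF; first exact: isomG_comp.
by rewrite comp_lfunE; apply: samefil_trans h'; apply: samefil_aut => //; apply: (isomG_aut hss).
Qed.

Lemma type_of_self p X : S p -> usphere p X -> type_of (endpt p X) (endpt p X).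
Proof.
move=> hp uX; exists \1%VF; first exact: isomG1.
by rewrite (act_endpt (aut1 L) hp uX) act1 id_lfunE.
Qed.

Lemma in_typeP p q X Y : S p -> S q -> usphere p X -> usphere q Y ->
  type_of (endpt p X) (endpt q Y) <-> sametype X Y.
Proof.
move=> hp hq uX uY; split=> [[a ha]|[a ha h]]; have aa := isomG_aut hss ha.
  rewrite (act_endpt aa hp uX) => h; exists a; first exact: ha.
  exact/(endptP (act_sym aa hp) hq (usphere_act aa uX) uY).
exists a; first exact: ha; rewrite (act_endpt aa hp uX).
exact/(endptP (act_sym aa hp) hq (usphere_act aa uX) uY).
Qed.

Lemma type_ofP p q X Y : S p -> S q -> usphere p X -> usphere q Y ->
  type_of (endpt p X) = type_of (endpt q Y) <-> sametype X Y.
Proof.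
move=> hp hq uX uY; split=> [h|].
  by apply/(in_typeP hp hq uX uY); rewrite h; apply: type_of_self.
suff h p' q' X' Y' : S p' -> S q' -> usphere p' X' -> usphere q' Y' -> sametype X' Y' ->
    type_of (endpt q' Y') `<=` type_of (endpt p' X').
  by move=> hXY; apply/seteqP; split; [apply: (h q p)|apply: h] => //; apply: sametype_sym.
move=> hp' hq' uX' uY' [g hg hgs] _ [a ha <-].
have aa := isomG_aut hss ha; have ag := isomG_aut hss hg; have aag := aut_comp aa ag.
exists (a \o g)%VF; first exact: isomG_comp.
rewrite (act_endpt aa hq' uY') (act_endpt aag hp' uX').
apply/(endptP (act_sym aag hp') (act_sym aa hq') (usphere_act aag uX') (usphere_act aa uY')).
by rewrite comp_lfunE; apply: samefil_aut.
Qed.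

(* Both ad X and ad Y act on F_l / F_(>l) as l. *)
Lemma samefil_sub p q X Y : S p -> X \in P p -> S q -> Y \in P q -> samefil X Y -> fil Y (gt_ 0) (X - Y).
Proof.
move=> hp hX hq hY h; have [k [a [w [h1 h2 h3]]]] := fil_all hss hq hY (X - Y).
have [n [e [m he]]] := exists_eigenbasis hss hp hX; have [ho hm] := he.
have [n' [f [l hf]]] := exists_eigenbasis hss hq hY; have [hfo hl] := hf.
have key i : fil Y (gt_ (l i)) (br (X - Y) (f i)).
  have hfi : fil Y (ge_ (l i)) (f i) by apply: fil_eigen (lexx _) _; rewrite -adE.
  rewrite (brBl hss) -[br Y (f i)]adE hl.
  have /(fil_onb hss _ _ hp hX he) := (h _ _).2 hfi => hX'.
  apply/(samefil_gt hss _ _ hp hX hq hY h)/(fil_onb hss _ _ hp hX he) => j; rewrite /gt_ /= => /negP.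
  rewrite -leNgt => mj; have H := bp_inner hss hp.
  rewrite (ipBr H) (ipZr H) (eb_coef hss _ _ hp hX he) -mulrBl.
  have [->|mi] := eqVneq (m j) (l i); first by rewrite subrr mul0r.
  by rewrite hX' ?mulr0 // /ge_ /=; apply/negP; rewrite -ltNge lt_neqAle mi.
have [u1 [w1 [e1 hu hw]]] := fil_split hss hq hY (gt_ 0) (X - Y).
suff -> : X - Y = u1 by [].
suff w0 : w1 = 0 by rewrite e1 w0 addr0.
have {}hw : fil Y (le_ 0) w1 by apply: fil_sub hw => b /negP; rewrite -leNgt.
have hu2 i : br w1 (f i) = 0.
  have E1 : fil Y (gt_ (l i)) (br w1 (f i)).
    have -> : w1 = (X - Y) - u1 by rewrite e1 addrAC subrr add0r.
    rewrite (brBl hss); apply: (filB hss hq hY) (key i) _.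
    apply: (fil_br hss hq hY (A := gt_ 0) (A' := ge_ (l i))) hu _.
      by move=> b c; rewrite /gt_ /ge_ /= => hb hc; rewrite -[l i]add0r ltr_leD.
    by apply: fil_eigen (lexx _) _; rewrite -adE.
  have E2 : fil Y (le_ (l i)) (br w1 (f i)).
    apply: (fil_br hss hq hY (A := le_ 0) (A' := le_ (l i))) hw _.
      by move=> b c; rewrite /le_ /= => hb hc; rewrite -[l i]add0r lerD.
    by apply: fil_eigen (lexx _) _; rewrite -adE.
  apply: fil_zero (filI hss hq hY E1 E2) => b [].
  by rewrite /gt_ /le_ /= => b1 b2; move: (lt_le_trans b1 b2); rewrite ltxx.
apply: (ad_inj hss) => v; rewrite (br0l hss) -adE (full_onb v hfo) linear_sum big1 // => i _.
by rewrite linearZ /= adE hu2 scaler0.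
Qed.

(** Successive approximation. An error r at a positive level K equals [v0, Y] for a v0 obtained by
    dividing its components by their eigenvalues; composing with e^{ad v0} cancels r to first order
    and leaves an error c levels higher. The spectrum is bounded, so the error becomes zero after
    finitely many rounds. *)
Lemma exists_unipotent q Y u : S q -> Y \in P q -> fil Y (gt_ 0) u ->
  exists g, [/\ isomG g, g Y = Y + u & forall l v, fil Y (ge_ l) (g v) <-> fil Y (ge_ l) v].
Proof.
move=> hq hY /(fil_ge_gt hss hq hY) [c c0 hu].
have expv l v0 w : fil Y (ge_ 0) v0 -> fil Y (ge_ l) w -> fil Y (ge_ l) (vexp (ad v0) w).
  move=> hv /(fspP _ _ hq hY) hw; apply/(fspP _ _ hq hY); apply: vexp_mem hw => x.
  move=> /(fspP _ _ hq hY) hx; apply/(fspP _ _ hq hY); rewrite adE.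
  apply: (fil_br hss hq hY _ hv hx) => a b; rewrite /ge_ /= => ha hb.
  by rewrite -[l]add0r lerD.
have claim k : exists g, [/\ isomG g, fil Y (ge_ (k.+1%:R * c)) (Y + u - g Y) &
    forall l v, fil Y (ge_ l) (g v) <-> fil Y (ge_ l) v].
  elim: k => [|k [g [hg hr hgf]]].
    exists \1%VF; split; [exact: isomG1| |by move=> l v; rewrite id_lfunE].
    by rewrite id_lfunE mul1r addrAC subrr add0r.
  set r := Y + u - g Y in hr; set K : R := k.+1%:R * c in hr.
  have K0 : 0 < K by rewrite mulr_gt0 // ltr0n.
  have cK : c <= K by rewrite -[leLHS]mul1r ler_pM2r // ler1n.
  have [v0 hv ev] : exists2 v0, fil Y (ge_ K) v0 & br v0 Y = r.
    have [n [a [w [h1 h2 h3]]]] := hr; exists (- \sum_i (a i)^-1 *: w i).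
      apply: (filN hss hq hY); apply: (fil_sum hss hq hY) => i; apply: (filZ hss hq hY).
      have [->|wi] := eqVneq (w i) 0; first exact: fil0.
      exact: fil_eigen (h1 i wi) (h2 i).
    rewrite (brC hss) -adE linearN /= opprK h3 linear_sum; apply: eq_bigr => i _.
    rewrite linearZ /= adE h2 scalerA.
    have [->|wi] := eqVneq (w i) 0; first by rewrite scaler0.
    by rewrite mulVf ?scale1r // gt_eqF // (lt_le_trans K0) //; apply: h1.
  have hv0 : fil Y (ge_ 0) v0 by apply: fil_sub hv => a; apply: le_trans; apply: ltW.
  exists (vexp (ad v0) \o g)%VF; split.
  - by apply: isomG_comp => //; apply: isomG_expA.
  - have gY : g Y = Y + (u - r) by rewrite /r; vring.
    have hur : fil Y (ge_ c) (u - r).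
      by apply: (filB hss hq hY) => //; apply: fil_sub hr => a; apply: le_trans.
    rewrite comp_lfunE gY.
    have -> : Y + u - vexp (ad v0) (Y + (u - r)) = - (vexp (ad v0) (Y + (u - r)) -
       ((Y + (u - r)) + ad v0 (Y + (u - r)))) - br v0 (u - r).
      by rewrite adE brDr ev; vring.
    have kk a b : K <= a -> c <= b -> k.+2%:R * c <= a + b.
      by move=> ha hb; rewrite -natr1 mulrDl mul1r lerD.
    have h2 : fil Y (ge_ (k.+2%:R * c)) (br v0 (u - r)) by apply: (fil_br hss hq hY _ hv hur).
    apply: (filB hss hq hY) => //; apply: (filN hss hq hY); apply/(fspP _ _ hq hY).
    apply: vexp_mem2 => [x /(fspP _ _ hq hY) hx|].
      apply/(fspP _ _ hq hY); rewrite adE; apply: (fil_br hss hq hY _ hv0 hx) => a b.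
      by rewrite /ge_ /= => ha hb; rewrite -[X in X <= _]add0r lerD.
    apply/(fspP _ _ hq hY); rewrite !adE brDr ev brDr; apply: (filD hss hq hY).
      by apply: (fil_br hss hq hY _ hv hr) => a b ha hb; apply: kk => //; apply: le_trans hb.
    apply: (fil_br hss hq hY _ hv0 h2) => a b.
    by rewrite /ge_ /= => ha hb; rewrite -[X in X <= _]add0r lerD.
  - move=> l v; rewrite comp_lfunE -(hgf l v); split=> [h|]; last exact: expv.
    rewrite -(expAN hss v0 (g v)); apply: expv => //; exact: (filN hss hq hY).
have [n [e [m he]]] := exists_eigenbasis hss hq hY.
have [k hk] : exists k : nat, knorm Y < k.+1%:R * c.
  exists (Num.truncn (knorm Y / c)); rewrite -ltr_pdivrMr //; exact: truncnS_gt.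
have [g [hg hr hgf]] := claim k; exists g; split=> //.
apply/eqP; rewrite eq_sym -subr_eq0; apply/eqP.
apply: (ip_eq0 (bp_inner hss hq)); apply: (fil_orth hss hq hY (A := ge_ (k.+1%:R * c)) (A' := set0)) => //.
apply/(fil_onb hss _ _ hq hY he) => i _.
have /(fil_onb hss _ _ hq hY he) := hr; apply; rewrite /ge_ /=; apply/negP; rewrite -ltNge.
by apply: le_lt_trans hk; apply: le_trans (ler_norm _) _; apply: (eb_le_knorm hss _ hq hY he).
Qed.

Lemma unipotent_fil q Y u : S q -> Y \in P q -> fil Y (gt_ 0) u ->
  exists g, [/\ isomG g, g Y = Y + u & samefil (Y + u) Y].
Proof.
move=> hq hY hu; have [g [hg e h]] := exists_unipotent hq hY hu; exists g; split=> //.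
have ag := isomG_aut hss hg; move=> l v; rewrite -e.
by have := h l (g^-1%VF v); have := fil_autE Y (ge_ l) (g^-1%VF v) ag; rewrite (autVK ag) => -> ->.
Qed.

End Ends.

(** * Types *)

Lemma linear_closed_space (R : realType) (V : vectType R) (Q : V -> Prop) : Q 0 ->
  (forall a u v, Q u -> Q v -> Q (a *: u + v)) -> exists U : {vspace V}, forall v, v \in U <-> Q v.
Proof.
move=> Q0 Ql; pose ok k := `[< exists2 U : {vspace V}, \dim U = k & forall v, v \in U -> Q v >].
have ok0 : exists k, ok k.
  by exists 0%N; apply/asboolP; exists 0%VS; rewrite ?dimv0 // => v; rewrite memv0 => /eqP ->.
have okle k : ok k -> (k <= \dim {:V})%N by move=> /asboolP [U <- _]; apply: dimvS; apply: subvf.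
case: (ex_maxnP ok0 okle) => k /asboolP [U Uk UQ] kmax; exists U => v; split; first exact: UQ.
move=> Qv; apply: contraT => vU; have : ok (\dim (U + <[v]>)%VS).
  apply/asboolP; exists (U + <[v]>)%VS => // w /memv_addP [u uU [w' /vlineP [a ->] ->]].
  by rewrite addrC; apply: Ql => //; apply: UQ.
move/kmax; rewrite leqNgt -Uk => /negP []; rewrite ltn_neqAle dimvS ?addvSl // andbT.
apply/negP => /eqP e; case/negP: vU.
have /eqP -> : U == (U + <[v]>)%VS by rewrite eqEdim addvSl e leqnn.
by rewrite memvE addvSr.
Qed.

Lemma enum_fun n k (A : {set 'I_n}) : #|A| = k -> exists f : 'I_k -> 'I_n,
  [/\ injective f, (forall i, i \in A <-> exists a, f a = i) &
      forall (M : nmodType) (F : 'I_n -> M), \sum_(i in A) F i = \sum_a F (f a)].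
Proof.
move=> <-; exists (fun a => enum_val a); split; [exact: enum_val_inj| |].
  move=> i; split=> [iA|[a <-]]; last exact: enum_valP.
  by exists (enum_rank_in iA i); rewrite enum_rankK_in.
by move=> M F; rewrite big_enum_val.
Qed.

(** * Tensor powers, wedges and the highest-weight argument *)

Section Tensor.
Variables (R : realType) (V : vectType R) (ip : V -> V -> R).
Hypothesis H : inner ip.
Variables (n k : nat) (e : 'I_n -> V).
Hypothesis he : onb ip fullv e.
Local Notation T := {ffun {ffun 'I_k -> 'I_n} -> R^o}.
Implicit Types (t : T) (f g : 'End(V)) (I : {ffun 'I_k -> 'I_n}) (j : 'I_k).

Definition upd I j m : {ffun 'I_k -> 'I_n} := [ffun a => if a == j then m else I a].

Lemma upd_id I j : upd I j (I j) = I.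
Proof. by apply/ffunP => a; rewrite ffunE; case: eqP => // ->. Qed.

Lemma updK I j m m' : upd (upd I j m) j m' = upd I j m'.
Proof. by apply/ffunP => a; rewrite !ffunE; case: eqP. Qed.

Lemma updC I i j m m' : i != j -> upd (upd I i m) j m' = upd (upd I j m') i m.
Proof.
by move=> ij; apply/ffunP => a; rewrite !ffunE; case: eqP => // ->; rewrite eq_sym (negPf ij).
Qed.

Lemma upd_at I i m : upd I i m i = m. Proof. by rewrite ffunE eqxx. Qed.
Lemma upd_ne I i j m : j != i -> upd I i m j = I j. Proof. by move=> ij; rewrite ffunE (negPf ij). Qed.

(** A tensor of degree k is its array of components in the basis e; this is f acting on the j-th
    factor. *)
Definition slot f j : 'End(T) :=
  linfun (fun t : T => [ffun I : {ffun 'I_k -> 'I_n} => \sum_m ip (e (I j)) (f (e m)) * t (upd I j m)] : T).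

Lemma slotE f j t I : slot f j t I = \sum_m ip (e (I j)) (f (e m)) * t (upd I j m).
Proof.
rewrite /slot linfunE ?ffunE // => a u v; apply/ffunP => I'; rewrite !ffunE scaler_sumr -big_split.
by apply: eq_bigr => m _; rewrite !ffunE /= mulrDr mulrCA.
Qed.

Lemma ip_lfun_sum f i v : ip (e i) (f v) = \sum_m ip (e i) (f (e m)) * ip (e m) v.
Proof.
rewrite {1}(full_onb v he) linear_sum (ip_sumr H); apply: eq_bigr => m _.
by rewrite linearZ /= (ipZr H) mulrC.
Qed.

Lemma slot_lin a f g j : slot (a *: f + g) j = a *: slot f j + slot g j.
Proof.
apply/lfunP => t; apply/ffunP => I; rewrite add_lfunE scale_lfunE !ffunE !slotE scaler_sumr -big_split.
by apply: eq_bigr => m _; rewrite !lfe (ipDr H) (ipZr H) mulrDl -mulrA.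
Qed.

Lemma slot_comp f g j t : slot f j (slot g j t) = slot (f \o g)%VF j t.
Proof.
apply/ffunP => I; rewrite !slotE.
under eq_bigr => m _ do rewrite slotE upd_at mulr_sumr.
rewrite exchange_big; apply: eq_bigr => m' _ /=.
under eq_bigr => m _ do rewrite updK mulrA.
by rewrite -mulr_suml comp_lfunE -ip_lfun_sum.
Qed.

Lemma slot_comm f g i j t : i != j -> slot f i (slot g j t) = slot g j (slot f i t).
Proof.
move=> ij; apply/ffunP => I; rewrite !slotE.
under eq_bigr => m _ do rewrite slotE upd_ne 1?eq_sym // mulr_sumr.
under [RHS]eq_bigr => m _ do rewrite slotE upd_ne // mulr_sumr.
rewrite exchange_big; apply: eq_bigr => m' _; apply: eq_bigr => m _ /=.
by rewrite mulrCA (updC _ _ _ ij).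
Qed.

Lemma vexp_slot f j t : vexp (slot f j) t = slot (vexp f) j t.
Proof.
apply/ffunP => I; pose A t := \sum_m t (upd I j m) *: e m : V.
have hA : additive_hom A.
  move=> a u v; rewrite /A scaler_sumr -big_split; apply: eq_bigr => m _.
  by rewrite !ffunE scalerDl scalerA.
have ipA i t' : ip (e i) (A t') = t' (upd I j i).
  have [oe _ _] := he; rewrite (ip_sumr H) (bigD1 i) //= (ipZr H) oe eqxx mulr1 big1 ?addr0 // => m mi.
  by rewrite (ipZr H) oe eq_sym (negPf mi) mulr0.
have hf t' : A (slot f j t') = f (A t').
  rewrite [RHS](full_onb _ he); apply: eq_bigr => i _; congr (_ *: _); rewrite slotE upd_at ip_lfun_sum.
  by apply: eq_bigr => m _; rewrite updK ipA.
have := vexp_intertwine hA hf t; move/(congr1 (ip (e (I j)))); rewrite ipA upd_id => ->.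
by rewrite slotE ip_lfun_sum; apply: eq_bigr => m _; rewrite ipA.
Qed.

(** For G independent of its first argument this is a wedge product. The extra argument lets
    different factors carry different vectors, as happens when an operator has been applied to some
    of the factors. *)
Definition rowT (G : 'I_k -> 'I_k -> V) : T := [ffun I : {ffun 'I_k -> 'I_n} => \det (\matrix_(a, b) ip (e (I a)) (G a b))].

Lemma rowT_ext G G' : (forall a b, G a b = G' a b) -> rowT G = rowT G'.
Proof. by move=> h; congr rowT; apply/funext => a; apply/funext => b. Qed.

Definition cof (G : 'I_k -> 'I_k -> V) I j b := cofactor (\matrix_(a, b) ip (e (I a)) (G a b)) j b.

Lemma rowT_upd G f I j m : rowT G (upd I j m) = \sum_b ip (e m) (G j b) * cof G I j b.
Proof.
rewrite ffunE (expand_det_row _ j); apply: eq_bigr => b _; rewrite mxE upd_at; congr (_ * _).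
rewrite /cof /cofactor; congr (_ * \det _); apply/matrixP => x y; rewrite !mxE upd_ne //.
by rewrite eq_sym neq_lift.
Qed.

Lemma slot_rowT f j G : slot f j (rowT G) = rowT (fun a b => if a == j then f (G a b) else G a b).
Proof.
apply/ffunP => I; rewrite slotE; under eq_bigr => m _ do rewrite (rowT_upd _ f) mulr_sumr.
rewrite exchange_big -[in RHS](upd_id I j) (rowT_upd _ f); apply: eq_bigr => b _ /=.
rewrite eqxx ip_lfun_sum mulr_suml.
rewrite (_ : cof (fun a b => if a == j then f (G a b) else G a b) I j b = cof G I j b); last first.
  rewrite /cof /cofactor; congr (_ * \det _); apply/matrixP => x y; rewrite !mxE.
  by rewrite eq_sym (negPf (neq_lift _ _)).
by apply: eq_bigr => m _; rewrite mulrA.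
Qed.

Definition deriv f : 'End(T) := \sum_j slot f j.

Lemma deriv_lin a f g : deriv (a *: f + g) = a *: deriv f + deriv g.
Proof. by rewrite /deriv scaler_sumr -big_split; apply: eq_bigr => j _; rewrite slot_lin. Qed.

Lemma derivE f t : deriv f t = \sum_j slot f j t.
Proof. by rewrite /deriv sum_lfunE. Qed.

Lemma deriv_br f g t : deriv f (deriv g t) = deriv (-1 *: (g \o f)%VF + (f \o g)%VF) t + deriv g (deriv f t).
Proof.
rewrite !derivE.
under eq_bigr => i _ do rewrite linear_sum (bigD1 i) //= slot_comp.
under [X in _ + X]eq_bigr => i _ do rewrite linear_sum (bigD1 i) //= slot_comp.
rewrite !big_split /= addrA; congr (_ + _).
  rewrite -big_split; apply: eq_bigr => i _ /=.
  by rewrite slot_lin add_lfunE scale_lfunE scaleN1r addrAC addNr add0r.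
under eq_bigr => i _ do rewrite big_mkcond; rewrite exchange_big; apply: eq_bigr => j _ /=.
rewrite -big_mkcond /=; under eq_bigl => i do rewrite eq_sym.
by apply: eq_bigr => i ij; rewrite slot_comm.
Qed.

(** The actions on different factors commute, so the exponential of their sum is taken one factor at
    a time. *)
Lemma vexp_deriv f w : vexp (deriv f) (rowT (fun _ => w)) = rowT (fun _ b => vexp f (w b)).
Proof.
suff h (r : seq 'I_k) : uniq r -> vexp (\sum_(j <- r) slot f j) (rowT (fun _ => w)) =
    rowT (fun a b => if a \in r then vexp f (w b) else w b).
  rewrite /deriv (h _ (index_enum_uniq _)); apply: rowT_ext => a b.
  by rewrite mem_index_enum.
elim: r => [|j r IH] /=; first by rewrite big_nil vexp0.
move=> /andP [jr ur]; rewrite big_cons vexpD.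
  apply: (eq_trans (f_equal _ (IH ur))); apply: (eq_trans (vexp_slot f j _)).
  apply: (eq_trans (slot_rowT _ _ _)); apply: rowT_ext => a b.
  by rewrite inE; have [->|//] := eqVneq a j; rewrite (negPf jr).
move=> t; rewrite !sum_lfunE linear_sum; apply: eq_big_seq => i ir; rewrite slot_comm //.
by apply: contraNneq jr => <-.
Qed.

Variable J : 'I_k -> 'I_n.
Definition wedge : T := rowT (fun _ b => e (J b)).

(** An operator preserving the span of k vectors acts on their wedge by its trace. In components
    this is Laplace expansion together with the adjugate identity for M. *)
Lemma deriv_wedge f x : (forall b, f (e (J b)) = \sum_c x c b *: e (J c)) ->
  deriv f wedge = (\sum_b x b b) *: wedge.
Proof.
move=> hx; apply/ffunP => I; rewrite derivE sum_ffunE ffunE.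
set M := \matrix_(a, b) ip (e (I a)) (e (J b)).
have adj c b : \sum_j M j c * cofactor M j b = (\det M) *+ (b == c).
  have := congr1 (fun N : ('M[R]_k) => N b c) (mul_adj_mx M); rewrite !mxE => <-.
  by apply: eq_bigr => j _; rewrite [in RHS]mxE mulrC.
have -> : (\sum_j slot f j wedge I) = \sum_j \sum_b \sum_c x c b * (M j c * cofactor M j b).
  apply: eq_bigr => j _; rewrite /wedge slot_rowT -[I in LHS](upd_id I j) (rowT_upd _ f).
  apply: eq_bigr => b _; rewrite eqxx hx (ip_sumr H) mulr_suml; apply: eq_bigr => c _.
  have Mjc : M j c = ip (e (I j)) (e (J c)) by rewrite mxE.
  rewrite (ipZr H) Mjc -mulrA; congr (_ * (_ * _)); rewrite /cof /cofactor; congr (_ * \det _).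
  by apply/matrixP => a b'; rewrite !mxE eq_sym (negPf (neq_lift _ _)).
rewrite ffunE exchange_big /= scaler_suml; apply: eq_bigr => b _; rewrite exchange_big /=.
rewrite (bigD1 b) //= [X in _ + X]big1 ?addr0; last first.
  by move=> c cb; rewrite -mulr_sumr adj eq_sym (negPf cb) mulr0.
by rewrite -mulr_sumr adj eqxx.
Qed.

Variable b : 'I_n -> R.

Lemma wedge_weight I : wedge I != 0 -> \sum_a b (I a) = \sum_a b (J a).
Proof.
rewrite ffunE => d0; have [s hs] : exists s : {perm ('I_k)}, forall a, I a = J (s a).
  apply: contrapT => h; case/negP: d0; apply/eqP; apply: big1 => s _.
  have [a /eqP ha] : exists a, I a <> J (s a).
    by apply: contrapT => h'; apply: h; exists s => a; apply: contrapT => h''; apply: h'; exists a.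
  have [oe _ _] := he.
  by rewrite (bigD1 a) //= mxE oe (negPf ha) mul0r mulr0.
under eq_bigr => a _ do rewrite hs.
by rewrite [RHS](reindex_inj (@perm_inj _ s)).
Qed.

Lemma deriv_weight f t (c : R) : (forall i m, b m < b i -> ip (e i) (f (e m)) = 0) ->
  (forall I, c < \sum_a b (I a) -> t I = 0) -> forall I, c < \sum_a b (I a) -> deriv f t I = 0.
Proof.
move=> hf ht I hI; rewrite derivE sum_ffunE big1 // => j _; rewrite slotE big1 // => m _.
have [h|h] := ltP (b m) (b (I j)); first by rewrite hf // mul0r.
rewrite ht ?mulr0 //; apply: lt_le_trans hI _.
rewrite (bigD1 j) //= [leRHS](bigD1 j) //= upd_at lerD //.
by apply: ler_sum => a aj; rewrite upd_ne.
Qed.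

End Tensor.

Section Types.
Variables (R : realType) (L : liealg R).
Hypothesis hss : semisimple L.
Implicit Types (X Y Z U V W u v w z : L) (f g p q r : 'End(L)) (A : set R).
Local Notation br := (@lie_br R L).
Local Notation S := (@symspace R L).
Local Notation P := (@pspace R L).

Lemma ad_br X Y : ad (br X Y) = -1 *: (ad Y \o ad X)%VF + (ad X \o ad Y)%VF.
Proof. by apply/lfunP => v; rewrite !lfe !adE (jacobi hss) scaleN1r addrC. Qed.

Section Weight.
Variables (p : 'End(L)) (n k : nat) (e : 'I_n -> L) (J : 'I_k -> 'I_n) (lower : L -> Prop).
Hypotheses (hp : S p) (he : onb (bp p) fullv e).
Hypothesis split_lower : forall X, exists X0 X1, [/\ X = X0 + X1, lower X1 &
  forall b, exists x : 'I_k -> R, br X0 (e (J b)) = \sum_c x c *: e (J c)].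

(* The U(g)-module generated by the wedge of the e_j is spanned by words in lowering operators. *)
Inductive lowered : {ffun {ffun 'I_k -> 'I_n} -> R^o} -> Prop :=
| lowered0 : lowered 0
| lowered_lin a (t1 t2 : {ffun {ffun 'I_k -> 'I_n} -> R^o}) : lowered t1 -> lowered t2 -> lowered (a *: t1 + t2)
| lowered_wedge : lowered (wedge (bp p) e J)
| lowered_step Y t : lower Y -> lowered t -> lowered (deriv (bp p) k e (ad Y) t).

Lemma loweredD t1 t2 : lowered t1 -> lowered t2 -> lowered (t1 + t2).
Proof. by move=> h1 h2; rewrite -[t1]scale1r; apply: lowered_lin. Qed.

(** X is commuted past the lowering operators until it reaches the wedge, on which its
    span-preserving part acts by a scalar and its remaining part is a lowering operator. *)
Lemma lowered_deriv X t : lowered t -> lowered (deriv (bp p) k e (ad X) t).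
Proof.
have H := bp_inner hss hp; move=> ht; elim: ht X => [X|a u v _ hu _ hv X||Y {}t hY ht IH X].
- by rewrite linear0; apply: lowered0.
- have -> : deriv (bp p) k e (ad X) (a *: u + v) = a *: deriv (bp p) k e (ad X) u + deriv (bp p) k e (ad X) v.
    exact: linearP.
  exact: lowered_lin.
- move=> X; have [X0 [X1 [-> l1 /choice [x hx]]]] := split_lower X.
  rewrite addrC -[X1]scale1r (adP hss) (deriv_lin H) add_lfunE scale_lfunE; apply: lowered_lin.
    by apply: lowered_step => //; apply: lowered_wedge.
  rewrite (deriv_wedge H he (x := fun c b => x b c)) => [|b]; last by rewrite adE hx.
  by rewrite -[_ *: _]addr0; apply: lowered_lin lowered_wedge lowered0.
- rewrite (deriv_br H he) -ad_br; apply: loweredD; first exact: IH.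
  exact: lowered_step.
Qed.

(** The image of the wedge under g stays in the span of lowered words, and no such word has a
    component of weight above that of J. The determinant is the J' component of that image. *)
Lemma isomG_weight (J' : 'I_k -> 'I_n) (b : 'I_n -> R) g : isomG g ->
  (forall Y, lower Y -> forall i m, b m < b i -> bp p (e i) (br Y (e m)) = 0) ->
  \det (\matrix_(a, c) bp p (e (J' a)) (g (e (J c)))) != 0 ->
  \sum_a b (J' a) <= \sum_a b (J a).
Proof.
have H := bp_inner hss hp; move=> hg hl hd; rewrite leNgt; apply/negP => lt.
have [U hU] := linear_closed_space lowered0 lowered_lin.
have gU : rowT (bp p) e (fun _ c => g (e (J c))) \in U.
  elim: hg => [|X a _ IH].
    have -> : rowT (bp p) e (fun _ c => \1%VF (e (J c))) = wedge (bp p) e J.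
      by apply: rowT_ext => i c; rewrite id_lfunE.
    by apply/hU; apply: lowered_wedge.
  have -> : rowT (bp p) e (fun _ c => (lfexp (ad X) \o a)%VF (e (J c))) =
      rowT (bp p) e (fun _ : 'I_k => fun c => vexp (ad X) (a (e (J c)))).
    by apply: rowT_ext => i c; rewrite comp_lfunE lfexpE.
  rewrite -(vexp_deriv H he); apply: vexp_mem IH => t /hU ht; apply/hU; exact: lowered_deriv.
have wU t : lowered t -> forall I : {ffun 'I_k -> 'I_n}, \sum_a b (J a) < \sum_a b (I a) -> t I = 0.
  elim=> [I _|a u v _ hu _ hv I hI|I hI|Y {}t hY _ IH I hI].
  - by rewrite ffunE.
  - by rewrite !ffunE hu ?hv // scaler0 addr0.
  - apply/eqP/negPn/negP => /(wedge_weight he b) h; by move: hI; rewrite h ltxx.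
  - by apply: (deriv_weight _ IH hI) => i m hm; rewrite adE; apply: hl hY _ _ hm.
have /hU /wU /(_ [ffun a => J' a]) := gU; rewrite ffunE.
have -> : \matrix_(a, c) bp p (e ([ffun a => J' a] a)) (g (e (J c))) = \matrix_(a, c) bp p (e (J' a)) (g (e (J c))).
  by apply/matrixP => a c; rewrite !mxE ffunE.
move=> h; case/negP: hd; apply/eqP/h; by under [ltRHS]eq_bigr => a _ do rewrite ffunE.
Qed.

End Weight.

Lemma fil_gt_sym p X Y : S p -> X \in P p -> Y \in P p -> (forall v, fil X (ge_ 0) v -> fil Y (ge_ 0) v) ->
  forall v, fil X (lt_ 0) v -> fil Y (le_ 0) v.
Proof.
move=> hp hX hY h v hv; rewrite -(symK v hp).
have h1 : fil Y (ge_ 0) (p v).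
  by apply: h; apply: fil_sub (fil_sym hss hp hX hv) => a; rewrite /opp_ /lt_ /ge_ /= oppr_lt0 => /ltW.
by apply: fil_sub (fil_sym hss hp hY h1) => a; rewrite /opp_ /ge_ /le_ /= oppr_ge0.
Qed.

(** The involution p sends W to - W and the parabolic of Z to the opposite one, so W lies in both
    and has weight 0. *)
Lemma fil_commute p Z W : S p -> Z \in P p -> W \in P p -> fil Z (ge_ 0) W -> br Z W = 0.
Proof.
move=> hp hZ hW h; rewrite -[RHS](scale0r W); apply: (fil_single hss hp hZ).
have h1 : fil Z (le_ 0) W.
  rewrite -[W]opprK -((memP p W).1 hW); apply: (filN hss hp hZ).
  by apply: fil_sub (fil_sym hss hp hZ h) => a; rewrite /opp_ /ge_ /le_ /= oppr_ge0.
by apply: fil_sub (filI hss hp hZ h h1) => a []; rewrite /ge_ /le_ /= => a0 a1; apply/eqP; rewrite eq_le a0 a1.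
Qed.

Lemma fil_self p Z : S p -> Z \in P p -> fil Z (ge_ 0) Z.
Proof. by move=> hp hZ; apply: (@fil_eigen _ _ _ _ 0); [rewrite /ge_ /=|rewrite lie_br_alt scale0r]. Qed.

Lemma commute_fil X Y : br X Y = 0 -> fil X (ge_ 0) Y.
Proof. by move=> h; apply: (@fil_eigen _ _ _ _ 0); [rewrite /ge_ /=|rewrite h scale0r]. Qed.

Lemma br_eq0C X Y : br X Y = 0 -> br Y X = 0.
Proof. by move=> h; rewrite (brC hss) h oppr0. Qed.

Lemma ad_commute X Y v : br X Y = 0 -> ad X (ad Y v) = ad Y (ad X v).
Proof. by move=> h; apply/eqP; rewrite -subr_eq0 !adE -(jacobi hss) h (br0l hss). Qed.

(* Let A and A' index the joint eigenvectors whose Z- resp. Z'-eigenvalue is at least l.  Since g carries the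
   filtration of Z to that of Z', its minor with columns A and rows A' is nonzero, so the Z'-weight of A' is at
   most that of A; as A' maximises the Z'-weight among sets of its size, A = A'. *)
Lemma sametype_eq p V Z Z' : S p -> V \in P p -> Z \in P p -> Z' \in P p -> sametype Z Z' ->
  (forall v, fil V (ge_ 0) v -> fil Z (ge_ 0) v) -> (forall v, fil V (ge_ 0) v -> fil Z' (ge_ 0) v) -> Z = Z'.
Proof.
move=> hp hV hZ hZ' [g hg hgs] h1 h2; have H := bp_inner hss hp; have ag := isomG_aut hss hg.
have c1 : br Z V = 0 by apply: (fil_commute hp) => //; apply/h1/fil_self/hV.
have c2 : br Z' V = 0 by apply: (fil_commute hp) => //; apply/h2/fil_self/hV.
have c3 : br Z Z' = 0 by apply: (fil_commute hp) => //; apply/h1/commute_fil/br_eq0C.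
have [|||n [e [he hj]]] := @joint_spectral _ _ _ H [set f | exists2 W, W = V \/ W = Z \/ W = Z' & f = ad W] fullv.
- by move=> _ [W [->|[->|->]] ->]; apply: (ad_selfadj hss hp).
- move=> _ _ v [W hW ->] [W' hW' ->]; apply: ad_commute.
  by case: hW => [->|[->|->]]; case: hW' => [->|[->|->]] //; rewrite ?lie_br_alt //; apply: br_eq0C.
- by move=> f v _ _; rewrite memvf.
have /choice [mV hmV] i : exists a, ad V (e i) = a *: e i by apply: hj; exists V; [left|].
have /choice [a ha] i : exists a, ad Z (e i) = a *: e i by apply: hj; exists Z; [right; left|].
have /choice [b hb] i : exists a, ad Z' (e i) = a *: e i by apply: hj; exists Z'; [right; right|].
have eV : eigenbasis p V e mV by split.
have eZ : eigenbasis p Z e a by split.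
have eZ' : eigenbasis p Z' e b by split.
have [oe _ _] := he.
have frame W m x k (f : 'I_k -> 'I_n) : W \in P p -> eigenbasis p W e m -> injective f ->
    (forall i, i \in [set i | x <= m i]%SET <-> exists c, f c = i) ->
    (forall (M : nmodType) (F : 'I_n -> M), \sum_(i in [set i | x <= m i]%SET) F i = \sum_c F (f c)) ->
    onb (bp p) (fsp W (ge_ x)) (fun c => e (f c)).
  move=> hW hm fi fA fs; have [_ hmm] := hm; split.
  - by move=> i j; rewrite oe (inj_eq fi).
  - move=> i; apply/(fspP hss _ _ hp hW); apply: (@fil_eigen _ _ _ _ (m (f i))); last by rewrite -adE.
    have : f i \in [set i | x <= m i]%SET by apply/fA; exists i.
    by rewrite inE.
  - move=> v /(fspP hss _ _ hp hW) hv.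
    rewrite {1}(full_onb v he) (bigID (fun i => i \in [set i | x <= m i]%SET)) /= [X in _ + X]big1 ?addr0.
      by rewrite fs.
    move=> i; rewrite inE -ltNge => mi.
    by have /(fil_onb hss _ _ hp hW hm) -> := hv; rewrite ?scale0r // /ge_ /= leNgt mi.
have ab i l : (l <= a i) = (l <= b i).
  have [f [fi fA fs]] := @enum_fun n _ [set i | l <= a i]%SET erefl.
  have hc : #|[set i | l <= b i]%SET| = #|[set i | l <= a i]%SET|.
    have [f' [fi' fA' fs']] := @enum_fun n _ [set i | l <= b i]%SET erefl.
    have := onb_dim H (frame _ _ _ _ _ hZ eZ fi fA fs); have := onb_dim H (frame _ _ _ _ _ hZ' eZ' fi' fA' fs').
    move=> -> ->; rewrite -(fsp_dim_aut hss _ hp hZ ag); congr (\dim _); apply/vspaceP => v.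
    have hp' := act_sym ag hp; have hgZ := pspace_act ag hZ.
    by apply/idP/idP => [/(fspP hss _ _ hp hZ') h|/(fspP hss _ _ hp' hgZ) h];
      [apply/(fspP hss _ _ hp' hgZ)/hgs|apply/(fspP hss _ _ hp hZ')/hgs].
  have [f' [fi' fA' fs']] := enum_fun hc.
  have of_ := frame _ _ _ _ _ hZ eZ fi fA fs; have of_' := frame _ _ _ _ _ hZ' eZ' fi' fA' fs'.
  have [_ fm fc] := of_; have [_ fm' fc'] := of_'.
  have le1 : \sum_(i in [set i | l <= b i]%SET) b i <= \sum_(i in [set i | l <= a i]%SET) b i.
    rewrite fs fs'; apply: (@isomG_weight p n _ e f (fun X => fil V (lt_ 0) X)) hg _ _ => //.
    - move=> X; have [X0 [X1 [-> h3 h4]]] := fil_split hss hp hV (ge_ 0) X.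
      exists X0, X1; split=> //.
        by apply: fil_sub h4 => y /negP; rewrite -ltNge.
      move=> c; exists (fun c' => bp p (e (f c')) (br X0 (e (f c)))); apply: fc.
      apply/(fspP hss _ _ hp hZ); move/(fspP hss _ _ hp hZ): (fm c) => hfc.
      apply: (fil_br hss hp hZ _ (h1 _ h3) hfc) => y y'; rewrite /ge_ /= => y0 yl.
      by rewrite -[l]add0r lerD.
    - move=> Y hY i' m hm; have hY' := fil_gt_sym hp hV hZ' h2 hY.
      have hem : fil Z' (le_ (b m)) (e m).
        by apply: (@fil_eigen _ _ _ _ (b m)); [rewrite /le_ /=|rewrite -adE].
      have : fil Z' (le_ (b m)) (br Y (e m)).
        apply: (fil_br hss hp hZ' _ hY' hem) => y y'; rewrite /le_ /= => y0 ym.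
        by rewrite -[X in _ <= X]add0r lerD.
      by move/(fil_onb hss _ _ hp hZ' eZ'); apply; apply/negP; rewrite -ltNge.
    - rewrite -det_tr; apply/negP => /det0P [x x0 hx].
      pose v := \sum_c x 0 c *: e (f c).
      have gv : g v \in fsp Z' (ge_ l).
        apply/(fspP hss _ _ hp hZ')/hgs/(fil_autE _ _ _ ag)/(fspP hss _ _ hp hZ).
        by apply: rpred_sum => c _; apply: rpredZ; apply: fm.
      have gv0 : g v = 0.
        rewrite (fc' _ gv) big1 // => c _; have := congr1 (fun N : ('rV[R]__) => N 0 c) hx; rewrite !mxE => hc0.
        rewrite (_ : bp p (e (f' c)) (g v) = 0) ?scale0r // -[RHS]hc0 linear_sum (ip_sumr H).
        by apply: eq_bigr => c' _; rewrite linearZ /= (ipZr H) !mxE.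
      have v0 : v = 0 by apply: (aut_inj ag); rewrite gv0 linear0.
      case/negP: x0; apply/eqP/matrixP => i0 c; rewrite !mxE ord1.
      have [of1 _ _] := of_; have := orthon_coef H (x 0) c of1; rewrite -/v v0 (ip0r H) => <-.
      by [].
  suff sub : [set i | l <= a i]%SET \subset [set i | l <= b i]%SET.
    have : [set i | l <= a i]%SET == [set i | l <= b i]%SET by rewrite eqEcard sub hc leqnn.
    by move=> /eqP /setP /(_ i); rewrite !inE.
  apply: contraT => nsub; move: le1; rewrite leNgt => /negP [].
  set A := [set i | l <= a i]%SET in hc nsub *; set B' := [set i | l <= b i]%SET in hc nsub *.
  rewrite (big_setID B') /= [ltRHS](big_setID A) /= finset.setIC ltrD2l.
  have cD : #|A :\: B'| = #|B' :\: A| by apply/eqP; rewrite -(eqn_add2l #|A :&: B'|) cardsID finset.setIC cardsID hc.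
  apply: (@lt_le_trans _ _ (\sum_(i in A :\: B') l)).
    have [i0 i0A] : exists i0, i0 \in A :\: B' by apply/set0Pn; rewrite finset.setD_eq0.
    rewrite (bigD1 i0) //= [ltRHS](bigD1 i0) //=; apply: ltr_leD.
      by move: i0A; rewrite !inE -ltNge => /andP [].
    by apply: ler_sum => i1 /andP []; rewrite !inE -ltNge => /andP [/ltW].
  rewrite sumr_const cD -sumr_const; apply: ler_sum => i1.
  by rewrite !inE => /andP [].
have {}ab i : a i = b i by apply/eqP; rewrite eq_le -ab lexx ab lexx.
apply: (ad_inj hss) => v; rewrite -!adE; congr (fun_of_lfun _ _); apply: (eq_on_onb he) => i.
by rewrite ha hb ab.
Qed.

End Types.

(** * Roots, chambers and simplices *)

Section Weights.
Variables (R : realType) (L : liealg R).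
Hypothesis hss : semisimple L.
Implicit Types (X Y Z U V W u v : L) (f g p q r : 'End(L)) (A : set R) (a : {vspace L}).
Local Notation br := (@lie_br R L).
Local Notation S := (@symspace R L).
Local Notation P := (@pspace R L).

Lemma rvalD a (al be : dual a) X : rval (al + be) X = rval al X + rval be X.
Proof. by rewrite /rval add_lfunE. Qed.

Lemma rvalN a (al : dual a) X : rval (- al) X = - rval al X.
Proof. by rewrite /rval opp_lfunE. Qed.

Lemma rval0 a X : rval (0 : dual a) X = 0.
Proof. by rewrite /rval zero_lfunE. Qed.

Lemma rvalDr a (al : dual a) X Y : rval al (X + Y) = rval al X + rval al Y.
Proof. by rewrite /rval !linearD. Qed.

Lemma rvalZr a (al : dual a) c X : rval al (c *: X) = c * rval al X.
Proof. by rewrite /rval !linearZ. Qed.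

Lemma rval_inj a (al be : dual a) : (forall X, X \in a -> rval al X = rval be X) -> al = be.
Proof. by move=> h; apply/lfunP => u; have := h (vsval u) (subvsP u); rewrite /rval vsvalK. Qed.

Lemma leigenspaceP f (c : R) v : v \in passmx.leigenspace f c <-> f v = c *: v.
Proof.
rewrite /passmx.leigenspace memv_ker !lfe.
by split=> [/eqP/eqP|h]; [rewrite subr_eq0 => /eqP|apply/eqP; rewrite h subrr].
Qed.

Lemma root_spaceP a (al : dual a) v : v \in root_space al <-> forall X, X \in a -> br X v = rval al X *: v.
Proof.
split=> [h X Xa|h]; last first.
  rewrite memvE; apply/subv_bigcapP => i _; rewrite -memvE; apply/leigenspaceP; rewrite adE; apply: h.
  by apply/vbasis_mem/mem_nth; rewrite size_tuple.
have hb i : br (vbasis a)`_i v = rval al (vbasis a)`_i *: v.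
  have [ia|ia] := ltnP i (\dim a); last first.
    by rewrite nth_default ?size_tuple // (br0l hss) -[X in rval _ X](scale0r 0) rvalZr mul0r scale0r.
  move: h; rewrite memvE => /subv_bigcapP /(_ (Ordinal ia) isT); rewrite -memvE.
  by move=> /leigenspaceP; rewrite adE.
rewrite (coord_vbasis Xa); elim: (index_enum _) => [|i s IH].
  by rewrite big_nil (br0l hss) -[X in rval _ X](scale0r 0) rvalZr mul0r scale0r.
by rewrite big_cons (brDl hss) (brZl hss) hb IH rvalDr rvalZr scalerA -scalerDl.
Qed.

Definition weights p a n (e : 'I_n -> L) (w : 'I_n -> dual a) :=
  onb (bp p) fullv e /\ forall X, X \in a -> forall i, br X (e i) = rval (w i) X *: e i.

Lemma exists_weights p a : S p -> abelian_in p a -> exists n (e : 'I_n -> L) (w : 'I_n -> dual a), weights p e w.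
Proof.
move=> hp [/subvP aP ab]; have H := bp_inner hss hp.
have [|||n [e [he hj]]] := @joint_spectral _ _ _ H [set f | exists2 X, X \in a & f = ad X] fullv.
- by move=> _ [X Xa ->]; apply: (ad_selfadj hss hp); apply: aP.
- by move=> _ _ v [X Xa ->] [Y Ya ->]; apply: (ad_commute hss); apply: ab.
- by move=> f v _ _; rewrite memvf.
exists n, e; have /choice [w hw] i : exists w : dual a, forall u' : subvs_of a, w u' = bp p (e i) (br (vsval u') (e i)) :> R.
  apply: (@lfun_linear R (subvs_of a) R^o) => c u v.
  by rewrite linearP (brPl hss) (ipDr H) (ipZr H).
exists w; split=> // X Xa i; rewrite /rval hw vsprojK //.
have [c hc] := hj (ad X) i (ex_intro2 _ _ X Xa erefl); have [oe _ _] := he.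
by rewrite -adE hc (ipZr H) oe eqxx mulr1.
Qed.

Section OneFlat.
Variables (p : 'End(L)) (a : {vspace L}) (n : nat) (e : 'I_n -> L) (w : 'I_n -> dual a).
Hypotheses (hp : S p) (ha : abelian_in p a) (hw : weights p e w).
Let H := bp_inner hss hp.
Let he := hw.1.

Lemma weights_eigenbasis X : X \in a -> eigenbasis p X e (fun i => rval (w i) X).
Proof. by move=> Xa; split=> // i; rewrite adE; apply: hw.2. Qed.

Lemma weights_P X : X \in a -> X \in P p.
Proof. by move: X; apply/subvP; case: ha. Qed.

Lemma weights_coef X v i : X \in a -> bp p (e i) (br X v) = rval (w i) X * bp p (e i) v.
Proof. by move=> Xa; apply: (eb_coef hss _ _ hp (weights_P Xa) (weights_eigenbasis Xa)). Qed.

Lemma weights_ne0 i : e i != 0.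
Proof.
by apply/negP => /eqP h; have [oe _ _] := he; have := oe i i; rewrite h (ip0l H) eqxx => /eqP; rewrite eq_sym oner_eq0.
Qed.

Lemma rootsP (al : dual a) : roots al <-> al != 0 /\ exists i, w i = al.
Proof.
split=> -[a0 h]; split=> //; last first.
  have [i <-] := h; apply/negP => /eqP h0; have := weights_ne0 i; rewrite -memv0 -h0.
  by move/negP; apply; apply/root_spaceP => X Xa; apply: hw.2.
apply: contrapT => hn; case/negP: h; rewrite -subv0; apply/subvP => v /root_spaceP hv.
rewrite memv0; apply/eqP/(onb_ext he) => i; rewrite (ip0r H); apply: contrapT => /eqP c0.
apply: hn; exists i; apply: rval_inj => X Xa; apply: (mulIf c0).
by rewrite -weights_coef // hv // (ipZr H).
Qed.

Lemma weight_opp i : exists j, w j = - w i.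
Proof.
have [c0|h] := pselect (exists j, bp p (e j) (p (e i)) != 0); last first.
  have := weights_ne0 i; rewrite -(symK (e i) hp) (_ : p (e i) = 0) ?linear0 ?eqxx //.
  apply: (onb_ext he) => j; rewrite (ip0r H); apply: contrapT => /eqP c; apply: h.
  by exists j.
have [j cj] := c0; exists j; apply: rval_inj => X Xa; apply: (mulIf cj); rewrite -weights_coef //.
rewrite -[X in br X](opprK X) -((memP p X).1 (weights_P Xa)) (brNl hss) -(sym_br _ _ hp) hw.2 //.
by rewrite linearZ /= rvalN -scaleNr (ipZr H).
Qed.

Lemma fil_weights X A v : X \in a -> fil X A v <-> forall i, ~ A (rval (w i) X) -> bp p (e i) v = 0.
Proof. by move=> Xa; apply: (fil_onb hss _ _ hp (weights_P Xa) (weights_eigenbasis Xa)). Qed.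

Lemma fil_weight X A i : X \in a -> A (rval (w i) X) -> fil X A (e i).
Proof. by move=> Xa h; apply: fil_eigen h _; apply: hw.2. Qed.

Lemma fil_weightE X A i : X \in a -> fil X A (e i) -> A (rval (w i) X).
Proof.
move=> Xa /(fil_weights _ _ Xa) h; apply: contrapT => /h; have [oe _ _] := he.
by rewrite oe eqxx => /eqP; rewrite oner_eq0.
Qed.

End OneFlat.

Lemma max_abelian_mem p a W : max_abelian p a -> W \in P p -> (forall X, X \in a -> br W X = 0) -> W \in a.
Proof.
move=> [[aP ab] hmax] hW cW; rewrite -(hmax (a + <[W]>)%VS _ (addvSl _ _)); first by rewrite memvE addvSr.
split.
  apply/subvP => v /memv_addP [u ua [u' /vlineP [c ->] ->]].
  by rewrite rpredD ?rpredZ // (subvP aP).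
move=> X Y /memv_addP [u ua [u' /vlineP [c ->] ->]] /memv_addP [v va [v' /vlineP [d ->] ->]].
by rewrite !(brDl hss) !brDr !(brZl hss) !brZr lie_br_alt cW // (br_eq0C hss (cW u ua)) ab // ?scaler0 ?addr0.
Qed.

(** Inclusion of parabolic subalgebras: geometrically, the simplex with W in its interior is a face
    of the one with Z in its interior. *)
Definition parle Z W := forall v, fil Z (ge_ 0) v -> fil W (ge_ 0) v.

Section ChamberFacts.
Variable C : chamber L.
Local Notation o := (ch_pt C).
Local Notation a := (ch_a C).
Local Notation H0 := (ch_reg C).
Variables (n : nat) (e : 'I_n -> L) (w : 'I_n -> dual (ch_a C)).
Hypothesis hw : weights o e w.

Let ho : S o := ch_ptP C.
Let ha : abelian_in o a := (ch_aP C).1.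

Lemma reg_weight i : rval (w i) H0 = 0 -> w i = 0.
Proof.
move=> h; apply/eqP/negPn/negP => w0; have : roots (w i) by apply/(rootsP ho ha hw); split=> //; exists i.
by move/(ch_regP (c := C)); rewrite h eqxx.
Qed.

Lemma positiveP (al : dual a) : positive_roots al <-> 0 < rval al H0 /\ exists i, w i = al.
Proof.
split=> [[/(rootsP ho ha hw) [_ h] h']|[h h']] //; split=> //; apply/(rootsP ho ha hw); split=> //.
by apply: contraTneq h => ->; rewrite rval0 ltxx.
Qed.

Lemma chamber_pos X i : spherical_chamber C X -> 0 < rval (w i) H0 -> 0 <= rval (w i) X.
Proof. by move=> [_ _ h] h'; apply: h; apply/positiveP; split=> //; exists i. Qed.

Lemma chamber_zero X i : rval (w i) H0 = 0 -> rval (w i) X = 0.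
Proof. by move=> /reg_weight ->; rewrite rval0. Qed.

Lemma chamber_neg X i : spherical_chamber C X -> rval (w i) H0 < 0 -> rval (w i) X <= 0.
Proof.
move=> hX h; have [j hj] := weight_opp ho ha hw i.
have : 0 <= rval (w j) X by apply: chamber_pos => //; rewrite hj rvalN oppr_gt0.
by rewrite hj rvalN oppr_ge0.
Qed.

Lemma chamber_mem X : spherical_chamber C X -> X \in a. Proof. by case. Qed.
Lemma chamber_usphere X : spherical_chamber C X -> usphere o X.
Proof. by case=> Xa nX _; split=> //; apply: weights_P ha _ Xa. Qed.

(** Decomposing a positive root that is not simple lowers its value at the regular vector; the
    recursion is on the number of weights of positive value below that value. *)
Lemma positive_ind (Q : dual a -> Prop) : (forall al, simple_roots al -> Q al) ->
  (forall be ga, positive_roots be -> positive_roots ga -> Q be -> Q ga -> Q (be + ga)) ->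
  forall al, positive_roots al -> Q al.
Proof.
move=> h1 h2; pose N (al : dual a) := #|[set i | 0 < rval (w i) H0 < rval al H0]%SET|.
suff h k al : (N al < k)%N -> positive_roots al -> Q al by move=> al; apply: (h (N al).+1).
elim: k al => // k IH al; rewrite ltnS => Nk pal.
have [sal|nsal] := pselect (simple_roots al); first exact: h1.
have [be [ga [pbe pga e1]]] : exists be ga, [/\ positive_roots be, positive_roots ga & al = be + ga].
  apply: contrapT => hn; apply: nsal; split=> // be ga pbe pga e1; apply: hn; by exists be, ga.
have dec b c : positive_roots b -> positive_roots c -> al = b + c -> (N b < k)%N.
  move=> /positiveP [b0 [i hi]] /positiveP [c0 _] e2; apply: leq_trans Nk; apply: proper_card.
  have lt : rval b H0 < rval al H0 by rewrite e2 rvalD ltrDl.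
  apply/properP; split; last by exists i; rewrite !inE hi ?b0 ?lt ?ltxx.
  by apply/fintype.subsetP => j; rewrite !inE => /andP [-> /= h]; apply: lt_trans lt.
rewrite e1; apply: h2 => //; apply: IH => //; first exact: dec pbe pga e1.
by apply: dec pga pbe _; rewrite addrC.
Qed.

Lemma simple_below Z (be : dual a) : spherical_chamber C Z -> positive_roots be -> 0 < rval be Z ->
  exists al : dual a, [/\ simple_roots al, 0 < rval al Z & forall X, spherical_chamber C X -> rval al X <= rval be X].
Proof.
move=> hZ; move: be; apply: positive_ind => [al sal al0|be ga pbe pga h1 h2]; first by exists al.
have pos (b : dual a) X : positive_roots b -> spherical_chamber C X -> 0 <= rval b X by move=> hb [_ _]; apply.
rewrite rvalD => hs; have [b0|b0] := ltP 0 (rval be Z).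
  have [al [s1 s2 s3]] := h1 b0; exists al; split=> // X hX; rewrite rvalD.
  by apply: le_trans (s3 X hX) _; rewrite lerDl; apply: pos.
have g0 : 0 < rval ga Z by move: hs b0; move: (rval be Z) (rval ga Z) => x y; lra.
have [al [s1 s2 s3]] := h2 g0; exists al; split=> // X hX; rewrite rvalD.
by apply: le_trans (s3 X hX) _; rewrite lerDr; apply: pos.
Qed.

Lemma zero_simple Z X : spherical_chamber C Z -> spherical_chamber C X ->
  (forall al : dual a, simple_roots al -> rval al Z = 0 -> rval al X = 0) ->
  forall be : dual a, positive_roots be -> rval be Z = 0 -> rval be X = 0.
Proof.
move=> hZ hX h; apply: positive_ind => [//|be ga pbe pga h1 h2]; rewrite !rvalD => hs.
have b0 : 0 <= rval be Z by case: hZ => _ _; apply.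
have g0 : 0 <= rval ga Z by case: hZ => _ _; apply.
by rewrite h1 ?h2 ?addr0 //; move: hs b0 g0; move: (rval be Z) (rval ga Z) => x y; lra.
Qed.

Lemma face_sub t X : face C t -> t X -> spherical_chamber C X.
Proof. by move=> [_ [Th _ ->]] []. Qed.

(** This removes chambers from the description of a face. For the converse, W commutes with the flat
    because each vector of the flat lies in the parabolic of Z; maximality then puts W in the flat,
    where the root inequalities can be compared. *)
Lemma face_intP t Z W : face C t -> face_int C t Z -> usphere o W -> t W <-> parle Z W.
Proof.
move=> hf [tZ hZ] [WP nW]; have cZ := face_sub hf tZ; have Za := chamber_mem cZ; split=> [tW|h].
  have cW := face_sub hf tW; have Wa := chamber_mem cW.
  move=> v /(fil_weights ho ha hw _ _ Za) h; apply/(fil_weights ho ha hw _ _ Wa) => i.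
  rewrite /ge_ /= => /negP; rewrite -ltNge => wW; apply: h; rewrite /ge_ /=; apply/negP; rewrite -ltNge.
  have hneg : rval (w i) H0 < 0.
    have [h|//|h] := ltgtP 0 (rval (w i) H0); first by move: wW; rewrite ltNge chamber_pos.
    by move: wW; rewrite chamber_zero ?ltxx.
  rewrite lt_neqAle chamber_neg // andbT; apply/eqP => wZ.
  have [j hj] := weight_opp ho ha hw i.
  have : rval (w j) W = 0.
    apply: (zero_simple cZ cW) => [al sal alZ||]; first exact: hZ.
      by apply/positiveP; split; [rewrite hj rvalN oppr_gt0|exists j].
    by rewrite hj rvalN wZ oppr0.
  by rewrite hj rvalN => /eqP; rewrite oppr_eq0 => /eqP w0; move: wW; rewrite w0 ltxx.
have ZP := weights_P ha Za.
have cW X : X \in a -> br W X = 0.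
  move=> Xa; apply: (fil_commute hss ho WP (weights_P ha Xa)); apply: h; apply: commute_fil.
  by case: ha => _; apply.
have Wa : W \in a := max_abelian_mem (ch_aP C) WP cW.
have wle i : 0 <= rval (w i) Z -> 0 <= rval (w i) W.
  move=> wZ; apply: (@fil_weightE _ _ _ _ _ ho ha hw W (ge_ 0)) => //; apply: h.
  by apply: (fil_weight hw).
have cWs : spherical_chamber C W.
  split=> // al pal; have /positiveP [al0 [i hi]] := pal; rewrite -hi; apply: wle.
  by apply: chamber_pos => //; rewrite hi.
have [_ [Th sTh tE]] := hf; rewrite tE; split=> // al hal.
have /(_ al hal) alZ : forall al, Th al -> rval al Z = 0 by move: tZ; rewrite tE => -[].
have /positiveP [al0 [i hi]] := (sTh al hal).1; have [j hj] := weight_opp ho ha hw i.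
have h1 : 0 <= rval (w i) W by apply: wle; rewrite hi alZ.
have h2 : 0 <= rval (w j) W by apply: wle; rewrite hj rvalN hi alZ oppr0.
by move: h1 h2; rewrite hj rvalN hi; move: (rval al W) => y; lra.
Qed.

(** An interior point is one on which the fewest weights are nonnegative: if a simple root vanished
    at Z but not on the whole face, adding a point where it is positive would make the opposite
    weight negative and leave no new weight nonnegative. *)
Lemma exists_face_int t : face C t -> exists Z, face_int C t Z.
Proof.
move=> hf; pose N X := #|[set i | 0 <= rval (w i) X]%SET|.
have [[Z1 tZ1] [Th sTh tE]] := hf.
have ex : exists k, `[< exists2 Z, t Z & N Z = k >] by exists (N Z1); apply/asboolP; exists Z1.
case: (ex_minnP ex) => k /asboolP [Z tZ Zk] kmin; exists Z; split=> // al sal alZ A' tA'.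
have cZ := face_sub hf tZ; have cA := face_sub hf tA'.
have [Za _ pZ] := cZ; have [Aa _ pA] := cA; apply: contrapT => /eqP al0.
have alA : 0 < rval al A' by rewrite lt_neqAle eq_sym al0 pA //; case: sal.
have nz : Z + A' != 0.
  by apply: contraTneq alA => h; rewrite (_ : rval al A' = 0) ?ltxx // -[LHS]add0r -{1}alZ -rvalDr h -(scale0r (0 : L)) rvalZr mul0r.
have Ra : Z + A' \in a by rewrite rpredD.
have np : 0 < knorm (Z + A').
  by rewrite (knormE hss (weights_P ha Ra)) (nrm_gt0 (bp_inner hss ho)).
pose W := (knorm (Z + A'))^-1 *: (Z + A').
have rW (be : dual a) : rval be W = (knorm (Z + A'))^-1 * (rval be Z + rval be A') by rewrite rvalZr rvalDr.
have c0 : 0 < (knorm (Z + A'))^-1 by rewrite invr_gt0.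
have Wa : W \in a by rewrite rpredZ.
have cW : spherical_chamber C W.
  split=> //.
    rewrite (knormE hss (weights_P ha Wa)) (nrmZ (bp_inner hss ho)) -(knormE hss (weights_P ha Ra)).
    by rewrite gtr0_norm // mulVf // gt_eqF.
  by move=> be pbe; rewrite rW mulr_ge0 ?(ltW c0) // addr_ge0 ?pZ ?pA.
have tW : t W.
  rewrite tE; split=> // be hbe; rewrite rW; move: tZ tA'; rewrite tE => -[_ ->] // [_ ->] //.
  by rewrite addr0 mulr0.
have : (k <= N W)%N by apply: kmin; apply/asboolP; exists W.
rewrite leqNgt -Zk => /negP []; apply: proper_card; apply/properP; split.
  apply/fintype.subsetP => i; rewrite !inE rW pmulr_rge0 // => hi.
  have [h|h|h] := ltgtP 0 (rval (w i) H0); [exact: chamber_pos| |by rewrite chamber_zero].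
  have := chamber_neg cA h; move: hi; move: (rval _ _) (rval _ _) => x y; lra.
have /positiveP [al1 [i hi]] := sal.1; have [j hj] := weight_opp ho ha hw i.
exists j; rewrite !inE ?rW hj !rvalN hi alZ ?oppr0 // pmulr_rge0 // add0r oppr_ge0 -ltNge //.
Qed.

Lemma exists_face Z : spherical_chamber C Z -> exists t, face C t /\ face_int C t Z.
Proof.
move=> hZ; exists [set A | spherical_chamber C A /\ forall al : dual a, simple_roots al /\ rval al Z = 0 -> rval al A = 0].
split; last by split=> [|al sal alZ A' [_ h]]; [split=> // al []|apply: h].
split; first by exists Z; split=> // al [].
by exists [set al : dual a | simple_roots al /\ rval al Z = 0] => // al [].
Qed.

Lemma simple_plus_below t Z i : face C t -> t Z -> 0 < rval (w i) Z ->
  exists al, simple_plus C t al /\ forall X, spherical_chamber C X -> rval al X <= rval (w i) X.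
Proof.
move=> hf tZ wZ; have cZ := face_sub hf tZ.
have pw : positive_roots (w i).
  apply/positiveP; split; last by exists i.
  have [//|h'|h'] := ltgtP 0 (rval (w i) H0); first by move: wZ; rewrite ltNge chamber_neg.
  by move: wZ; rewrite chamber_zero ?ltxx.
have [al [sal alZ le]] := simple_below cZ pw wZ; exists al; split=> //; split=> // A' [tA' hA'].
rewrite lt_neqAle; have [_ _ pA] := face_sub hf tA'; rewrite pA ?andbT; last by case: sal.
by apply/eqP => h0; move: alZ; rewrite (hA' al sal (esym h0) Z tZ) ltxx.
Qed.

Lemma simple_plus_lower t Z X (c : R) : face C t -> t Z -> spherical_chamber C X ->
  (forall al, simple_plus C t al -> c <= rval al X) ->
  forall v, fil Z (gt_ 0) v -> fil X (ge_ c) v.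
Proof.
move=> hf tZ cX h v; have cZ := face_sub hf tZ; have Za := chamber_mem cZ; have Xa := chamber_mem cX.
move=> /(fil_weights ho ha hw _ _ Za) hv; apply/(fil_weights ho ha hw _ _ Xa) => i.
move=> /negP; rewrite -ltNge => wX; apply: hv; rewrite /gt_ /= => wZ; move: wX; rewrite ltNge => /negP; apply.
by have [al [sal le]] := simple_plus_below hf tZ wZ; apply: le_trans (le X cX); apply: h.
Qed.

Lemma simple_plus_parle t Z X : face C t -> t Z -> spherical_chamber C X ->
  (forall al, simple_plus C t al -> 0 < rval al X) -> parle X Z.
Proof.
move=> hf tZ cX h v; have cZ := face_sub hf tZ; have Za := chamber_mem cZ; have Xa := chamber_mem cX.
move=> /(fil_weights ho ha hw _ _ Xa) hv; apply/(fil_weights ho ha hw _ _ Za) => i.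
move=> /negP; rewrite -ltNge => wZ; apply: hv; rewrite /ge_ /=; apply/negP; rewrite -ltNge.
have [j hj] := weight_opp ho ha hw i; have wZ' : 0 < rval (w j) Z by rewrite hj rvalN oppr_gt0.
have [al [sal le]] := simple_plus_below hf tZ wZ'; rewrite -oppr_gt0 -rvalN -hj.
exact: lt_le_trans (h al sal) (le X cX).
Qed.

End ChamberFacts.

End Weights.

(** * Chamber-free descriptions of simplices and of regularity *)

Section Simplices.
Variables (R : realType) (L : liealg R).
Hypothesis hss : semisimple L.
Implicit Types (X Y Z U V W u v z : L) (f g p q r : 'End(L)) (A : set R) (a : {vspace L}).
Local Notation br := (@lie_br R L).
Local Notation S := (@symspace R L).
Local Notation P := (@pspace R L).

Lemma exists_max_abelian p b : S p -> abelian_in p b -> exists a, max_abelian p a /\ (b <= a)%VS.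
Proof.
move=> hp hb; pose ok k := `[< exists a, [/\ abelian_in p a, (b <= a)%VS & \dim a = k] >].
have ok0 : exists k, ok k by exists (\dim b); apply/asboolP; exists b.
have okle k : ok k -> (k <= \dim {:L})%N by move=> /asboolP [a [_ _ <-]]; apply: dimvS; apply: subvf.
case: (ex_maxnP ok0 okle) => k /asboolP [a [ha ba ak]] kmax; exists a; split=> //; split=> // c hc ac.
apply/eqP; rewrite eq_sym eqEdim ac ak; apply: kmax; apply/asboolP; exists c; split=> //.
exact: subv_trans ac.
Qed.

(* A small generic perturbation moves X off the walls without crossing any. *)
Lemma exists_regular a n (w : 'I_n -> dual a) X : X \in a ->
  exists H, [/\ H \in a, forall i, w i != 0 -> rval (w i) H != 0,
    forall i, 0 < rval (w i) X -> 0 < rval (w i) H & forall i, rval (w i) X < 0 -> rval (w i) H < 0].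
Proof.
move=> Xa0; suff h (s : seq 'I_n) : exists H, [/\ H \in a, forall i, i \in s -> w i != 0 -> rval (w i) H != 0,
    forall i, 0 < rval (w i) X -> 0 < rval (w i) H & forall i, rval (w i) X < 0 -> rval (w i) H < 0].
  by have [H [h1 h2 h3 h4]] := h (enum 'I_n); exists H; split=> // i; apply: h2; rewrite mem_enum.
elim: s => [|j s [H [h1 h2 h3 h4]]]; first by exists X.
have [ok|nok] := pselect (w j != 0 -> rval (w j) H != 0).
  by exists H; split=> // i; rewrite inE => /orP [/eqP ->|/h2].
have wj : w j != 0 by apply: contra_notT nok => /negPn/eqP ->; rewrite eqxx.
have Hj : rval (w j) H = 0 by apply/eqP; apply: contra_notT nok.
have [D Da wD] : exists2 D, D \in a & rval (w j) D != 0.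
  apply: contrapT => hn; case/negP: wj; apply/eqP/rval_inj => Y Ya; rewrite rval0; apply: contrapT => /eqP c.
  by apply: hn; exists Y.
have [c c0 hc] : exists2 c : R, 0 < c & forall i, rval (w i) H != 0 -> c * `|rval (w i) D| < `|rval (w i) H|.
  elim: (n) (w) => [|m IH] w'; first by exists 1 => // -[].
  have [c c0 hc] := IH (fun i => w' (lift ord0 i)).
  have [z0|nz] := eqVneq (rval (w' ord0) H) 0.
    exists c => // i; case: (unliftP ord0 i) => [i'|] ->; first exact: hc.
    by rewrite z0 eqxx.
  have [d d0 hd] : exists2 d : R, 0 < d & d * `|rval (w' ord0) D| < `|rval (w' ord0) H|.
    exists (`|rval (w' ord0) H| / (`|rval (w' ord0) D| + 1)); first by rewrite divr_gt0 ?normr_gt0 // ltr_wpDl.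
    have : 0 < `|rval (w' ord0) H| by rewrite normr_gt0.
    have : 0 <= `|rval (w' ord0) D| by [].
    move: `|_| => x x0; move: `|_| => y y0; rewrite mulrAC ltr_pdivrMr ?ltr_wpDl //; nra.
  exists (Num.min c d); first by rewrite lt_min c0.
  move=> i; case: (unliftP ord0 i) => [i'|] -> hi.
    by apply: le_lt_trans (hc i' hi); rewrite ler_wpM2r // ge_min lexx.
  by apply: le_lt_trans hd; rewrite ler_wpM2r // ge_min lexx orbT.
exists (H + c *: D); have e1 i : rval (w i) (H + c *: D) = rval (w i) H + c * rval (w i) D by rewrite rvalDr rvalZr.
have bd i : rval (w i) H != 0 -> `|c * rval (w i) D| < `|rval (w i) H| by move=> /hc; rewrite normrM gtr0_norm.
split.
- by rewrite rpredD // rpredZ.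
- move=> i; rewrite inE e1 => /orP [/eqP ->|is_ wi].
    by move=> _; rewrite Hj add0r mulf_neq0 // gt_eqF.
  have := bd i (h2 i is_ wi); apply: contraTneq => h.
  by rewrite -leNgt (_ : rval (w i) H = - (c * rval (w i) D)) ?normrN //; apply/eqP; rewrite -addr_eq0 h.
- move=> i /h3 hi; rewrite e1; have := bd i (lt0r_neq0 hi); rewrite (gtr0_norm hi).
  by move: (c * _) => x; rewrite ltr_norml => /andP [h _]; move: h; lra.
- move=> i /h4 hi; rewrite e1; have := bd i (ltr0_neq0 hi); rewrite (ltr0_norm hi).
  by move: (c * _) => x; rewrite ltr_norml => /andP [_ h]; move: h; lra.
Qed.

(** No root takes opposite signs on V and Z, so a chamber whose interior contains a small regular
    perturbation of V + Z contains both in its closure. *)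
Lemma exists_chamber p V Z : S p -> usphere p V -> usphere p Z -> br V Z = 0 ->
  (forall v, fil Z (gt_ 0) v -> fil V (ge_ 0) v) ->
  exists C : chamber L, [/\ ch_pt C = p, spherical_chamber C V & spherical_chamber C Z].
Proof.
move=> hp [hV nV] [hZ nZ] hVZ hsgn.
have [a [hma ba]] : exists a, max_abelian p a /\ (<[V]> + <[Z]> <= a)%VS.
  apply: exists_max_abelian => //; split.
    by apply/subvP => v /memv_addP [u /vlineP [c ->] [u' /vlineP [d ->] ->]]; rewrite rpredD ?rpredZ.
  move=> X Y /memv_addP [u /vlineP [c ->] [u' /vlineP [d ->] ->]] /memv_addP [v /vlineP [c' ->] [v' /vlineP [d' ->] ->]].
  by rewrite !(brDl hss) !brDr !(brZl hss) !brZr !lie_br_alt hVZ (br_eq0C hss hVZ) !scaler0 !addr0.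
have Va : V \in a by apply: (subvP ba); rewrite memvE addvSl.
have Za : Z \in a by apply: (subvP ba); rewrite memvE addvSr.
have ha := hma.1; have [n [e [w hw]]] := exists_weights hss hp ha.
have [H [Ha Hreg Hpos Hneg]] := exists_regular w (rpredD Va Za).
have hreg : forall al : dual a, roots al -> rval al H != 0.
  by move=> al /(rootsP hss hp ha hw) [al0 [i hi]]; rewrite -hi; apply: Hreg; rewrite hi.
have pp i : 0 < rval (w i) Z -> 0 <= rval (w i) V.
  move=> wZ; apply: (@fil_weightE _ _ hss _ _ _ _ _ hp ha hw V (ge_ 0)) => //; apply: hsgn.
  exact: (fil_weight hw).
have nn i : rval (w i) Z < 0 -> rval (w i) V <= 0.
  have [j hj] := weight_opp hss hp ha hw i; have := pp j; rewrite hj !rvalN oppr_gt0 oppr_ge0.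
  exact.
have key i : 0 < rval (w i) H -> 0 <= rval (w i) V /\ 0 <= rval (w i) Z.
  move=> wH; have : 0 <= rval (w i) (V + Z).
    by rewrite leNgt; apply/negP => /Hneg h; move: (lt_trans wH h); rewrite ltxx.
  rewrite rvalDr; have := pp i; have := nn i; move: (rval (w i) V) (rval (w i) Z) => x y.
  move=> h1 h2 h3; have [y0|y0] := ltP y 0; first by have := h1 y0; lra.
  by have [y1|y1] := ltP 0 y; [have := h2 y1|]; split; lra.
exists (Chamber hp hma Ha hreg); split=> //; split=> // al [/(rootsP hss hp ha hw) [_ [i hi]] h];
  by have [] := key i; rewrite hi.
Qed.

(** The simplex having the ideal point of Z in its interior, described without a base point or a
    chamber. *)
Definition Sz Z : set (ideal L) :=
  [set xi | exists r W, [/\ S r, usphere r W, parle Z W & xi = endpt r W]].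

Lemma Sz_eq Z Z' : parle Z Z' -> parle Z' Z -> Sz Z = Sz Z'.
Proof.
move=> h h'; apply/seteqP; split=> xi [r [W [h1 h2 h3 h4]]]; exists r, W; split=> // v hv; apply: h3.
  exact: h'.
exact: h.
Qed.

Lemma samefil_parle (Z Z' : L) : samefil Z Z' -> parle Z Z'. Proof. by move=> h v /h. Qed.

Lemma Sz_samefil Z Z' : samefil Z Z' -> Sz Z = Sz Z'.
Proof. by move=> h; apply: Sz_eq; apply: samefil_parle => //; apply: samefil_sym. Qed.

Lemma mem_Sz p Z W : S p -> usphere p W -> Sz Z (endpt p W) <-> parle Z W.
Proof.
move=> hp uW; split=> [[r [W' [hr uW' h /(endptP hss hp hr uW uW') h']]] v /h /h' //|h].
by exists p, W.
Qed.

Lemma simplex_Sz (C : chamber L) t Z : face C t -> face_int C t Z -> [set endpt (ch_pt C) X | X in t] = Sz Z.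
Proof.
move=> hf hZ; have ho := ch_ptP C; have [n [e [w hw]]] := exists_weights hss ho (ch_aP C).1.
have us X : t X -> usphere (ch_pt C) X by move=> /(face_sub hf) /chamber_usphere.
apply/seteqP; split=> [_ [X tX <-]|xi [r [W [hr uW hle ->]]]].
  by apply/(mem_Sz _ ho (us X tX)); apply/(face_intP hss hw hf hZ (us X tX)).
have [WP nW] := uW; have [W' [hW' hs nW']] := exists_dir hss hr ho WP.
have uW' : usphere (ch_pt C) W' by split; rewrite ?nW'.
exists W'; last by apply/(endptP hss ho hr uW' uW)/samefil_sym.
by apply/(face_intP hss hw hf hZ uW') => v /hle /hs.
Qed.

Lemma exists_face_at p Z : S p -> usphere p Z -> exists (C : chamber L) t,
  [/\ ch_pt C = p, face C t & face_int C t Z].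
Proof.
move=> hp uZ; have [|v hv|C [h1 h2 _]] := exists_chamber hp uZ uZ; first exact: lie_br_alt.
  by apply: fil_sub hv => b; apply: ltW.
have [t [h3 h4]] := exists_face h2; by exists C, t.
Qed.

Lemma fsp_parle p Z W : S p -> Z \in P p -> W \in P p -> parle Z W <-> (fsp Z (ge_ 0) <= fsp W (ge_ 0))%VS.
Proof.
move=> hp hZ hW; split=> [h|/subvP h v hv].
  by apply/subvP => v /(fspP hss _ _ hp hZ) hv; apply/(fspP hss _ _ hp hW)/h.
by apply/(fspP hss _ _ hp hW)/h/(fspP hss _ _ hp hZ).
Qed.

Lemma samefil_dim p q X Y x : S p -> S q -> X \in P p -> Y \in P q -> samefil X Y ->
  \dim (fsp X (ge_ x)) = \dim (fsp Y (ge_ x)).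
Proof.
move=> hp hq hX hY h; congr (\dim _); apply/vspaceP => v.
apply/idP/idP => [/(fspP hss _ _ hp hX)|/(fspP hss _ _ hq hY)] hv.
  exact/(fspP hss _ _ hq hY)/h.
exact/(fspP hss _ _ hp hX)/h.
Qed.

Lemma sametype_dim p q X Y x : S p -> S q -> X \in P p -> Y \in P q -> sametype X Y ->
  \dim (fsp X (ge_ x)) = \dim (fsp Y (ge_ x)).
Proof.
move=> hp hq hX hY [g hg h]; have ag := isomG_aut hss hg.
by rewrite -(fsp_dim_aut hss _ hp hX ag); apply: (samefil_dim _ (act_sym ag hp) hq (pspace_act ag hX) hY h).
Qed.

Lemma Sz_types Z Z' : sametype Z Z' -> [set type_of xi | xi in Sz Z] `<=` [set type_of xi | xi in Sz Z'].
Proof.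
move=> [g hg h] _ [xi [r [W [hr uW hle ->]]] <-]; have ag := isomG_aut hss hg.
exists (endpt (act g r) (g W)).
  apply/(mem_Sz _ (act_sym ag hr) (usphere_act ag uW)) => v /h hv.
  by rewrite -(autVK ag v); apply/(fil_autE _ _ _ ag)/hle/(fil_autE _ _ _ ag); rewrite (autVK ag).
apply/(type_ofP hss (act_sym ag hr) hr (usphere_act ag uW) uW)/(sametype_sym hss).
by exists g.
Qed.

(** For unit vectors and positive c this is regularity of V with respect to the simplex of Z, by
    [regular_dir_reg] and [reg_regular_dir]. It passes through limits, opposites and rescaling
    without choosing a chamber. *)
Definition reg (c : R) Z V := br Z V = 0 /\ forall v, fil Z (gt_ 0) v -> fil V (ge_ c) v.

Lemma Sz_face (C : chamber L) t Z : usphere (ch_pt C) Z -> face C t -> Sz Z = [set endpt (ch_pt C) X | X in t] -> t Z.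
Proof.
move=> uZ hf e1; have ho := ch_ptP C; have : Sz Z (endpt (ch_pt C) Z) by apply/(mem_Sz _ ho uZ).
rewrite e1 => -[Y tY]; have cY := face_sub hf tY; have uY := chamber_usphere cY.
move=> /(endptP hss ho ho uY uZ) h; have [hY _] := uY; have [hZ _] := uZ.
by rewrite -(samefil_eq hss ho hY hZ h).
Qed.

Lemma regular_dir_reg c p Z X : usphere p Z -> regular_dir c (Sz Z) p X -> usphere p X /\ reg c Z X.
Proof.
move=> uZ [C [t [hCp hf e1 cX hX]]]; subst p; have ho := ch_ptP C.
have [n [e [w hw]]] := exists_weights hss ho (ch_aP C).1.
have uX := chamber_usphere cX; split=> //; have tZ := Sz_face uZ hf e1.
have cZ := face_sub hf tZ; split; first by have [[_ h] _] := ch_aP C; apply: h; [case: cZ|case: cX].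
move=> v; apply: (simple_plus_lower hss hw hf tZ cX) => al /hX.
by case: uX => _ ->; rewrite mulr1.
Qed.

Lemma tau_regular_parle p Z X : usphere p Z -> tau_regular_dir (Sz Z) p X -> usphere p X /\ parle X Z.
Proof.
move=> uZ [C [t [hCp hf e1 cX hX]]]; subst p; have ho := ch_ptP C.
have [n [e [w hw]]] := exists_weights hss ho (ch_aP C).1.
split; first exact: chamber_usphere.
exact: (simple_plus_parle hss hw hf (Sz_face uZ hf e1) cX).
Qed.

Lemma reg_chamber c p Z V : S p -> usphere p Z -> usphere p V -> 0 < c -> reg c Z V ->
  exists (C : chamber L) t, [/\ ch_pt C = p, face C t, Sz Z = [set endpt p Y | Y in t], spherical_chamber C V &
    forall al, simple_plus C t al -> c <= rval al V].
Proof.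
move=> hp uZ uV c0 [hc hr].
have [|v hv|C [hCp cV cZ]] := exists_chamber hp uV uZ; first exact: br_eq0C.
  by apply: fil_sub (hr v hv) => b; apply: le_trans; apply: ltW.
subst p; have [n [e [w hw]]] := exists_weights hss (ch_ptP C) (ch_aP C).1.
have [t [hf hi]] := exists_face cZ; exists C, t; split=> //; first by rewrite (simplex_Sz hf hi).
move=> al [sal hal]; have /(positiveP hss hw) [_ [i ei]] := sal.1; rewrite -ei.
apply: (@fil_weightE _ _ hss _ _ _ _ _ hp (ch_aP C).1 hw V (ge_ c)); first exact: (chamber_mem cV).
apply: hr; apply: (fil_weight hw); first exact: (chamber_mem cZ).
by rewrite /gt_ /= ei; apply: hal.
Qed.

Lemma reg_regular_dir c p Z V : S p -> usphere p Z -> usphere p V -> 0 < c -> reg c Z V ->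
  regular_dir c (Sz Z) p V /\ tau_regular_dir (Sz Z) p V.
Proof.
move=> hp uZ uV c0 hr; have [C [t [h1 h2 h3 h4 h5]]] := reg_chamber hp uZ uV c0 hr.
split; exists C, t; split=> // al /h5 h; first by case: uV => _ ->; rewrite mulr1.
exact: lt_le_trans h.
Qed.

Lemma reg_parle c p Z V : S p -> usphere p Z -> usphere p V -> 0 < c -> reg c Z V -> parle V Z.
Proof.
by move=> hp uZ uV c0 hr; have [_ /(tau_regular_parle uZ) []] := reg_regular_dir hp uZ uV c0 hr.
Qed.

Lemma reg_opp c p Z V : S p -> Z \in P p -> V \in P p -> reg c Z V -> reg c (- Z) (- V).
Proof.
move=> hp hZ hV [h1 h2]; split; first by rewrite (brNl hss) brNr h1 !oppr0.
move=> v /(fil_oppE hss) hv; apply/(fil_oppE hss); rewrite -(symK v hp); apply: fil_sub (fil_sym hss hp hV (h2 (p v) _)) => //.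
by apply: fil_sub (fil_sym hss hp hZ hv) => b; rewrite /opp_ /= opprK.
Qed.

Lemma dirP p X : S p -> usphere p X -> dir p (endpt p X) = X.
Proof.
move=> hp uX; rewrite /dir; case: xgetP => [Y _ [uY /(endptP hss hp hp uY uX) h]|/(_ X) []//].
by case: uX uY => hX _ [hY _]; apply: (samefil_eq hss hp hY hX h).
Qed.

End Simplices.

Lemma mem_undup_image (T : eqType) n (f : 'I_n -> T) (Q : pred 'I_n) x :
  x \in undup [seq f i | i <- enum 'I_n & Q i] -> exists2 i, Q i & x = f i.
Proof.
rewrite mem_undup; elim: (enum _) => [//|i s IH] /=; case: ifP => // Qi.
by rewrite inE => /orP [/eqP ->|//]; exists i.
Qed.

(** * Flags represented by vectors of type zeta *)

Section Flags.
Variables (R : realType) (L : liealg R).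
Hypothesis hss : semisimple L.
Implicit Types (X Y Z U V W u v z : L) (f g p q r : 'End(L)) (A : set R) (a : {vspace L}).
Local Notation B := (@killing R L).
Local Notation S := (@symspace R L).
Local Notation P := (@pspace R L).

Opaque type_of.

Lemma geoN p X t : S p -> X \in P p -> geo p (- X) t = geo p X (- t).
Proof. by move=> hp hX; rewrite -scaleN1r (geoZ hss (-1) t hp hX) mulN1r. Qed.

Lemma usphere_samefil p q X Y : S p -> S q -> usphere p X -> Y \in P q -> samefil X Y -> usphere q Y.
Proof. by move=> hp hq [hX nX] hY h; split=> //; rewrite -(samefil_knorm hss hp hq hX hY h). Qed.

Lemma usphereN p X : S p -> usphere p X -> usphere p (- X).
Proof. by move=> hp [hX nX]; split; rewrite ?rpredN // (knormN hss hp). Qed.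

Lemma parle_opp p X Z : S p -> X \in P p -> Z \in P p -> parle X Z -> parle (- X) (- Z).
Proof.
move=> hp hX hZ h v /(fil_oppE hss) hv; apply/(fil_oppE hss); rewrite -(symK v hp).
apply: fil_sub (fil_sym hss hp hZ (h (p v) _)) => //.
by apply: fil_sub (fil_sym hss hp hX hv) => b; rewrite /opp_ /= opprK.
Qed.

Lemma simplex_int_Sz p X Sg : S p -> usphere p X -> simplex_int Sg (endpt p X) -> Sg = Sz X.
Proof.
move=> hp uX [C [t [hf -> [X1 hX1 e1]]]]; rewrite (simplex_Sz hss hf hX1); apply: Sz_samefil.
have u1 : usphere (ch_pt C) X1 by apply/chamber_usphere/(face_sub hf)/hX1.1.
exact/samefil_sym/(endptP hss hp (ch_ptP C) uX u1).
Qed.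

Lemma simplex_int_self p X : S p -> usphere p X -> simplex_int (Sz X) (endpt p X) /\ simplex (Sz X).
Proof.
move=> hp uX; have [C [t [<- hf hX]]] := exists_face_at hss hp uX.
by split; exists C, t; split=> //; rewrite ?(simplex_Sz hss hf hX) //; exists X.
Qed.

Variables (C : chamber L) (tau : set L) (zeta : L).
Hypotheses (htau : face C tau) (hzeta : face_int C tau zeta).
Local Notation T := [set type_of (endpt (ch_pt C) X) | X in tau].
Local Notation zt := (type_of (endpt (ch_pt C) zeta)).

Definition typed p Z := usphere p Z /\ sametype zeta Z.

Let ho : S (ch_pt C) := ch_ptP C.
Lemma zeta_usphere : usphere (ch_pt C) zeta.
Proof. exact/chamber_usphere/(face_sub htau)/hzeta.1. Qed.

Lemma typed_samefil p q Z Z' : S p -> S q -> typed p Z -> Z' \in P q -> samefil Z Z' -> typed q Z'.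
Proof.
move=> hp hq [uZ tZ] hZ' h; split; first exact: (usphere_samefil hp hq uZ hZ' h).
exact: (sametype_trans hss tZ (sametype_fil h)).
Qed.

Lemma typed_act g p Z : S p -> isomG g -> typed p Z -> typed (act g p) (g Z).
Proof.
move=> hp hg [uZ tZ]; split; first exact: (usphere_act (isomG_aut hss hg) uZ).
by apply: (sametype_trans hss tZ); exists g.
Qed.

Lemma exists_typed p : S p -> exists Z, typed p Z.
Proof.
move=> hp; have [Z [hZ h nZ]] := exists_dir hss ho hp zeta_usphere.1.
exists Z; apply: (typed_samefil ho hp _ hZ h); split; first exact: zeta_usphere.
exact: sametype_refl.
Qed.

(** A simplex has at most one face of a given type; here this is [sametype_eq]. *)
Lemma typed_parle_eq p V Z Z' : S p -> V \in P p -> typed p Z -> typed p Z' -> parle V Z -> parle V Z' -> Z = Z'.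
Proof.
move=> hp hV [[hZ _] tZ] [[hZ' _] tZ'] h h'; apply: (sametype_eq hss hp hV hZ hZ' _ h h').
exact: (sametype_trans hss (sametype_sym hss tZ) tZ').
Qed.

Lemma typesE : T = [set type_of xi | xi in Sz zeta].
Proof.
rewrite -(simplex_Sz hss htau hzeta); apply/seteqP; split=> [_ [X tX <-]|_ [_ [X tX <-] <-]].
  by exists (endpt (ch_pt C) X) => //; exists X.
by exists X.
Qed.

Lemma typed_flag p Z : S p -> typed p Z -> flag T (Sz Z).
Proof.
move=> hp [uZ tZ]; split; first by case: (simplex_int_self hp uZ).
by rewrite typesE; apply/seteqP; split; apply: (Sz_types hss) => //; apply: (sametype_sym hss).
Qed.

(** Being a flag is an equality of sets of types, so the simplex contains a point Z1 of type zeta,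
    and its interior point W has the type of some W0 in the model face. The parabolic of W is
    contained in that of Z1, while its dimension, that of the parabolic of W0, is at least that of
    zeta and so of Z1. Hence the two agree and Z1 is interior. *)
Lemma flag_typed Sg p : flag T Sg -> S p -> exists Z, typed p Z /\ Sg = Sz Z.
Proof.
move=> [[C1 [t1 [hf1 eS]]] eT] hp; have ho1 := ch_ptP C1.
have [n [e [w hw]]] := exists_weights hss ho1 (ch_aP C1).1.
have us X : t1 X -> usphere (ch_pt C1) X by move=> /(face_sub hf1) /chamber_usphere.
have us0 X : tau X -> usphere (ch_pt C) X by move=> /(face_sub htau) /chamber_usphere.
have [n0 [e0 [w0 hw0]]] := exists_weights hss ho (ch_aP C).1.
have [Z1 tZ1 sZ1] : exists2 Z1, t1 Z1 & sametype zeta Z1.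
  have hT : [set type_of xi | xi in Sg] zt by rewrite eT; exists zeta; [case: hzeta|].
  move: hT; rewrite eS => -[_ [Z1 tZ1 <-] h]; exists Z1; first exact: tZ1.
  apply: (sametype_sym hss).
  exact/(type_ofP hss ho1 ho (us Z1 tZ1) zeta_usphere).
have [W hW] := exists_face_int hss hw hf1; have tW := hW.1.
have WZ1 : parle W Z1 by apply/(face_intP hss hw hf1 hW (us Z1 tZ1)).
have [W0 tW0 sW0] : exists2 W0, tau W0 & sametype W0 W.
  have hT : T (type_of (endpt (ch_pt C1) W)).
    rewrite -eT eS; exists (endpt (ch_pt C1) W); last by [].
    by exists W.
  case: hT => W0 tW0 h; exists W0; first exact: tW0.
  exact/(type_ofP hss ho ho1 (us0 W0 tW0) (us W tW)).
have zW0 : parle zeta W0 by apply/(face_intP hss hw0 htau hzeta (us0 W0 tW0)).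
have [hW1 _] := us W tW; have [hZ1 _] := us Z1 tZ1; have [hz _] := zeta_usphere; have [hW0 _] := us0 W0 tW0.
have Z1W : parle Z1 W.
  apply/(fsp_parle hss ho1 hZ1 hW1); move/(fsp_parle hss ho1 hW1 hZ1): WZ1 => sub.
  have : fsp W (ge_ 0) == fsp Z1 (ge_ 0).
    rewrite eqEdim sub -(sametype_dim hss 0 ho ho1 hz hZ1 sZ1) -(sametype_dim hss 0 ho ho1 hW0 hW1 sW0).
    by apply: dimvS; apply/(fsp_parle hss ho hz hW0).
  by move=> /eqP ->.
have [Z [hZ h nZ]] := exists_dir hss ho1 hp hZ1; exists Z; split.
  by apply: (typed_samefil ho1 hp _ hZ h); split=> //; apply: us.
by rewrite eS (simplex_Sz hss hf1 hW) -(Sz_samefil h); apply: Sz_eq.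
Qed.

Lemma Sz_parle p Z Z' : S p -> usphere p Z' -> Sz Z = Sz Z' -> parle Z Z'.
Proof. by move=> hp uZ' e1; apply/(mem_Sz hss _ hp uZ'); rewrite e1; apply/(mem_Sz hss _ hp uZ'). Qed.

Lemma typed_Sz_inj p Z Z' : S p -> typed p Z -> typed p Z' -> Sz Z = Sz Z' -> Z = Z'.
Proof.
move=> hp tZ tZ' e1; apply: (typed_parle_eq hp tZ.1.1 tZ tZ') => //.
exact: (Sz_parle hp tZ'.1 e1).
Qed.

Lemma zeta_ptE p Z : S p -> typed p Z -> zeta_pt zt (Sz Z) = endpt p Z.
Proof.
move=> hp tZ; have uZ := tZ.1; rewrite /zeta_pt; case: xgetP => [xi _ [hi hty]|/(_ (endpt p Z))]; last first.
  case; split; first by case: (simplex_int_self hp uZ).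
  exact/(type_ofP hss hp ho uZ zeta_usphere)/(sametype_sym hss)/tZ.2.
have [C1 [t1 [hf1 _ [X1 hX1 e1]]]] := hi; have ho1 := ch_ptP C1.
have u1 : usphere (ch_pt C1) X1 by apply/chamber_usphere/(face_sub hf1)/hX1.1.
subst xi; have [X [hX h nX]] := exists_dir hss ho1 hp u1.1.
have tX1 : typed (ch_pt C1) X1.
  split; first exact: u1.
  by apply: (sametype_sym hss); apply/(type_ofP hss ho1 ho u1 zeta_usphere).
have tX := typed_samefil ho1 hp tX1 hX h.
have -> : Z = X by apply: (typed_Sz_inj hp tZ tX); rewrite (simplex_int_Sz ho1 u1 hi); apply: Sz_samefil.
exact/(endptP hss ho1 hp u1 tX.1).
Qed.

Lemma tau_ofE c p Z V t : S p -> typed p Z -> usphere p V -> 0 < c -> reg c Z V -> 0 < t ->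
  tau_of T p (geo p V t) = Sz Z.
Proof.
move=> hp tZ uV c0 hr t0; have uZ := tZ.1; rewrite /tau_of; case: xgetP => [Sg _ [hfl [X [t' [t'0 e1 htr]]]]|/(_ (Sz Z))]; last first.
  case; split; first exact: (typed_flag hp tZ).
  by exists V, t; split=> //; case: (reg_regular_dir hss hp uZ uV c0 hr).
have [Z' [tZ' eS]] := flag_typed hfl hp; subst Sg.
have [uX hX] := tau_regular_parle hss tZ'.1 htr; have [hXP nX] := uX; have [hVP nV] := uV.
have XV : X = V.
  have e2 : t *: V = t' *: X.
    apply: (log_unique hss hp); rewrite ?rpredZ //.
    by rewrite (geoZ hss _ _ hp hVP) (geoZ hss _ _ hp hXP) !mulr1.
  have e3 : t = t'.
    have H := bp_inner hss hp; have := congr1 (fun x => knorm x) e2.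
    rewrite !(knormE hss (p := p)) ?rpredZ // !(nrmZ H) -!(knormE hss (p := p)) // nX nV !mulr1.
    by rewrite !gtr0_norm.
  by move: e2; rewrite e3 => /(scalerI (lt0r_neq0 t'0)).
subst X; have hZ := reg_parle hss hp uZ uV c0 hr.
by rewrite (typed_parle_eq hp hVP tZ tZ' hZ hX).
Qed.

Lemma mod_regular_reg c p q : S p -> mod_regular_seg T c p q ->
  exists Z V t, [/\ typed p Z, usphere p V, reg c Z V, 0 < t & q = geo p V t].
Proof.
move=> hp [Sg hfl [V [t [t0 e1 hr]]]]; have [Z [tZ eS]] := flag_typed hfl hp; subst Sg.
by have [uV hr'] := regular_dir_reg hss tZ.1 hr; exists Z, V, t.
Qed.

Lemma reg_mod_regular c p Z V t : S p -> typed p Z -> usphere p V -> 0 < c -> reg c Z V -> 0 < t ->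
  mod_regular_seg T c p (geo p V t).
Proof.
move=> hp tZ uV c0 hr t0; exists (Sz Z); first exact: (typed_flag hp tZ).
by exists V, t; split=> //; case: (reg_regular_dir hss hp tZ.1 uV c0 hr).
Qed.

Lemma reg_star_cone c p Z V t : S p -> typed p Z -> usphere p V -> 0 < c -> reg c Z V -> 0 <= t ->
  star_cone p (Sz Z) c (geo p V t).
Proof.
move=> hp tZ uV c0 hr t0; exists V, t; split=> //; exists p, V; split=> //.
by case: (reg_regular_dir hss hp tZ.1 uV c0 hr).
Qed.

Hypothesis hiota : opposition zt = zt.

Lemma typedN p Z : S p -> typed p Z -> typed p (- Z).
Proof.
move=> hp [uZ tZ]; have uZ' := usphereN hp uZ; split=> //.
have /(in_typeP hss ho hp zeta_usphere uZ') // : zt (endpt p (- Z)).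
rewrite -hiota; exists (p, endpt p Z); last first.
  by apply: (eq_trans (act_endpt hss (sym_aut hp) hp uZ)); rewrite (act_self hp) ((memP p Z).1 uZ.1).
by split=> //=; apply/(in_typeP hss ho hp zeta_usphere uZ).
Qed.

Lemma zeta_angleE p x y Z Z' : S p -> typed p Z -> typed p Z' ->
  tau_of T p x = Sz Z -> tau_of T p y = Sz Z' -> zeta_angle T zt p x y = acos (B Z Z').
Proof.
move=> hp tZ tZ' e1 e2; rewrite /zeta_angle e1 e2 (zeta_ptE hp tZ) (zeta_ptE hp tZ') /angle.
by rewrite (dirP hss hp tZ.1) (dirP hss hp tZ'.1).
Qed.

Lemma antipodal_Sz q z : S q -> typed q z -> antipodal (Sz (- z)) (Sz z).
Proof.
move=> hq tz; have uz := tz.1; have uz' := usphereN hq uz; exists q, z; split=> //.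
  by case: (simplex_int_self hq uz').
by case: (simplex_int_self hq uz).
Qed.

(** Lines joining the interiors of the two simplices may have various directions X, but a line
    parallel to one of them has the same X. At any point of it the typed faces of X and of - X are
    opposite vectors, so z itself, determined by its two filtrations, lies in P at that point. *)
Lemma parallel_setP q z r : S q -> typed q z -> parallel_set (Sz (- z)) (Sz z) r <-> S r /\ z \in P r.
Proof.
move=> hq tz; have tz' := typedN hq tz; split; last first.
  move=> [hr hz]; have tzr := typed_samefil hq hr tz hz (samefil_refl z).
  have uz := tzr.1; have uz' := usphereN hr uz.
  exists r, z; split=> //; [by case: (simplex_int_self hr uz')|by case: (simplex_int_self hr uz)|].
  exists r, z, 0; split=> //; last by rewrite (geo0 hss hr hz).
  by exists 0 => t; rewrite (distxx hss (geo_sym hss z t hr)).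
move=> [p [X [hp uX hXm hXp [q' [Y [t [hq' uY [c hc] ->]]]]]]].
have [hX nX] := uX; have [hY nY] := uY; have hr := geo_sym hss Y t hq'.
have XY : X = Y.
  apply: (samefil_parallel hss hp hX hq' hY).
    by apply/(asymptoticP hss hp hq' hX hY); exists c => s _.
  have hX' : - X \in P p by rewrite rpredN.
  have hY' : - Y \in P q' by rewrite rpredN.
  apply/(asymptoticP hss hp hq' hX' hY'); exists c => s _.
  by rewrite (geoN s hp hX) (geoN s hq' hY).
subst Y; split=> //; have hXr : X \in P (geo q' X t) by apply: (geo_P hss t hq' hY).
set r' := geo q' X t in hr hXr *.
have uX' := usphereN hp uX.
have e1 := simplex_int_Sz hp uX hXp; have e2 := simplex_int_Sz hp uX' hXm.
have Xz : parle X z by apply: (Sz_parle hq tz.1).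
have Xz' : parle (- X) (- z) by apply: (Sz_parle hq tz'.1).
have [Z1 [hZ1 s1 _]] := exists_dir hss hq hr tz.1.1.
have [Z2 [hZ2 s2 _]] := exists_dir hss hq hr tz'.1.1.
have t1 := typed_samefil hq hr tz hZ1 s1; have t2 := typed_samefil hq hr tz' hZ2 s2.
have e3 : Z1 = - Z2.
  apply: (typed_parle_eq hr hXr t1 (typedN hr t2)).
    by move=> v /Xz /s1.
  rewrite -[X]opprK; apply: (parle_opp hr) => //; first by rewrite rpredN.
  by move=> v /Xz' /s2.
have -> // : z = Z1.
apply: (samefil_parallel hss hq tz.1.1 hr hZ1 s1).
by rewrite e3 opprK.
Qed.

Variable zeta0 : R.
Hypothesis hzeta0 : forall al, simple_plus C tau al -> zeta0 <= rval al zeta.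

Lemma typed_gap p Z v : S p -> typed p Z -> fil Z (gt_ 0) v -> fil Z (ge_ zeta0) v.
Proof.
move=> hp [[hZ _] [g hg h]] hv; have ag := isomG_aut hss hg.
have [hz _] := zeta_usphere; have [n [e [w hw]]] := exists_weights hss ho (ch_aP C).1.
have hp' := act_sym ag ho; have hz' := pspace_act ag hz.
apply/h; rewrite -(autVK ag v); apply/(fil_autE _ _ _ ag).
apply: (simple_plus_lower hss hw htau hzeta.1 (face_sub htau hzeta.1) hzeta0).
apply/(fil_autE _ _ _ ag); rewrite (autVK ag).
by apply/(samefil_gt hss _ _ hp hZ hp' hz' (samefil_sym h)).
Qed.

Lemma typed_dim p Z : S p -> typed p Z -> \dim (fsp Z (gt_ 0)) = \dim (fsp zeta (gt_ 0)).
Proof.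
move=> hp [[hZ _] [g hg h]]; have ag := isomG_aut hss hg; have [hz _] := zeta_usphere.
rewrite -(fsp_dim_aut hss _ ho hz ag); congr (\dim _); apply/vspaceP => v.
have hp' := act_sym ag ho; have hz' := pspace_act ag hz; have hh := samefil_gt hss 0 v hp hZ hp' hz' (samefil_sym h).
by apply/idP/idP => [/(fspP hss _ _ hp hZ)/hh h1|/(fspP hss _ _ hp' hz')/hh h1];
  [apply/(fspP hss _ _ hp' hz')|apply/(fspP hss _ _ hp hZ)].
Qed.

Lemma unit_gt0 p Z : S p -> usphere p Z -> (0 < \dim (fsp Z (gt_ 0)))%N.
Proof.
move=> hp [hZ nZ]; rewrite lt0n; apply/negP => /eqP d0; have := fsp_dim_opp hss (gt_ 0) hp hZ.
rewrite d0 => /eqP; rewrite dimv_eq0 => /eqP e2; move/eqP: d0; rewrite dimv_eq0 => /eqP e1.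
have [n [e [m he]]] := exists_eigenbasis hss hp hZ; have [hon hm] := he; have [oe _ _] := hon.
have H := bp_inner hss hp.
have e0 i : e i != 0.
  by apply/negP => /eqP h; have := oe i i; rewrite h (ip0l H) eqxx => /eqP; rewrite eq_sym oner_eq0.
have := eb_knorm hss hp hZ he; rewrite nZ expr1n big1; first by move/eqP; rewrite oner_eq0.
move=> i _; have [hi|hi|<-] := ltgtP 0 (m i); last by rewrite expr0n.
  have : e i \in fsp Z (gt_ 0) by apply/(fspP hss _ _ hp hZ); apply: fil_eigen hi _; rewrite -adE.
  by rewrite e1 memv0 (negPf (e0 i)).
have : e i \in fsp Z (opp_ (gt_ 0)).
  by apply/(fspP hss _ _ hp hZ); apply: (@fil_eigen _ _ _ _ (m i)); [rewrite /opp_ /gt_ /= oppr_gt0|rewrite -adE].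
by rewrite e2 memv0 (negPf (e0 i)).
Qed.

Lemma zeta_weights_pos n (e : 'I_n -> L) (w : 'I_n -> dual (ch_a C)) i : weights (ch_pt C) e w ->
  0 < rval (w i) zeta -> roots_plus C tau (w i).
Proof.
move=> hw h; have Za := chamber_mem (face_sub htau hzeta.1); split.
  apply/(rootsP hss ho (ch_aP C).1 hw); split; last by exists i.
  by apply: contraTneq h => ->; rewrite rval0 ltxx.
move=> X hX; have [al [sal le]] := simple_plus_below hss hw htau hzeta.1 h.
exact: lt_le_trans (sal.2 X hX) (le X (face_sub htau hX.1)).
Qed.

(** Both numbers count vectors of a weight basis: a weight belonging to [roots_plus] is positive on
    the interior point zeta, and distinct roots account for distinct basis vectors. *)
Lemma c0_le : (c0 C tau <= \dim (fsp zeta (gt_ 0)))%N.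
Proof.
have [hz _] := zeta_usphere; have [n [e [w hw]]] := exists_weights hss ho (ch_aP C).1.
have Za := chamber_mem (face_sub htau hzeta.1); have H := bp_inner hss ho.
have frame (Q : pred 'I_n) (U : {vspace L}) : (forall v, v \in U <-> forall i, ~~ Q i -> bp (ch_pt C) (e i) v = 0) ->
    \dim U = #|[set i | Q i]%SET|.
  move=> hU; have [f [fi fA fs]] := @enum_fun n _ [set i | Q i]%SET erefl; have [he _] := hw; have [oe _ _] := he.
  symmetry; apply: (onb_dim H (e := fun c => e (f c))); split.
  - by move=> i j; rewrite oe (inj_eq fi).
  - move=> c; apply/hU => i Qi; rewrite oe; case: eqP => // e1; case/negP: Qi.
    have : f c \in [set i | Q i]%SET by apply/fA; exists c.
    by rewrite -e1 inE.
  - move=> v /hU hv; rewrite {1}(full_onb v he) (bigID (fun i => i \in [set i | Q i]%SET)) /= [X in _ + X]big1 ?addr0.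
      by rewrite fs.
    by move=> i; rewrite inE => /hv ->; rewrite scale0r.
have -> : \dim (fsp zeta (gt_ 0)) = #|[set i | 0 < rval (w i) zeta]%SET|.
  apply: frame => v; split=> [/(fspP hss _ _ ho hz)/(fil_weights hss ho (ch_aP C).1 hw _ _ Za) h i hi|h].
    by apply: h; apply/negP.
  by apply/(fspP hss _ _ ho hz)/(fil_weights hss ho (ch_aP C).1 hw _ _ Za) => i hi; apply: h; apply/negP.
have rd al : \dim (root_space al) = #|[set i | w i == al]%SET|.
  apply: frame => v; split=> [/(root_spaceP hss) h i wi|h].
    apply/eqP/negPn/negP => c; case/negP: wi; apply/eqP/rval_inj => X Xa; apply: (mulIf c).
    by rewrite -(weights_coef hss ho (ch_aP C).1 hw _ _ Xa) h // (ipZr H).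
  apply/(root_spaceP hss) => X Xa; apply: (onb_ext hw.1) => i.
  rewrite (weights_coef hss ho (ch_aP C).1 hw _ _ Xa) (ipZr H).
  by have [->//|/h ->] := eqVneq (w i) al; rewrite !mulr0.
pose s := undup [seq w i | i <- enum 'I_n & 0 < rval (w i) zeta].
have rps al : roots_plus C tau al -> al \in s.
  move=> [/(rootsP hss ho (ch_aP C).1 hw) [_ [i hi]] h]; rewrite mem_undup -hi; apply: map_f.
  by rewrite mem_filter mem_enum hi h.
have hs al : al \in s -> 0 < rval al zeta.
  by move=> als; have [i h ->] := mem_undup_image als.
have hs' al : al \in s -> roots_plus C tau al.
  move=> als; have [i h ->] := mem_undup_image als.
  exact: zeta_weights_pos hw h.
rewrite /c0 (@fsbig_fwiden _ nat 0%N addn s) ?undup_uniq //; last by move=> al [/= /hs' h /(_ h)].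
rewrite big_seq (eq_bigr (fun al => \sum_(i | (0 < rval (w i) zeta)%R) (w i == al : nat))%N); last first.
  move=> al als; rewrite rd -sum1dep_card big_mkcond [RHS]big_mkcond; apply: eq_bigr => i _.
  have [->|] := eqVneq (w i) al; first by rewrite hs.
  by rewrite if_same.
rewrite -big_seq exchange_big /= -sum1dep_card; apply: leq_sum => i hi.
rewrite (_ : (\sum_(al <- s) (w i == al))%N = count (pred1 (w i)) s).
  by rewrite count_uniq_mem ?undup_uniq // leq_b1.
by elim: (s) => [|al s' IH]; rewrite ?big_nil //= big_cons IH eq_sym.
Qed.

End Flags.

Section Bounds.
Variables (R : realType) (V : vectType R) (ip : V -> V -> R).
Hypothesis H : inner ip.

Lemma vN_le_nrm : exists2 K : R, 0 <= K & forall v, vN v <= K * nrm ip v.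
Proof.
have [n [e he]] := exists_onb H fullv; exists (\sum_i vN (e i)).
  by apply: sumr_ge0 => i _; apply: vN_ge0.
move=> v; rewrite {1}(full_onb v he) mulr_suml; apply: le_trans (vN_sum _ _ _) _.
apply: ler_sum => i _; rewrite vNZ mulrC ler_wpM2l ?vN_ge0 //.
have [oe _ _] := he; apply: le_trans (ip_CS H _ _) _; rewrite {1}/nrm oe eqxx sqrtr1 mul1r //.
Qed.

Lemma nrm_le_vN : exists2 K : R, 0 <= K & forall v, nrm ip v <= K * vN v.
Proof.
exists (\sum_(i < \dim {:V}) nrm ip (vbasis {:V})`_i); first by apply: sumr_ge0 => i _; apply: nrm_ge0.
move=> v; rewrite {1}(coord_vbasis (memvf v)) mulr_suml; apply: le_trans (nrm_sum H _ _ _) _.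
apply: ler_sum => i _; rewrite (nrmZ H) mulrC ler_wpM2l ?nrm_ge0 //.
exact: (cb_le_vN v i).
Qed.

Lemma ultra_nrm_cvg (F : set_system nat) (u : nat -> V) (M : R) : UltraFilter F ->
  (forall k, nrm ip (u k) <= M) -> exists l, vcvg F u l.
Proof.
move=> FU hM; have [K K0 hK] := vN_le_nrm; apply: (@ultra_vcvg _ _ _ _ (K * M)) => k i.
by apply: le_trans (cb_le_vN _ _) _; apply: le_trans (hK _) _; rewrite ler_wpM2l.
Qed.

Lemma vcvg_ip (F : set_system nat) {FF : ProperFilter F} (u w : nat -> V) a b :
  vcvg F u a -> vcvg F w b -> (fun k => ip (u k) (w k)) @ F --> ip a b.
Proof.
apply: vcvg_bilr => [v c x y|v c x y]; first by rewrite (ipDr H) (ipZr H).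
by rewrite (ipDl H) (ipZl H).
Qed.

End Bounds.

(** The first-derivative test at a maximum: D is a derivative and C bounds the second-order
    remainder. *)
Lemma pos_of_quadratic (R : realType) (D C : R) : 0 <= C ->
  (forall s, `|s| <= 1 -> s * D <= C * s ^+ 2) -> D = 0.
Proof.
move=> C0 h; suff hh D' : (forall s, `|s| <= 1 -> s * D' <= C * s ^+ 2) -> D' <= 0.
  apply/eqP; rewrite eq_le hh //= -oppr_le0; apply: hh => s s1.
  by have := h (- s); rewrite normrN sqrrN mulrN mulNr; apply.
move=> {h}h; rewrite leNgt; apply/negP => D0.
pose s := Num.min 1 (D' / (2 * (C + 1))).
have c1 : 0 < 2 * (C + 1) by move: C0; lra.
have s0 : 0 < s by rewrite lt_min ltr01 divr_gt0.
have s1 : s <= 1 by rewrite ge_min lexx.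
have s2 : s * (2 * (C + 1)) <= D' by rewrite -ler_pdivlMr // ge_min lexx orbT.
have := h s; rewrite (gtr0_norm s0) => /(_ s1); rewrite expr2 mulrCA ler_pM2l // => h1.
move: s2 h1 s0 C0; clear; move: s => s; nra.
Qed.

(** * The bound of [ad X] by the largest value of a root *)

Section Kappa.
Variables (R : realType) (L : liealg R).
Hypothesis hss : semisimple L.
Implicit Types (X Y Z U V W u v z : L) (f g p q r : 'End(L)) (A : set R) (a : {vspace L}).
Local Notation br := (@lie_br R L).
Local Notation B := (@killing R L).
Local Notation S := (@symspace R L).
Local Notation P := (@pspace R L).

Lemma nrm_br_knorm p X u : S p -> X \in P p -> nrm (bp p) (br X u) <= knorm X * nrm (bp p) u.
Proof.
move=> hp hX; have [n [e [m he]]] := exists_eigenbasis hss hp hX.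
apply: (nrm_br_le hss _ hp hX he); first exact: knorm_ge0.
by move=> i; apply: (eb_le_knorm hss _ hp hX he).
Qed.

Lemma vcvg_br (F : set_system nat) {FF : ProperFilter F} (x y : nat -> L) X Y :
  vcvg F x X -> vcvg F y Y -> vcvg F (fun k => br (x k) (y k)) (br X Y).
Proof.
apply: vcvg_bil => [v c u w|v c u w]; first exact: brPr.
exact: (brPl hss).
Qed.

Lemma vcvg_ad (F : set_system nat) {FF : ProperFilter F} (x : nat -> L) X :
  vcvg F x X -> vcvg F (fun k => ad (x k)) (ad X).
Proof.
move=> h; apply: vcvg_End => v; rewrite adE; under [X in vcvg _ X _]funext do rewrite adE.
by apply: vcvg_br => //; apply: vcvg_cst.
Qed.

Lemma vexp_ad_cvg (F : set_system nat) {FF : ProperFilter F} p (x : nat -> L) X (c : R) v : S p ->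
  (forall k, x k \in P p) -> X \in P p -> (forall k, knorm (x k) <= c) -> knorm X <= c -> vcvg F x X ->
  vcvg F (fun k => vexp (ad (x k)) v) (vexp (ad X) v).
Proof.
move=> hp hx hX hxc hXc h; have H := bp_inner hss hp.
have [K K0 hK] := vN_le_nrm H; have [K' K0' hK'] := nrm_le_vN H.
have c0 : 0 <= c := le_trans (knorm_ge0 _) hXc.
have bd Y : Y \in P p -> knorm Y <= c -> forall w, vN (ad Y w) <= (K * c * K') * vN w.
  move=> hY Yc w; rewrite adE -!mulrA; apply: le_trans (hK _) _; rewrite ler_wpM2l //.
  apply: le_trans (nrm_br_knorm w hp hY) _; apply: ler_pM => //; [exact: knorm_ge0|exact: nrm_ge0].
apply: (@vexp_cvg_ultra _ _ F _ _ _ (K * c * K')); first by rewrite !mulr_ge0.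
- by move=> k w; apply: bd.
- by move=> w; apply: bd.
- exact: vcvg_ad.
Qed.

Lemma bp_geo_cvg (F : set_system nat) {FF : ProperFilter F} p (x w : nat -> L) X (c : R) t v : S p ->
  (forall k, x k \in P p) -> X \in P p -> (forall k, knorm (x k) <= c) -> knorm X <= c -> vcvg F x X ->
  vcvg F w v -> (fun k => bp (geo p (x k) t) (w k) (w k)) @ F --> bp (geo p X t) v v.
Proof.
move=> hp hx hX hxc hXc h hw; have H := bp_inner hss hp; have c0 : 0 <= c := le_trans (knorm_ge0 _) hXc.
rewrite (bp_geo hss) //; under [X in X @ _ --> _]funext => k do rewrite (bp_geo hss _ _ _ hp (hx k)).
have nZ Y : Y \in P p -> knorm Y <= c -> knorm ((- 2 * t) *: Y) <= `|- 2 * t| * c.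
  move=> hY Yc; rewrite (knormE hss (p := p)) ?rpredZ // (nrmZ H) -(knormE hss hY) ler_wpM2l //.
apply: (vcvg_ip H) => //; apply: (vcvg_eval (u := fun k => vexp (ad ((- 2 * t) *: x k)))) => //.
apply: vcvg_End => u; apply: (@vexp_ad_cvg F _ p _ _ (`|- 2 * t| * c)) => //.
- by move=> k; rewrite rpredZ.
- by rewrite rpredZ.
- by move=> k; apply: nZ.
- exact: nZ.
- by apply: vcvgZ => //; apply: cvg_cst.
Qed.

Lemma act_exp_fix p W : S p -> p W = W -> act (vexp (ad W)) p = p.
Proof.
move=> hp hW; apply/lfunP => v; rewrite actE (expA_inv hss) (aut_exp _ _ (sym_aut hp)) linearN /= hW.
exact: (expANr hss).
Qed.

Variable C : chamber L.
Local Notation o := (ch_pt C).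
Local Notation a := (ch_a C).
Local Notation H0 := (ch_reg C).
Let ho : S o := ch_ptP C.
Let ha : abelian_in o a := (ch_aP C).1.
Local Notation kappa := (kappa0 (ch_a C)).

Lemma kappa_weight n (e : 'I_n -> L) (w : 'I_n -> dual a) i Y : weights o e w -> Y \in a ->
  `|rval (w i) Y| <= kappa * knorm Y.
Proof.
move=> hw Ya; have H := bp_inner hss ho; have hY := weights_P ha Ya.
pose E : set R := [set r | exists (al : dual a) (A : L), [/\ roots al, A \in a, knorm A = 1 & r = rval al A]].
have ub : has_ubound E.
  exists 1 => _ [al [A [/(rootsP hss ho ha hw) [_ [j <-]] Aa nA ->]]].
  apply: le_trans (ler_norm _) _; rewrite -nA.
  exact: (eb_le_knorm hss _ ho (weights_P ha Aa) (weights_eigenbasis hw Aa)).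
have Eopp (r : R) : E r -> E (- r).
  move=> [al [A [h1 h2 h3 ->]]]; exists al, (- A); split=> //; first by rewrite rpredN.
    by rewrite (knormN hss ho (weights_P ha h2)).
  by rewrite -[- A]scaleN1r rvalZr mulN1r.
have Ele (r : R) : E r -> `|r| <= kappa.
  move=> Er; rewrite /kappa0 -/E ler_norml lerNl; apply/andP; split; apply: ub_le_sup => //.
  exact: Eopp.
have [Y0|Y0] := eqVneq Y 0.
  by rewrite Y0 -(scale0r (0 : L)) rvalZr mul0r normr0 scale0r (knormE hss (mem0v (P o))) (nrm0 H) mulr0.
have nY : 0 < knorm Y by rewrite (knormE hss hY) (nrm_gt0 H).
have [w0|w0] := eqVneq (w i) 0.
  rewrite w0 rval0 normr0 mulr_ge0 ?(ltW nY) //.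
  have [[r Er]|nE] := pselect (exists r : R, E r); first exact: le_trans (normr_ge0 r) (Ele r Er).
  (* If there are no roots the supremum is taken over the empty set, where its value is 0. *)
  rewrite /kappa0 -/E (_ : E = set0) ?sup0 //.
  by apply/seteqP; split=> // r Er; apply: nE; exists r.
have : E (rval (w i) ((knorm Y)^-1 *: Y)).
  exists (w i), ((knorm Y)^-1 *: Y); split=> //.
  - by apply/(rootsP hss ho ha hw); split=> //; exists i.
  - by rewrite rpredZ.
  - rewrite (knormE hss (p := o)) ?rpredZ // (nrmZ H) -(knormE hss hY) gtr0_norm ?invr_gt0 //.
    by rewrite mulVf // gt_eqF.
by move/Ele; rewrite rvalZr normrM gtr0_norm ?invr_gt0 // ler_pdivrMl // mulrC.
Qed.

(* A maximum point Y of B(., H0) on the closure of the orbit of X under the stabiliser of o commutes with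
   the regular vector H0, hence lies in the flat a. *)
Lemma eigen_le_kappa_base X u (m : R) : X \in P o -> u != 0 -> br X u = m *: u -> `|m| <= kappa * knorm X.
Proof.
move=> hX u0 hu; have H := bp_inner hss ho; have h0P := weights_P ha (ch_reg_a C).
have [n [e [w hw]]] := exists_weights hss ho ha.
pose G := [set g | isomG g /\ act g o = o].
have Gip g v1 v2 : G g -> bp o (g v1) (g v2) = bp o v1 v2.
  by move=> [hg go]; rewrite -{1}go bp_act //; apply: (isomG_aut hss).
have GP g : G g -> g X \in P o by move=> [hg go]; rewrite -[in P _]go; apply: pspace_act => //; apply: (isomG_aut hss).
have Gn g v : G g -> nrm (bp o) (g v) = nrm (bp o) v by move=> hg; rewrite /nrm Gip.
pose E := [set B (g X) H0 | g in G].
have E0 : E (B X H0).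
  by exists \1%VF; [split; [exact: isomG1|exact: act1]|rewrite id_lfunE].
have ub : has_ubound E.
  exists (nrm (bp o) X * nrm (bp o) H0) => _ [g hg <-]; rewrite -(bpPr hss (p := o)) //.
  by apply: le_trans (ler_norm _) _; apply: le_trans (ip_CS H _ _) _; rewrite Gn.
have hs : has_sup E by split=> //; exists (B X H0).
have /choice [g hg] (k : nat) : exists g : 'End(L), G g /\ sup E - k.+1%:R^-1 < B (g X) H0.
  have k0 : 0 < k.+1%:R^-1 :> R by rewrite invr_gt0 ltr0n.
  have [_ [g hg <-] lt] := sup_adherent k0 hs; by exists g.
have [F [FU Foo]] := exists_free_ultrafilter.
have FP : ProperFilter F := @ultra_proper _ _ FU.
have [Y hY] : exists Y, vcvg F (fun k => g k X) Y.
  by apply: (ultra_nrm_cvg H (M := nrm (bp o) X)) => k; rewrite Gn //; case: (hg k).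
have [u' hu'] : exists u', vcvg F (fun k => g k u) u'.
  by apply: (ultra_nrm_cvg H (M := nrm (bp o) u)) => k; rewrite Gn //; case: (hg k).
have YP : Y \in P o by apply: (vcvg_mem _ hY) => k; apply: GP; case: (hg k).
have nY : knorm Y = knorm X.
  rewrite !(knormE hss (p := o)) // /nrm; congr Num.sqrt; have : (fun k => bp o (g k X) (g k X)) @ F --> bp o Y Y by apply: (vcvg_ip H).
  rewrite (_ : (fun k => _) = fun=> bp o X X); last by apply/funext => k; rewrite Gip //; case: (hg k).
  by move=> h; apply: (cvgr_uniq h); apply: cvg_cst.
have hf : lfunctional (fun v => B v H0) by move=> c v1 v2; rewrite (killingPl hss).
have BY : B Y H0 = sup E.
  have h1 : (fun k => B (g k X) H0) @ F --> B Y H0 by apply: (vcvg_functional hf).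
  apply/eqP; rewrite eq_le; apply/andP; split.
    apply: (cvgr_lel h1 (cvg_cst (sup E))) => k; apply: ub_le_sup => //; exists (g k) => //; by case: (hg k).
  have h2 : (fun k => sup E - k.+1%:R^-1) @ F --> sup E - 0.
    by apply: cvgB; [exact: cvg_cst|apply: (oo_cvg_ultra Foo); exact: cvg_harmonic].
  by rewrite subr0 in h2; apply: (cvgr_lel h2 h1) => k; apply: ltW; case: (hg k).
(* For W fixed by o the element e^{sW} stabilises o, so B(e^{s ad W} Y, H0) is largest at s = 0 and
   its derivative vanishes there. *)
have crit W : o W = W -> B (br W Y) H0 = 0.
  move=> hW; have [Q Q0 hQ] := vexp_remainder (ad W) Y; have [K K0 hK] := lfunctional_bound hf.
  apply: (@pos_of_quadratic _ _ (K * Q)); first exact: mulr_ge0.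
  move=> s s1; have hsW : o (s *: W) = s *: W by rewrite linearZ /= hW.
  have le : B (vexp (s *: ad W) Y) H0 <= B Y H0.
    rewrite BY -(adZ hss).
    have h1 : (fun k => B (vexp (ad (s *: W)) (g k X)) H0) @ F --> B (vexp (ad (s *: W)) Y) H0.
      by apply: (vcvg_functional hf); apply: vcvg_lfun.
    apply: (cvgr_lel h1 (cvg_cst (sup E))) => k; apply: ub_le_sup => //.
    have [[hgk gko] _] := hg k; exists (vexp (ad (s *: W)) \o g k)%VF; last by rewrite comp_lfunE.
    split; first by apply: isomG_comp => //; apply: isomG_expA.
    by rewrite act_comp ?gko ?act_exp_fix //; [exact: expA_aut|exact: isomG_aut].
  have := hK (vexp (s *: ad W) Y - (Y + s *: ad W Y)).
  rewrite (killingBl hss) (killingDl hss) (killingZl hss) [in X in _ * X]adE => h2.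
  have h3 := le_trans h2 (ler_wpM2l K0 (hQ s s1)); rewrite mulrA in h3.
  by move: h3 le; rewrite ler_norml => /andP [h3 _]; move: h3; move: (B _ _) (s * _) (_ * _ ^+ 2) => x y z; lra.
(* Apply this to W = [Y, H0], which o fixes: by invariance B([W, Y], H0) = B(W, W), and - B(W, W) is
   the squared length of W. *)
have YH : br Y H0 = 0.
  have hk : o (br Y H0) = br Y H0.
    by rewrite (sym_br _ _ ho) ((memP o Y).1 YP) ((memP o H0).1 h0P) (brNl hss) brNr opprK.
  apply: (ip_eq0 H); rewrite /bp hk -(killing_inv hss) crit ?oppr0 //.
have Ya : Y \in a.
  apply: (max_abelian_mem hss (ch_aP C) YP) => X' X'a; apply: (onb_ext hw.1) => i; rewrite (ip0r H).
  rewrite (brC hss) (ipNr H) (weights_coef hss ho ha hw _ _ X'a).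
  have := weights_coef hss ho ha hw Y i (ch_reg_a C); rewrite (br_eq0C hss YH) (ip0r H).
  move/esym/eqP; rewrite mulf_eq0 => /orP [/eqP /(reg_weight hss hw) ->|/eqP ->].
    by rewrite rval0 mul0r oppr0.
  by rewrite mulr0 oppr0.
have hYu : br Y u' = m *: u'.
  apply: (vcvg_uniq (F := F) (u := fun k => br (g k X) (g k u))); first exact: vcvg_br.
  rewrite (_ : (fun k => _) = fun k => m *: g k u); first by apply: vcvgZ => //; apply: cvg_cst.
  apply/funext => k; have [[hgk _] _] := hg k.
  by rewrite -(aut_br _ _ (isomG_aut hss hgk)) hu linearZ.
have u'0 : u' != 0.
  apply/negP => /eqP h; have : (fun k => bp o (g k u) (g k u)) @ F --> bp o u' u' by apply: (vcvg_ip H).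
  rewrite (_ : (fun k => _) = fun=> bp o u u); last by apply/funext => k; rewrite Gip //; case: (hg k).
  rewrite h (ip0l H) => h1; case/negP: u0; apply/eqP/(ip_eq0 H).
  by apply: (cvgr_uniq _ h1); apply: cvg_cst.
have [i ci] : exists i, bp o (e i) u' != 0.
  apply: contrapT => h; case/negP: u'0; apply/eqP/(onb_ext hw.1) => i; rewrite (ip0r H).
  by apply: contrapT => /eqP c; apply: h; exists i.
have -> : m = rval (w i) Y.
  by apply: (mulIf ci); rewrite -(weights_coef hss ho ha hw _ _ Ya) hYu (ipZr H).
by rewrite -nY; apply: (kappa_weight _ hw).
Qed.

Lemma eigen_le_kappa p X u (m : R) : S p -> X \in P p -> u != 0 -> br X u = m *: u -> `|m| <= kappa * knorm X.
Proof.
move=> hp hX u0 hu; have [g hg gp] := transitive hss hp ho; have ag := isomG_aut hss hg.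
rewrite -(knorm_aut X ag); apply: (eigen_le_kappa_base (u := g u)).
- by rewrite -[in P _]gp; apply: pspace_act.
- by apply: contraNneq u0 => h; apply/eqP/(aut_inj ag); rewrite h linear0.
- by rewrite -(aut_br _ _ ag) hu linearZ.
Qed.

Lemma nrm_br_kappa p X v : S p -> X \in P p -> 0 <= kappa ->
  nrm (bp p) (br X v) <= kappa * knorm X * nrm (bp p) v.
Proof.
move=> hp hX k0; have [n [e [m he]]] := exists_eigenbasis hss hp hX.
apply: (nrm_br_le hss _ hp hX he); first by rewrite mulr_ge0 ?knorm_ge0.
move=> i; have [[oe _ _] hm] := he; have H := bp_inner hss hp.
apply: (eigen_le_kappa (u := e i) hp hX); last by rewrite -adE.
by apply/negP => /eqP h; have := oe i i; rewrite h (ip0l H) eqxx => /eqP; rewrite eq_sym oner_eq0.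
Qed.

End Kappa.

(** * Opposite flags *)

Section Opposite.
Variables (R : realType) (L : liealg R).
Hypothesis hss : semisimple L.
Implicit Types (X Y Z U V W u v z : L) (f g p q r : 'End(L)) (A : set R).
Local Notation br := (@lie_br R L).
Local Notation B := (@killing R L).
Local Notation S := (@symspace R L).
Local Notation P := (@pspace R L).

(** An interface between the algebra of types and the geometry: vectors of type zeta are used from
    here on only through these properties, which [zeta_flag_type] establishes. [ty_gap] says that no
    positive weight is below zeta0. *)
Record flag_type (Ty : 'End(L) -> L -> Prop) (zeta0 kappa : R) : Prop := FlagType {
  ty_usphere : forall p Z, S p -> Ty p Z -> usphere p Z;
  ty_gap : forall p Z v, S p -> Ty p Z -> fil Z (gt_ 0) v -> fil Z (ge_ zeta0) v;
  ty_dim : forall p q Z Z', S p -> S q -> Ty p Z -> Ty q Z' -> \dim (fsp Z (gt_ 0)) = \dim (fsp Z' (gt_ 0));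
  ty_eq : forall p V Z Z', S p -> V \in P p -> Ty p Z -> Ty p Z' -> parle V Z -> parle V Z' -> Z = Z';
  ty_samefil : forall p q Z Z', S p -> S q -> Ty p Z -> Z' \in P q -> samefil Z Z' -> Ty q Z';
  ty_act : forall g p Z, S p -> isomG g -> Ty p Z -> Ty (act g p) (g Z);
  ty_opp : forall p Z, S p -> Ty p Z -> Ty p (- Z);
  ty_pos : forall p Z, S p -> Ty p Z -> (0 < \dim (fsp Z (gt_ 0)))%N;
  ty_ex : forall p, S p -> exists Z, Ty p Z;
  ty_kappa : forall p X v, S p -> X \in P p -> nrm (bp p) (br X v) <= kappa * knorm X * nrm (bp p) v;
  ty_zeta0 : 0 < zeta0 }.

Variables (Ty : 'End(L) -> L -> Prop) (zeta0 kappa : R).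
Hypothesis D : flag_type Ty zeta0 kappa.

Lemma ty_P p Z : S p -> Ty p Z -> Z \in P p.
Proof. by move=> hp /(ty_usphere D hp) []. Qed.

Lemma ty_move p q Z : S p -> S q -> Ty p Z -> Z \in P q -> Ty q Z.
Proof. by move=> hp hq tZ hZ; apply: (ty_samefil D hp hq tZ hZ). Qed.

Lemma fil_ltE Z v : fil Z (lt_ 0) v <-> fil (- Z) (gt_ 0) v.
Proof.
split=> [h|/(fil_oppE hss)]; last by apply: fil_sub => b; rewrite /opp_ /gt_ /lt_ /= oppr_gt0.
by apply/(fil_oppE hss); apply: fil_sub h => b; rewrite /opp_ /gt_ /lt_ /= oppr_gt0.
Qed.

Lemma fil_leE Z x v : fil Z (le_ x) v <-> fil (- Z) (ge_ (- x)) v.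
Proof.
split=> [h|/(fil_oppE hss)]; last by apply: fil_sub => b; rewrite /opp_ /ge_ /le_ /= lerN2.
by apply/(fil_oppE hss); apply: fil_sub h => b; rewrite /opp_ /ge_ /le_ /= lerN2.
Qed.

Lemma ty_gap_lt p Z v : S p -> Ty p Z -> fil Z (lt_ 0) v -> fil Z (le_ (- zeta0)) v.
Proof.
move=> hp tZ /fil_ltE /(ty_gap D hp (ty_opp D hp tZ)) h; apply/fil_leE; by rewrite opprK.
Qed.

Lemma fsp_dim_lt p Z : S p -> Z \in P p -> \dim (fsp Z (lt_ 0)) = \dim (fsp Z (gt_ 0)).
Proof.
move=> hp hZ; rewrite -(fsp_dim_opp hss (gt_ 0) hp hZ); congr (\dim (fsp Z _)).
by apply/seteqP; split=> b; rewrite /opp_ /gt_ /lt_ /= oppr_gt0.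
Qed.

Lemma fsp_dim_ge p Z : S p -> Z \in P p -> (\dim (fsp Z (ge_ 0)) + \dim (fsp Z (gt_ 0)) = \dim {:L})%N.
Proof.
move=> hp hZ; rewrite -(fsp_dim_lt hp hZ) -(fsp_dimC hss (ge_ 0) hp hZ); congr (_ + \dim (fsp Z _))%N.
apply/seteqP; split=> b; rewrite /ge_ /lt_ /= => hb; first by apply/negP; rewrite -ltNge.
by move/negP: hb; rewrite -ltNge.
Qed.

(** A nonzero v would have Rayleigh quotients at least m1 for Y and at most m2 for W, and these
    differ by at most the operator norm of [ad (Y - W)]. *)
Lemma gap_zero q Y W v (m1 m2 : R) : S q -> Ty q Y -> Ty q W -> kappa * knorm (Y - W) < m1 - m2 ->
  fil Y (ge_ m1) v -> fil W (le_ m2) v -> v = 0.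
Proof.
move=> hq tY tW hk h1 h2; have H := bp_inner hss hq; have hY := ty_P hq tY; have hW := ty_P hq tW.
apply: (ip_eq0 H); apply/eqP; rewrite eq_le (ip_ge0 H) andbT leNgt; apply/negP => v0.
have e1 := fil_nrm_ge hss hq hY (x := m1) (A := ge_ m1) (fun a h => h) h1.
have e2 := fil_nrm hss hq hW (x := m2) (A := le_ m2) (fun a h => h) h2.
have hYW : Y - W \in P q by rewrite rpredB.
have e3 : bp q v (br (Y - W) v) <= kappa * knorm (Y - W) * bp q v v.
  apply: le_trans (ler_norm _) _; apply: le_trans (ip_CS H _ _) _.
  rewrite -(sqr_nrm H) expr2 mulrA [leRHS]mulrC ler_wpM2l ?nrm_ge0 //.
  exact: (ty_kappa D v hq hYW).
move: e3; rewrite (brBl hss) (ipBr H); move: hk e1 e2 v0; clear.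
move: (bp q v _) (bp q v _) (bp q v v) (kappa * _) => a b c d; nra.
Qed.

Lemma kappa_ge p : S p -> zeta0 <= kappa.
Proof.
move=> hp; have [Z tZ] := ty_ex D hp; have hZ := ty_P hp tZ; have H := bp_inner hss hp.
have [v vn v0] : exists2 v, fil Z (ge_ zeta0) v & v != 0.
  exists (vpick (fsp Z (gt_ 0))).
    by apply: (ty_gap D hp tZ); apply/(fspP hss _ _ hp hZ); apply: memv_pick.
  by rewrite vpick0 -dimv_eq0 -lt0n; apply: (ty_pos D hp tZ).
have e1 := fil_nrm_ge hss hp hZ (A := ge_ zeta0) (fun a h => h) vn.
have e2 : bp p v (br Z v) <= kappa * bp p v v.
  apply: le_trans (ler_norm _) _; apply: le_trans (ip_CS H _ _) _.
  rewrite -(sqr_nrm H) expr2 mulrA [leRHS]mulrC ler_wpM2l ?nrm_ge0 //.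
  by have := ty_kappa D v hp hZ; rewrite (ty_usphere D hp tZ).2 mulr1.
have := le_trans e1 e2; rewrite ler_pM2r // -(sqr_nrm H) exprn_gt0 //.
by rewrite (nrm_gt0 H).
Qed.

Lemma geo_commute_P p X Z t : S p -> X \in P p -> Z \in P p -> br X Z = 0 -> Z \in P (geo p X t).
Proof.
move=> hp hX hZ h; apply/memP; rewrite (geoE hss _ _ hp hX) ((memP p Z).1 hZ).
rewrite (@vexp_eigen _ _ _ 0) ?expR0 ?scale1r //.
by rewrite (adZ hss) !lfe linearN /= adE h oppr0 scaler0 scale0r.
Qed.

Lemma disjoint_full (U V : {vspace L}) : (forall v, v \in U -> v \in V -> v = 0) ->
  (\dim U + \dim V = \dim {:L})%N -> forall v, exists u w, [/\ u \in U, w \in V & v = u + w].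
Proof.
move=> h0 hd v; have hcap : (U :&: V = 0)%VS.
  by apply/eqP; rewrite -subv0; apply/subvP => w; rewrite memv_cap memv0 => /andP [wU wV]; rewrite (h0 w).
have : (U + V)%VS == fullv by rewrite eqEdim subvf dimv_disjoint_sum // hd leqnn.
by move=> /eqP e; have := memvf v; rewrite -e => /memv_addP [u uU [w wV ->]]; exists u, w.
Qed.

Lemma unipotent_opp q W u : S q -> Ty q W -> fil W (lt_ 0) u ->
  exists r, [/\ S r, Ty r (W + u) & samefil (- (W + u)) (- W)].
Proof.
move=> hq tW /fil_ltE hu; have hW := ty_P hq tW; have hW' : - W \in P q by rewrite rpredN.
have hu' := filN hss hq hW' hu.
have [g [hg e1 sf]] := unipotent_fil hss hq hW' hu'; have ag := isomG_aut hss hg.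
exists (act g q); split; first exact: act_sym.
  have <- : g W = W + u by apply: oppr_inj; rewrite opprD -e1 linearN.
  exact: (ty_act D hq hg tW).
by rewrite opprD.
Qed.

Lemma unipotent_ty q Y u r : S q -> Y \in P q -> fil Y (gt_ 0) u -> S r -> Ty r (Y + u) -> Ty q Y.
Proof.
move=> hq hY hu hr tr; have [g [hg e1 sf]] := unipotent_fil hss hq hY hu.
exact: (ty_samefil D hr hq tr hY sf).
Qed.

(* z is the common conjugate direction of the parallel set joining the flags of -W and Y: the part of W
   in par(Y) along n(-W). *)
Lemma opposite q Y W : S q -> Ty q Y -> Ty q W -> kappa * knorm (Y - W) < zeta0 ->
  exists z r, [/\ S r, Ty r z, samefil z Y, samefil (- z) (- W) &
    fil Y (gt_ 0) (z - Y) /\ fil W (lt_ 0) (z - W)].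
Proof.
move=> hq tY tW hk; have hY := ty_P hq tY; have hW := ty_P hq tW.
have dYW : (\dim (fsp Y (ge_ 0)) + \dim (fsp W (lt_ 0)) = \dim {:L})%N.
  by rewrite (fsp_dim_lt hq hW) (ty_dim D hq hq tW tY) (fsp_dim_ge hq hY).
(* By dimensions and [gap_zero], the parabolic of Y and the nilradical of - W are complementary.
   Subtracting from W its nilradical component gives y, which is conjugate to W by a unipotent
   fixing the flag of - W. *)
have [|y [u [/(fspP hss _ _ hq hY) hy /(fspP hss _ _ hq hW) hu eW]]] := disjoint_full _ dYW W.
  move=> v /(fspP hss _ _ hq hY) h1 /(fspP hss _ _ hq hW) /(ty_gap_lt hq tW) h2.
  by apply: (gap_zero hq tY tW _ h1 h2); rewrite sub0r opprK.
have ez : W + - u = y by rewrite {1}eW addrK.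
have [r [hr]] := unipotent_opp hq tW (filN hss hq hW hu); rewrite ez => tz sf.
have hz := ty_P hr tz.
have stab v : fil Y (gt_ 0) v -> fil Y (gt_ 0) (br y v).
  move=> hv; apply: (fil_br hss hq hY _ hy hv) => a b; rewrite /ge_ /gt_ /= => a0 b0.
  by rewrite -[0]addr0 ler_ltD.
(* As y lies in the parabolic of Y, it preserves the nilradical of Y. An eigenvector there of
   eigenvalue at most 0 would have weight at least zeta0 for Y and, since - y and - W have the same
   filtration, at most 0 for W. *)
have nn v : fil Y (gt_ 0) v -> fil y (gt_ 0) v.
  have [|n [e [m [he hm]]]] := spectral (bp_inner hss hr) (U := fsp Y (gt_ 0)) (ad_selfadj hss hr hz).
    by move=> w /(fspP hss _ _ hq hY) hw; rewrite adE; apply/(fspP hss _ _ hq hY)/stab.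
  have [oe em ec] := he.
  move=> /(fspP hss _ _ hq hY) /ec ->; apply: (fil_sum hss hr hz) => i; apply: (filZ hss hr hz).
  apply: (@fil_eigen _ _ _ _ (m i)); last by rewrite -adE.
  rewrite /gt_ /= ltNge; apply/negP => m0.
  have h1 : fil W (le_ 0) (e i).
    apply/fil_leE; rewrite oppr0; apply/sf; apply/(fil_oppE hss).
    by apply: (@fil_eigen _ _ _ _ (m i)); [rewrite /opp_ /ge_ /= oppr_ge0|rewrite -adE].
  have /(fspP hss _ _ hq hY) /(ty_gap D hq tY) h2 := em i.
  have e0 : e i = 0 by apply: (gap_zero hq tY tW _ h2 h1); rewrite subr0.
  by have := oe i i; rewrite e0 (ip0l (bp_inner hss hr)) eqxx => /eqP; rewrite eq_sym oner_eq0.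
have nE v : fil y (gt_ 0) v -> fil Y (gt_ 0) v.
  move=> /(fspP hss _ _ hr hz) hv; apply/(fspP hss _ _ hq hY).
  suff /eqP -> : fsp Y (gt_ 0) == fsp y (gt_ 0) by [].
  rewrite eqEdim (ty_dim D hq hr tY tz) leqnn andbT; apply/subvP => w /(fspP hss _ _ hq hY) hw.
  exact/(fspP hss _ _ hr hz)/nn.
(* A parabolic is the Killing orthogonal of its nilradical, and the nilradicals of Y and y
   coincide. *)
have Yz : parle Y y.
  move=> v hv; apply: (fil_ge_killing hss hr hz) => w; rewrite oppr0 => /nE hw.
  apply: (fil_killing hss hq hY _ hw hv) => a b; rewrite /gt_ /ge_ /= => a0 b0; apply/eqP.
  by rewrite gt_eqF // ltr_wpDr.
(* The direction at q of the ideal point of y is typed and its parabolic contains that of Y, so it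
   is Y by uniqueness of the typed face. *)
have [Y2 [hY2 sY2 _]] := exists_dir hss hr hq hz.
have tY2 := ty_samefil D hr hq tz hY2 sY2.
have eY : Y = Y2 by apply: (ty_eq D hq hY tY tY2) => // v /Yz /sY2.
have szY : samefil y Y by rewrite eY.
exists y, r; split=> //; split; first exact: (samefil_sub hss hr hz hq hY szY).
by rewrite -ez addrAC subrr add0r; apply: (filN hss hq hW).
Qed.

(** The components a and b are nearly orthogonal: b has weights at least zeta0 for Y and a at most -
    zeta0 for W, so the spectral gap 2 zeta0 bounds their cosine. Thus the square of Y - W is almost
    the sum of the two squares. *)
Lemma opposite_bound q Y W a b : S q -> Ty q Y -> Ty q W -> fil W (lt_ 0) a -> fil Y (gt_ 0) b ->
  Y - W = a - b ->
  (1 - kappa * knorm (Y - W) / (2 * zeta0)) * (nrm (bp q) a ^+ 2 + nrm (bp q) b ^+ 2) <= knorm (Y - W) ^+ 2.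
Proof.
move=> hq tY tW ha hb e1; have H := bp_inner hss hq; have hY := ty_P hq tY; have hW := ty_P hq tW.
have hYW : Y - W \in P q by rewrite rpredB.
have z0 := ty_zeta0 D.
have sg : `|bp q b a| <= kappa * knorm (Y - W) / (zeta0 - - zeta0) * (nrm (bp q) b * nrm (bp q) a).
  apply: (spectral_gap_ip H (f := ad Y) (g := ad W) (A := fsp Y (gt_ 0)) (B := fsp W (lt_ 0))).
  - exact: (ad_selfadj hss hq hY).
  - exact: (ad_selfadj hss hq hW).
  - move=> v /(fspP hss _ _ hq hY) hv; apply/(fspP hss _ _ hq hY); rewrite adE; exact: (fil_br0 hss hq hY).
  - move=> v /(fspP hss _ _ hq hW) hv; apply/(fspP hss _ _ hq hW); rewrite adE; exact: (fil_br0 hss hq hW).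
  - move=> v /(fspP hss _ _ hq hY) /(ty_gap D hq tY) hv; rewrite adE.
    exact: (fil_nrm_ge hss hq hY (A := ge_ zeta0) (fun a h => h) hv).
  - move=> v /(fspP hss _ _ hq hW) /(ty_gap_lt hq tW) hv; rewrite adE.
    exact: (fil_nrm hss hq hW (A := le_ (- zeta0)) (fun a h => h) hv).
  - by move=> v; rewrite !adE -(brBl hss); apply: (ty_kappa D v hq hYW).
  - by rewrite -subr_gt0 opprK addr_gt0.
  - exact/(fspP hss _ _ hq hY).
  - exact/(fspP hss _ _ hq hW).
have e2 : knorm (Y - W) ^+ 2 = nrm (bp q) a ^+ 2 + nrm (bp q) b ^+ 2 - 2 * bp q b a.
  rewrite (knormE hss hYW) e1 !(sqr_nrm H) (ipBl H) !(ipBr H) (ipC H a b).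
  by move: (bp q a a) (bp q b a) (bp q b b) => x y z; lra.
move: sg; rewrite opprK (_ : zeta0 + zeta0 = 2 * zeta0); last by lra.
have t0 : 0 <= kappa * knorm (Y - W) / (2 * zeta0).
  by rewrite divr_ge0 ?mulr_ge0 ?knorm_ge0 ?(ltW z0) // (le_trans (ltW z0) (kappa_ge hq)).
rewrite e2; move: t0; move: (_ / _) (bp q b a) (nrm _ b) (nrm _ a) => t x b' a' t0.
rewrite ler_norml => /andP [_ h]; have := sqr_ge0 (a' - b'); nra.
Qed.

(** Let z be the common conjugate of the flag of Y and the opposite flag of Z. Its deviation a = z -
    Z lies in the nilradical of - Z, which shrinks by the factor e^{-tc} on the way back from q to
    p, and at p the direction W' differs from Z by at most twice the length of a. *)
Lemma contraction p Z X Y W' (c t : R) : S p -> Ty p Z -> usphere p X -> reg c Z X -> 0 <= t ->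
  Ty (geo p X t) Y -> kappa * knorm (Y - Z) < zeta0 -> W' \in P p -> samefil Y W' ->
  exists a, (1 - kappa * knorm (Y - Z) / (2 * zeta0)) * nrm (bp (geo p X t)) a ^+ 2 <= knorm (Y - Z) ^+ 2 /\
    knorm (W' - Z) <= 2 * (expR (- (t * c)) * nrm (bp (geo p X t)) a).
Proof.
move=> hp tZ [hX nX] hr t0 tY hk hW' sf; set q := geo p X t.
have hq : S q := geo_sym hss X t hp; have hXq : X \in P q := geo_P hss t hp hX.
have H := bp_inner hss hp; have hZ := ty_P hp tZ; have hZX := hr.1.
have hZq : Z \in P q.
  by apply: (geo_commute_P _ hp hX hZ); apply: (br_eq0C hss).
have tZq := ty_move hp hq tZ hZq.
have [z [r [hr' tz szY _ [hb ha]]]] := opposite hq tY tZq hk.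
exists (z - Z); have z0 := ty_zeta0 D; split.
  have e1 : Y - Z = (z - Z) - (z - Y) by vring.
  apply: le_trans (opposite_bound hq tY tZq ha hb e1); rewrite ler_wpM2l ?lerDl ?sqr_ge0 //.
  rewrite subr_ge0 ler_pdivrMr ?mulr_gt0 //; move: hk z0; move: (kappa * _) => k; lra.
have hz := ty_P hr' tz; set a := z - Z in ha *.
have nW : knorm W' = 1 by rewrite -(samefil_knorm hss hq hp (ty_P hq tY) hW' sf) (ty_usphere D hq tY).2.
have nZ := (ty_usphere D hp tZ).2.
have self U : fil U [set 0] U by apply: (@fil_eigen _ _ _ _ 0) => //; rewrite lie_br_alt scale0r.
have o1 : bp p W' (z - W') = 0.
  have h1 := samefil_sub hss hr' hz hp hW' (samefil_trans szY sf).
  by apply: (fil_orth hss hp hW' _ (self W') h1) => b ->; rewrite /gt_ /= ltxx.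
have o2 : bp p Z a = 0.
  by apply: (fil_orth hss hp hZ _ (self Z) ha) => b ->; rewrite /lt_ /= ltxx.
have sW : bp p W' W' = 1 by rewrite -(sqr_nrm H) -(knormE hss hW') nW expr1n.
have sZ : bp p Z Z = 1 by rewrite -(sqr_nrm H) -(knormE hss hZ) nZ expr1n.
have hN : W' - Z \in P p by rewrite rpredB.
(* Both W' and Z are unit vectors having inner product 1 with z at p, since z - W' and z - Z lie in
   nilradicals orthogonal to W' and to Z respectively. *)
have e2 : knorm (W' - Z) ^+ 2 = 2 * bp p (W' - Z) a.
  have ez : z = W' + (z - W') by rewrite addrC subrK.
  have o3 : bp p W' z = 1 by rewrite ez (ipDr H) o1 sW addr0.
  have zz : bp p Z z = 1 by apply/eqP; rewrite -subr_eq0 -[X in _ - X]sZ -(ipBr H) -/a o2.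
  rewrite (knormE hss hN) (sqr_nrm H) /a !(ipBl H) !(ipBr H) o3 zz sW sZ (ipC H Z W'); ring.
have e3 : knorm (W' - Z) <= 2 * nrm (bp p) a.
  have e4 : bp p (W' - Z) a <= knorm (W' - Z) * nrm (bp p) a.
    by rewrite (knormE hss hN); apply: le_trans (ler_norm _) (ip_CS H _ _).
  have := knorm_ge0 (W' - Z); have := nrm_ge0 (bp p) a.
  move: e2 e4; move: (bp p (W' - Z) a) (knorm _) (nrm _ _) => x y n; nra.
apply: le_trans e3 _; rewrite ler_wpM2l //.
have hXn : - X \in P q by rewrite rpredN.
have h2 : fil (- X) (ge_ c) a by apply: (reg_opp hss hp hZ hX hr).2; apply/fil_ltE.
have := fil_decay hss hq hXn h2 t0; rewrite (geo_back hss t hp hX) => h3.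
rewrite -(ler_pXn2r (n:=2)) ?nnegrE ?mulr_ge0 ?expR_ge0 ?nrm_ge0 // exprMn !sqr_nrm //; last exact: (bp_inner hss hq).
rewrite expr2 -expRD; apply: le_trans h3 _; rewrite (_ : - (t * c) - t * c = - 2 * t * c) //; ring.
Qed.

End Opposite.

(** The spectral loss is at most 3/20, and (17/20) a^2 <= 9 eps^2 gives a <= 4 eps. With E <= 1/4
    the result is 2 eps, leaving room for one turn of size eps before the next pullback. The case E
    = 0 is used for the bound on a alone. *)
Lemma pullback_arith (R : realType) (zeta0 kappa eps th a E N : R) : 0 < zeta0 -> 0 < eps -> 0 <= a ->
  0 <= kappa -> 0 <= th -> th <= 3 * eps -> 10 * (kappa * eps) <= zeta0 -> 0 <= E -> 4 * E <= 1 ->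
  (1 - kappa * th / (2 * zeta0)) * a ^+ 2 <= th ^+ 2 -> N <= 2 * (E * a) -> N <= 2 * eps /\ a <= 4 * eps.
Proof.
move=> z0 e0 a0 k0 th0 h1 h2 E0 h4 h5 h6.
have h3 : kappa * th / (2 * zeta0) <= 3 / 20.
  rewrite ler_pdivrMr ?mulr_gt0 //; have := ler_wpM2l k0 h1; lra.
have h7 : a <= 4 * eps.
  rewrite leNgt; apply/negP => h8; have h9 : (17 / 20) * a ^+ 2 <= th ^+ 2.
    by apply: le_trans h5; rewrite ler_wpM2r ?sqr_ge0 //; move: h3; lra.
  have h10 : th ^+ 2 <= (3 * eps) ^+ 2 by rewrite ler_pXn2r ?nnegrE ?mulr_ge0 // ltW.
  have h11 : (4 * eps) ^+ 2 < a ^+ 2 by rewrite ltr_pXn2r ?nnegrE ?mulr_ge0 // ltW.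
  have ep : 0 < eps ^+ 2 by rewrite exprn_gt0.
  by move: h9 h10 h11 ep; rewrite !exprMn; lra.
split=> //; apply: le_trans h6 _; nra.
Qed.

Lemma cvgr_le_near (R : realType) (F : set_system nat) (u : nat -> R) (a c : R) (K : nat) : ProperFilter F ->
  \oo `<=` F -> u @ F --> a -> (forall k, (K <= k)%N -> u k <= c) -> a <= c.
Proof.
move=> FF Foo h hK; rewrite leNgt; apply/negP => ca.
have h1 : F [set k | c < u k] by apply: (cvgr_gt a h).
have h2 : F [set k | (K <= k)%N] by apply: Foo; exists K.
have [k [/= k1 k2]] := filter_ex (filterI h1 h2).
by move: (lt_le_trans k1 (hK k k2)); rewrite ltxx.
Qed.

(** * The limit flag of a straight sequence *)

Section Forward.
Variables (R : realType) (L : liealg R).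
Hypothesis hss : semisimple L.
Implicit Types (X Y Z U V W u v z : L) (f g p q r : 'End(L)) (A : set R).
Local Notation S := (@symspace R L).
Local Notation P := (@pspace R L).

Lemma knormD p X Y : S p -> X \in P p -> Y \in P p -> knorm (X + Y) <= knorm X + knorm Y.
Proof.
move=> hp hX hY; rewrite !(knormE hss (p := p)) ?rpredD //; exact: (nrmD (bp_inner hss hp)).
Qed.

Lemma knormB p X Y : S p -> X \in P p -> Y \in P p -> knorm (X - Y) = knorm (Y - X).
Proof. by move=> hp hX hY; rewrite -opprB (knormN hss hp) // rpredB. Qed.

Lemma knorm_triangle p X Y Z : S p -> X \in P p -> Y \in P p -> Z \in P p ->
  knorm (X - Z) <= knorm (X - Y) + knorm (Y - Z).
Proof.
move=> hp hX hY hZ; have -> : X - Z = (X - Y) + (Y - Z) by rewrite addrA subrK.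
by apply: (knormD hp); rewrite rpredB.
Qed.

Lemma knorm0 p : S p -> knorm (0 : L) = 0.
Proof. by move=> hp; rewrite (knormE hss (mem0v (P p))) (nrm0 (bp_inner hss hp)). Qed.

(** The direction at q of the ideal point of Z. *)
Definition tr Z q := xget 0 [set Y : L | Y \in P q /\ samefil Z Y].

Lemma trP p q Z : S p -> S q -> Z \in P p -> tr Z q \in P q /\ samefil Z (tr Z q).
Proof.
move=> hp hq hZ; have [Y [hY h _]] := exists_dir hss hp hq hZ.
exact: (@xgetI _ 0 [set Y : L | Y \in P q /\ samefil Z Y] Y).
Qed.

Variables (Ty : 'End(L) -> L -> Prop) (zeta0 kappa : R).
Hypothesis D : flag_type Ty zeta0 kappa.
Variables (a0 s eps : R).
Hypotheses (ha0 : 0 < a0) (hs0 : 0 < s) (heps : 0 < eps) (hN1 : 10 * (kappa * eps) <= zeta0)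
  (hN2 : 4 * expR (- (a0 * s)) <= 1).

Definition link p q Z := exists X t, [/\ Ty p Z, usphere p X, reg a0 Z X, s <= t & q = geo p X t].

Lemma link_end p q Z : S p -> link p q Z -> S q /\ Ty q Z.
Proof.
move=> hp [X [t [tZ [hX nX] [h _] st ->]]]; have hq := geo_sym hss X t hp; split=> //.
apply: (ty_move D hp hq tZ); apply: (geo_commute_P hss _ hp hX (ty_P D hp tZ)).
exact: (br_eq0C hss).
Qed.

Lemma link_opp p q Z : S p -> link p q Z -> link q p (- Z).
Proof.
move=> hp hl; have [hq tZ'] := link_end hp hl; have [X [t [tZ [hX nX] hr st e1]]] := hl; subst q.
have hXq := geo_P hss t hp hX; exists (- X), t; split=> //; first exact: (ty_opp D hq tZ').
- by apply: (usphereN hss hq); split.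
- by apply: (reg_opp hss hp (ty_P D hp tZ) hX hr).
- by rewrite (geo_back hss t hp hX).
Qed.

Lemma pullback p q Z Y W : S p -> link p q Z -> Ty q Y -> knorm (Y - Z) <= 3 * eps ->
  W \in P p -> samefil Y W -> knorm (W - Z) <= 2 * eps.
Proof.
move=> hp [X [t [tZ uX hr st ->]]] tY h3 hW sf; have k0 := le_trans (ltW (ty_zeta0 D)) (kappa_ge hss D hp).
have z0 := ty_zeta0 D; have hk : kappa * knorm (Y - Z) < zeta0.
  by apply: le_lt_trans (ler_wpM2l k0 h3) _; move: hN1 z0; lra.
have t0 : 0 <= t := ltW (lt_le_trans hs0 st).
have [a [h1 h2]] := contraction hss D hp tZ uX hr t0 tY hk hW sf.
have h4 : 4 * expR (- (t * a0)) <= 1.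
  apply: le_trans hN2; rewrite ler_wpM2l // ler_expR lerN2 mulrC ler_wpM2r // ltW //.
by have [] := pullback_arith z0 heps (nrm_ge0 _ a) k0 (knorm_ge0 _) h3 hN1 (expR_ge0 _) h4 h1 h2.
Qed.

Variables (I : set int) (x : int -> 'End(L)) (Zs : int -> L).
Hypotheses (hI : interval_set I) (hx : forall n, I n -> S (x n))
  (hlink : forall n, I n -> I (n + 1) -> link (x n) (x (n + 1)) (Zs n))
  (hchord : forall n, I (n - 1) -> I n -> I (n + 1) -> knorm (Zs n - Zs (n - 1)) <= eps).

Lemma link_ty n : I n -> I (n + 1) -> Ty (x n) (Zs n).
Proof. by move=> h1 h2; have [X [t []]] := hlink h1 h2. Qed.

Lemma link_ty_prev n : I (n - 1) -> I n -> Ty (x n) (Zs (n - 1)).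
Proof.
move=> h1 h2; have e : n - 1 + 1 = n by rewrite subrK.
by have [] := link_end (hx h1) (hlink h1 _); rewrite e.
Qed.

(** Backward induction from the end E. Pulling back turns 3 eps at x (n + 1) into 2 eps at x n, and
    turning to the previous segment costs eps. At the end itself the flag is that of the entering
    segment, so the comparison with a leaving segment starts at k > 0. *)
Lemma family_bound E k n : I (E - 1) -> I E -> n + k%:Z = E -> I n ->
  (I (n - 1) -> knorm (tr (Zs (E - 1)) (x n) - Zs (n - 1)) <= 3 * eps) /\
  ((0 < k)%N -> knorm (tr (Zs (E - 1)) (x n) - Zs n) <= 2 * eps).
Proof.
move=> hE1 hE; have tE := link_ty_prev hE1 hE; have ZE := ty_P D (hx hE) tE.
elim: k n => [|k IH] n.
  rewrite addr0 => -> _; split=> // _; have [h1 h2] := trP (hx hE) (hx hE) ZE.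
  by rewrite -(samefil_eq hss (hx hE) ZE h1 h2) subrr (knorm0 (hx hE)) mulr_ge0 // ltW.
move=> e1 hn; have hn1 : I (n + 1) by apply: (hI hn hE); lia.
have e2 : n + 1 + k%:Z = E by lia.
have [h1 _] := IH _ e2 hn1; have [h3 h4] := trP (hx hE) (hx hn1) ZE; have [h5 h6] := trP (hx hE) (hx hn) ZE.
have e3 : n + 1 - 1 = n by rewrite addrK.
rewrite e3 in h1; have h7 : knorm (tr (Zs (E - 1)) (x n) - Zs n) <= 2 * eps.
  apply: (pullback (hx hn) (hlink hn hn1) (ty_samefil D (hx hE) (hx hn1) tE h3 h4) (h1 hn) h5).
  exact: samefil_trans (samefil_sym h4) h6.
split=> // hp1; have tn := link_ty hn hn1; have tp := link_ty_prev hp1 hn.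
apply: le_trans (knorm_triangle (hx hn) h5 (ty_P D (hx hn) tn) (ty_P D (hx hn) tp)) _.
by move: h7 (hchord hp1 hn hn1); move: (knorm _) (knorm _) => y y'; lra.
Qed.

(** One family of end indices for both cases: constant at the last index if the interval is bounded
    above, otherwise tending to infinity. *)
Lemma exists_ends n0 : I n0 -> I (n0 + 1) -> exists E : nat -> int, (forall k, I (E k) /\ n0 + 1 <= E k) /\
  forall n, I n -> exists K : nat, forall k, (K <= k)%N -> n <= E k /\ (I (n + 1) -> n + 1 <= E k).
Proof.
move=> h0 h1; have [[M [IM hM]]|nb] := pselect (exists M, I M /\ forall n, I n -> n <= M).
  exists (fun=> M); split=> [k|n hn]; first by split=> //; apply: hM.
  by exists 0%N => k _; split; [apply: hM|apply: hM].
have /choice [E hE] (k : nat) : exists e, I e /\ n0 + 1 + k%:Z <= e.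
  elim: k => [|k [e [Ie he]]]; first by exists (n0 + 1); split=> //; rewrite addr0.
  have [e' [Ie' he']] : exists e', I e' /\ e < e'.
    apply: contrapT => h; apply: nb; exists e; split=> // n hn; rewrite leNgt; apply/negP => lt.
    by apply: h; exists n.
  by exists e'; split=> //; lia.
exists E; split=> [k|n hn]; first by have [h2 h3] := hE k; split=> //; lia.
by exists `|n - n0|%N => k hk; have [_ h3] := hE k; split=> [|_]; lia.
Qed.

(** At every x n the directions of the flags of the segments ending at E k are unit vectors in a
    finite-dimensional space, so they have an ultralimit. The limits at different points stay
    asymptotic because the comparison constants do not depend on k; that they are still of type zeta
    requires a separate argument. *)
Lemma forward_flag n0 : I n0 -> I (n0 + 1) -> exists Y : int -> L,
  [/\ forall n, I n -> Ty (x n) (Y n), forall n m, I n -> I m -> samefil (Y n) (Y m),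
      forall n, I n -> I (n + 1) -> knorm (Y n - Zs n) <= 2 * eps &
      forall n, I (n - 1) -> I n -> knorm (Y n - Zs (n - 1)) <= 3 * eps].
Proof.
move=> h0 h1; have [E [hE1 hE2]] := exists_ends h0 h1.
have hEI k : I (E k - 1) by have [h2 h3] := hE1 k; apply: (hI h0 h2); lia.
have tE k : Ty (x (E k)) (Zs (E k - 1)) by apply: link_ty_prev (hEI k) (hE1 k).1.
have ZE k := ty_P D (hx (hE1 k).1) (tE k).
pose Yk n k := tr (Zs (E k - 1)) (x n).
have YkP n k : I n -> Yk n k \in P (x n) /\ samefil (Zs (E k - 1)) (Yk n k).
  by move=> hn; apply: trP (hx (hE1 k).1) (hx hn) (ZE k).
have tYk n k : I n -> Ty (x n) (Yk n k).
  by move=> hn; have [h2 h3] := YkP n k hn; apply: (ty_samefil D (hx (hE1 k).1) (hx hn) (tE k) h2 h3).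
have nYk n k : I n -> knorm (Yk n k) = 1 by move=> hn; have [_ ->] := ty_usphere D (hx hn) (tYk n k hn).
have b2 n : I n -> I (n + 1) -> exists K, forall k, (K <= k)%N -> knorm (Yk n k - Zs n) <= 2 * eps.
  move=> hn hn1; have [K hK] := hE2 n hn; exists K => k kK; have [h2 h3] := hK k kK; have h4 := h3 hn1.
  have [_ h5] := @family_bound (E k) `|E k - n|%N n (hEI k) (hE1 k).1 ltac:(lia) hn.
  by apply: h5; lia.
have b3 n : I (n - 1) -> I n -> exists K, forall k, (K <= k)%N -> knorm (Yk n k - Zs (n - 1)) <= 3 * eps.
  move=> hn1 hn; have [K hK] := hE2 n hn; exists K => k kK; have [h2 _] := hK k kK.
  have [h5 _] := @family_bound (E k) `|E k - n|%N n (hEI k) (hE1 k).1 ltac:(lia) hn.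
  exact: h5.
have [F [FU Foo]] := exists_free_ultrafilter; have FP : ProperFilter F := @ultra_proper _ _ FU.
have /choice [Y hY] n : exists l, I n -> vcvg F (Yk n) l.
  have [hn|hn] := pselect (I n); last by exists 0.
  have [l hl] : exists l, vcvg F (Yk n) l.
    apply: (ultra_nrm_cvg (bp_inner hss (hx hn)) (M := 1)) => k.
    by rewrite -(knormE hss (YkP n k hn).1) nYk.
  by exists l.
have YP n : I n -> Y n \in P (x n) by move=> hn; apply: (vcvg_mem _ (hY n hn)) => k; have [] := YkP n k hn.
have cvn n W : I n -> W \in P (x n) -> (fun k => knorm (Yk n k - W) ^+ 2) @ F --> knorm (Y n - W) ^+ 2.
  move=> hn hW; have H := bp_inner hss (hx hn).
  have e1 V : V \in P (x n) -> knorm (V - W) ^+ 2 = bp (x n) (V - W) (V - W).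
    by move=> hV; rewrite (knormE hss (p := x n)) ?rpredB // (sqr_nrm H).
  rewrite e1 ?YP //; under [X in X @ _ --> _]funext => k do rewrite (e1 _ (YkP n k hn).1).
  by apply: (vcvg_ip H); apply: vcvgB; [apply: hY|apply: vcvg_cst|apply: hY|apply: vcvg_cst].
have lim_le n W c : I n -> W \in P (x n) -> 0 <= c -> (exists K, forall k, (K <= k)%N -> knorm (Yk n k - W) <= c) ->
    knorm (Y n - W) <= c.
  move=> hn hW c0 [K hK]; rewrite -(ler_pXn2r (n:=2)) ?nnegrE ?knorm_ge0 //.
  apply: (cvgr_le_near FP Foo (cvn n W hn hW) (K := K)) => k kK.
  by rewrite ler_pXn2r ?nnegrE ?knorm_ge0 // hK.
have nY n : I n -> knorm (Y n) = 1.
  move=> hn; have h2 := cvn n 0 hn (mem0v _); rewrite subr0 in h2.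
  have h3 : knorm (Y n) ^+ 2 = 1.
    apply: (cvgr_uniq h2); under [X in X @ _ --> _]funext => k do rewrite subr0 nYk // expr1n.
    exact: cvg_cst.
  by apply/eqP; rewrite -(eqrXn2 (n := 2)) ?knorm_ge0 // h3 expr1n.
have sY n m : I n -> I m -> samefil (Y n) (Y m).
  have bd i j : I i -> I j -> forall t v, 0 <= t -> bp (geo (x j) (Y j) t) v v <=
      (\dim {:L})%:R ^+ 2 * expR (2 * dist (x i) (x j)) * bp (geo (x i) (Y i) t) v v.
    move=> hi hj t v t0.
    have c1 : (fun k => bp (geo (x j) (Yk j k) t) v v) @ F --> bp (geo (x j) (Y j) t) v v.
      apply: (@bp_geo_cvg _ _ hss F FP (x j) (Yk j) (fun=> v) (Y j) 1 t v (hx hj)) => [k||k|||];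
        [by have [] := YkP j k hj|exact: YP|by rewrite nYk|by rewrite nY|exact: hY|exact: vcvg_cst].
    have c2 : (fun k => (\dim {:L})%:R ^+ 2 * expR (2 * dist (x i) (x j)) * bp (geo (x i) (Yk i k) t) v v) @ F -->
        (\dim {:L})%:R ^+ 2 * expR (2 * dist (x i) (x j)) * bp (geo (x i) (Y i) t) v v.
      apply: cvgM; first exact: cvg_cst.
      apply: (@bp_geo_cvg _ _ hss F FP (x i) (Yk i) (fun=> v) (Y i) 1 t v (hx hi)) => [k||k|||];
        [by have [] := YkP i k hi|exact: YP|by rewrite nYk|by rewrite nY|exact: hY|exact: vcvg_cst].
    apply: (cvgr_lel c1 c2) => k; have [h2 h3] := YkP i k hi; have [h4 h5] := YkP j k hj.
    apply: (samefil_bound hss (hx hi) (hx hj) h2 h4 _ v t0).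
    exact: samefil_trans (samefil_sym h3) h5.
  move=> hn hm; apply: (bound_samefil hss (hx hn) (hx hm) (YP n hn) (YP m hm) _ _ (bd n m hn hm) (bd m n hm hn)).
    by rewrite mulr_ge0 ?expR_ge0 ?exprn_ge0.
  by rewrite mulr_ge0 ?expR_ge0 ?exprn_ge0.
(* The type is recovered at n0 through the opposite flag of W = Zs n0. The common conjugates z k of
   Yk and W are bounded, so in the limit W + a = Y + b with a in the nilradical of - W and b in that
   of Y. Unipotent elements conjugate W to W + a and Y to Y + b, so Y has the type of W. *)
have t0 : Ty (x n0) (Y n0).
  have hq := hx h0; have H := bp_inner hss hq; have tW := link_ty h0 h1; have hW := ty_P D hq tW.
  set q := x n0 in hq H tW hW *; set W := Zs n0 in tW hW *.
  have k0 := le_trans (ltW (ty_zeta0 D)) (kappa_ge hss D hq); have z0 := ty_zeta0 D.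
  have th k : knorm (Yk n0 k - W) <= 3 * eps.
    have [_ h5] := @family_bound (E k) `|E k - n0|%N n0 (hEI k) (hE1 k).1 ltac:(have [_ ?] := hE1 k; lia) h0.
    have := h5 ltac:(have [_ ?] := hE1 k; lia).
    by rewrite -/W -/(Yk n0 k); move: heps; move: (knorm _) => y; lra.
  have tk k := tYk n0 k h0.
  have /choice [z hz] k : exists z, fil (Yk n0 k) (gt_ 0) (z - Yk n0 k) /\ fil W (lt_ 0) (z - W).
    have [|z [r [_ _ _ _ h2]]] := opposite hss D hq (tk k) tW; last by exists z.
    by apply: le_lt_trans (ler_wpM2l k0 (th k)) _; move: hN1 z0; lra.
  have bd k : nrm (bp q) (z k - W) <= 4 * eps /\ nrm (bp q) (z k - Yk n0 k) <= 4 * eps.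
    have [hb ha] := hz k; have e1 : Yk n0 k - W = (z k - W) - (z k - Yk n0 k) by vring.
    have := opposite_bound hss D hq (tk k) tW ha hb e1.
    set c := 1 - _ => h2; have c0 : 0 <= c.
      rewrite subr_ge0 ler_pdivrMr ?mulr_gt0 //; have := ler_wpM2l k0 (th k); move: hN1 z0.
      move: (kappa * knorm _) => y; lra.
    have E0 : 4 * 0 <= 1 :> R by rewrite mulr0.
    split.
      have h3 : c * nrm (bp q) (z k - W) ^+ 2 <= knorm (Yk n0 k - W) ^+ 2.
        by apply: le_trans h2; rewrite ler_wpM2l // lerDl sqr_ge0.
      have h4 : 0 <= 2 * (0 * nrm (bp q) (z k - W)) by rewrite mul0r mulr0.
      by have [] := pullback_arith z0 heps (nrm_ge0 _ _) k0 (knorm_ge0 _) (th k) hN1 (lexx 0) E0 h3 h4.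
    have h3 : c * nrm (bp q) (z k - Yk n0 k) ^+ 2 <= knorm (Yk n0 k - W) ^+ 2.
      by apply: le_trans h2; rewrite ler_wpM2l // lerDr sqr_ge0.
    have h4 : 0 <= 2 * (0 * nrm (bp q) (z k - Yk n0 k)) by rewrite mul0r mulr0.
    by have [] := pullback_arith z0 heps (nrm_ge0 _ _) k0 (knorm_ge0 _) (th k) hN1 (lexx 0) E0 h3 h4.
  have [a ha] : exists a, vcvg F (fun k => z k - W) a.
    by apply: (ultra_nrm_cvg H (M := 4 * eps)) => k; have [] := bd k.
  have haW : fil W (lt_ 0) a.
    apply/(fspP hss _ _ hq hW); apply: (vcvg_mem _ ha) => k; apply/(fspP hss _ _ hq hW).
    by have [] := hz k.
  have hb : vcvg F (fun k => z k - Yk n0 k) (W + a - Y n0).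
    have h2 : vcvg F (fun k => W + (z k - W) - Yk n0 k) (W + a - Y n0).
      by apply: vcvgB; [apply: vcvgD => //; apply: vcvg_cst|apply: hY].
    by under [X in vcvg _ X _]funext => k do rewrite -[z k](subrKC W).
  (* Membership in a varying nilradical passes to the limit through its decay rate; the uniform gap
     zeta0 and the bound 4 eps keep the decay estimate independent of k. *)
  have hbY : fil (Y n0) (ge_ zeta0) (W + a - Y n0).
    apply: (decay_fil hss hq (YP n0 h0) (C := (4 * eps) ^+ 2)) => t t0.
    have c1 : (fun k => bp (geo q (Yk n0 k) t) (z k - Yk n0 k) (z k - Yk n0 k)) @ F -->
        bp (geo q (Y n0) t) (W + a - Y n0) (W + a - Y n0).
      apply: (@bp_geo_cvg _ _ hss F FP q (Yk n0) _ (Y n0) 1 t _ hq) => [k||k|||//];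
        [by have [] := YkP n0 k h0|exact: YP|by rewrite nYk|by rewrite nY|exact: hY].
    apply: (cvgr_lel c1 (cvg_cst _)) => k; have [h2 _] := hz k.
    apply: le_trans (fil_decay hss hq (YkP n0 k h0).1 (ty_gap D hq (tk k) h2) t0) _.
    rewrite mulrC ler_wpM2r ?expR_ge0 // -(sqr_nrm H) ler_pXn2r ?nnegrE ?nrm_ge0 //.
      by have [] := bd k.
    by rewrite mulr_ge0 // ltW.
  have [r [hr tr_ _]] := unipotent_opp hss D hq tW haW.
  apply: (unipotent_ty hss D (u := W + a - Y n0) hq (YP n0 h0) _ hr).
    by apply: fil_sub hbY => b; apply: lt_le_trans.
  by rewrite addrC subrK.
exists Y; split=> [n hn|//|n hn hn1|n hn1 hn].
- exact: (ty_samefil D (hx h0) (hx hn) t0 (YP n hn) (sY n0 n h0 hn)).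
- apply: lim_le (b2 n hn hn1) => //; first exact: (ty_P D (hx hn) (link_ty hn hn1)).
  by rewrite mulr_ge0 // ltW.
- apply: lim_le (b3 n hn1 hn) => //; first exact: (ty_P D (hx hn) (link_ty_prev hn1 hn)).
  by rewrite mulr_ge0 // ltW.
Qed.

End Forward.

(** * Projection to a parallel set *)

(** At y / 2^n the bound holds up to the factor e^{-y / 2^n}; doubling the argument multiplies sinh
    by 2 cosh >= 2 and preserves that factor, which tends to 1 with n. *)
Lemma sinh_ge (R : realType) (y : R) : 0 <= y -> 2 * y <= expR y - expR (- y).
Proof.
move=> y0; have dbl (h : R) : expR (2 * h) - expR (- (2 * h)) = (expR h - expR (- h)) * (expR h + expR (- h)).
  have -> : expR (2 * h) = expR h * expR h by rewrite -expRD; congr expR; ring.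
  have -> : expR (- (2 * h)) = expR (- h) * expR (- h) by rewrite -expRD; congr expR; ring.
  ring.
have cosh2 (h : R) : 2 <= expR h + expR (- h).
  have e1 : expR h * expR (- h) = 1 by rewrite -expRD subrr expR0.
  have := expR_gt0 h; have := expR_gt0 (- h); have := sqr_ge0 (expR h - expR (- h)).
  move: e1; move: (expR h) (expR (- h)) => a b; nra.
have low (h : R) : 0 <= h -> expR (- h) * (2 * h) <= expR h - expR (- h).
  move=> h0; have -> : expR h = expR (- h) * expR (2 * h) by rewrite -expRD; congr expR; ring.
  have := expR_ge1Dx (2 * h); have := expR_gt0 (- h).
  move: (expR (- h)) (expR (2 * h)) => a b; nra.
have it n (h : R) : 0 <= h -> expR (- h) * (2 * (2 ^+ n * h)) <= expR (2 ^+ n * h) - expR (- (2 ^+ n * h)).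
  move=> h0; elim: n => [|n IH]; first by rewrite expr0 mul1r; apply: low.
  rewrite exprS -mulrA dbl; have := cosh2 (2 ^+ n * h).
  have : 0 <= expR (- h) * (2 * (2 ^+ n * h)) by rewrite mulr_ge0 ?expR_ge0 // mulr_ge0 // mulr_ge0 ?exprn_ge0.
  move: IH; move: (expR (- h)) (2 ^+ n * h) (expR _ - expR _) (expR _ + expR _) => a b c d; nra.
have key (n : nat) : 2 * y - 2 * y ^+ 2 / n.+1%:R <= expR y - expR (- y).
  have p0 : 0 < 2 ^+ n :> R by rewrite exprn_gt0.
  have := it n (y / 2 ^+ n) (divr_ge0 y0 (ltW p0)); rewrite (mulrC (2 ^+ n)) divfK ?gt_eqF // => h.
  apply: le_trans h; have e1 : n.+1%:R <= 2 ^+ n :> R by rewrite -natrX ler_nat ltn_expl.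
  have e2 := expR_ge1Dx (- (y / 2 ^+ n)).
  have e3 : y / 2 ^+ n <= y / n.+1%:R by rewrite ler_wpM2l // lef_pV2 ?posrE ?ltr0n.
  have -> : 2 * y - 2 * y ^+ 2 / n.+1%:R = (1 - y / n.+1%:R) * (2 * y) by ring.
  by rewrite ler_wpM2r ?mulr_ge0 //; apply: le_trans e2; rewrite lerD2l lerN2.
rewrite leNgt; apply/negP => lt; set d := 2 * y - (expR y - expR (- y)).
have d0 : 0 < d by rewrite subr_gt0.
have [k hk] : exists k : nat, 2 * y ^+ 2 / d < k.+1%:R.
  by exists (Num.truncn (2 * y ^+ 2 / d)); apply: truncnS_gt.
have h2 : 2 * y ^+ 2 / k.+1%:R < d.
  by move: hk; rewrite ltr_pdivrMr // => hk; rewrite ltr_pdivrMr ?ltr0n // [d * _]mulrC.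
by have := key k; move: h2; rewrite /d; move: (expR y) (expR _) (_ / _) => a b c; lra.
Qed.

Lemma cosh_ge (R : realType) (y : R) : 2 + y ^+ 2 <= expR y + expR (- y).
Proof.
have h (x : R) : 0 <= x -> 2 + x ^+ 2 <= expR x + expR (- x).
  move=> x0; have := sinh_ge (y := x / 2) (divr_ge0 x0 (ler0n _ 2)).
  have -> : expR x = expR (x / 2) * expR (x / 2) by rewrite -expRD; congr expR; field.
  have -> : expR (- x) = expR (- (x / 2)) * expR (- (x / 2)) by rewrite -expRD; congr expR; field.
  have e1 : expR (x / 2) * expR (- (x / 2)) = 1 by rewrite -expRD subrr expR0.
  move: e1; move: (expR _) (expR _) => a b e1; rewrite (_ : 2 * (x / 2) = x); last by field.
  by move=> h; have := ler_pM x0 x0 h h; move: e1; nra.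
have [y0|y0] := leP 0 y; first exact: h.
have h2 := h (- y); rewrite oppr_ge0 opprK sqrrN in h2.
by have := h2 (ltW y0); rewrite [expR (- y) + _]addrC.
Qed.

Section Projection.
Variables (R : realType) (L : liealg R).
Hypothesis hss : semisimple L.
Implicit Types (X Y Z U V W u v z : L) (f g p q r x : 'End(L)) (A : set R).
Local Notation br := (@lie_br R L).
Local Notation B := (@killing R L).
Local Notation S := (@symspace R L).
Local Notation P := (@pspace R L).

Lemma geo_zero q : S q -> geo q 0 1 = q.
Proof.
move=> hq; have h0 : (0 : L) \in P q by apply: mem0v.
by rewrite -[X in geo q X](scale0r (0 : L)) (geoZ hss _ _ hq h0) mul0r (geo0 hss hq h0).
Qed.

(** If z is reversed at both points, then e^{2 ad W} fixes z, and positivity of the exponential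
    forces [W, z] = 0. So the geodesic between two points of a parallel set stays in it. *)
Lemma log_commute q W z : S q -> W \in P q -> z \in P q -> z \in P (geo q W 1) -> br W z = 0.
Proof.
move=> hq hW hz /memP; rewrite (geoE hss _ _ hq hW) ((memP q z).1 hz) linearN /= => /oppr_inj.
have hW2 : (2 * 1) *: W \in P q by rewrite rpredZ.
move=> h; have {h} : vexp (ad ((2 * 1) *: W)) z = expR 0 *: z by rewrite expR0 scale1r.
move=> /(vexp_eigen_inv (bp_inner hss hq) (ad_selfadj hss hq hW2)).
rewrite (adZ hss) !lfe adE scale0r => /eqP; rewrite scaler_eq0 mulr1 => /orP [|/eqP //].
by rewrite (negPf (lt0r_neq0 (ltr0Sn R 1))).
Qed.

Lemma dist_commute q U W : S q -> U \in P q -> W \in P q -> br U W = 0 ->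
  dist (geo q U 1) (geo q W 1) = knorm (U - W).
Proof.
move=> hq hU hW h; have hq' := geo_sym hss W 1 hq.
have hd : U - W \in P (geo q W 1).
  by rewrite rpredB //; [apply: (geo_commute_P hss _ hq hW hU); apply: (br_eq0C hss)|apply: (geo_P hss)].
have hq'' := geo_sym hss U 1 hq; rewrite (distC hss hq'' hq').
apply: (dist_log hss hq' hd); apply/lfunP => v; rewrite (geoE hss _ _ hq' hd) (geoE hss _ _ hq hW) (geoE hss _ _ hq hU).
rewrite -vexpD; first by congr (fun_of_lfun (vexp _) _); apply/lfunP => w; rewrite !lfe !adE !(brZl hss) (brBl hss) -scalerDr subrK.
move=> w; rewrite !(adZ hss) !lfe !linearZ /= scalerA mulrC -scalerA; congr (_ *: (_ *: _)).
apply: (ad_commute hss); by rewrite (brBl hss) lie_br_alt h subr0.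
Qed.

(** A point q' at most as far as q would give equality in the law of cosines, hence [U, W] = 0; then
    distances are Euclidean on the span of U and W, and Pythagoras makes q' strictly farther. *)
Lemma nearest_of_orth q z U : S q -> z \in P q -> U \in P q ->
  (forall W, W \in P q -> br z W = 0 -> B U W = 0) ->
  forall q', S q' -> z \in P q' -> q' <> q -> dist (geo q U 1) q < dist (geo q U 1) q'.
Proof.
move=> hq hz hU ho q' hq' hz' ne; have [W hW eW] := exists_log hss hq hq'.
have hx := geo_sym hss U 1 hq.
rewrite (distC hss hx hq) (dist_log hss hq hU erefl) ltNge; apply/negP => le.
have zW : br z W = 0 by apply: (br_eq0C hss); apply: (log_commute hq hW hz); rewrite eW.
have BUW := ho W hW zW; have [_ h2] := cosine_inequality hss hq hU hW.
have cUW : br U W = 0.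
  by apply: h2; rewrite eW BUW subr0 expr2 ler_wpM2l ?knorm_ge0.
move: le; rewrite -eW (dist_commute hq hU hW cUW); apply/negP; rewrite -ltNge.
rewrite -(ltr_pXn2r (n:=2)) ?nnegrE ?knorm_ge0 //; have H := bp_inner hss hq.
have hd : U - W \in P q by rewrite rpredB.
rewrite (knormE hss hU) (knormE hss hd) !(sqr_nrm H) (ipBl H) !(ipBr H) (ipC H W U) (bpPl hss W hq hU) BUW.
have W0 : W != 0 by apply/negP => /eqP W0; apply: ne; rewrite -eW W0 geo_zero.
by have := ip_gt0 H W0; move: (bp q U U) (bp q W W) => a b; lra.
Qed.

Lemma exists_min x z q0 : S x -> S q0 -> z \in P q0 ->
  exists q, [/\ S q, z \in P q & forall q', S q' -> z \in P q' -> dist x q <= dist x q'].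
Proof.
move=> hx hq0 hz0; have H := bp_inner hss hx.
pose E := [set dist x q | q in [set q | S q /\ z \in P q]].
have lb : has_lbound E by exists 0 => _ [q [hq _] <-]; apply: (dist_ge0 hss).
have hi : has_inf E by split=> //; exists (dist x q0), q0.
have [F [FU Foo]] := exists_free_ultrafilter; have FP : ProperFilter F := @ultra_proper _ _ FU.
have /choice [U hU] (k : nat) : exists U, [/\ U \in P x, z \in P (geo x U 1) & knorm U < inf E + k.+1%:R^-1].
  have k0 : 0 < k.+1%:R^-1 :> R by rewrite invr_gt0 ltr0n.
  have [_ [q [hq hz] <-] lt] := inf_adherent k0 hi; have [V hV eV] := exists_log hss hx hq.
  by exists V; split; rewrite ?eV // -(dist_log hss hx hV eV).
have UP k : U k \in P x by case: (hU k).
have Ub k : knorm (U k) <= inf E + 1.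
  have [_ _ /ltW h] := hU k; apply: le_trans h _; rewrite lerD2l invf_le1 ?ltr0n // ler1n //.
have [V hV] : exists V, vcvg F U V.
  by apply: (ultra_nrm_cvg H (M := inf E + 1)) => k; rewrite -(knormE hss (UP k)).
have VP : V \in P x by apply: (vcvg_mem _ hV).
have cn : (fun k => knorm (U k) ^+ 2) @ F --> knorm V ^+ 2.
  rewrite (knormE hss VP) (sqr_nrm H); under [X in X @ _ --> _]funext => k do rewrite (knormE hss (UP k)) (sqr_nrm H).
  exact: (vcvg_ip H).
have inf0 : 0 <= inf E by apply: lb_le_inf; [case: hi|move=> _ [q [hq _] <-]; apply: (dist_ge0 hss)].
have Vb c : 0 <= c -> (exists K, forall k, (K <= k)%N -> knorm (U k) <= c) -> knorm V <= c.
  move=> c0 [K hK]; rewrite -(ler_pXn2r (n:=2)) ?nnegrE ?knorm_ge0 //.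
  apply: (cvgr_le_near FP Foo cn (K := K)) => k kK.
  by rewrite ler_pXn2r ?nnegrE ?knorm_ge0 // hK.
have V1 : knorm V <= inf E + 1 by apply: Vb; [rewrite addr_ge0|exists 0%N].
have Vi : knorm V <= inf E.
  apply/ler_addgt0Pr => e e0; apply: Vb; first by rewrite addr_ge0 // ltW.
  exists (Num.truncn e^-1) => k kK; have [_ _ /ltW h] := hU k; apply: le_trans h _; rewrite lerD2l.
  rewrite -[leRHS]invrK lef_pV2 ?posrE ?ltr0n ?invr_gt0 //; apply: ltW; apply: lt_le_trans (truncnS_gt _) _.
  by rewrite ler_nat ltnS.
have hq := geo_sym hss V 1 hx; exists (geo x V 1); split=> //.
  apply/memP; apply: (vcvg_uniq (F := F) (u := fun k => geo x (U k) 1 z)); last first.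
    rewrite (_ : (fun k => geo x (U k) 1 z) = fun=> - z); first exact: vcvg_cst.
    by apply/funext => k; have [_ /memP -> _] := hU k.
  rewrite (geoE hss _ _ hx VP); under [X in vcvg _ X _]funext => k do rewrite (geoE hss _ _ hx (UP k)).
  have nZ Y : Y \in P x -> knorm Y <= inf E + 1 -> knorm ((2 * 1) *: Y) <= `|2 * 1| * (inf E + 1).
    by move=> hY Yc; rewrite (knormE hss (p := x)) ?rpredZ // (nrmZ H) -(knormE hss hY) ler_wpM2l.
  apply: (@vexp_ad_cvg _ _ hss F _ x _ _ (`|2 * 1| * (inf E + 1))) => //.
  - by move=> k; rewrite rpredZ.
  - by rewrite rpredZ.
  - by move=> k; apply: nZ.
  - exact: nZ.
  - by apply: vcvgZ => //; apply: cvg_cst.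
move=> q' hq' hz'; rewrite (dist_log hss hx VP erefl); apply: le_trans Vi _.
by apply: ge_inf => //; exists q'.
Qed.

(** Instead of moving q along W, x is moved back by e^{-tW}, so that all logarithms Uk are based at
    q. The law of cosines gives |Uk|^2 + t B(Uk, W) <= |Uk| |U|, and minimality gives |U| <= |Uk|,
    so B(Uk, W) <= 0 before t tends to 0. No derivative of the distance is taken. *)
Lemma first_variation x q z U W : S x -> S q -> z \in P q ->
  (forall q', S q' -> z \in P q' -> dist x q <= dist x q') -> U \in P q -> geo q U 1 = x ->
  W \in P q -> br z W = 0 -> B U W <= 0.
Proof.
move=> hx hq hz hmin hU eU hW hzW; have H := bp_inner hss hq.
pose t (k : nat) : R := k.+1%:R^-1; pose h k := vexp (ad (t k *: W)).
have t0 k : 0 < t k by rewrite invr_gt0 ltr0n.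
have hh k : isaut (h k) := expA_aut hss (t k *: W).
pose xk k := act (h k)^-1%VF x.
have hxk k : S (xk k) := act_sym (autV (hh k)) hx.
have /choice [Uk hUk] k : exists V, V \in P q /\ geo q V 1 = xk k.
  by have [V hV eV] := exists_log hss hq (hxk k); exists V.
have UkP k : Uk k \in P q by case: (hUk k).
have dU : dist x q = knorm U by rewrite (distC hss hx hq) (dist_log hss hq hU eU).
have hqk k : S (geo q W (t k)) := geo_sym hss W (t k) hq.
have qkE k : geo q W (t k) = act (h k) q by [].
have nUk k : knorm (Uk k) = dist x (geo q W (t k)).
  rewrite -(dist_log hss hq (UkP k) (hUk k).2) qkE -(dist_act hss (hh k) hq (hxk k)) /xk (act_inv_sym _ (hh k)).
  by rewrite (distC hss (act_sym (hh k) hq) hx).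
have nUk1 k : knorm U <= knorm (Uk k).
  rewrite nUk -dU; apply: hmin => //; apply: (geo_commute_P hss _ hq hW hz); exact: (br_eq0C hss).
have nUk2 k : knorm (Uk k) <= knorm U + knorm W.
  rewrite nUk -dU; apply: le_trans (dist_triangle hss hx hq (hqk k)) _; rewrite lerD2l.
  rewrite (dist_geo hss _ hq hW) gtr0_norm // -[leRHS]mul1r ler_wpM2r ?knorm_ge0 //.
  by rewrite invf_le1 ?ltr0n // ler1n.
have le k : B (Uk k) W <= 0.
  have hV : - (t k *: W) \in P q by rewrite rpredN rpredZ.
  have [h1 _] := cosine_inequality hss hq (UkP k) hV.
  have e1 : dist (geo q (Uk k) 1) (geo q (- (t k *: W)) 1) = knorm U.
    rewrite (hUk k).2 -dU; have -> : geo q (- (t k *: W)) 1 = act (h k)^-1%VF q.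
      by rewrite /h (expA_inv hss) /geo lfexpE scale1r.
    exact: (dist_act hss (autV (hh k)) hx hq).
  rewrite e1 (killingNr hss) (killingZr hss) opprK in h1.
  have h2 : t k * B (Uk k) W <= 0.
    have := nUk1 k; have := knorm_ge0 (Uk k); move: h1; move: (knorm (Uk k)) (knorm U) (t k * _) => a b c; nra.
  by rewrite -(pmulr_rle0 _ (t0 k)).
have [F [FU Foo]] := exists_free_ultrafilter; have FP : ProperFilter F := @ultra_proper _ _ FU.
have [V hV] : exists V, vcvg F Uk V.
  by apply: (ultra_nrm_cvg H (M := knorm U + knorm W)) => k; rewrite -(knormE hss (UkP k)).
have VP : V \in P q by apply: (vcvg_mem _ hV).
have ct : t @ F --> 0 by apply: (oo_cvg_ultra Foo); exact: cvg_harmonic.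
have nV : knorm V <= knorm U + knorm W.
  have cn : (fun k => knorm (Uk k) ^+ 2) @ F --> knorm V ^+ 2.
    rewrite (knormE hss VP) (sqr_nrm H); under [X in X @ _ --> _]funext => k do rewrite (knormE hss (UkP k)) (sqr_nrm H).
    exact: (vcvg_ip H).
  rewrite -(ler_pXn2r (n:=2)) ?nnegrE ?addr_ge0 ?knorm_ge0 //.
  apply: (cvgr_lel cn (cvg_cst _)) => k; by rewrite ler_pXn2r ?nnegrE ?addr_ge0 ?knorm_ge0.
have cW (c : R) v : `|c| <= 1 -> vcvg F (fun k => vexp (ad ((c * t k) *: W)) v) v.
  move=> c1; have e0 : vexp (ad ((c * 0) *: W)) v = v.
    by rewrite mulr0 scale0r (_ : ad 0 = 0) ?vexp0 //; apply/lfunP => w; rewrite lfe adE (br0l hss).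
  rewrite -{2}e0; apply: (@vexp_ad_cvg _ _ hss F _ q _ _ (knorm W)) => //.
  - by move=> k; rewrite rpredZ.
  - by rewrite rpredZ.
  - move=> k; rewrite (knormE hss (p := q)) ?rpredZ // (nrmZ H) -(knormE hss hW) -[leRHS]mul1r ler_wpM2r ?knorm_ge0 //.
    rewrite normrM -[leRHS]mul1r ler_pM // gtr0_norm // invf_le1 ?ltr0n // ler1n //.
  - by rewrite mulr0 scale0r (knorm0 hss hq) knorm_ge0.
  - by apply: vcvgZ; [apply: cvgM => //; apply: cvg_cst|apply: vcvg_cst].
have VU : V = U.
  apply: (log_unique hss hq VP hU); apply/lfunP => v; rewrite eU.
  apply: (vcvg_uniq (F := F) (u := fun k => geo q (Uk k) 1 v)).
    rewrite (geoE hss _ _ hq VP); under [X in vcvg _ X _]funext => k do rewrite (geoE hss _ _ hq (UkP k)).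
    have nZ Y : Y \in P q -> knorm Y <= knorm U + knorm W -> knorm ((2 * 1) *: Y) <= `|2 * 1| * (knorm U + knorm W).
      by move=> hY Yc; rewrite (knormE hss (p := q)) ?rpredZ // (nrmZ H) -(knormE hss hY) ler_wpM2l.
    apply: (@vexp_ad_cvg _ _ hss F _ q _ _ (`|2 * 1| * (knorm U + knorm W))) => //.
    - by move=> k; rewrite rpredZ.
    - by rewrite rpredZ.
    - by move=> k; apply: nZ.
    - exact: nZ.
    - by apply: vcvgZ => //; apply: cvg_cst.
  under [X in vcvg _ X _]funext => k do rewrite (hUk k).2 /xk actE /h (expA_inv hss) (expA_inv hss) opprK.
  have c1 w : vcvg F (fun k => vexp (ad (t k *: W)) w) w.
    by have := cW 1 w; rewrite normr1 lexx => /(_ isT); under [X in vcvg _ X _]funext => k do rewrite mul1r.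
  have c2 w : vcvg F (fun k => vexp (ad (- (t k *: W))) w) w.
    have := cW (-1) w; rewrite normrN1 lexx => /(_ isT).
    by under [X in vcvg _ X _]funext => k do rewrite mulN1r scaleNr.
  have := @vcvg_eval _ _ _ F _ (fun k => vexp (ad (- (t k *: W)))) \1%VF (fun k => x (vexp (ad (t k *: W)) v)) (x v).
  rewrite id_lfunE; apply; last by apply: vcvg_lfun.
  by apply: vcvg_End => w; rewrite id_lfunE.
rewrite -VU; have hf : lfunctional (fun v => B v W) by move=> c v1 v2; rewrite (killingPl hss).
have cB : (fun k => B (Uk k) W) @ F --> B V W by apply: (vcvg_functional hf).
exact: (cvgr_lel cB (cvg_cst 0) le).
Qed.

Lemma exists_foot x z q0 : S x -> S q0 -> z \in P q0 ->
  exists q U, [/\ S q, z \in P q, U \in P q, geo q U 1 = x & forall W, W \in P q -> br z W = 0 -> B U W = 0].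
Proof.
move=> hx hq0 hz0; have [q [hq hz hmin]] := exists_min hx hq0 hz0.
have [U hU eU] := exists_log hss hq hx; exists q, U; split=> // W hW hzW.
apply/eqP; rewrite eq_le (first_variation hx hq hz hmin hU eU hW hzW) /=.
rewrite -oppr_le0 -(killingNr hss); apply: (first_variation hx hq hz hmin hU eU); first by rewrite rpredN.
by rewrite brNr hzW oppr0.
Qed.

Variables (Ty : 'End(L) -> L -> Prop) (zeta0 kappa : R).
Hypothesis D : flag_type Ty zeta0 kappa.

(** The symmetry at q allows U to be replaced by - U, so the squared length of z at the other end is
    a mean of cosh(2 m), at least 1 + 2 |[U, z]|^2. Since U is orthogonal to the centraliser of z,
    the gap gives |[U, z]| >= zeta0 |U|. *)
Lemma proj_bound q z U : S q -> Ty q z -> U \in P q -> (forall W, W \in P q -> br z W = 0 -> B U W = 0) ->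
  1 + 2 * (zeta0 * knorm U) ^+ 2 <= bp (geo q U 1) z z.
Proof.
move=> hq tz hU ho; have H := bp_inner hss hq; have hz := ty_P D hq tz.
have sz : bp q z z = 1 by rewrite -(sqr_nrm H) -(knormE hss hz) (ty_usphere D hq tz).2 expr1n.
have [n [e [m he]]] := exists_eigenbasis hss hq hU; have [hon hm] := he.
have e1 := eb_geo hss z z 1 hq hU he.
have e2 : bp (geo q U 1) z z = \sum_i expR (2 * m i) * (bp q (e i) z * bp q (e i) z).
  have -> : bp (geo q U 1) z z = bp (geo q U (-1)) z z.
    rewrite -(bp_act (geo q U 1) z z (sym_aut hq)) (act_geo hss _ (sym_aut hq) hq hU) (act_self hq).
    rewrite ((memP q U).1 hU) ((memP q z).1 hz) (geoN hss _ hq hU).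
    have Hm := bp_inner hss (geo_sym hss U (-1) hq); by rewrite (ipNl Hm) (ipNr Hm) opprK.
  rewrite (eb_geo hss _ _ _ hq hU he); apply: eq_bigr => i _; congr (expR _ * _); ring.
have e3 : 2 + 4 * bp q (br U z) (br U z) <= 2 * bp (geo q U 1) z z.
  have s2 : \sum_i bp q (e i) z * bp q (e i) z = 1 by rewrite -(onb_sum_ip H _ hon (memvf _)).
  have -> : 2 + 4 * bp q (br U z) (br U z) = \sum_i (2 * (bp q (e i) z * bp q (e i) z) +
      4 * ((m i * bp q (e i) z) * (m i * bp q (e i) z))).
    rewrite big_split /= -!mulr_sumr s2 mulr1; congr (_ + _ * _); rewrite (onb_sum_ip H _ hon (memvf _)).
    by apply: eq_bigr => i _; rewrite (eb_coef hss _ _ hq hU he).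
  have -> : 2 * bp (geo q U 1) z z = bp (geo q U 1) z z + bp (geo q U 1) z z by ring.
  rewrite {1}e1 e2 -big_split /=; apply: ler_sum => i _; rewrite -mulrDl.
  have := cosh_ge (2 * m i); rewrite (_ : - (2 * m i) = - 2 * 1 * m i); last by ring.
  rewrite [expR (2 * m i) + _]addrC; have := sqr_ge0 (bp q (e i) z).
  move: (m i) (expR _ + expR _) (bp q (e i) z) => a b c; nra.
have e4 : (zeta0 * knorm U) ^+ 2 <= bp q (br U z) (br U z).
  have [n' [f [l hf]]] := exists_eigenbasis hss hq hz; have [hof hl] := hf.
  rewrite (brC hss) (ipNl H) (ipNr H) opprK exprMn (knormE hss hU) (sqr_nrm H).
  rewrite !(onb_sum_ip H _ hof (memvf _)) mulr_sumr; apply: ler_sum => i _.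
  rewrite (eb_coef hss _ _ hq hz hf); have [l0|l0] := eqVneq (l i) 0.
    suff -> : bp q (f i) U = 0 by rewrite !mulr0.
    (* If z centralises [f i], it also centralises this component in P q, to which U is orthogonal;
       hence U has no coefficient along [f i]. *)
    have hW : f i - q (f i) \in P q by apply/memP; rewrite linearB /= (symK _ hq) opprB.
    have zf : br z (f i) = 0 by rewrite -adE hl l0 scale0r.
    have := ho _ hW; rewrite brBr zf -[X in br X (q _)]opprK -((memP q z).1 hz) (brNl hss) -(sym_br _ _ hq) zf.
    rewrite linear0 oppr0 subr0 => /(_ erefl); rewrite -(bpPl hss _ hq hU) (ipBr H) -(bp_sym U (q (f i)) hq) (symK _ hq).
    rewrite ((memP q U).1 hU) (ipNl H) opprK (ipC H U); move: (bp q (f i) U) => y; lra.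
  have gl : zeta0 <= `|l i|.
    have fi0 : f i != 0.
      by have [of_ _ _] := hof; apply/negP => /eqP h; have := of_ i i; rewrite h (ip0l H) eqxx => /eqP; rewrite eq_sym oner_eq0.
    have gap Z (c : R) : Ty q Z -> 0 < c -> br Z (f i) = c *: f i -> zeta0 <= c.
      move=> tZ c0 hc; have hZ := ty_P D hq tZ.
      have h1 : fil Z (ge_ zeta0) (f i) by apply: (ty_gap D hq tZ); apply: fil_eigen c0 hc.
      have h2 := fil_nrm_ge hss hq hZ (A := ge_ zeta0) (fun a h => h) h1.
      by move: h2; rewrite hc (ipZr H) ler_pM2r // (ip_gt0 H).
    have [lp|ln|] := ltgtP (l i) 0; last by move=> h; rewrite h eqxx in l0.
      apply: (gap (- z)) => //; [exact: (ty_opp D hq tz)|by rewrite normr_gt0|].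
      by rewrite (brNl hss) -adE hl ltr0_norm // scaleNr.
    by apply: (gap z) => //; [rewrite normr_gt0|rewrite -adE hl gtr0_norm].
  have gl2 : zeta0 ^+ 2 <= l i ^+ 2.
    by rewrite -[l i ^+ 2]real_normK ?num_real // ler_pXn2r ?nnegrE // ltW // (ty_zeta0 D).
  rewrite -!expr2 exprMn; apply: ler_wpM2r => //; exact: sqr_ge0.
by move: e3 e4; move: (bp q _ _) (bp _ z z) (_ ^+ 2) => a b c; lra.
Qed.

End Projection.

(** The spectral loss is now at most 1/4, so (3/4) b^2 <= 25 eps^2 and 2 (zeta0 U)^2 <= b^2; the
    constant 41/10 is an upper bound of sqrt(50/3). The slack below 5 eps is spent in
    [cone_arith]. *)
Lemma proj_arith (R : realType) (zeta0 kappa eps th b U : R) : 0 < zeta0 -> 0 < eps -> 0 <= b -> 0 <= U ->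
  0 <= kappa -> 0 <= th -> th <= 5 * eps -> 10 * (kappa * eps) <= zeta0 ->
  (1 - kappa * th / (2 * zeta0)) * b ^+ 2 <= th ^+ 2 -> 1 + 2 * (zeta0 * U) ^+ 2 <= 1 + b ^+ 2 ->
  zeta0 * U <= (41 / 10) * eps.
Proof.
move=> z0 e0 b0 U0 k0 th0 h1 h2 h5 h6.
have h3 : kappa * th / (2 * zeta0) <= 1 / 4.
  rewrite ler_pdivrMr ?mulr_gt0 //; have := ler_wpM2l k0 h1; lra.
have h9 : (3 / 4) * b ^+ 2 <= th ^+ 2.
  by apply: le_trans h5; rewrite ler_wpM2r ?sqr_ge0 //; move: h3; lra.
have h10 : th ^+ 2 <= (5 * eps) ^+ 2 by rewrite ler_pXn2r ?nnegrE ?mulr_ge0 // ltW.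
rewrite leNgt; apply/negP => h8.
have h11 : (41 / 10 * eps) ^+ 2 < (zeta0 * U) ^+ 2.
  by rewrite ltr_pXn2r ?nnegrE ?mulr_ge0 ?(ltW z0) ?(ltW e0) // divr_ge0.
have ep : 0 < eps ^+ 2 by rewrite exprn_gt0.
by move: h6 h9 h10 h11 ep; rewrite !exprMn; lra.
Qed.

(** With y = kappa eps / zeta0 the exponent gains 4 (5 - 41/10) y = (36/10) y from the difference
    between delta and the actual distance u, and this absorbs the factor 1 - (3y)^2 since y <=
    1/10. *)
Lemma cone_arith (R : realType) (zeta0 kappa eps delta u t a0 c : R) : 0 < zeta0 -> 0 < eps -> 0 <= kappa ->
  10 * (kappa * eps) <= zeta0 -> 5 * eps <= delta * zeta0 -> zeta0 * u <= (41 / 10) * eps ->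
  c = kappa * (3 * eps) / zeta0 ->
  expR (2 * (kappa * u)) * expR (- 2 * t * a0) * expR (2 * (kappa * u)) <=
    (1 - c ^+ 2) * expR (- 2 * (a0 * t - 2 * kappa * delta)).
Proof.
move=> z0 e0 k0 h1 h2 h3 hc; set y := kappa * eps / zeta0.
have y0 : 0 <= y by rewrite divr_ge0 ?mulr_ge0 ?(ltW e0) ?(ltW z0).
have y1 : y <= 1 / 10 by rewrite ler_pdivrMr //; move: h1; lra.
have ku : kappa * u <= 41 / 10 * y.
  rewrite /y !mulrA ler_pdivlMr // [leRHS](_ : _ = kappa * (41 / 10 * eps)); last by ring.
  by rewrite -[leLHS]mulrA ler_wpM2l // mulrC.
have kd : 5 * y <= kappa * delta.
  rewrite /y !mulrA ler_pdivrMr // [leLHS](_ : _ = kappa * (5 * eps)); last by ring.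
  by rewrite -mulrA ler_wpM2l.
have -> : c = 3 * y by rewrite hc /y; ring.
have key : 1 <= (1 - (3 * y) ^+ 2) * expR (36 / 10 * y).
  have e1 := expR_ge1Dx (36 / 10 * y); have c0 : 0 <= 1 - (3 * y) ^+ 2 by nra.
  by apply: le_trans (ler_wpM2l c0 e1); nra.
apply: (@le_trans _ _ ((1 - (3 * y) ^+ 2) * expR (36 / 10 * y) * (expR (2 * (kappa * u)) * expR (- 2 * t * a0) * expR (2 * (kappa * u))))).
  by rewrite -[leLHS]mul1r ler_wpM2r // !mulr_ge0 ?expR_ge0.
have c0 : 0 <= 1 - (3 * y) ^+ 2 by nra.
rewrite -mulrA ler_wpM2l // -!expRD ler_expR; move: ku kd; move: (kappa * u) => ku.
rewrite (_ : 2 * kappa * delta = 2 * (kappa * delta)); last by ring.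
by move: (kappa * delta) => kd h4 h5; rewrite -subr_ge0 [X in 0 <= X](_ : _ = 4 * kd - 4 * ku - 36 / 10 * y); [lra|ring].
Qed.

(** * Contraction on the nilradical along one segment *)

Section Cone.
Variables (R : realType) (L : liealg R).
Hypothesis hss : semisimple L.
Implicit Types (X Y Z U V W u v w z : L) (f g p q r : 'End(L)) (A : set R).
Local Notation br := (@lie_br R L).
Local Notation B := (@killing R L).
Local Notation S := (@symspace R L).
Local Notation P := (@pspace R L).

Lemma fsp_card p z n (e : 'I_n -> L) m (Q : pred R) : S p -> z \in P p -> eigenbasis p z e m ->
  \dim (fsp z [set a | Q a]) = #|[set i | Q (m i)]%SET|.
Proof.
move=> hp hz he; have H := bp_inner hss hp; have [hon hm] := he; have [oe _ _] := hon.
have [f [fi fA fs]] := @enum_fun n _ [set i | Q (m i)]%SET erefl.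
symmetry; apply: (onb_dim H (e := fun c => e (f c))); split.
- by move=> i j; rewrite oe (inj_eq fi).
- move=> c; apply/(fspP hss _ _ hp hz); apply: (@fil_eigen _ _ _ _ (m (f c))); last by rewrite -adE.
  by have : f c \in [set i | Q (m i)]%SET by [apply/fA; exists c]; rewrite inE.
- move=> v /(fspP hss _ _ hp hz) /(fil_onb hss _ _ hp hz he) hv.
  rewrite {1}(full_onb v hon) (bigID (fun i => i \in [set i | Q (m i)]%SET)) /= [X in _ + X]big1 ?addr0.
    by rewrite fs.
  by move=> i; rewrite inE => /negP h; rewrite hv ?scale0r.
Qed.

Variables (Ty : 'End(L) -> L -> Prop) (zeta0 kappa : R).
Hypothesis D : flag_type Ty zeta0 kappa.

Lemma bp_le_kappa p q v : S p -> S q -> bp q v v <= expR (2 * (kappa * dist p q)) * bp p v v.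
Proof.
move=> hp hq; have [X hX eX] := exists_log hss hp hq; rewrite (dist_log hss hp hX eX).
by apply: (bp_le_exp hss v hp hX eX) => u; apply: (ty_kappa D u hp hX).
Qed.

Variables (a0 eps delta : R).
Hypotheses (heps : 0 < eps) (hN1 : 10 * (kappa * eps) <= zeta0) (hN3 : 5 * eps <= delta * zeta0).

(* The ray E = n(Z) is transverse to par(-z), and the quotient norm on L / par(-z) at a point of the
   parallel set is the norm on n(z). *)
Lemma cone_step p Z X t W z q q' v : S p -> Ty p Z -> usphere p X -> reg a0 Z X -> 0 <= t ->
  Ty p W -> knorm (W - Z) <= 3 * eps -> S q -> Ty q z -> S q' -> z \in P q' -> samefil (- z) (- W) ->
  zeta0 * dist p q <= (41 / 10) * eps -> zeta0 * dist (geo p X t) q' <= (41 / 10) * eps ->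
  fil z (gt_ 0) v -> bp q' v v <= expR (- 2 * (a0 * t - 2 * kappa * delta)) * bp q v v.
Proof.
move=> hp tZ [hX nX] hr t0 tW hW3 hq tz hq' hz' sf d1 d2 hv.
have H := bp_inner hss hp; have H' := bp_inner hss hq'; have hZ := ty_P D hp tZ; have hW := ty_P D hp tW.
have z0 := ty_zeta0 D; have k0 := le_trans (ltW z0) (kappa_ge hss D hp).
have hp' := geo_sym hss X t hp; set p' := geo p X t in d2 hp' *.
have hk3 : knorm (Z - W) <= 3 * eps by rewrite (knormB hss hp hZ hW).
have dd : (\dim (fsp Z (gt_ 0)) + \dim (fsp W (le_ 0)) = \dim {:L})%N.
  rewrite (ty_dim D hp hp tZ tW) -(fsp_dimC hss (gt_ 0) hp hW); congr (_ + \dim (fsp W _))%N.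
  by apply/seteqP; split=> b; rewrite /le_ /gt_ /= => hb; [apply/negP; rewrite -leNgt|rewrite leNgt; apply/negP].
have [|w [u [/(fspP hss _ _ hp hZ) hw /(fspP hss _ _ hp hW) hu ev]]] := disjoint_full _ dd v.
  move=> y /(fspP hss _ _ hp hZ) /(ty_gap D hp tZ) h1 /(fspP hss _ _ hp hW) h2.
  apply: (gap_zero hss D hp tZ tW _ h1 h2); rewrite subr0; apply: le_lt_trans (ler_wpM2l k0 hk3) _.
  by move: hN1 z0; lra.
have huz : fil z (le_ 0) u.
  by apply/(fil_leE hss); rewrite oppr0; apply/sf; have := fil_leE hss W 0 u; rewrite oppr0 => -[h _]; apply: h.
(* At q' the nilradical of z is orthogonal to the parabolic of - z, so v is the orthogonal component
   of w. *)
have s1 : bp q' v v <= bp q' w w.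
  have o1 : bp q' v u = 0.
    by apply: (fil_orth hss hq' hz' _ hv huz) => b; rewrite /gt_ /le_ /= => b0 b1; move: (lt_le_trans b0 b1); rewrite ltxx.
  have -> : w = v - u by rewrite ev addrK.
  rewrite (ipBl H') !(ipBr H') (ipC H' u v) o1; have := ip_ge0 H' u; move: (bp q' v v) (bp q' u u) => a b; lra.
have s2 := bp_le_kappa w hp' hq'.
have s3 := fil_decay hss hp hX (hr.2 w hw) t0.
pose c := kappa * (3 * eps) / zeta0.
(* At p the summands w and u are only nearly orthogonal: the gap between Z on its nilradical and W
   on the parabolic of - W bounds their cosine by c, so adding u shortens the square of w by at most
   the factor 1 - c^2. *)
have s4 : (1 - c ^+ 2) * bp p w w <= bp p v v.
  have sg : `|bp p w u| <= kappa * (3 * eps) / (zeta0 - 0) * (nrm (bp p) w * nrm (bp p) u).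
    apply: (spectral_gap_ip H (f := ad Z) (g := ad W) (A := fsp Z (gt_ 0)) (B := fsp W (le_ 0))).
    - exact: (ad_selfadj hss hp hZ).
    - exact: (ad_selfadj hss hp hW).
    - move=> y /(fspP hss _ _ hp hZ) hy; apply/(fspP hss _ _ hp hZ); rewrite adE; exact: (fil_br0 hss hp hZ).
    - move=> y /(fspP hss _ _ hp hW) hy; apply/(fspP hss _ _ hp hW); rewrite adE; exact: (fil_br0 hss hp hW).
    - move=> y /(fspP hss _ _ hp hZ) /(ty_gap D hp tZ) hy; rewrite adE.
      exact: (fil_nrm_ge hss hp hZ (A := ge_ zeta0) (fun a h => h) hy).
    - move=> y /(fspP hss _ _ hp hW) hy; rewrite adE.
      exact: (fil_nrm hss hp hW (A := le_ 0) (fun a h => h) hy).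
    - move=> y; rewrite !adE -(brBl hss); have hZW : Z - W \in P p by rewrite rpredB.
      apply: le_trans (ty_kappa D y hp hZW) _; rewrite ler_wpM2r ?nrm_ge0 // ler_wpM2l //.
    - exact: z0.
    - exact/(fspP hss _ _ hp hZ).
    - exact/(fspP hss _ _ hp hW).
  rewrite subr0 -/c in sg; rewrite ev (ipDl H) !(ipDr H) (ipC H u w) -!(sqr_nrm H).
  move: sg; rewrite ler_norml => /andP [sg _]; have := sqr_ge0 (c * nrm (bp p) w - nrm (bp p) u).
  move: sg; move: (bp p w u) (nrm _ w) (nrm _ u) c => a b d c'; nra.
have s5 := bp_le_kappa v hq hp.
have dq0 := dist_ge0 hss hp hq; have dq0' := dist_ge0 hss hp' hq'.
have c1 : 0 < 1 - c ^+ 2.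
  have cc : c <= 3 / 10 by rewrite ler_pdivrMr //; move: hN1; lra.
  have c0 : 0 <= c by rewrite divr_ge0 ?mulr_ge0 ?(ltW z0) ?(ltW heps).
  nra.
pose M := Num.max (dist p q) (dist p' q').
have hM : zeta0 * M <= 41 / 10 * eps by rewrite /M maxEle; case: ifP.
have ar := cone_arith t a0 z0 heps k0 hN1 hN3 hM (erefl c).
rewrite -(ler_pM2l c1); apply: le_trans (ler_wpM2l (ltW c1) (le_trans s1 s2)) _.
have m1 : expR (2 * (kappa * dist p' q')) <= expR (2 * (kappa * M)).
  by rewrite ler_expR ler_wpM2l // ler_wpM2l // le_max lexx orbT.
have m2 : expR (2 * (kappa * dist q p)) <= expR (2 * (kappa * M)).
  by rewrite (distC hss hq hp) ler_expR ler_wpM2l // ler_wpM2l // le_max lexx.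
have n1 : 0 <= bp p' w w := ip_ge0 (bp_inner hss hp') w.
have n2 : 0 <= bp p w w := ip_ge0 H w.
have n3 : 0 <= bp q v v := ip_ge0 (bp_inner hss hq) v.
set E := expR (2 * (kappa * M)) in ar m1 m2; have E0 : 0 <= E := expR_ge0 _.
set T := expR (- 2 * t * a0) in s3 ar; have T0 : 0 <= T := expR_ge0 _.
apply: (@le_trans _ _ ((1 - c ^+ 2) * (E * (T * bp p w w)))).
  by rewrite ler_wpM2l ?(ltW c1) //; apply: ler_pM => //; exact: expR_ge0.
apply: (@le_trans _ _ (E * T * (E * bp q v v))).
  rewrite (_ : (1 - c ^+ 2) * (E * (T * bp p w w)) = E * T * ((1 - c ^+ 2) * bp p w w)); last by ring.
  rewrite ler_wpM2l ?mulr_ge0 //; apply: le_trans s4 _; apply: le_trans s5 _; exact: ler_wpM2r.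
by rewrite mulrA [leRHS]mulrA; apply: ler_wpM2r.
Qed.

Lemma contract_fil q z V (la : R) : S q -> z \in P q -> V \in P q -> br z V = 0 ->
  (forall v, fil z (gt_ 0) v -> bp (geo q V 1) v v <= expR (- 2 * la) * bp q v v) ->
  forall v, fil z (gt_ 0) v -> fil V (ge_ la) v.
Proof.
move=> hq hz hV hc hla; have H := bp_inner hss hq.
have [|n [e [m [he hm]]]] := spectral H (U := fsp z (gt_ 0)) (ad_selfadj hss hq hV).
  move=> w /(fspP hss _ _ hq hz) hw; rewrite adE; apply/(fspP hss _ _ hq hz).
  apply: (fil_br hss hq hz (A := set1 0) _ _ hw) => [a b -> //|]; first by rewrite add0r.
  by apply: (@fil_eigen _ _ _ _ 0) => //; rewrite hc scale0r.
have [oe em ec] := he; move=> v /(fspP hss _ _ hq hz) /ec ->.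
apply: (fil_sum hss hq hV) => i; apply: (filZ hss hq hV).
apply: (@fil_eigen _ _ _ _ (m i)); last by rewrite -adE.
have /(fspP hss _ _ hq hz) /hla := em i; rewrite (bp_geo hss _ _ _ hq hV).
rewrite (@vexp_eigen _ _ _ (- 2 * m i)); last by rewrite (adZ hss) !lfe hm scalerA; congr (_ *: _); ring.
rewrite (ipZr H) oe eqxx !mulr1 ler_expR /ge_ /=; lra.
Qed.

(** In a joint eigenbasis B(z, V) is the sum of the products of eigenvalues. Each positive weight of
    z contributes at least [zeta0 * la], each negative one as much, and the remaining terms vanish;
    Cauchy-Schwarz with the unit vector z bounds the sum by [knorm V]. *)
Lemma killing_ge q z V (la : R) : S q -> Ty q z -> V \in P q -> 0 <= la -> reg la z V ->
  2 * (\dim (fsp z (gt_ 0)))%:R * zeta0 * la <= knorm V.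
Proof.
move=> hq tz hV la0 hr; have H := bp_inner hss hq; have hz := ty_P D hq tz; have z0 := ty_zeta0 D.
have [|||n [e [he hj]]] := @joint_spectral _ _ _ H [set f | f = ad z \/ f = ad V] fullv.
- by move=> _ [->|->]; apply: (ad_selfadj hss hq).
- move=> _ _ v [->|->] [->|->] //; apply: (ad_commute hss); first exact: hr.1.
  exact: (br_eq0C hss hr.1).
- by move=> f v _ _; rewrite memvf.
have /choice [l hl] i : exists a, ad z (e i) = a *: e i by apply: hj; left.
have /choice [m hm] i : exists a, ad V (e i) = a *: e i by apply: hj; right.
have ez : eigenbasis q z e l by split.
have [oe _ _] := he.
have e1 : B z V = \sum_i l i * m i.
  rewrite /killing (lftrace_onb _ H he); apply: eq_bigr => i _.
  by rewrite !lfe hm linearZ /= hl !(ipZr H) oe eqxx mulr1 mulrC.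
have e2 : B z V <= knorm V.
  rewrite -(bpPl hss _ hq hz); apply: le_trans (ler_norm _) _; apply: le_trans (ip_CS H _ _) _.
  by rewrite -(knormE hss hz) -(knormE hss hV) (ty_usphere D hq tz).2 mul1r.
apply: le_trans e2; rewrite e1.
have eigE Z (A' : set R) i (c' : R) : Z \in P q -> br Z (e i) = c' *: e i -> fil Z A' (e i) -> A' c'.
  move=> hZ hc hf; apply: contrapT => nA.
  have e0 : e i = 0.
    apply: (fil_zero (z := Z) (A := A' `&` [set c'])); first by move=> a [h1 h2]; apply: nA; rewrite -h2.
    by apply: (filI hss hq hZ hf); apply: fil_eigen hc.
  by have := oe i i; rewrite e0 (ip0l H) eqxx => /eqP; rewrite eq_sym oner_eq0.
have term Z W i (c c' : R) : Ty q Z -> W \in P q -> reg la Z W -> br Z (e i) = c *: e i -> br W (e i) = c' *: e i ->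
    0 < c -> zeta0 * la <= c * c'.
  move=> tZ hW [_ hrr] hc hc' c0; have hZ := ty_P D hq tZ.
  have f1 : fil Z (gt_ 0) (e i) by apply: fil_eigen c0 hc.
  have f2 := eigE Z (ge_ zeta0) i c hZ hc (ty_gap D hq tZ f1).
  have f3 := eigE W (ge_ la) i c' hW hc' (hrr _ f1).
  by apply: ler_pM => //; apply: ltW.
have card_pos : \dim (fsp z (gt_ 0)) = #|[set i | 0 < l i]%SET| := fsp_card (fun a => 0 < a) hq hz ez.
have card_neg : \dim (fsp z (gt_ 0)) = #|[set i | l i < 0]%SET|.
  by rewrite -(fsp_dim_lt hss hq hz); apply: (fsp_card (fun a => a < 0) hq hz ez).
rewrite (bigID (fun i => i \in [set i | 0 < l i]%SET)) /=.
have p1 : (\dim (fsp z (gt_ 0)))%:R * (zeta0 * la) <= \sum_(i in [set i | 0 < l i]%SET) l i * m i.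
  rewrite card_pos mulr_natl -sumr_const; apply: ler_sum => i; rewrite inE => li.
  by apply: (term z V i) => //; rewrite -adE.
have p2 : (\dim (fsp z (gt_ 0)))%:R * (zeta0 * la) <= \sum_(i | i \notin [set i | 0 < l i]%SET) l i * m i.
  rewrite (bigID (fun i => i \in [set i | l i < 0]%SET)) /= [X in _ <= _ + X]big1 ?addr0; last first.
    move=> i; rewrite !inE => /andP [h1 h2]; rewrite (_ : l i = 0) ?mul0r //.
    by apply/eqP; rewrite eq_le leNgt h1 leNgt h2.
  rewrite (eq_bigl (fun i => i \in [set i | l i < 0]%SET)); last first.
    by move=> i; rewrite !inE; case: ltgtP.
  rewrite card_neg mulr_natl -sumr_const; apply: ler_sum => i; rewrite inE => li.
  rewrite -[l i * m i]mulrNN; have hV' : - V \in P q by rewrite rpredN.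
  apply: (term (- z) (- V) i) => //.
  - exact: (ty_opp D hq tz).
  - exact: (reg_opp hss hq hz hV hr).
  - by rewrite (brNl hss) -adE hl scaleNr.
  - by rewrite (brNl hss) -adE hm scaleNr.
  - by rewrite oppr_gt0.
by apply: le_trans (lerD p1 p2); rewrite le_eqVlt; apply/orP; left; apply/eqP; ring.
Qed.

End Cone.

Lemma step_arith (R : realType) (anew a0 s delta kappa t D : R) : 0 < anew -> anew < a0 -> 0 < delta ->
  2 * delta < s -> 0 <= kappa -> anew * (s - 2 * delta) <= a0 * (s - 2 * delta) - 2 * delta * (a0 + kappa) ->
  s <= t -> D <= t + 2 * delta ->
  anew * D <= a0 * t - 2 * kappa * delta /\ anew * (s - 2 * delta) <= a0 * t - 2 * kappa * delta.
Proof.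
move=> h1 h2 h3 h4 h5 h6 h7 h8.
have k1 : (a0 - anew) * s <= (a0 - anew) * t by rewrite ler_wpM2l // subr_ge0 ltW.
have k2 : anew * D <= anew * (t + 2 * delta) by rewrite ler_wpM2l // ltW.
have k3 : anew * s <= anew * t by rewrite ler_wpM2l // ltW.
have k4 : 0 < anew * delta by rewrite mulr_gt0.
have k5 : anew * delta <= a0 * delta by rewrite ler_wpM2r // ltW.
by split; move: k1 k2 k3 k4 k5 h6; clear; lra.
Qed.

Lemma int_addS (n : int) (m : nat) : n + m.+1%:Z = n + m%:Z + 1.
Proof. lia. Qed.

Lemma int_between (n : int) (m : nat) : n <= n + m%:Z <= n + m%:Z + 1.
Proof. lia. Qed.

(** * The axis of a straight sequence and the composition of contractions *)

Section Core.
Variables (R : realType) (L : liealg R).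
Hypothesis hss : semisimple L.
Implicit Types (X Y Z U V W u v w z : L) (f g p q r : 'End(L)) (A : set R).
Local Notation br := (@lie_br R L).
Local Notation S := (@symspace R L).
Local Notation P := (@pspace R L).

Lemma reg_scale c (k : R) Z V : 0 < k -> reg c Z V -> reg (k * c) Z (k *: V).
Proof.
move=> k0 [h1 h2]; split; first by rewrite brZr h1 scaler0.
move=> v /h2 [m [a [w [ha hw ->]]]]; exists m, (fun i => k * a i), w; split=> [i /ha|i|//].
  by rewrite /ge_ /= => h; rewrite ler_pM2l.
by rewrite (brZl hss) hw scalerA.
Qed.

Lemma reg_weaken (c c' : R) Z V : c' <= c -> reg c Z V -> reg c' Z V.
Proof.
move=> hc [h1 h2]; split=> // v /h2; apply: fil_sub => b; rewrite /ge_ /=; exact: le_trans.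
Qed.

Variables (Ty : 'End(L) -> L -> Prop) (zeta0 kappa : R).
Hypothesis D : flag_type Ty zeta0 kappa.
Variables (a0 s eps delta anew : R).
Hypotheses (heps : 0 < eps) (hdelta : 0 < delta) (hs : 2 * delta < s)
  (hanew : 0 < anew) (hanew0 : anew < a0)
  (hN1 : 10 * (kappa * eps) <= zeta0) (hN2 : 4 * expR (- (a0 * s)) <= 1) (hN3 : 5 * eps <= delta * zeta0)
  (hN4 : anew * (s - 2 * delta) <= a0 * (s - 2 * delta) - 2 * delta * (a0 + kappa)).
Variables (I : set int) (x : int -> 'End(L)) (Zs : int -> L).
Hypotheses (hI : interval_set I) (hx : forall n, I n -> S (x n))
  (hlink : forall n, I n -> I (n + 1) -> link Ty a0 s (x n) (x (n + 1)) (Zs n))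
  (hchord : forall n, I (n - 1) -> I n -> I (n + 1) -> knorm (Zs n - Zs (n - 1)) <= eps).
Variable (n0 : int).
Hypotheses (h0 : I n0) (h1 : I (n0 + 1)).

Let hs0 : 0 < s. Proof. by apply: lt_trans hs; rewrite mulr_gt0. Qed.
Let ha0 : 0 < a0. Proof. exact: lt_trans hanew0. Qed.

Lemma axis : exists z r (W : int -> L), [/\ S r, Ty r z, forall n, I n -> Ty (x n) (W n) /\ samefil (- z) (- W n),
    forall n, I n -> I (n + 1) -> knorm (W n - Zs n) <= 3 * eps &
    forall n, I n -> exists th b, [/\ 0 <= th <= 5 * eps, 0 <= b,
      (1 - kappa * th / (2 * zeta0)) * b ^+ 2 <= th ^+ 2 & bp (x n) z z = 1 + b ^+ 2]].
Proof.
have [Y [tY sY Y2 Y3]] := forward_flag hss D ha0 hs0 heps hN1 hN2 hI hx hlink hchord h0 h1.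
(* The reversed sequence. Its segment leaving x' n joins x (- n) to x (- n - 1), hence the shift by
   one and the sign in Zs'. *)
pose I' : set int := [set n | I (- n)]; pose x' n := x (- n); pose Zs' n := - Zs (- n - 1).
have hI' : interval_set I'.
  by move=> i j k hi hk /andP [h2 h3]; apply: (hI hk hi); rewrite !lerN2 h3 h2.
have hx' n : I' n -> S (x' n) by apply: hx.
have idx (n : int) : - (n + 1) = - n - 1 by rewrite opprD.
have hlink' n : I' n -> I' (n + 1) -> link Ty a0 s (x' n) (x' (n + 1)) (Zs' n).
  rewrite /I' /x' /Zs' /= idx => hn hn1; apply: (link_opp hss D); first exact: hx.
  by have := hlink hn1; rewrite subrK; apply.
have hchord' n : I' (n - 1) -> I' n -> I' (n + 1) -> knorm (Zs' n - Zs' (n - 1)) <= eps.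
  rewrite /I' /Zs' /= idx opprB => hm hn hp.
  rewrite (_ : 1 - n - 1 = - n); last by ring.
  rewrite opprK addrC; apply: hchord => //; by rewrite addrC.
have h0' : I' (- (n0 + 1)) by rewrite /I' /= opprK.
have h1' : I' (- (n0 + 1) + 1) by rewrite /I' /= opprD !opprK addrK.
have [Y' [tY' sY' Y2' Y3']] := forward_flag hss D ha0 hs0 heps hN1 hN2 hI' hx' hlink' hchord' h0' h1'.
pose W n := - Y' (- n).
have inI n : I n -> I' (- n) by rewrite /I' /= opprK.
have tW n : I n -> Ty (x n) (W n).
  by move=> hn; apply: (ty_opp D (hx hn)); have := tY' _ (inI _ hn); rewrite /x' opprK.
have ZP n : I n -> I (n + 1) -> Zs n \in P (x n).
  by move=> hn hn1; have [X [t [tZ _ _ _ _]]] := hlink hn hn1; apply: (ty_P D (hx hn) tZ).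
have ZP1 n : I (n - 1) -> I n -> Zs (n - 1) \in P (x n).
  move=> hn hn1; have := hlink hn; rewrite subrK => /(_ hn1) h.
  have [h2 h3] := link_end hss D (hx hn) h; exact: (ty_P D (hx hn1) h3).
have WP n (hn : I n) := ty_P D (hx hn) (tW n hn).
have YP n (hn : I n) := ty_P D (hx hn) (tY n hn).
have W3 n : I n -> I (n + 1) -> knorm (W n - Zs n) <= 3 * eps.
  move=> hn hn1; have q1 : I' (- n - 1) by rewrite /I' /= opprB opprK addrC.
  have ez : Zs' (- n - 1) = - Zs n by rewrite /Zs' opprB opprK [1 + n]addrC addrK.
  have := Y3' (- n) q1 (inI n hn); rewrite ez.
  have e : Y' (- n) - - Zs n \in P (x n).
    rewrite opprK rpredD ?ZP // -[Y' _]opprK rpredN; exact: WP.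
  by rewrite -(knormN hss (hx hn) e) opprB addrC.
have W2 n : I (n - 1) -> I n -> knorm (Zs (n - 1) - W n) <= 2 * eps.
  move=> hn hn1; have := Y2' (- n); rewrite /I' /Zs' /= opprK opprD opprK => /(_ hn1 hn).
  by rewrite /W !opprK addrC.
(* One flag is within 2 eps and the other within 3 eps of an adjacent segment; the position of n
   relative to n0 tells whether the leaving or the entering segment exists. *)
have th5 n : I n -> knorm (Y n - W n) <= 5 * eps.
  move=> hn; have [le|gt] := lerP n n0.
    have hn1 : I (n + 1) by apply: (hI hn h1); lia.
    apply: le_trans (knorm_triangle hss (hx hn) (YP n hn) (ZP n hn hn1) (WP n hn)) _.
    have a1 := Y2 n hn hn1; have := W3 n hn hn1.
    rewrite (knormB hss (hx hn) (WP n hn) (ZP n hn hn1)); move: a1; lra.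
  have hn1 : I (n - 1) by apply: (hI h0 hn); lia.
  apply: le_trans (knorm_triangle hss (hx hn) (YP n hn) (ZP1 n hn1 hn) (WP n hn)) _.
  have a1 := Y3 n hn1 hn; have := W2 n hn1 hn; move: a1; lra.
have z0 := ty_zeta0 D; have k0 := le_trans (ltW z0) (kappa_ge hss D (hx h0)).
have [|z [r [hr tz s1 s2 _]]] := opposite hss D (hx h0) (tY n0 h0) (tW n0 h0).
  by apply: le_lt_trans (ler_wpM2l k0 (th5 n0 h0)) _; move: hN1 z0; lra.
have sz n : I n -> samefil z (Y n) by move=> hn; apply: samefil_trans s1 (sY _ _ h0 hn).
have sw n : I n -> samefil (- z) (- W n).
  by move=> hn; apply: samefil_trans s2 _; rewrite /W !opprK; apply: sY'; apply: inI.
have hz := ty_P D hr tz; have hz' : - z \in P r by rewrite rpredN.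
exists z, r, W; split=> // n hn; first by split; [exact: tW|exact: sw].
clearbody W.
have H := bp_inner hss (hx hn).
have fb : fil (Y n) (gt_ 0) (z - Y n) := samefil_sub hss hr hz (hx hn) (YP n hn) (sz n hn).
have fa : fil (W n) (lt_ 0) (z - W n).
  apply/(fil_ltE hss); have hW' : - W n \in P (x n) by rewrite rpredN WP.
  rewrite (_ : z - W n = - (- z - - W n)); last by rewrite opprB opprK addrC.
  by apply: (filN hss (hx hn) hW'); apply: (samefil_sub hss hr hz' (hx hn) hW' (sw n hn)).
exists (knorm (Y n - W n)), (nrm (bp (x n)) (z - Y n)); split.
- by rewrite knorm_ge0 th5.
- exact: nrm_ge0.
- have := opposite_bound hss D (hx hn) (tY n hn) (tW n hn) fa fb _.
  rewrite opprB [z - W n + _]addrC addrA subrK => /(_ erefl); apply: le_trans; rewrite ler_wpM2l ?lerDr ?sqr_ge0 //.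
  rewrite subr_ge0 ler_pdivrMr ?mulr_gt0 // mul1r.
  by have := ler_wpM2l k0 (th5 n hn); move: hN1 z0; lra.
- have fY : fil (Y n) [set 0] (Y n) by apply: fil_eigen => //; rewrite lie_br_alt scale0r.
  have o : bp (x n) (z - Y n) (Y n) = 0.
    apply: (fil_orth hss (hx hn) (YP n hn) _ fb fY) => b; rewrite /gt_ /= => b0 eb; by rewrite eb ltxx in b0.
  have ez : z = (z - Y n) + Y n by rewrite subrK.
  have [_ nY] := ty_usphere D (hx hn) (tY n hn); move: o ez; move: (z - Y n) => b o ->.
  rewrite (ipDl H) !(ipDr H) (ipC H (Y n) b) o add0r addr0 -!(sqr_nrm H).
  by rewrite -(knormE hss (YP n hn)) nY expr1n addrC.
Qed.

Lemma core : exists z r (xb : int -> 'End(L)), [/\ S r, Ty r z,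
  forall n, I n -> [/\ S (xb n), z \in P (xb n), dist (x n) (xb n) <= delta &
    forall q, S q -> z \in P q -> q <> xb n -> dist (x n) (xb n) < dist (x n) q] &
  forall n (m : nat), I n -> I (n + m%:Z) -> (0 < m)%N -> exists V t,
    [/\ usphere (xb n) V, reg anew z V, 0 < t, xb (n + m%:Z) = geo (xb n) V t &
      2 * anew * zeta0 * (\dim (fsp z (gt_ 0)))%:R * (s - 2 * delta) * m%:R <= t]].
Proof.
have [z [r [W [hr tz hW W3 hb]]]] := axis.
have hz := ty_P D hr tz; have z0 := ty_zeta0 D; have k0 := le_trans (ltW z0) (kappa_ge hss D (hx h0)).
have /choice [xb hxb] n : exists q, I n -> [/\ S q, z \in P q, zeta0 * dist (x n) q <= 41 / 10 * eps &
    forall q', S q' -> z \in P q' -> q' <> q -> dist (x n) q < dist (x n) q'].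
  have [hn|hn] := pselect (I n); last by exists 0.
  have [q [U [hq hzq hU eU ho]]] := exists_foot hss (hx hn) hr hz.
  exists q => _; have dU : dist (x n) q = knorm U by rewrite (distC hss (hx hn) hq); apply: dist_log.
  split=> //; last by rewrite -eU; apply: nearest_of_orth.
  have [th [b [/andP [th0 th1] b0 hb1 hb2]]] := hb n hn.
  rewrite dU; apply: (proj_arith z0 heps b0 (knorm_ge0 U) k0 th0 th1 hN1 hb1).
  by rewrite -hb2 -eU; apply: (proj_bound hss D hq (ty_move D hr hq tz hzq) hU ho).
have sxb n : I n -> S (xb n) by move=> /hxb [].
have dxb n : I n -> dist (x n) (xb n) <= delta.
  move=> /hxb [_ _ h _]; rewrite -(ler_pM2l z0) [_ * delta]mulrC; apply: le_trans h _; apply: le_trans hN3.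
  by move: heps; lra.
exists z, r, xb; split=> // [n hn|].
  by have [h2 h3 h4 h5] := hxb n hn; split=> //; apply: dxb.
(* The contraction exponent of one segment dominates two quantities: alpha_new times the distance of
   the projections, which will give regularity, and [anew * (s - 2 * delta)], which will give
   length. *)
have step n : I n -> I (n + 1) -> exists la, [/\ anew * dist (xb n) (xb (n + 1)) <= la, anew * (s - 2 * delta) <= la &
    forall v, fil z (gt_ 0) v -> bp (xb (n + 1)) v v <= expR (- 2 * la) * bp (xb n) v v].
  move=> hn hn1; have [X [t [tZ uX hr1 ts e1]]] := hlink hn hn1.
  have [q1 q2 q3 _] := hxb n hn; have [q1' q2' q3' _] := hxb _ hn1.
  have t0 : 0 <= t by apply: le_trans ts; apply: ltW.
  have [tw sw] := hW n hn.
  have dt : dist (x n) (x (n + 1)) = t.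
    by rewrite e1 (dist_geo hss _ (hx hn) uX.1) uX.2 mulr1 ger0_norm.
  have DD : dist (xb n) (xb (n + 1)) <= t + 2 * delta.
    have i1 := dist_triangle hss q1 (hx hn) q1'; have i2 := dist_triangle hss (hx hn) (hx hn1) q1'.
    have i3 := dxb n hn; have i4 := dxb _ hn1; rewrite dt in i2; rewrite (distC hss q1 (hx hn)) in i1.
    by move: i1 i2 i3 i4; lra.
  have [a1 a2] := step_arith hanew hanew0 hdelta hs k0 hN4 ts DD.
  exists (a0 * t - 2 * kappa * delta); split=> // v hv.
  have := (cone_step hss D heps hN1 hN3 (hx hn) tZ uX hr1 t0 tw (W3 n hn hn1) q1 (ty_move D hr q1 tz q2) q1' q2' sw q3 _ hv).
  by rewrite -e1; apply.
(* Exponents add, while distances obey the triangle inequality, so the ratio never drops below anew.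
   No error accumulates with m. *)
have steps m : forall n, I n -> I (n + m%:Z) -> exists la, [/\ anew * dist (xb n) (xb (n + m%:Z)) <= la,
    anew * (m%:R * (s - 2 * delta)) <= la &
    forall v, fil z (gt_ 0) v -> bp (xb (n + m%:Z)) v v <= expR (- 2 * la) * bp (xb n) v v].
  elim: m => [|m IH] n hn hm.
    exists 0; rewrite addr0 (distxx hss (sxb n hn)) mul0r mulr0; split=> // v _.
    by rewrite mulr0 expR0 mul1r.
  have e1 : n + m.+1%:Z = n + m%:Z + 1 by exact: int_addS.
  rewrite e1 in hm *; have hm' : I (n + m%:Z) by apply: (hI hn hm); exact: int_between.
  have [la [l1 l2 l3]] := IH n hn hm'; have [lb [k1 k2 k3]] := step _ hm' hm.
  exists (la + lb); split.
  - apply: le_trans (lerD l1 k1); rewrite -mulrDr ler_wpM2l ?(ltW hanew) //.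
    by apply: dist_triangle => //; apply: sxb.
  - by apply: le_trans (lerD l2 k2); rewrite -mulrDr ler_wpM2l ?(ltW hanew) // -natr1 mulrDl mul1r.
  - move=> v hv; apply: le_trans (k3 v hv) _; rewrite mulrDr expRD mulrC [leRHS]mulrAC.
    rewrite [leRHS]mulrC [leLHS]mulrC ler_wpM2l ?expR_ge0 //; exact: l3.
move=> n m hn hm m0; have [la [l1 l2 l3]] := steps m n hn hm.
have hq := sxb n hn; have hq' := sxb _ hm; have [_ zq _ _] := hxb n hn; have [_ zq' _ _] := hxb _ hm.
have [V hV eV] := exists_log hss hq hq'; have dV := dist_log hss hq hV eV.
have cV : br z V = 0 by apply: (br_eq0C hss); apply: (log_commute hss hq hV zq); rewrite eV.
have rV : reg la z V.
  by split=> //; apply: (contract_fil hss hq zq hV cV) => v hv; rewrite eV; apply: l3.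
have m0' : 0 < m%:R :> R by rewrite ltr0n.
have ds : 0 < s - 2 * delta by rewrite subr_gt0.
have la0 : 0 < la by apply: lt_le_trans l2; rewrite !mulr_gt0.
have tzq := ty_move D hr hq tz zq; have N0 : 0 < (\dim (fsp z (gt_ 0)))%:R :> R by rewrite ltr0n (ty_pos D hq tzq).
have kg := killing_ge hss D hq tzq hV (ltW la0) rV.
have V0 : 0 < knorm V by apply: lt_le_trans kg; rewrite !mulr_gt0.
exists ((knorm V)^-1 *: V), (knorm V); split=> //.
- have hV' : (knorm V)^-1 *: V \in P (xb n) by rewrite rpredZ.
  split=> //; rewrite (knormE hss hV') (nrmZ (bp_inner hss hq)) -(knormE hss hV).
  by rewrite ger0_norm ?invr_ge0 ?knorm_ge0 // mulVf // gt_eqF.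
- apply: (@reg_weaken ((knorm V)^-1 * la)); last by apply: reg_scale => //; rewrite invr_gt0.
  by rewrite mulrC ler_pdivlMr // -dV.
- by rewrite -eV geoZ // mulVf ?gt_eqF.
- apply: le_trans kg; rewrite [leLHS](_ : _ = 2 * (\dim (fsp z (gt_ 0)))%:R * zeta0 * (anew * (m%:R * (s - 2 * delta)))); last by ring.
  by rewrite ler_wpM2l // !mulr_ge0 ?ler0n // ltW.
Qed.

End Core.

(** * Straight sequences *)

(** Condition 1 is quadratic in zeta0 / kappa; one factor is given up using zeta0 <= kappa. *)
Lemma eps_kappa_arith (R : realType) (zeta0 kappa eps : R) : 0 < zeta0 -> zeta0 <= kappa ->
  5 * eps <= zeta0 ^+ 2 / (2 * kappa ^+ 2) -> 10 * (kappa * eps) <= zeta0.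
Proof.
move=> z0 zk; have k0 := lt_le_trans z0 zk; rewrite ler_pdivlMr ?mulr_gt0 ?exprn_gt0 // => h.
rewrite -(ler_pM2l k0); have : zeta0 ^+ 2 <= kappa * zeta0 by rewrite expr2 ler_wpM2r // ltW.
by apply: le_trans; move: h; rewrite (_ : kappa * (10 * (kappa * eps)) = 5 * eps * (2 * kappa ^+ 2)) //; ring.
Qed.

Lemma abs_sin_le (R : realType) (y : R) : 0 <= y -> `|sin y| <= y.
Proof.
move=> y0; have [|c _] := @MVT_segment R sin cos 0 y y0.
- by apply: continuous_subspaceT; exact: continuous_sin.
- rewrite sin0 !subr0 => ->; rewrite normrM (ger0_norm y0) -[leRHS]mul1r.
  by apply: ler_wpM2r => //; exact: cos_max.
Qed.

Lemma cos_ge_quadratic (R : realType) (y : R) : 0 <= y -> 1 - y ^+ 2 / 2 <= cos y.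
Proof.
move=> y0; have e1 : y = (y / 2) *+ 2 by rewrite mulr2n; lra.
rewrite {2}e1 cos_mulr2n; have h := cos2Dsin2 (y / 2).
have : sin (y / 2) ^+ 2 <= (y / 2) ^+ 2.
  have y2 : 0 <= y / 2 by rewrite divr_ge0.
  by rewrite -[leLHS]real_normK ?num_real // ler_pXn2r ?nnegrE // abs_sin_le.
rewrite (_ : (y / 2) ^+ 2 = y ^+ 2 / 4); last by field.
move: h; move: (cos _ ^+ 2) (sin _ ^+ 2) => a b.
rewrite -[a *+ 2]mulr_natr; move: (y ^+ 2) => c; lra.
Qed.

Lemma acos_le_cos (R : realType) (c eps : R) : -1 <= c <= 1 -> 0 <= eps <= pi -> acos c <= eps -> cos eps <= c.
Proof.
move=> hc he; rewrite !leNgt; apply: contra; have [h1 h2] := acos_def hc.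
by rewrite -{1}h2 ltr_cos // in_itv.
Qed.

(** Bound sin(eps / 4) by eps / 4 and use kappa / zeta0 >= 1 on the left; eps then cancels. *)
Lemma exp_arith (R : realType) (zeta0 kappa eps a0 s : R) : 0 < zeta0 -> zeta0 <= kappa -> 0 < eps ->
  eps * kappa / zeta0 * expR (2 * kappa * eps / zeta0 - a0 * s) <= sin (eps / 4) -> 4 * expR (- (a0 * s)) <= 1.
Proof.
move=> z0 zk e0 h; have k0 := lt_le_trans z0 zk.
have h1 : sin (eps / 4) <= eps / 4.
  by apply: le_trans (ler_norm _) _; apply: abs_sin_le; rewrite divr_ge0 // ltW.
have h2 : eps * expR (- (a0 * s)) <= eps * kappa / zeta0 * expR (2 * kappa * eps / zeta0 - a0 * s).
  apply: ler_pM; [exact: ltW|exact: expR_ge0| |].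
    by rewrite -mulrA ler_peMr ?(ltW e0) // ler_pdivlMr // mul1r.
  by rewrite ler_expR lerDr divr_ge0 ?(ltW z0) // !mulr_ge0 // ltW.
by rewrite -(ler_pM2l e0); move: (le_trans h2 (le_trans h h1)); move: (expR _) => E; lra.
Qed.

Lemma spacing_arith (R : realType) (anew a0 delta kappa s : R) : 2 * delta < s ->
  anew <= a0 - 2 * delta * (a0 + kappa) / (s - 2 * delta) ->
  anew * (s - 2 * delta) <= a0 * (s - 2 * delta) - 2 * delta * (a0 + kappa).
Proof.
rewrite -subr_gt0 => ds; rewrite -(ler_pM2r ds) mulrBl divfK ?gt_eqF //.
Qed.

Lemma int_lediff (n i : int) : n <= i -> exists m : nat, i = n + m%:Z.
Proof. by move=> h; exists `|i - n|%N; lia. Qed.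

Lemma interval_next (I : set int) n m : interval_set I -> I n -> I (n + m.+1%:Z) -> I (n + 1).
Proof. by move=> hI h1 h2; apply: (hI _ _ _ h1 h2); lia. Qed.

Lemma interval_single (I : set int) : interval_set I -> (forall n, I n -> ~ I (n + 1)) ->
  forall k n, I k -> I n -> k = n.
Proof.
move=> hI hno k n hk hn; wlog: k n hk hn / k <= n.
  by move=> W; have [/W|/ltW /W] := lerP k n => ->.
move=> /int_lediff [[|m] e]; first by rewrite e addr0.
by exfalso; apply: (hno _ hk); apply: (interval_next (m := m) hI hk); rewrite -e.
Qed.

Section Straight.
Variables (R : realType) (L : liealg R).
Hypothesis hss : semisimple L.
Implicit Types (X Y Z U V W u v w z : L) (f g p q r : 'End(L)) (A : set R).
Local Notation B := (@killing R L).
Local Notation S := (@symspace R L).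
Local Notation P := (@pspace R L).

Lemma dist_set_le p q (E : set 'End(L)) : S p -> (forall r, E r -> S r) -> E q -> dist_set p E <= dist p q.
Proof.
move=> hp hE hq; apply: ge_inf; last by exists q.
by exists 0 => _ [r hr <-]; apply: dist_ge0 => //; apply: hE.
Qed.

Variables (C : chamber L) (tau : set L) (zeta : L).
Hypotheses (htau : face C tau) (hzeta : face_int C tau zeta).
Local Notation T := [set type_of (endpt (ch_pt C) X) | X in tau].
Local Notation zt := (type_of (endpt (ch_pt C) zeta)).
Local Notation kappa := (kappa0 (ch_a C)).
Hypothesis hiota : opposition zt = zt.
Variable zeta0 : R.
Hypotheses (z0 : 0 < zeta0) (hzeta0 : forall al, simple_plus C tau al -> zeta0 <= rval al zeta).

Lemma kappa0_ge0 : 0 <= kappa.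
Proof.
have [hz nz] := zeta_usphere htau hzeta; have ho := ch_ptP C.
have [[|n] [e [w hw]]] := exists_weights hss ho (ch_aP C).1.
  have : zeta = 0 by rewrite (full_onb zeta hw.1) big_ord0.
  by move=> e0; move: nz; rewrite e0 (knorm0 hss ho) => /eqP; rewrite eq_sym oner_eq0.
have za : zeta \in ch_a C by case: (face_sub htau hzeta.1).
by have := kappa_weight hss ord0 hw za; rewrite nz mulr1; apply: le_trans.
Qed.

Lemma zeta_flag_type : flag_type (typed zeta) zeta0 kappa.
Proof.
split=> //.
- by move=> p Z _ [].
- by move=> p Z v hp hZ; apply: (typed_gap hss htau hzeta hzeta0 hp hZ).
- move=> p q Z Z' hp hq hZ hZ'.
  by rewrite (typed_dim hss htau hzeta hp hZ) (typed_dim hss htau hzeta hq hZ').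
- by move=> p V Z Z'; apply: typed_parle_eq.
- by move=> p q Z Z'; apply: typed_samefil.
- by move=> g p Z; apply: typed_act.
- by move=> p Z hp hZ; apply: (typedN hss htau hzeta hiota hp hZ).
- by move=> p Z hp [hZ _]; apply: (unit_gt0 hss hp hZ).
- by move=> p hp; apply: (exists_typed hss htau hzeta hp).
- by move=> p X v hp hX; apply: nrm_br_kappa => //; exact: kappa0_ge0.
Qed.
Let D := zeta_flag_type.

Lemma link_tau a0 s p q Z : S p -> 0 < a0 -> 0 < s -> link (typed zeta) a0 s p q Z -> tau_of T p q = Sz Z.
Proof.
move=> hp ha0 hs0 [X [t [tZ uX hr st ->]]].
exact: (tau_ofE hss htau hzeta hp tZ uX ha0 hr (lt_le_trans hs0 st)).
Qed.

Lemma diamond_geo c p Z V t : S p -> typed zeta p Z -> usphere p V -> 0 < c -> reg c Z V -> 0 < t ->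
  diamond T c p (geo p V t) = star_cone p (Sz Z) c `&` star_cone (geo p V t) (Sz (- Z)) c.
Proof.
move=> hp tZ uV c0 hr t0; rewrite /diamond (tau_ofE hss htau hzeta hp tZ uV c0 hr t0).
have hq := geo_sym hss V t hp; have hZ := tZ.1.1; have hV := uV.1.
have uV' : usphere (geo p V t) (- V) by apply: (usphereN hss hq); split; [apply: (geo_P hss)|exact: uV.2].
have tZ' : typed zeta (geo p V t) (- Z).
  apply: (typedN hss htau hzeta hiota hq); apply: (typed_samefil hss hp hq tZ) => //.
  by apply: (geo_commute_P hss); rewrite // (br_eq0C hss) // hr.1.
have := tau_ofE hss htau hzeta hq tZ' uV' c0 (reg_opp hss hp hZ hV hr) t0.
by rewrite (geo_back hss _ hp hV) => ->.
Qed.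

Lemma star_cone_sym p Sg c q : S p -> star_cone p Sg c q -> S q.
Proof. by move=> hp [X [t [_ _ _ ->]]]; apply: geo_sym. Qed.

Lemma star_cone_self c p Z V : S p -> typed zeta p Z -> usphere p V -> 0 < c -> reg c Z V -> star_cone p (Sz Z) c p.
Proof.
move=> hp tZ uV c0 hr; rewrite -{2}(geo0 hss hp uV.1).
exact: (reg_star_cone hss hp tZ uV c0 hr).
Qed.

Variables (anew a0 delta eps s : R).
Hypotheses (hanew : 0 < anew) (hanew0 : anew < a0) (hdelta : 0 < delta) (heps : 0 < eps) (hs : 2 * delta < s)
  (h1 : 5 * eps <= zeta0 ^+ 2 / (2 * kappa ^+ 2))
  (h2 : eps * kappa / zeta0 * expR (2 * kappa * eps / zeta0 - a0 * s) <= sin (eps / 4))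
  (h3 : 5 * eps / zeta0 <= delta)
  (h4 : anew <= a0 - 2 * delta * (a0 + kappa) / (s - 2 * delta)).
Variables (I : set int) (x : int -> 'End(L)).
Hypotheses (hI : interval_set I) (hx : forall n, I n -> S (x n))
  (hstraight : straight T zt I x a0 eps) (hspaced : spaced I x s).

Let hs0 : 0 < s. Proof. by apply: lt_trans hs; rewrite mulr_gt0. Qed.
Let ha0 : 0 < a0. Proof. exact: lt_trans hanew0. Qed.
Let zk : zeta0 <= kappa := kappa_ge hss D (ch_ptP C).

Lemma straight_links : exists Zs : int -> L,
  (forall n, I n -> I (n + 1) -> link (typed zeta) a0 s (x n) (x (n + 1)) (Zs n)) /\
  (forall n, I (n - 1) -> I n -> I (n + 1) -> knorm (Zs n - Zs (n - 1)) <= eps).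
Proof.
have /choice [Zs hZ] n : exists Z, I n -> I (n + 1) -> link (typed zeta) a0 s (x n) (x (n + 1)) Z.
  have [hn|hn] := pselect (I n); last by exists 0.
  have [hn1|hn1] := pselect (I (n + 1)); last by exists 0.
  have [Z [V [t [tZ uV hr t0 e1]]]] := mod_regular_reg hss htau hzeta (hx hn) (hstraight.1 n hn hn1).
  exists Z => _ _; exists V, t; split=> //; have := hspaced hn hn1.
  by rewrite e1 (dist_geo hss _ (hx hn) uV.1) uV.2 mulr1 gtr0_norm.
exists Zs; split=> // n hm hn hp.
have l1 := hZ _ hn hp; have l0 : link (typed zeta) a0 s (x (n - 1)) (x n) (Zs (n - 1)).
  by have := hZ _ hm; rewrite subrK; apply.
have l0' := link_opp hss D (hx hm) l0; have [_ tZ'] := link_end hss D (hx hm) l0.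
have [X [t [tZ _ _ _ _]]] := l1; have [X' [t' [tZ'' _ _ _ _]]] := l0'.
have := hstraight.2 n hm hn hp.
(* The segment back to x (n - 1) has flag direction - Zs (n - 1), so the angle is pi minus the angle
   between Zs (n - 1) and Zs n. *)
rewrite (zeta_angleE hss htau hzeta (hx hn) tZ'' tZ (link_tau (hx hn) ha0 hs0 l0') (link_tau (hx hn) ha0 hs0 l1)).
rewrite (killingNl hss); have H := bp_inner hss (hx hn); have hZ1 := tZ.1.1; have hZ0 := tZ'.1.1.
have u1 : nrm (bp (x n)) (Zs n) = 1 by rewrite -(knormE hss hZ1) tZ.1.2.
have u0 : nrm (bp (x n)) (Zs (n - 1)) = 1 by rewrite -(knormE hss hZ0) tZ'.1.2.
have hc : -1 <= B (Zs (n - 1)) (Zs n) <= 1.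
  by rewrite -ler_norml -(bpPl hss _ (hx hn) hZ0); apply: le_trans (ip_CS H _ _) _; rewrite u1 u0 mulr1.
rewrite acosN // lerD2l lerN2 => ha.
(* From zeta0 <= kappa one gets 10 eps <= 1, which puts eps in the interval where cosine is
   decreasing. *)
have e10 : eps <= pi.
  apply: le_trans (pi_ge2 R); have k10 := eps_kappa_arith z0 zk h1; have k0 := lt_le_trans z0 zk.
  have : 10 * (kappa * eps) <= kappa by apply: le_trans k10 zk.
  by rewrite mulrCA -[leRHS]mulr1 ler_pM2l //; move: heps; lra.
(* The squared chord is 2 - 2 B, so this lower bound makes the chord at most eps. *)
have hcos : 1 - eps ^+ 2 / 2 <= B (Zs (n - 1)) (Zs n).
  apply: le_trans (cos_ge_quadratic (ltW heps)) _; apply: acos_le_cos => //.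
  by rewrite (ltW heps) e10.
have hd : Zs n - Zs (n - 1) \in P (x n) by rewrite rpredB.
rewrite -(ler_pXn2r (n := 2)) ?nnegrE ?knorm_ge0 ?(ltW heps) // (knormE hss hd) (sqr_nrm H).
rewrite (ipBl H) !(ipBr H) (ipC H (Zs n) (Zs (n - 1))) (bpPl hss _ (hx hn) hZ0) -!(sqr_nrm H) u1 u0 expr1n.
by move: hcos; move: (B _ _) (eps ^+ 2) => a b; lra.
Qed.

Lemma straight_axis : exists z r (xb : int -> 'End(L)), [/\ S r, typed zeta r z,
  forall n, I n -> [/\ S (xb n), z \in P (xb n), dist (x n) (xb n) <= delta &
    forall q, S q -> z \in P q -> q <> xb n -> dist (x n) (xb n) < dist (x n) q] &
  forall n (m : nat), I n -> I (n + m%:Z) -> (0 < m)%N -> exists V t,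
    [/\ usphere (xb n) V, reg anew z V, 0 < t, xb (n + m%:Z) = geo (xb n) V t &
      2 * anew * zeta0 * (\dim (fsp zeta (gt_ 0)))%:R * (s - 2 * delta) * m%:R <= t]].
Proof.
have [[n0 [hn0 hn1]]|hno] := pselect (exists n, I n /\ I (n + 1)).
  have [Zs [hlink hchord]] := straight_links.
  have hN1 := eps_kappa_arith z0 zk h1; have hN2 := exp_arith z0 zk heps h2.
  have hN3 : 5 * eps <= delta * zeta0 by rewrite -ler_pdivrMr.
  have hN4 := spacing_arith hs h4.
  have [z [r [xb [hr tz c1 c2]]]] := core hss D heps hdelta hs hanew hanew0 hN1 hN2 hN3 hN4 hI hx hlink hchord hn0 hn1.
  exists z, r, xb; split=> //.
  by rewrite -(typed_dim hss htau hzeta hr tz).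
(* Without two consecutive indices the interval has at most one point. Any typed direction there, or
   at the base point of the chamber if the interval is empty, serves as axis, and the sequence is
   its own projection. *)
have hno' n : I n -> ~ I (n + 1) by move=> h5 h6; apply: hno; exists n.
have [r [hr hrx]] : exists r, S r /\ forall n, I n -> x n = r.
  have [[k hk]|h5] := pselect (exists k, I k).
    exists (x k); split; first exact: hx.
    by move=> n hn; rewrite (interval_single hI hno' hk hn).
  by exists (ch_pt C); split=> [|n hn]; [exact: ch_ptP|case: h5; exists n].
have [z tz] := exists_typed hss htau hzeta hr.
exists z, r, x; split=> //.
- move=> n /hrx ->; split=> //; first exact: tz.1.1.
    by rewrite (distxx hss hr) ltW.
  move=> q hq hzq ne; have := nearest_of_orth hss hr tz.1.1 (mem0v (P r)) _ hq hzq ne.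
  by rewrite (geo_zero hss hr); apply=> W _ _; rewrite (killing0l hss).
- move=> n [|m] // hn hm _; exfalso; apply: (hno' n hn); exact: interval_next hm.
Qed.

End Straight.

Lemma interval_neighbour (I : set int) n0 n : interval_set I -> I n0 -> I (n0 + 1) -> I n -> I (n + 1) \/ I (n - 1).
Proof.
move=> hI h0 h1 hn; have [le|gt] := lerP n n0; [left; apply: (hI _ _ _ hn h1)|right; apply: (hI _ _ _ h0 hn)]; lia.
Qed.

Theorem theorem5p1 (R : realType) (L : liealg R) (hL : noncompact_type L)
  (* sigma_mod is the image in the quotient of the ideal boundary by G of the
     spherical Weyl chamber C, and tau_mod the image of its face tau *)
  (C : chamber L) (tau : set L) (htau : face C tau)
  (taumod : set (set (ideal L)))
  (htaumod : taumod = [set type_of (endpt (ch_pt C) X) | X in tau])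
  (htaumod_iota : [set opposition z | z in taumod] = taumod)
  (zeta : L) (hzeta : face_int C tau zeta)
  (zetatype : set (ideal L))
  (hzetatype : zetatype = type_of (endpt (ch_pt C) zeta))
  (hzeta_iota : opposition zetatype = zetatype)
  (zeta0 : R) (hzeta0 : 0 < zeta0)
  (hzeta_zeta0 : forall alpha, simple_plus C tau alpha ->
     zeta0 <= rval alpha zeta)
  (kappa : R) (hkappa : kappa = kappa0 (ch_a C))
  (alpha_new alpha_0 delta eps s : R)
  (halpha_new : 0 < alpha_new) (halpha_0 : alpha_new < alpha_0)
  (hdelta : 0 < delta) (heps : 0 < eps) (hs : 2 * delta < s)
  (h1 : 5 * eps <= zeta0 ^+ 2 / (2 * kappa ^+ 2))
  (h2 : eps * kappa / zeta0 * expR (2 * kappa * eps / zeta0 - alpha_0 * s)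
        <= sin (eps / 4))
  (h3 : 5 * eps / zeta0 <= delta)
  (h4 : alpha_new <=
        alpha_0 - 2 * delta * (alpha_0 + kappa) / (s - 2 * delta))
  (* the argument of the inverse sine lies in its domain *)
  (h5_dom : 2 * delta / (alpha_0 * zeta0 * s) <= 1)
  (h5 : 2 * eps + asin (2 * delta / (alpha_0 * zeta0 * s))
        < eps_zeta C tau zeta)
  (I : set int) (hI : interval_set I)
  (x : int -> 'End(L)) (hx : forall n, I n -> symspace (x n))
  (hstraight : straight taumod zetatype I x alpha_0 eps)
  (hspaced : spaced I x s) :
  [/\ exists taum taup : set (ideal L),
        [/\ flag taumod taum, flag taumod taup, antipodal taum taup,
            (forall n, I n ->
               dist_set (x n) (parallel_set taum taup) <= delta) &
            exists xbar : int -> 'End(L),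
              (forall n, I n ->
                 nearest (parallel_set taum taup) (x n) (xbar n)) /\
              (forall (n : int) (m : nat), I n -> (1 <= m)%N ->
                 (I (n + m%:Z) ->
                    star_cone (xbar n) taup alpha_new (xbar (n + m%:Z))) /\
                 (I (n - m%:Z) ->
                    star_cone (xbar n) taum alpha_new (xbar (n - m%:Z))))],
      (forall (n : int) (m : nat), I n -> (1 <= m)%N ->
         (I (n + m%:Z) ->
            2 * alpha_new * zeta0 * (c0 C tau)%:R * (s - 2 * delta) * m%:R
              - 2 * delta <= dist (x n) (x (n + m%:Z))) /\
         (I (n - m%:Z) ->
            2 * alpha_new * zeta0 * (c0 C tau)%:R * (s - 2 * delta) * m%:R
              - 2 * delta <= dist (x n) (x (n - m%:Z)))),
      coarsely_spaced I x &
      (* a one-point sequence has no segment, so no diamond is forced to exist *)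
      ((exists n, I n /\ I (n + 1)) ->
       coarsely_lipschitz I x -> morse taumod I x alpha_new delta)].
Proof.
have hss := hL.1; subst taumod zetatype kappa.
have [z [r [xb [hr tz hxb hst]]]] := straight_axis hss htau hzeta hzeta_iota hzeta0 hzeta_zeta0
  halpha_new halpha_0 hdelta heps hs h1 h2 h3 h4 hI hx hstraight hspaced.
have sxb n : I n -> symspace (xb n) by move=> /hxb [].
have dxb n : I n -> dist (x n) (xb n) <= delta by move=> /hxb [].
have txb n : I n -> typed zeta (xb n) z.
  by move=> /hxb [h6 h7 _ _]; apply: (typed_samefil hss hr h6 tz h7); exact: samefil_refl.
have tzN : typed zeta r (- z) := typedN hss htau hzeta hzeta_iota hr tz.
have opp n m V t : I n -> I m -> usphere (xb n) V -> reg alpha_new z V -> xb m = geo (xb n) V t ->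
    [/\ typed zeta (xb m) (- z), usphere (xb m) (- V), reg alpha_new (- z) (- V) & xb n = geo (xb m) (- V) t].
  move=> hn hm uV rV eV; have hV : V \in pspace (xb m) by rewrite eV; apply: (geo_P hss); [exact: sxb|exact: uV.1].
  split.
  - exact: (typedN hss htau hzeta hzeta_iota (sxb m hm) (txb m hm)).
  - by apply: (usphereN hss (sxb m hm)); split; [exact: hV|exact: uV.2].
  - exact: (reg_opp hss (sxb n hn) (txb n hn).1.1 uV.1 rV).
  - by rewrite eV (geo_back hss _ (sxb n hn) uV.1).
have fwd n (m : nat) : I n -> I (n + m%:Z) -> (0 < m)%N -> star_cone (xb n) (Sz z) alpha_new (xb (n + m%:Z)).
  move=> hn hm m0; have [V [t [uV rV t0 -> _]]] := hst n m hn hm m0.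
  exact: (reg_star_cone hss (sxb n hn) (txb n hn) uV halpha_new rV (ltW t0)).
have bwd n (m : nat) : I n -> I (n + m%:Z) -> (0 < m)%N -> star_cone (xb (n + m%:Z)) (Sz (- z)) alpha_new (xb n).
  move=> hn hm m0; have [V [t [uV rV t0 eV _]]] := hst n m hn hm m0.
  have [t' uV' rV' ->] := opp _ _ _ _ hn hm uV rV eV.
  exact: (reg_star_cone hss (sxb _ hm) t' uV' halpha_new rV' (ltW t0)).
(* K uses the dimension of the nilradical, which is visibly positive; [c0_le] passes to the bound
   with [c0]. *)
set K := 2 * alpha_new * zeta0 * (\dim (fsp zeta (gt_ 0)))%:R * (s - 2 * delta).
have ds : 0 < s - 2 * delta by rewrite subr_gt0.
have K0 : 0 < K.
  rewrite !mulr_gt0 // ltr0n; exact: (unit_gt0 hss (ch_ptP C) (zeta_usphere htau hzeta)).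
have gap n (m : nat) : I n -> I (n + m%:Z) -> (0 < m)%N -> K * m%:R - 2 * delta <= dist (x n) (x (n + m%:Z)).
  move=> hn hm m0; have [V [t [uV rV t0 eV le]]] := hst n m hn hm m0.
  have e1 : dist (xb n) (xb (n + m%:Z)) = t.
    by rewrite eV (dist_geo hss _ (sxb n hn) uV.1) uV.2 mulr1 gtr0_norm.
  have i1 := dist_triangle hss (sxb n hn) (hx n hn) (sxb _ hm).
  have i2 := dist_triangle hss (hx n hn) (hx _ hm) (sxb _ hm).
  rewrite (distC hss (sxb n hn) (hx n hn)) in i1; have i3 := dxb n hn; have i4 := dxb _ hm.
  by move: le i1 i2 i3 i4; rewrite e1 -/K; lra.
have gap0 n (m : nat) : I n -> I (n + m%:Z) -> (0 < m)%N ->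
    2 * alpha_new * zeta0 * (c0 C tau)%:R * (s - 2 * delta) * m%:R - 2 * delta <= dist (x n) (x (n + m%:Z)).
  move=> hn hm m0; apply: le_trans (gap n m hn hm m0); rewrite lerD2r ler_wpM2r // ler_wpM2r ?(ltW ds) //.
  by rewrite ler_wpM2l ?ler_nat ?(c0_le hss htau hzeta) // !mulr_ge0 // ltW.
have spc : coarsely_spaced I x.
  exists K^-1, (2 * delta); split; first by rewrite invr_gt0.
  have d0 : 0 <= 2 * delta by rewrite mulr_ge0 // ltW.
  move=> n [[|m]|m] hn hm; rewrite invrK.
  - by rewrite addr0 normr0 mulr0 sub0r (distxx hss (hx n hn)) oppr_le0.
  - exact: (gap n m.+1).
  - have e1 : n = n + Negz m + m.+1%:Z by rewrite NegzE subrK.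
    rewrite (distC hss (hx n hn) (hx _ hm)) {2}e1.
    by apply: gap => //; rewrite -e1.
split=> //.
- have parP q : parallel_set (Sz (- z)) (Sz z) q <-> symspace q /\ z \in pspace q.
    exact: (parallel_setP hss htau hzeta hzeta_iota q hr tz).
  exists (Sz (- z)), (Sz z); split.
  + exact: (typed_flag hss htau hzeta hr tzN).
  + exact: (typed_flag hss htau hzeta hr tz).
  + exact: (antipodal_Sz hss hr tz).
  + move=> n hn; apply: le_trans (dxb n hn); apply: (dist_set_le hss (hx n hn)).
      by move=> q /parP [].
    by apply/parP; have [h6 h7 _ _] := hxb n hn.
  exists xb; split=> [n hn|n m hn m0].
    have [h6 h7 _ h8] := hxb n hn; split; first by apply/parP.
    by move=> q /parP [h9 h10]; apply: h8.
  split=> hm; first exact: fwd.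
  by have := bwd (n - m%:Z) m hm; rewrite subrK; apply.
- move=> n m hn m0; split=> hm; first exact: gap0.
  have := gap0 (n - m%:Z) m hm; rewrite subrK (distC hss (hx n hn) (hx _ hm)); exact.
move=> [n0 [hn0 hn1]] lip; split; first by split.
move=> n m hn hm; rewrite le_eqVlt => /predU1P [<-{m hm}|nm].
(* For n = m a diamond still needs a nondegenerate segment: take one of length delta from x n in the
   direction of an adjacent segment, which exists because the interval has two consecutive
   indices. *)
- have [Z [V [tZ uV rV]]] : exists Z V, [/\ typed zeta (x n) Z, usphere (x n) V & reg alpha_new Z V].
    have [Zs [hl _]] := straight_links hss htau hzeta hzeta_iota hzeta0 hzeta_zeta0 halpha_new halpha_0
      hdelta heps hs h1 hx hstraight hspaced.
    have D := zeta_flag_type hss htau hzeta hzeta_iota hzeta0 hzeta_zeta0.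
    have [h6|h6] := interval_neighbour hI hn0 hn1 hn.
      have [V [t [tZ uV rV _ _]]] := hl n hn h6; exists (Zs n), V; split=> //.
      exact: (reg_weaken (ltW halpha_0) rV).
    have := hl _ h6; rewrite subrK => /(_ hn) /(link_opp hss D (hx _ h6)) [V [t [tZ uV rV _ _]]].
    exists (- Zs (n - 1)), V; split=> //; exact: (reg_weaken (ltW halpha_0) rV).
  have sn := hx n hn; have hq := geo_sym hss V delta sn.
  exists (x n), (geo (x n) V delta); split=> //.
  + exact: (reg_mod_regular hss htau hzeta sn tZ uV halpha_new rV hdelta).
  + rewrite (distxx hss sn) (distC hss hq sn) (dist_geo hss _ sn uV.1) uV.2 mulr1 gtr0_norm //.
    by rewrite (ltW hdelta).
  move=> i /andP [h6 h7]; have -> : i = n by apply/eqP; rewrite eq_le h7 h6.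
  apply: (@le_trans _ _ (dist (x n) (x n))); last by rewrite (distxx hss sn) ltW.
  rewrite (diamond_geo hss htau hzeta hzeta_iota sn tZ uV halpha_new rV hdelta).
  apply: (dist_set_le hss sn) => [q [h8 _]|]; first exact: (star_cone_sym hss sn h8).
  split; first exact: (star_cone_self hss sn tZ uV halpha_new rV).
  rewrite -[X in star_cone _ _ _ X](geo_back hss delta sn uV.1).
  have hV' : V \in pspace (geo (x n) V delta) := geo_P hss _ sn uV.1.
  have uV' : usphere (geo (x n) V delta) (- V) by apply: (usphereN hss hq); split; [exact: hV'|exact: uV.2].
  apply: (reg_star_cone hss hq _ uV' halpha_new (reg_opp hss sn tZ.1.1 uV.1 rV) (ltW hdelta)).
  apply: (typedN hss htau hzeta hzeta_iota hq); apply: (typed_samefil hss sn hq tZ) => //.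
  by apply: (geo_commute_P hss); [exact: sn|exact: uV.1|exact: tZ.1.1|apply: (br_eq0C hss); exact: rV.1].
(* For n < m the tips are the projections of the two end points; the intermediate projections lie in
   both cones, and the original points are within delta of them. *)
- have [[|k] ek] := int_lediff (ltW nm); first by rewrite ek addr0 ltxx in nm.
  have sn := sxb n hn; have sm := sxb m hm.
  have hm' := hm; rewrite ek in hm'.
  have [V [t [uV rV t0 eV _]]] := hst n k.+1 hn hm' (ltn0Sn k); rewrite -ek in eV.
  have [tZ' uV' rV' _] := opp _ _ _ _ hn hm uV rV eV.
  exists (xb n), (xb m); split=> //.
  + by rewrite eV; exact: (reg_mod_regular hss htau hzeta sn (txb n hn) uV halpha_new rV t0).
  + by rewrite (distC hss sn (hx n hn)) (distC hss sm (hx m hm)) !dxb.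
  move=> i im; have hi : I i := hI _ _ _ hn hm im; move: im => /andP [h6 h7].
  apply: le_trans (dxb i hi); rewrite eV (diamond_geo hss htau hzeta hzeta_iota sn (txb n hn) uV halpha_new rV t0) -eV.
  apply: (dist_set_le hss (hx i hi)) => [q [h8 _]|]; first exact: (star_cone_sym hss sn h8).
  split.
  + have [[|j] ej] := int_lediff h6.
      by rewrite ej addr0; exact: (star_cone_self hss sn (txb n hn) uV halpha_new rV).
    by rewrite ej; apply: fwd => //; rewrite -ej.
  + have [[|j] ej] := int_lediff h7.
      rewrite ej addr0 in tZ' uV' *; rewrite -(addr0 i) -ej; rewrite ej addr0.
      exact: (star_cone_self hss (sxb i hi) tZ' uV' halpha_new rV').
    by rewrite ej; apply: bwd => //; rewrite -ej.
Qed.
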